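(* Let $W$ be a regular Bessel type $N\times N$ matrix of weights with support on $\gamma$. Then, for each $n\in\mathbb N$, the matrix functions $Y_n^{\mathsf L}$ and $Y_n^{\mathsf R}$ are, respectively, the unique solutions of the following (left, respectively right) Riemann–Hilbert problems, each consisting in the determination of a $2N\times 2N$ complex matrix function such that: (RH1) $Y_n^{\mathsf L}$ (respectively $Y_n^{\mathsf R}$) is holomorphic in $\mathbb C\setminus\gamma$; (RH2) for $z\in\gamma$ it satisfies the jump condition $$\big(Y_n^{\mathsf L}(z)\big)_+=\big(Y_n^{\mathsf L}(z)\big)_-\begin{bmatrix} I & W(z)\\ 0& I\end{bmatrix},\qquad \text{respectively}\qquad \big(Y_n^{\mathsf R}(z)\big)_+=\begin{bmatrix} I & 0\\ W(z)& I\end{bmatrix}\big(Y_n^{\mathsf R}(z)\big)_-;$$ (RH3) as $|z|\to\infty$, $$Y_n^{\mathsf L}(z)=\Big(I+O\big(\tfrac1z\big)\Big)\begin{bmatrix} z^n I&0\\0&z^{-n}I\end{bmatrix},\qquad\text{respectively}\qquad Y_n^{\mathsf R}(z)=\begin{bmatrix} z^n I&0\\0&z^{-n}I\end{bmatrix}\Big(I+O\big(\tfrac1z\big)\Big);$$ (RH4) as $z\to0$, $$Y_n^{\mathsf L}(z)=\begin{bmatrix} O(1)& s_1^{\mathsf L}(z)\\ O(1)& s_2^{\mathsf L}(z)\end{bmatrix},\qquad\text{respectively}\qquad Y_n^{\mathsf R}(z)=\begin{bmatrix} O(1)&O(1)\\ s_1^{\mathsf R}(z)&s_2^{\mathsf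 R}(z)\end{bmatrix},$$ with $\lim_{z\to0}z\,s_j^{\mathsf L}(z)=0$, respectively $\lim_{z\to0}z\,s_j^{\mathsf R}(z)=0$, for $j=1,2$.
   Context: $\mathbb N=\{0,1,2,\dots\}$; $N\ge1$ is fixed; $I$ and $0$ denote identity and zero matrices of the appropriate size; all block matrices have $N\times N$ blocks. Curve: $\gamma$ is a simple loop starting at the origin, encircling the point at infinity once in the positive direction, and then returning to the origin. $(f(z))_\pm$ are the boundary values of $f$ on $\gamma$ from the two sides, $\pm$ determined by the orientation of $\gamma$, with the convention that the Plemelj formula reads $(g)_+-(g)_-=f$ for $g(z)=\frac1{2\pi i}\int_\gamma\frac{f(t)}{t-z}dt$. Bessel type: an $N\times N$ matrix of weights $W=[W^{(j,k)}]_{j,k=1}^N$ with support $\gamma$ is of Bessel type if $W^{(j,k)}(z)=\sum_{m\in I_{j,k}}\varphi_m(z)z^{p_m}\log^{q_m}(z)\,e^{-\lambda_m/z}$, $z\in\gamma$, where each $I_{j,k}$ is a finite set of indices, $p_m$ are exponents, $\Re(\lambda_m)\ge0$, $q_m\in\mathbb N$, and each $\varphi_m$ is Hölder continuous, bounded and nonvanishing on $\gamma$. It is assumed throughout that the functions $\varphi_m$ have a holomorphic extension to the whole complex plane. Regular: the moments $W_n=\int_\gamma z^nW(z)\frac{dz}{2\pi i}$, $n\in\mathbb N$, exist and satisfy $\det[W_{j+k}]_{j,k=0,\dots,n}\neq0$ for all $n\in\mathbb N$. Biorthogonal polynomials: $P_n^{\mathsf L},P_n^{\mathsf R}$ are the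 monic $N\times N$ matrix polynomials of degree $n$ with, for $k\in\{0,\dots,n\}$, $n\in\mathbb N$, $$\int_\gamma P_n^{\mathsf L}(z)W(z)z^k\frac{dz}{2\pi i}=\delta_{n,k}C_n^{-1},\qquad \int_\gamma z^kW(z)P_n^{\mathsf R}(z)\frac{dz}{2\pi i}=\delta_{n,k}C_n^{-1},$$ where $C_n$ is a nonsingular matrix. Second kind functions: $Q_n^{\mathsf L}(z)=\int_\gamma\frac{P_n^{\mathsf L}(z')}{z'-z}W(z')\frac{dz'}{2\pi i}$, $Q_n^{\mathsf R}(z)=\int_\gamma W(z')\frac{P_n^{\mathsf R}(z')}{z'-z}\frac{dz'}{2\pi i}$. Conventions for index $-1$: $P_{-1}^{\mathsf L}=P_{-1}^{\mathsf R}=0$ and $Q_{-1}^{\mathsf L}=Q_{-1}^{\mathsf R}=-C_{-1}^{-1}$ (so $-C_{-1}Q^{\mathsf L}_{-1}=-Q^{\mathsf R}_{-1}C_{-1}=I$). $$Y_n^{\mathsf L}(z)=\begin{bmatrix}P_n^{\mathsf L}(z)&Q_n^{\mathsf L}(z)\\-C_{n-1}P_{n-1}^{\mathsf L}(z)&-C_{n-1}Q_{n-1}^{\mathsf L}(z)\end{bmatrix},\qquad Y_n^{\mathsf R}(z)=\begin{bmatrix}P_n^{\mathsf R}(z)&-P_{n-1}^{\mathsf R}(z)C_{n-1}\\Q_n^{\mathsf R}(z)&-Q_{n-1}^{\mathsf R}(z)C_{n-1}\end{bmatrix}.$$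
   Formalization: The simple loop is taken piecewise C² with nonzero derivative (for loops that are only C¹, (RH4) can fail), log is a continuous branch along the loop minus 0, moments converge absolutely, and (RH2) is asked for z≠0, since W is undefined at the origin. *)

(* Defs.v *)
From HB Require Import structures.
From mathcomp Require Import all_boot all_order all_algebra.
From mathcomp Require Import all_classical all_reals all_analysis.
From mathcomp Require Import complex.
Set Implicit Arguments.
Unset Strict Implicit.
Unset Printing Implicit Defensive.
Import Order.TTheory GRing.Theory Num.Theory numFieldNormedType.Exports.
Local Open Scope classical_set_scope.
Local Open Scope ring_scope.
Local Open Scope complex_scope.

(* The bare type R[i] carries no topology; bundled as a numClosedFieldType it
   receives the norm topology of the library. *)
Definition Cx (R : realType) : numClosedFieldType := R[i].

Definition cexp (R : realType) (z : Cx R) : Cx R :=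
  (expR (complex.Re z) * cos (complex.Im z)) +i*
  (expR (complex.Re z) * sin (complex.Im z)).

Definition twopii (R : realType) : Cx R := 0 +i* (2 * pi).

Definition holomorphic_on (R : realType) (D : set (Cx R)) (f : Cx R -> Cx R)
  : Prop := forall z, D z -> derivable f z 1.

Definition C2 (R : realType) (f : R -> R) : Prop :=
  [/\ forall x, derivable f x 1,
      forall x, derivable (derive1 f) x 1 &
      continuous (derive1n 2 f)].

Definition cderiv (R : realType) (c : R -> Cx R) (t : R) : Cx R :=
  derive1 (fun s => complex.Re (c s)) t +i* derive1 (fun s => complex.Im (c s)) t.

(* C^1 would not be enough: with an unbounded second derivative near 0 the
   modulus of exp (- lambda / z) can spike along the curve, and an integrable
   weight W need not satisfy z W(z) -> 0.  The pieces are closed sub-intervals,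
   so one-sided derivatives of order at most two exist at the break points,
   where corners are allowed. *)
Definition piecewise_C2 (R : realType) (g : R -> Cx R) : Prop :=
  exists s : seq R,
    [/\ path <%R 0 s, last 0 s = 1 &
        forall k, (k < size s)%N ->
          exists c : R -> Cx R,
            [/\ C2 (fun t => complex.Re (c t)), C2 (fun t => complex.Im (c t)) &
                forall t, nth 0 (0 :: s) k <= t <= nth 0 s k ->
                  g t = c t /\ cderiv c t != 0]].

Definition trace (R : realType) (g : R -> Cx R) : set (Cx R) :=
  g @` `[0, 1].

(* Integrals along g are absolutely convergent (Lebesgue) integrals in the
   parameter; the finitely many break points are negligible. *)
Definition pullback (R : realType) (g : R -> Cx R) (f : Cx R -> Cx R) (t : R)
  : Cx R := f (g t) * cderiv g t.

Definition cintegrable (R : realType) (g : R -> Cx R) (f : Cx R -> Cx R)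
  : Prop :=
  (@lebesgue_measure R).-integrable `[0, 1]
    (fun t => (complex.Re (pullback g f t))%:E) /\
  (@lebesgue_measure R).-integrable `[0, 1]
    (fun t => (complex.Im (pullback g f t))%:E).

Definition cint (R : realType) (g : R -> Cx R) (f : Cx R -> Cx R) : Cx R :=
  (\int[@lebesgue_measure R]_(t in `[0, 1]) complex.Re (pullback g f t)) +i*
  (\int[@lebesgue_measure R]_(t in `[0, 1]) complex.Im (pullback g f t)).

(* Entrywise integral against dz / (2 pi i). *)
Definition mint (R : realType) (m n : nat) (g : R -> Cx R)
    (F : Cx R -> 'M[Cx R]_(m, n)) : 'M[Cx R]_(m, n) :=
  \matrix_(i, j) ((twopii R)^-1 * cint g (fun z => F z i j)).

Definition winding (R : realType) (g : R -> Cx R) (z : Cx R) : Cx R :=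
  (twopii R)^-1 * cint g (fun w => (w - z)^-1).

(* Encircling infinity once in the positive direction means that infinity stays
   on the left: the loop runs clockwise in the plane, with index -1 about the
   points it encloses and index 0 about the others. *)
Definition loop_at_origin (R : realType) (g : R -> Cx R) : Prop :=
  [/\ piecewise_C2 g,
      g 0 = 0 /\ g 1 = 0,
      {in `[0, 1[ &, injective g},
      forall z, ~ trace g z -> winding g z = 0 \/ winding g z = -1 &
      exists2 z, ~ trace g z & winding g z = -1].

(* For f = 1 the function g of the Plemelj formula is the index, and
   g_+ - g_- = 1: the + side is the one on which the index is 0, the - side the
   one on which it is -1. *)
Definition plus_side (R : realType) (g : R -> Cx R) : set (Cx R) :=
  [set z | ~ trace g z /\ winding g z = 0].

Definition minus_side (R : realType) (g : R -> Cx R) : set (Cx R) :=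
  [set z | ~ trace g z /\ winding g z = -1].

(* log z is a continuous branch of the logarithm along the loop without its
   base point; another branch gives the same class of weights. *)
Definition log_branch (R : realType) (g : R -> Cx R) (lg : Cx R -> Cx R)
  : Prop :=
  (forall z, trace g z -> z != 0 -> cexp (lg z) = z) /\
  {within trace g `\ 0, continuous lg}.

Definition hoelder_on (R : realType) (D : set (Cx R)) (f : Cx R -> Cx R)
  : Prop :=
  exists a K : R, 0 < a <= 1 /\
    forall z w, D z -> D w ->
      `|f z - f w| <= ((K * (complex.Re `|z - w|) `^ a)%:C : Cx R).

Definition admissible_factor (R : realType) (g : R -> Cx R)
    (phi : Cx R -> Cx R) : Prop :=
  [/\ holomorphic_on setT phi,
      hoelder_on (trace g) phi,
      exists K : R, forall z, trace g z -> `|phi z| <= (K%:C : Cx R) &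
      forall z, trace g z -> phi z != 0].

(* The powers are z^p = exp (p log z), with the same branch of the logarithm in
   every term of every entry.  W 0 is left unspecified. *)
Definition bessel_type (R : realType) (N : nat) (g : R -> Cx R)
    (W : Cx R -> 'M[Cx R]_N) : Prop :=
  exists lg : Cx R -> Cx R, log_branch g lg /\
    forall j k : 'I_N,
      exists (d : nat) (phi : 'I_d -> Cx R -> Cx R)
             (p lam : 'I_d -> Cx R) (q : 'I_d -> nat),
        [/\ forall m, admissible_factor g (phi m),
            forall m, 0 <= complex.Re (lam m) &
            forall z, trace g z -> z != 0 ->
              W z j k = \sum_(m < d) phi m z * cexp (p m * lg z)
                                     * lg z ^+ q m * cexp (- (lam m / z))].

Definition moment (R : realType) (N : nat) (g : R -> Cx R)
    (W : Cx R -> 'M[Cx R]_N) (n : nat) : 'M[Cx R]_N :=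
  mint g (fun z => z ^+ n *: W z).

Definition regular_weight (R : realType) (N : nat) (g : R -> Cx R)
    (W : Cx R -> 'M[Cx R]_N) : Prop :=
  (forall n i j, cintegrable g (fun z => z ^+ n * W z i j)) /\
  (forall n, \det (\mxblock_(j < n.+1, k < n.+1) moment g W (j + k)%N) != 0).

(* A matrix polynomial is evaluated at the scalar matrix z%:M. *)
Definition meval (R : realType) (N : nat) (P : {poly 'M[Cx R]_N.+1}) (z : Cx R)
  : 'M[Cx R]_N.+1 := P.[z%:M].

Definition biorthogonal (R : realType) (N : nat) (g : R -> Cx R)
    (W : Cx R -> 'M[Cx R]_N.+1) (PL PR : nat -> {poly 'M[Cx R]_N.+1})
    (C : nat -> 'M[Cx R]_N.+1) : Prop :=
  forall n,
    [/\ PL n \is monic /\ size (PL n) = n.+1,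
        PR n \is monic /\ size (PR n) = n.+1,
        C n \in unitmx,
        forall k, (k <= n)%N ->
          mint g (fun z => meval (PL n) z *m W z *m (z ^+ k)%:M) =
          if n == k then invmx (C n) else 0 &
        forall k, (k <= n)%N ->
          mint g (fun z => (z ^+ k)%:M *m W z *m meval (PR n) z) =
          if n == k then invmx (C n) else 0].

Definition QL (R : realType) (N : nat) (g : R -> Cx R)
    (W : Cx R -> 'M[Cx R]_N.+1) (PL : nat -> {poly 'M[Cx R]_N.+1})
    (n : nat) (z : Cx R) : 'M[Cx R]_N.+1 :=
  mint g (fun w => (w - z)^-1 *: (meval (PL n) w *m W w)).

Definition QR (R : realType) (N : nat) (g : R -> Cx R)
    (W : Cx R -> 'M[Cx R]_N.+1) (PR : nat -> {poly 'M[Cx R]_N.+1})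
    (n : nat) (z : Cx R) : 'M[Cx R]_N.+1 :=
  mint g (fun w => (w - z)^-1 *: (W w *m meval (PR n) w)).

(* For n = 0 the index -1 occurs: P_{-1} = 0 and
   - C_{-1} Q^L_{-1} = - Q^R_{-1} C_{-1} = I. *)
Definition YL (R : realType) (N : nat) (g : R -> Cx R)
    (W : Cx R -> 'M[Cx R]_N.+1) (PL : nat -> {poly 'M[Cx R]_N.+1})
    (C : nat -> 'M[Cx R]_N.+1) (n : nat) (z : Cx R)
  : 'M[Cx R]_(N.+1 + N.+1) :=
  block_mx (meval (PL n) z) (QL g W PL n z)
    (if n is m.+1 then - (C m *m meval (PL m) z) else 0)
    (if n is m.+1 then - (C m *m QL g W PL m z) else 1%:M).

Definition YR (R : realType) (N : nat) (g : R -> Cx R)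
    (W : Cx R -> 'M[Cx R]_N.+1) (PR : nat -> {poly 'M[Cx R]_N.+1})
    (C : nat -> 'M[Cx R]_N.+1) (n : nat) (z : Cx R)
  : 'M[Cx R]_(N.+1 + N.+1) :=
  block_mx (meval (PR n) z)
    (if n is m.+1 then - (meval (PR m) z *m C m) else 0)
    (QR g W PR n z)
    (if n is m.+1 then - (QR g W PR m z *m C m) else 1%:M).

Definition mx_holomorphic_on (R : realType) (m n : nat) (D : set (Cx R))
    (F : Cx R -> 'M[Cx R]_(m, n)) : Prop :=
  forall i j, holomorphic_on D (fun z => F z i j).

(* The boundary value at z from the side S, as an unrestricted limit in S. *)
Definition boundary_value (R : realType) (m n : nat) (S : set (Cx R))
    (F : Cx R -> 'M[Cx R]_(m, n)) (z : Cx R) (V : 'M[Cx R]_(m, n)) : Prop :=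
  F w @[w --> within S (nbhs z)] --> V.

(* E(z) = O(1/z) entrywise as |z| tends to infinity. *)
Definition bigO_inv (R : realType) (m n : nat)
    (E : Cx R -> 'M[Cx R]_(m, n)) : Prop :=
  exists K r : R, 0 < r /\
    forall z, (r%:C : Cx R) <= `|z| ->
      forall i j, `|E z i j| <= (K%:C : Cx R) / `|z|.

(* F(z) = O(1) entrywise as z tends to 0 off the loop. *)
Definition bigO_one_at0 (R : realType) (m n : nat) (g : R -> Cx R)
    (F : Cx R -> 'M[Cx R]_(m, n)) : Prop :=
  exists K : R, \forall z \near within (~` trace g) (nbhs (0 : Cx R)),
    forall i j, `|F z i j| <= (K%:C : Cx R).

(* z F(z) tends to 0 as z tends to 0 off the loop. *)
Definition littleo_inv_at0 (R : realType) (m n : nat) (g : R -> Cx R)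
    (F : Cx R -> 'M[Cx R]_(m, n)) : Prop :=
  (z *: F z) @[z --> within (~` trace g) (nbhs (0 : Cx R))] -->
  (0 : 'M[Cx R]_(m, n)).

Definition asymp (R : realType) (N n : nat) (z : Cx R) : 'M[Cx R]_(N + N) :=
  block_mx (z ^+ n)%:M 0 0 (z ^- n)%:M.

(* In both problems the jump is required at the points of the loop other than
   the base point 0, where W is not defined and the behaviour is prescribed by
   the last clause. *)
Definition left_RHP (R : realType) (N : nat) (g : R -> Cx R)
    (W : Cx R -> 'M[Cx R]_N) (n : nat) (Y : Cx R -> 'M[Cx R]_(N + N)) : Prop :=
  [/\ mx_holomorphic_on (~` trace g) Y,
      forall z, trace g z -> z != 0 ->
        exists Yp Ym : 'M[Cx R]_(N + N),
          [/\ boundary_value (plus_side g) Y z Yp,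
              boundary_value (minus_side g) Y z Ym &
              Yp = Ym *m block_mx 1%:M (W z) 0 1%:M],
      exists E : Cx R -> 'M[Cx R]_(N + N), bigO_inv E /\
        exists r : R, forall z, ~ trace g z -> (r%:C : Cx R) <= `|z| ->
          Y z = (1%:M + E z) *m asymp N n z &
      exists s1 s2 : Cx R -> 'M[Cx R]_N,
      exists b1 b2 : Cx R -> 'M[Cx R]_N,
        [/\ forall z, ~ trace g z -> Y z = block_mx (b1 z) (s1 z) (b2 z) (s2 z),
            bigO_one_at0 g b1 /\ bigO_one_at0 g b2 &
            littleo_inv_at0 g s1 /\ littleo_inv_at0 g s2]].

Definition right_RHP (R : realType) (N : nat) (g : R -> Cx R)
    (W : Cx R -> 'M[Cx R]_N) (n : nat) (Y : Cx R -> 'M[Cx R]_(N + N)) : Prop :=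
  [/\ mx_holomorphic_on (~` trace g) Y,
      forall z, trace g z -> z != 0 ->
        exists Yp Ym : 'M[Cx R]_(N + N),
          [/\ boundary_value (plus_side g) Y z Yp,
              boundary_value (minus_side g) Y z Ym &
              Yp = block_mx 1%:M 0 (W z) 1%:M *m Ym],
      exists E : Cx R -> 'M[Cx R]_(N + N), bigO_inv E /\
        exists r : R, forall z, ~ trace g z -> (r%:C : Cx R) <= `|z| ->
          Y z = asymp N n z *m (1%:M + E z) &
      exists s1 s2 : Cx R -> 'M[Cx R]_N,
      exists b1 b2 : Cx R -> 'M[Cx R]_N,
        [/\ forall z, ~ trace g z -> Y z = block_mx (b1 z) (b2 z) (s1 z) (s2 z),
            bigO_one_at0 g b1 /\ bigO_one_at0 g b2 &
            littleo_inv_at0 g s1 /\ littleo_inv_at0 g s2]].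

(* Matrix functions are compared off the loop, where the problem lives. *)
Definition unique_solution_off (R : realType) (m : nat) (S : set (Cx R))
    (RHP : (Cx R -> 'M[Cx R]_m) -> Prop) (Y : Cx R -> 'M[Cx R]_m) : Prop :=
  RHP Y /\ forall X, RHP X -> forall z, ~ S z -> X z = Y z.

(* Main.v *)
(* Uniqueness.  If Y solves the left problem, Z the right one and
   J = [0, I; -I, 0], then Y J Z has no jump, is o(1/z) at 0 and tends to J at
   infinity, hence equals J.  So each solution of one problem is the inverse, up
   to J, of every solution of the other, and existence for both gives
   uniqueness for both.

   Existence.  The jump is Plemelj's formula.  The delicate point is
   z Q(z) -> 0 at the origin, as the terms of W oscillate like
   t^p (log t)^q exp (- nu / t) along the two arcs ending there.  After merging
   equal terms and factoring out the zeros of the holomorphic coefficients,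
   integrability of W forces every term to be O(t^(e-1)) with e > 0: otherwise
   divide by the dominant term, whose quotients with the others are, up to o(1),
   pure oscillations in log t and 1/t of bounded integral against dt/t, and
   integrate to get a logarithmic divergence.  The integrand F then satisfies
   |F(s) - F(t)| = O(t^(e-3) |s - t|) for |s - t| = O(t^2).  In the Cauchy
   integral at z let t0 be the parameter of the point of the arc nearest to z.
   Parameters at distance >= t0/2 from t0 contribute little by absolute
   integrability, those at distance between t0^2 and t0/2 a factor log t0, which
   t0^e absorbs, and those at distance <= t0^2 are handled by replacing F(t) by
   F(t0).  The right problem is the transpose of the left one for W^T. *)

Require Import Defs.
From mathcomp Require Import all_boot all_order all_algebra.
From mathcomp Require Import all_classical all_reals all_analysis.
From mathcomp Require Import complex ring lra measurable_realfun.
Set Implicit Arguments.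
Unset Strict Implicit.
Unset Printing Implicit Defensive.
Import Order.TTheory GRing.Theory Num.Theory numFieldNormedType.Exports.
Local Open Scope classical_set_scope.
Local Open Scope ring_scope.
Local Open Scope complex_scope.
Local Notation Re := (@complex.Re _).
Local Notation Im := (@complex.Im _).
Local Notation msr D := (@measurable _ (measurableTypeR _) D).

(** * Complex numbers, exponential and integrals *)

(** The loop enters the complex analysis through two facts only: its trace is covered by O(n) discs
    of radius O(1/n), and off it the index is 0 or -1. The first makes the trace removable for
    continuous functions, by cutting a square into small cells; the second turns the jump of a
    Cauchy integral into the jump of an index.

    In Y J Z each product pairs an O(1) block of one solution with an o(1/z) block of the other, so
    two singular blocks never meet. Hence z (Y J Z - J) extends by 0 at the origin, and it is
    bounded at infinity.

    Boundary values are unrestricted limits and the origin is approached from all directions, even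
    tangentially, so z can be far closer to the curve than to its limit. Both for Plemelj's formula
    and at the origin, distances are therefore measured from the curve point nearest to z. The
    half-width t0^2 of the innermost interval is the scale on which the phase 1/t changes by O(1),
    so that F is nearly constant there; what remains is the integral of c'/(c - z) over an interval
    symmetric about t0, and this is bounded independently of z. *)

Definition cabs (R : realType) (z : Cx R) : R := Re `|z|.

Section ComplexModulus.
Context {R : realType}.
Implicit Types (x y z : Cx R) (a b : R).

Lemma eq_cx x y : Re x = Re y -> Im x = Im y -> x = y.
Proof. by case: x => a b; case: y => c d /= -> ->. Qed.

Lemma ReD x y : Re (x + y) = Re x + Re y. Proof. by case: x; case: y. Qed.
Lemma ImD x y : Im (x + y) = Im x + Im y. Proof. by case: x; case: y. Qed.
Lemma ReN x : Re (- x) = - Re x. Proof. by case: x. Qed.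
Lemma ImN x : Im (- x) = - Im x. Proof. by case: x. Qed.
Lemma ReM x y : Re (x * y) = Re x * Re y - Im x * Im y.
Proof. by case: x; case: y. Qed.
Lemma ImM x y : Im (x * y) = Re x * Im y + Im x * Re y.
Proof. by case: x => a b; case: y => c d /=. Qed.
Lemma Re0 : Re (0 : Cx R) = 0. Proof. by []. Qed.
Lemma Im0 : Im (0 : Cx R) = 0. Proof. by []. Qed.
Lemma Re1 : Re (1 : Cx R) = 1. Proof. by []. Qed.
Lemma Im1 : Im (1 : Cx R) = 0. Proof. by []. Qed.
Definition ReImE := (ReD, ImD, ReN, ImN, ReM, ImM, Re0, Im0, Re1, Im1).

Lemma ReV z : Re z^-1 = Re z / (Re z ^+ 2 + Im z ^+ 2).
Proof. by case: z. Qed.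
Lemma ImV z : Im z^-1 = - Im z / (Re z ^+ 2 + Im z ^+ 2).
Proof. by case: z => a b /=; rewrite mulNr. Qed.

Lemma Re_sum I (r : seq I) (P : pred I) (F : I -> Cx R) :
  Re (\sum_(i <- r | P i) F i) = \sum_(i <- r | P i) Re (F i).
Proof. by elim/big_rec2: _ => // i a b _ <-; rewrite ReD. Qed.
(** The norm of [Cx R] takes its values in [Cx R] itself; this bridge moves inequalities to the real
    number [cabs], where [lra] and [nra] apply. *)
Lemma normcE z : `|z| = ((cabs z)%:C : Cx R).
Proof. by rewrite /cabs normc_def. Qed.

Lemma cabsE z : cabs z = Num.sqrt (Re z ^+ 2 + Im z ^+ 2).
Proof. by rewrite /cabs normc_def. Qed.

Lemma cabs_sqr z : cabs z ^+ 2 = Re z ^+ 2 + Im z ^+ 2.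
Proof. by rewrite cabsE sqr_sqrtr// addr_ge0 ?sqr_ge0. Qed.

Lemma cabs_ge0 z : 0 <= cabs z.
Proof. by rewrite cabsE sqrtr_ge0. Qed.

Lemma cabs0 : cabs (0 : Cx R) = 0. Proof. by rewrite /cabs normr0. Qed.
Lemma cabs1 : cabs (1 : Cx R) = 1. Proof. by rewrite /cabs normr1. Qed.

Lemma cabsN z : cabs (- z) = cabs z. Proof. by rewrite /cabs normrN. Qed.

Lemma cabsM x y : cabs (x * y) = cabs x * cabs y.
Proof. by rewrite {1}/cabs normrM !normcE/= mulr0 subr0. Qed.

Lemma cabs_eq0 z : (cabs z == 0) = (z == 0).
Proof.
apply/eqP/eqP => [h|->]; last exact: cabs0.
by apply/eqP; rewrite -normr_eq0 normcE h.
Qed.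

Lemma cabs_gt0 z : (0 < cabs z) = (z != 0).
Proof. by rewrite lt_def cabs_ge0 andbT cabs_eq0. Qed.

Lemma cabsV z : cabs z^-1 = (cabs z)^-1.
Proof.
have [->|z0] := eqVneq z 0; first by rewrite invr0 cabs0 invr0.
have h : cabs z != 0 by rewrite cabs_eq0.
by apply: (mulfI h); rewrite -cabsM !mulfV// cabs1.
Qed.

Lemma cabsX z n : cabs (z ^+ n) = cabs z ^+ n.
Proof. by elim: n => [|n ih]; rewrite ?expr0 ?cabs1// !exprS cabsM ih. Qed.

Lemma cabsD x y : cabs (x + y) <= cabs x + cabs y.
Proof. by have := ler_normD x y; rewrite !normcE -rmorphD/= lecR. Qed.

Lemma cabsB x y : cabs (x - y) <= cabs x + cabs y.
Proof. by rewrite (le_trans (cabsD _ _))// cabsN. Qed.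

Lemma cabsC x y : cabs (x - y) = cabs (y - x).
Proof. by rewrite -cabsN opprB. Qed.

Lemma cabs_tri z x y : cabs (x - y) <= cabs (x - z) + cabs (z - y).
Proof. by rewrite (le_trans _ (cabsD _ _))// addrA subrK. Qed.

Lemma cabs_sub x y : cabs x - cabs y <= cabs (x - y).
Proof. by rewrite lerBlDr (le_trans _ (cabsD _ _))// subrK. Qed.

Lemma cabs_sum I (r : seq I) (P : pred I) (F : I -> Cx R) :
  cabs (\sum_(i <- r | P i) F i) <= \sum_(i <- r | P i) cabs (F i).
Proof.
elim/big_rec2: _ => [|i a b _ h]; first by rewrite cabs0.
by rewrite (le_trans (cabsD _ _))// lerD2l.
Qed.

Lemma Re_le_cabs z : `|Re z| <= cabs z.
Proof.
rewrite -(@ler_pXn2r _ 2)// ?nnegrE ?cabs_ge0// cabs_sqr real_normK ?num_real//.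
by rewrite lerDl sqr_ge0.
Qed.

Lemma Im_le_cabs z : `|Im z| <= cabs z.
Proof.
rewrite -(@ler_pXn2r _ 2)// ?nnegrE ?cabs_ge0// cabs_sqr real_normK ?num_real//.
by rewrite lerDr sqr_ge0.
Qed.

Lemma cabs_le_ReIm z : cabs z <= `|Re z| + `|Im z|.
Proof.
rewrite -(@ler_pXn2r _ 2)// ?nnegrE ?cabs_ge0// ?addr_ge0//.
rewrite cabs_sqr sqrrD !real_normK ?num_real// -addrA lerD2l lerDr.
by rewrite mulrn_wge0// mulr_ge0.
Qed.

Lemma cabs_real a : cabs (a%:C : Cx R) = `|a|.
Proof. by rewrite cabsE/= expr0n addr0 sqrtr_sqr. Qed.

Lemma cabs_nat n : cabs (n%:R : Cx R) = n%:R.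
Proof. by rewrite /cabs normr_nat; elim: n => //= n ih; rewrite -addn1 !natrD ReD ih. Qed.

Lemma cabs_le_real z a : cabs z <= a <-> `|z| <= (a%:C : Cx R).
Proof. by rewrite normcE lecR. Qed.

End ComplexModulus.

Section ComplexTopology.
Context {R : realType}.
Implicit Types (x y z : Cx R) (a b e d : R).

Lemma cx_gt0P (e : Cx R) : 0 < e -> exists2 r : R, 0 < r & e = r%:C.
Proof.
case: e => a b; rewrite ltcE/= => /andP[/eqP -> a0]; by exists a.
Qed.

Lemma cx_nbhsP z (P : set (Cx R)) :
  nbhs z P <-> exists2 d : R, 0 < d & forall w, cabs (w - z) < d -> P w.
Proof.
split.
  move=> /nbhs_ballP[e /= e0]; have [r r0 ->] := cx_gt0P e0 => h.
  by exists r => // w wz; apply: h; rewrite /ball/= cabsC in wz *;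
     rewrite normcE ltcR.
move=> [d d0 h]; apply/nbhs_ballP; exists (d%:C : Cx R) => /=; first by rewrite ltcR.
by move=> w; rewrite /ball/= normcE ltcR cabsC => /h.
Qed.

Lemma cx_cvgP T (F : set_system T) {FF : Filter F} (f : T -> Cx R) (l : Cx R) :
  f t @[t --> F] --> l <->
  forall e : R, 0 < e -> \forall t \near F, cabs (f t - l) < e.
Proof.
split.
  move=> h e e0; apply: (h [set w | cabs (w - l) < e]).
  by apply/cx_nbhsP; exists e.
move=> h A /cx_nbhsP[d d0 hA]; rewrite /fmap/=.
by near do apply: hA; exact: h.
Unshelve. all: by end_near. Qed.

Lemma mx_cvgP T (F : set_system T) {FF : Filter F} m n
    (f : T -> 'M[Cx R]_(m, n)) (l : 'M[Cx R]_(m, n)) :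
  f t @[t --> F] --> l <->
  forall i j, f t i j @[t --> F] --> l i j.
Proof.
split.
  move=> h i j; exact: (cvg_comp _ _ h (@coord_continuous _ m n i j l)).
move=> h A [P hP hA]; rewrite /fmap/=.
have hf : \forall t \near F, forall i j, P i j (f t i j).
  by apply: filter_forall => i; apply: filter_forall => j; apply: h; exact: hP.
by apply: filterS hf => t ht; apply: hA => i j; exact: ht.
Qed.

Lemma cx_contP (f : Cx R -> Cx R) z :
  {for z, continuous f} <-> forall e : R, 0 < e -> exists2 d : R, 0 < d &
    forall w, cabs (w - z) < d -> cabs (f w - f z) < e.
Proof.
split=> [h e e0|h].
  by apply/cx_nbhsP; apply: (@cx_cvgP _ (nbhs z) _ f (f z)).1.
by apply/(@cx_cvgP _ (nbhs z) _ f (f z)) => e e0; apply/cx_nbhsP; exact: h.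
Qed.

(** The increment form without a quotient also holds at [w = z], so the complex derivative can be
    used without punctured neighbourhoods. *)
Lemma cx_derivableP (f : Cx R -> Cx R) z :
  derivable f z 1 <-> exists l : Cx R, forall e : R, 0 < e -> exists2 d : R, 0 < d &
    forall w, cabs (w - z) < d -> cabs (f w - f z - l * (w - z)) <= e * cabs (w - z).
Proof.
split.
  move=> /cvg_ex[/= l /cx_cvgP h]; exists l => e e0.
  have [d d0 hd] := (@cx_nbhsP 0 _).1 (h e e0).
  exists d => // w; have [->|wz] := eqVneq w z.
    by rewrite !subrr mulr0 subr0 cabs0 mulr0.
  move=> wd; have hwz : w - z != 0 by rewrite subr_eq0.
  have := hd (w - z); rewrite subr0 => /(_ wd hwz).
  rewrite /GRing.scale/= mulr1 subrK => hh.
  rewrite -ler_pdivrMr ?cabs_gt0// -cabsV -cabsM.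
  by rewrite mulrBl mulrK ?unitfE// mulrC; exact: ltW.
move=> [l h]; apply/cvg_ex; exists l; apply/cx_cvgP => e e0.
apply/cx_nbhsP; have [d d0 hd] := h (e / 2) (divr_gt0 e0 (ltr0Sn _ 1)).
exists d => // w; rewrite subr0 => wd w0.
have := hd (w + z); rewrite addrK => /(_ wd) hh.
rewrite /= /GRing.scale/= mulr1; apply: (@le_lt_trans _ _ (e / 2)); last lra.
rewrite -(ler_pM2r (_ : 0 < cabs w)) ?cabs_gt0// -cabsM mulrBl mulrAC mulVf// mul1r.
exact: hh.
Qed.

End ComplexTopology.

Section RealCalculus.
Context {R : realType}.
Implicit Types (a b x y t : R).

Lemma derive_bound (f df : R -> R) a b M : a <= b ->
  (forall x, a <= x <= b -> is_derive x 1 f (df x)) ->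
  (forall x, a <= x <= b -> `|df x| <= M) -> `|f b - f a| <= M * (b - a).
Proof.
move=> ab fd fM.
have cf : {within `[a, b], continuous f}.
  apply: derivable_within_continuous => x; rewrite in_itv/= => /fd h.
  exact: ex_derive.
have [|c] := @MVT_segment R f df a b ab _ cf.
  by move=> x; rewrite in_itv/= => /andP[ax xb]; apply: fd; rewrite !ltW.
rewrite in_itv/= => hc ->; rewrite normrM (ger0_norm (_ : 0 <= b - a)) ?subr_ge0//.
by rewrite ler_wpM2r ?subr_ge0 ?fM.
Qed.

Lemma derive_bound_sym (f df : R -> R) M a b :
  (forall x, Num.min a b <= x <= Num.max a b -> is_derive x 1 f (df x)) ->
  (forall x, Num.min a b <= x <= Num.max a b -> `|df x| <= M) ->
  `|f b - f a| <= M * `|b - a|.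
Proof.
have [ab|/ltW ba] := leP a b => h1 h2.
  rewrite (ger0_norm (_ : 0 <= b - a)) ?subr_ge0//; exact: derive_bound h1 h2.
rewrite (distrC (f b)) (distrC b) (ger0_norm (_ : 0 <= a - b)) ?subr_ge0//.
exact: derive_bound h1 h2.
Qed.

Lemma cos_le1 x : `|cos x| <= 1.
Proof. by rewrite ler_norml cos_geN1 cos_le1. Qed.
Lemma sin_le1 x : `|sin x| <= 1.
Proof. by rewrite ler_norml sin_geN1 sin_le1. Qed.

Lemma norm_sin_le x : `|sin x| <= `|x|.
Proof.
have := @derive_bound_sym sin cos 1 0 x.
rewrite sin0 !subr0 mul1r; by apply=> y _; exact: cos_le1.
Qed.

Lemma between0 x y : Num.min 0 x <= y <= Num.max 0 x -> `|y| <= `|x|.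
Proof.
have [x0|/ltW x0] := leP 0 x => /andP[h1 h2]; first by rewrite !ger0_norm.
by rewrite !ler0_norm ?lerN2.
Qed.

Lemma cos_sub1_le x : `|cos x - 1| <= x ^+ 2.
Proof.
have := @derive_bound_sym cos (fun x => - sin x) `|x| 0 x.
rewrite cos0 !subr0 -expr2 real_normK ?num_real//; apply=> y hy.
by rewrite normrN (le_trans (norm_sin_le _))// between0.
Qed.

Lemma sin_sub_le x : `|x| <= 1 -> `|sin x - x| <= x ^+ 2.
Proof.
move=> x1.
have := @derive_bound_sym (fun x => sin x - x) (fun x => cos x - 1) `|x| 0 x.
rewrite sin0 !subr0 -expr2 real_normK ?num_real//; apply=> y hy.
rewrite (le_trans (cos_sub1_le _))// -real_normK ?num_real// expr2.
have h := between0 hy; rewrite (le_trans _ h)// ler_piMr// (le_trans h)//.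
Qed.

Lemma expR_sub_le x : `|x| <= 2^-1 -> `|expR x - 1 - x| <= 2 * x ^+ 2.
Proof.
rewrite ler_norml => /andP[x1 x2].
have h1 := expR_ge1Dx x; have := expR_ge1Dx (- x).
rewrite expRN => h2.
have e0 := expR_gt0 x.
rewrite ger0_norm; last by lra.
have : (1 - x) * expR x <= 1.
  by rewrite -[leRHS](mulVf (lt0r_neq0 e0)) ler_wpM2r// ltW.
nra.
Qed.

End RealCalculus.

Section ComplexExp.
Context {R : realType}.
Implicit Types (x y z h : Cx R) (a b e d : R).

Lemma Re_cexp z : Re (cexp z) = expR (Re z) * cos (Im z). Proof. by []. Qed.
Lemma Im_cexp z : Im (cexp z) = expR (Re z) * sin (Im z). Proof. by []. Qed.

Lemma cexpD x y : cexp (x + y) = cexp x * cexp y.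
Proof.
apply: eq_cx; rewrite !(Re_cexp, Im_cexp, ReImE) expRD ?cosD ?sinD; ring.
Qed.

Lemma cexp0 : cexp (0 : Cx R) = 1.
Proof. by apply: eq_cx; rewrite !(Re_cexp, Im_cexp, ReImE) expR0 ?cos0 ?sin0 !mul1r. Qed.

Lemma cabs_cexp z : cabs (cexp z) = expR (Re z).
Proof.
rewrite cabsE Re_cexp Im_cexp !exprMn -mulrDr cos2Dsin2 mulr1 sqrtr_sqr.
by rewrite gtr0_norm// expR_gt0.
Qed.

Lemma cexp_neq0 z : cexp z != 0.
Proof. by rewrite -cabs_gt0 cabs_cexp expR_gt0. Qed.

Lemma cexpN z : cexp (- z) = (cexp z)^-1.
Proof.
by apply: (mulfI (cexp_neq0 z)); rewrite -cexpD subrr cexp0 mulfV// cexp_neq0.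
Qed.

Lemma cexpB x y : cexp (x - y) = cexp x / cexp y.
Proof. by rewrite cexpD cexpN. Qed.

Lemma cexpMn z n : cexp (n%:R * z) = cexp z ^+ n.
Proof.
elim: n => [|n ih]; first by rewrite mul0r cexp0 expr0.
by rewrite -addn1 natrD mulrDl mul1r cexpD ih exprD expr1.
Qed.

(** The two parts of the remainder are rearranged into the real remainders [expR a - 1 - a],
    [cos b - 1], [sin b - b] and [expR a - 1]; the constant 10 is generous. *)
Lemma cexp_sub1_sub h : cabs h <= 2^-1 -> cabs (cexp h - 1 - h) <= 10 * cabs h ^+ 2.
Proof.
move=> h2.
have ha : `|Re h| <= 2^-1 by exact: le_trans (Re_le_cabs _) h2.
have hb : `|Im h| <= 2^-1 by exact: le_trans (Im_le_cabs _) h2.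
rewrite (le_trans (cabs_le_ReIm _))// cabs_sqr !(Re_cexp, Im_cexp, ReImE).
move: (Re h) (Im h) ha hb => a b ha hb.
have := expR_sub_le ha; have := cos_sub1_le b.
have hb1 : `|b| <= 1 by lra.
have h3 := sin_sub_le hb1 => h4 h5.
have e0 := expR_gt0 a.
have e3 : expR a <= 2 by move: ha h5; rewrite !ler_norml => /andP[? ?] /andP[? ?]; nra.
rewrite oppr0 addr0.
have E1 : expR a * cos b - 1 - a = expR a * (cos b - 1) + (expR a - 1 - a) by ring.
have E2 : expR a * sin b - b = expR a * (sin b - b) + (expR a - 1) * b by ring.
have B1 : `|expR a * cos b - 1 - a| <= 2 * b ^+ 2 + 2 * a ^+ 2.
  rewrite E1 (le_trans (ler_normD _ _))// lerD// normrM gtr0_norm//.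
  by rewrite ler_pM// ltW.
have B2 : `|expR a - 1| <= 2 * `|a|.
  have h6 : `|expR a - 1 - a| <= `|a|.
    rewrite (le_trans h5)// -real_normK ?num_real// expr2 mulrA ler_piMl//; lra.
  have := ler_normD (expR a - 1 - a) a; rewrite subrK; lra.
have B3 : `|expR a * sin b - b| <= 2 * b ^+ 2 + 2 * `|a| * `|b|.
  rewrite E2 (le_trans (ler_normD _ _))// lerD//.
    by rewrite normrM gtr0_norm// ler_pM// ltW.
  by rewrite normrM ler_wpM2r.
have B4 : 2 * `|a| * `|b| <= a ^+ 2 + b ^+ 2.
  rewrite -(real_normK (num_real a)) -(real_normK (num_real b)).
  have := sqr_ge0 (`|a| - `|b|); nra.
have := sqr_ge0 a; have := sqr_ge0 b; nra.
Qed.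

Lemma cexp_sub1_ub h : cabs h <= 20^-1 -> cabs (cexp h - 1) <= 2 * cabs h.
Proof.
move=> h2; have h2' : cabs h <= 2^-1 by lra.
have h3 := cexp_sub1_sub h2'.
have := cabsD (cexp h - 1 - h) h; rewrite subrK.
have := cabs_ge0 h; nra.
Qed.

(** Quantitative local injectivity of the exponential: for |h| <= 1/20 the remainder 10 |h|^2 is at
    most |h|/2. This is how increments of a logarithm are controlled by those of its exponential. *)
Lemma cexp_sub1_lb h : cabs h <= 20^-1 -> cabs h <= 2 * cabs (cexp h - 1).
Proof.
move=> h2; have h2' : cabs h <= 2^-1 by lra.
have h3 := cexp_sub1_sub h2'.
have := cabs_sub h (h - (cexp h - 1)); rewrite subKr (cabsC h).
have := cabs_ge0 h; nra.
Qed.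

Lemma cexp_continuous z : {for z, continuous (@cexp R)}.
Proof.
apply/cx_contP => e e0.
exists (Num.min 20^-1 (e / (4 * expR (Re z)))).
  by rewrite lt_min invr_gt0 ltr0n/= divr_gt0// mulr_gt0// expR_gt0.
move=> w; rewrite lt_min => /andP[h1 h2].
have -> : cexp w - cexp z = cexp z * (cexp (w - z) - 1).
  by rewrite cexpB mulrBr mulrCA mulfV ?cexp_neq0// !mulr1.
rewrite cabsM cabs_cexp; have := cexp_sub1_ub (ltW h1) => h3.
have e1 := expR_gt0 (Re z).
move: h2; rewrite ltr_pdivlMr ?mulr_gt0// => h2; nra.
Qed.

End ComplexExp.

(** [cintegrable g f] and [cint g f] unfold to [CInt] and [CI] of [pullback g f] on [0, 1], so facts
    about the loop are used below by conversion. *)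
Definition CInt (R : realType) (D : set R) (f : R -> Cx R) : Prop :=
  (@lebesgue_measure R).-integrable D (EFin \o (Re \o f)) /\
  (@lebesgue_measure R).-integrable D (EFin \o (Im \o f)).

Definition CI (R : realType) (D : set R) (f : R -> Cx R) : Cx R :=
  (\int[@lebesgue_measure R]_(t in D) Re (f t)) +i*
  (\int[@lebesgue_measure R]_(t in D) Im (f t)).

(** A majorant of the modulus whose integrability follows at once from that of the two parts. *)
Definition norm1 (R : realType) (z : Cx R) : R := `|Re z| + `|Im z|.

Definition cmeas (R : realType) (D : set R) (h : R -> Cx R) : Prop :=
  measurable_fun D (Re \o h) /\ measurable_fun D (Im \o h).

Section ComplexIntegral.
Context {R : realType}.
Local Notation mu := (@lebesgue_measure R).
Implicit Types (D : set R) (f g h : R -> Cx R) (a b c M : R).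

Lemma norm1_ge0 (z : Cx R) : 0 <= norm1 z.
Proof. by rewrite addr_ge0. Qed.

Lemma cabs_le_norm1 (z : Cx R) : cabs z <= norm1 z.
Proof. exact: cabs_le_ReIm. Qed.

Lemma eq_CInt D f g : msr D -> {in D, f =1 g} -> CInt D f -> CInt D g.
Proof.
move=> mD fg [h1 h2]; split.
  by apply: eq_integrable h1 => // t /fg/= ->.
by apply: eq_integrable h2 => // t /fg/= ->.
Qed.

Lemma eq_CI D f g : {in D, f =1 g} -> CI D f = CI D g.
Proof.
by move=> fg; congr Complex; apply: eq_Rintegral => t /fg ->.
Qed.

Lemma integrable_norm1 D f : msr D -> CInt D f ->
  mu.-integrable D (EFin \o (fun t => norm1 (f t))).
Proof.
move=> mD [h1 h2].
have n1 := integrable_norm h1; have n2 := integrable_norm h2.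
by apply: eq_integrable (integrableD mD n1 n2) => // t _ /=; rewrite EFinD.
Qed.

Section OnMeasurableSet.
Context (D : set R) (mD : msr D).

Lemma Rint_D (f g : R -> R) : mu.-integrable D (EFin \o f) ->
  mu.-integrable D (EFin \o g) -> mu.-integrable D (EFin \o (fun t => f t + g t)).
Proof. by move=> h1 h2; apply: eq_integrable (integrableD mD h1 h2). Qed.

Lemma Rint_B (f g : R -> R) : mu.-integrable D (EFin \o f) ->
  mu.-integrable D (EFin \o g) -> mu.-integrable D (EFin \o (fun t => f t - g t)).
Proof. by move=> h1 h2; apply: eq_integrable (integrableB mD h1 h2). Qed.

Lemma Rint_Z (k : R) (f : R -> R) : mu.-integrable D (EFin \o f) ->
  mu.-integrable D (EFin \o (fun t => k * f t)).
Proof. by move=> h1; apply: eq_integrable (integrableZl mD k h1). Qed.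

Lemma Rint_M (M : R) (h g : R -> R) : measurable_fun D h ->
  (forall t, D t -> `|h t| <= M) -> mu.-integrable D (EFin \o g) ->
  mu.-integrable D (EFin \o (fun t => h t * g t)).
Proof.
move=> mh hM ig; apply: eq_integrable (integrableMr mD mh _ ig) => //.
exists M; split; first exact: num_real.
by move=> x Mx t Dt /=; exact: le_trans (hM _ Dt) (ltW Mx).
Qed.

Lemma CInt_D f g : CInt D f -> CInt D g -> CInt D (fun t => f t + g t).
Proof.
move=> [f1 f2] [g1 g2]; split.
  by apply: eq_integrable (Rint_D f1 g1) => // t _ /=; rewrite ReD.
by apply: eq_integrable (Rint_D f2 g2) => // t _ /=; rewrite ImD.
Qed.

Lemma CID f g : CInt D f -> CInt D g ->
  CI D (fun t => f t + g t) = CI D f + CI D g.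
Proof.
move=> [f1 f2] [g1 g2]; apply: eq_cx; rewrite ReImE/= -RintegralD//.
  by apply: eq_Rintegral => t _; rewrite ReD.
by apply: eq_Rintegral => t _; rewrite ImD.
Qed.

Lemma CInt_M M h f : cmeas D h -> (forall t, D t -> cabs (h t) <= M) ->
  CInt D f -> CInt D (fun t => h t * f t).
Proof.
move=> [h1 h2] hM [f1 f2].
have r1 t : D t -> `|(Re \o h) t| <= M.
  by move=> /hM; apply: le_trans; exact: Re_le_cabs.
have r2 t : D t -> `|(Im \o h) t| <= M.
  by move=> /hM; apply: le_trans; exact: Im_le_cabs.
split.
  apply: eq_integrable (Rint_B (Rint_M h1 r1 f1) (Rint_M h2 r2 f2)) => // t _ /=.
  by rewrite ReM.
apply: eq_integrable (Rint_D (Rint_M h1 r1 f2) (Rint_M h2 r2 f1)) => // t _ /=.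
by rewrite ImM.
Qed.

Lemma CInt_Z (k : Cx R) f : CInt D f -> CInt D (fun t => k * f t).
Proof.
by move=> hf; apply: (@CInt_M (cabs k) (fun=> k)) => //; split;
  exact: measurable_cst.
Qed.

Lemma CIZ (k : Cx R) f : CInt D f -> CI D (fun t => k * f t) = k * CI D f.
Proof.
move=> [f1 f2]; apply: eq_cx; rewrite ReImE/=.
  rewrite -!RintegralZl// -RintegralB//; [|exact: Rint_Z..].
  by apply: eq_Rintegral => t _; rewrite ReM.
rewrite -!RintegralZl// -RintegralD//; [|exact: Rint_Z..].
by apply: eq_Rintegral => t _; rewrite ImM.
Qed.

Lemma CInt_N f : CInt D f -> CInt D (fun t => - f t).
Proof.
by move=> /(CInt_Z (-1)); apply: eq_CInt => // t _; rewrite mulN1r.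
Qed.

Lemma CIN f : CInt D f -> CI D (fun t => - f t) = - CI D f.
Proof.
by move=> /(CIZ (-1)); rewrite mulN1r => <-; apply: eq_CI => t _; rewrite mulN1r.
Qed.

Lemma CInt_B f g : CInt D f -> CInt D g -> CInt D (fun t => f t - g t).
Proof. by move=> hf hg; apply: CInt_D => //; exact: CInt_N. Qed.

Lemma CIB f g : CInt D f -> CInt D g ->
  CI D (fun t => f t - g t) = CI D f - CI D g.
Proof. by move=> hf hg; rewrite CID// ?CIN//; exact: CInt_N. Qed.

Lemma CInt_0 : CInt D (fun=> 0).
Proof. by split; apply: eq_integrable (integrable0 mu D). Qed.

Lemma CI_0 : CI D (fun=> 0) = 0.
Proof. by apply: eq_cx; rewrite /= Rintegral_cst// mul0r. Qed.

Lemma CInt_sum I (r : seq I) (F : I -> R -> Cx R) :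
  (forall i, CInt D (F i)) -> CInt D (fun t => \sum_(i <- r) F i t).
Proof.
move=> hF; elim: r => [|i r ih].
  by apply: eq_CInt CInt_0 => // t _; rewrite big_nil.
by apply: eq_CInt (CInt_D (hF i) ih) => // t _; rewrite big_cons.
Qed.

Lemma CI_sum I (r : seq I) (F : I -> R -> Cx R) :
  (forall i, CInt D (F i)) ->
  CI D (fun t => \sum_(i <- r) F i t) = \sum_(i <- r) CI D (F i).
Proof.
move=> hF; elim: r => [|i r ih].
  by rewrite big_nil -[RHS]CI_0; apply: eq_CI => t _; rewrite big_nil.
rewrite big_cons -ih -CID//; last exact: CInt_sum.
by apply: eq_CI => t _; rewrite big_cons.
Qed.

(** The factor 2 is the price of estimating the real and imaginary parts separately; it is carried
    through all later constants. *)
Lemma CI_le f (B : R -> R) : CInt D f -> mu.-integrable D (EFin \o B) ->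
  (forall t, D t -> cabs (f t) <= B t) ->
  cabs (CI D f) <= 2 * \int[mu]_(t in D) B t.
Proof.
move=> [f1 f2] iB fB; rewrite (le_trans (cabs_le_ReIm _))//= mulr_natl mulr2n.
rewrite lerD//.
  apply: le_trans (le_normr_Rintegral mD f1) _.
  apply: le_Rintegral => //; first exact: integrable_norm f1.
  by move=> t Dt /=; rewrite (le_trans (Re_le_cabs _))// fB.
apply: le_trans (le_normr_Rintegral mD f2) _.
apply: le_Rintegral => //; first exact: integrable_norm f2.
by move=> t Dt /=; rewrite (le_trans (Im_le_cabs _))// fB.
Qed.

End OnMeasurableSet.

Lemma CInt_sub D E f : msr D -> msr E -> D `<=` E ->
  CInt E f -> CInt D f.
Proof. by move=> mD mE DE [h1 h2]; split; [move: h1|move: h2]; exact: integrableS. Qed.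

Lemma Rint_continuous a b (f : R -> R) :
  {within `[a, b], continuous f} -> mu.-integrable `[a, b] (EFin \o f).
Proof.
by move=> cf; apply: continuous_compact_integrable => //; exact: segment_compact.
Qed.

Lemma Rint_cst a b (k : R) : mu.-integrable `[a, b] (EFin \o (fun=> k)).
Proof.
by apply: Rint_continuous; apply: continuous_subspaceT => x; exact: cvg_cst.
Qed.

Lemma Rintegral_cst_itv a b (k : R) : a <= b ->
  \int[mu]_(t in `[a, b]) k = k * (b - a).
Proof.
move=> ab; rewrite Rintegral_cst//= lebesgue_measure_itv/= lte_fin.
by case: ltgtP ab => //= -> _; rewrite subrr.
Qed.

Lemma CI_le_cst a b f M : a <= b -> CInt `[a, b] f ->
  (forall t, a <= t <= b -> cabs (f t) <= M) ->
  cabs (CI `[a, b] f) <= 2 * (M * (b - a)).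
Proof.
move=> ab hf hM; rewrite -Rintegral_cst_itv//; apply: CI_le => //.
exact: Rint_cst.
Qed.

Lemma Rint_split a b c (f : R -> R) : a <= c -> c <= b ->
  mu.-integrable `[a, b] (EFin \o f) ->
  \int[mu]_(t in `[a, b]) f t = \int[mu]_(t in `[a, c]) f t + \int[mu]_(t in `[c, b]) f t.
Proof.
move=> ac cb hf.
have h : mu.-integrable `]c, b] (EFin \o f).
  by apply: integrableS hf => //; apply: subset_itvr; rewrite bnd_simp.
rewrite -(@Rintegral_itv_obnd_cbnd R c (BRight b) f h).
by rewrite -(@Rintegral_itvB R f (BLeft a) (BRight b) c hf) ?bnd_simp// addrC subrK.
Qed.

Lemma CI_split a b c f : a <= c -> c <= b -> CInt `[a, b] f ->
  CI `[a, b] f = CI `[a, c] f + CI `[c, b] f.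
Proof.
by move=> ac cb [h1 h2]; apply: eq_cx; rewrite ReImE/=; exact: Rint_split.
Qed.

Lemma CInt_subitv a b a' b' f : a <= a' -> b' <= b -> CInt `[a, b] f ->
  CInt `[a', b'] f.
Proof.
move=> aa bb; apply: CInt_sub => //.
by apply: subset_itvScc; rewrite bnd_simp.
Qed.

Lemma Rint_FTC a b (f F : R -> R) : a <= b ->
  (forall x, a <= x <= b -> is_derive x 1 F (f x)) ->
  {within `[a, b], continuous f} ->
  \int[mu]_(t in `[a, b]) f t = F b - F a.
Proof.
rewrite le_eqVlt => /predU1P[<- _ _|ab dF cf].
  by rewrite set_itv1 Rintegral_set1 subrr.
have dF' x : a <= x <= b -> derivable F x 1 by move=> /dF h; exact: ex_derive.
have cF x : a <= x <= b -> {for x, continuous F}.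
  by move=> /dF' h; apply/differentiable_continuous/derivable1_diffP.
rewrite /Rintegral (@continuous_FTC2 _ f F)//.
- split.
  + by move=> x; rewrite in_itv/= => /andP[h1 h2]; apply: dF'; rewrite !ltW.
  + by apply/cvg_at_right_filter/cF; rewrite lexx ltW.
  + by apply/cvg_at_left_filter/cF; rewrite lexx ltW.
- move=> x; rewrite in_itv/= => /andP[h1 h2].
  have h : a <= x <= b by rewrite !ltW.
  by rewrite derive1E; have hh := dF _ h; rewrite derive_val.
Qed.

End ComplexIntegral.

(** * The substitution t -> 1 - t, which exchanges the two ends of the loop *)

Section Reflection.
Context {R : realType}.
Local Notation mu := (@lebesgue_measure R).

Definition reflect1 (x : measurableTypeR R) : measurableTypeR R := 1 - x.

Lemma measurable_reflect1 : measurable_fun setT reflect1.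
Proof.
apply: (@measurable_realfun.measurable_funB _ (measurableTypeR R) R setT (cst 1) id).
  exact: measurable_cst.
exact: measurable_id.
Qed.

Local Notation mu' := (measure_function_pushforward__canonical__measure_function_Measure
  mu measurable_reflect1).

Lemma reflect1K : involutive reflect1. Proof. by move=> x; rewrite /reflect1 subKr. Qed.

(** Lebesgue measure is determined by its values on half-open intervals, and the reflected interval
    has the same length. *)
Lemma lebesgue_reflection (A : set (measurableTypeR R)) : msr A -> mu A = mu' A.
Proof.
apply: lebesgue_measure_unique => X [[a b] _ <-] /=.
rewrite /pushforward.
have -> : reflect1 @^-1` `]a, b]%classic = `[1 - b, 1 - a[%classic.
  by apply/seteqP; split=> x; rewrite /reflect1 /= !in_itv/=; lra.
rewrite !lebesgue_measure_itv/= !lte_fin ltrD2l ltrN2.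
by case: ifP => // _; rewrite -!EFinB; congr EFin; ring.
Qed.

Lemma Rint_reflection a b (f : R -> R) : a <= b ->
  mu.-integrable `[a, b] (EFin \o f) ->
  mu.-integrable `[1 - b, 1 - a] (EFin \o (fun t => f (1 - t))) /\
  \int[mu]_(t in `[a, b]) f t = \int[mu]_(t in `[1 - b, 1 - a]) f (1 - t).
Proof.
move=> ab fi.
have pre : reflect1 @^-1` `[1 - b, 1 - a]%classic = `[a, b]%classic.
  by apply/seteqP; split=> x; rewrite /reflect1 /= !in_itv/=; lra.
(* The pushforward theorem asks for a function measurable on the whole line, hence the extension by
   0. *)
pose fab : measurableTypeR R -> R := f \_ `[a, b].
pose h : measurableTypeR R -> R := fab \o reflect1.
have mf : measurable_fun [set: measurableTypeR R] (EFin \o fab).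
  rewrite /fab -restrict_EFin; apply/(measurable_restrictT _ _).1 => //.
  exact: (measurable_int mu).
have mh : measurable_fun [set: measurableTypeR R] (EFin \o h).
  rewrite /h compA; apply: measurableT_comp; [exact: mf|exact: measurable_reflect1].
have hK : (EFin \o h) \o reflect1 = EFin \o fab.
  by apply/funext => x; rewrite /h /= reflect1K.
have fi' : mu.-integrable (reflect1 @^-1` `[1 - b, 1 - a]%classic) ((EFin \o h) \o reflect1).
  rewrite hK pre; apply: (@eq_integrable _ (measurableTypeR R) R mu `[a, b]%classic (measurable_itv _) (EFin \o f) (EFin \o fab) _ fi) => x xab.
  by rewrite /= /fab patchE xab.
have hE : {in `[1 - b, 1 - a]%classic, (EFin \o h) =1 EFin \o (fun t => f (1 - t))}.
  move=> x; rewrite inE/= in_itv/= => hx; rewrite /h /fab /= patchE mem_set//= in_itv/=.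
  by rewrite /reflect1; lra.
have eqm (k : measurableTypeR R -> \bar R) D : msr D ->
    (\int[mu']_(x in D) k x = \int[mu]_(x in D) k x)%E.
  by move=> mD; apply: eq_measure_integral => A mA _; exact/esym/lebesgue_reflection.
have ih : mu'.-integrable `[1 - b, 1 - a] (EFin \o h).
  exact: (integrable_pushforward measurable_reflect1 mh fi' (measurable_itv _)).
have ih' : mu.-integrable `[1 - b, 1 - a] (EFin \o h).
  move/integrableP : ih => [mhD ihD]; apply/integrableP; split=> //.
  by rewrite -eqm.
split; first exact: (@eq_integrable _ (measurableTypeR R) R mu _ (measurable_itv _) _ _ hE ih').
have := integral_pushforward measurable_reflect1 mh fi' (measurable_itv _).
rewrite pre eqm// hK => E; rewrite /Rintegral; congr fine.
transitivity (\int[mu]_(x in `[a, b]) (EFin \o fab) x)%E.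
  by apply: eq_integral => x xab; rewrite /= /fab patchE xab.
by rewrite -E; apply: eq_integral => x /hE.
Qed.

Lemma CI_reflection a b (f : R -> Cx R) : a <= b -> CInt `[a, b] f ->
  CInt `[1 - b, 1 - a] (fun t => f (1 - t)) /\
  CI `[a, b] f = CI `[1 - b, 1 - a] (fun t => f (1 - t)).
Proof.
move=> ab [/(Rint_reflection ab)[h1 e1] /(Rint_reflection ab)[h2 e2]].
by split; [split|rewrite /CI e1 e2].
Qed.

End Reflection.

(** * Cauchy's formula and Liouville's theorem *)

Section Bisection.
Context {R : realType}.
Implicit Types (a w c h x y e d : R).

(** The left ends increase and stay below every right end, so their supremum lies in all the
    intervals. *)
Lemma nested_point (a : nat -> R) w : 0 <= w ->
  (forall n, a n <= a n.+1 /\ a n.+1 + w / 2 ^+ n.+1 <= a n + w / 2 ^+ n) ->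
  exists x, forall n, a n <= x <= a n + w / 2 ^+ n.
Proof.
move=> w0 ha.
have mono n m : a n <= a (n + m)%N /\
    a (n + m)%N + w / 2 ^+ (n + m) <= a n + w / 2 ^+ n.
  elim: m => [|m [ih1 ih2]]; first by rewrite addn0.
  have [h1 h2] := ha (n + m)%N; rewrite addnS; split.
    exact: le_trans h1.
  exact: le_trans ih2.
have pos n : 0 <= w / 2 ^+ n by rewrite divr_ge0// exprn_ge0.
have up n m : a m <= a n + w / 2 ^+ n.
  have [nm|/ltnW mn] := leqP n m.
    have [_] := mono n (m - n)%N; rewrite subnKC// => h.
    by apply: le_trans h; rewrite lerDl.
  have [h _] := mono m (n - m)%N; rewrite subnKC// in h.
  by apply: le_trans h _; rewrite lerDl.
have hs : has_sup (range a).
  by split; [exists (a 0%N); exists 0%N|exists (a 0%N + w / 2 ^+ 0) => _ [m _ <-]].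
exists (sup (range a)) => n; apply/andP; split.
  by apply: ub_le_sup; [case: hs|exists n].
by apply: ge_sup; [case: hs|move=> _ [m _ <-]].
Qed.

Lemma half_pow_small w d : 0 <= w -> 0 < d -> exists n : nat, w / 2 ^+ n < d.
Proof.
move=> w0 d0.
have [n hn] : exists n : nat, w / d < n%:R.
  by exists (Num.bound (w / d)); rewrite archi_boundP// divr_ge0// ltW.
exists n; rewrite ltr_pdivrMr ?exprn_gt0// mulrC -ltr_pdivrMr//.
apply: lt_trans hn _; rewrite -natrX ltr_nat; exact: ltn_expl.
Qed.

(** Compactness of a rectangle as an induction principle, in the coordinates left end, width,
    bottom, height. Failure would descend through nested quarters to a point, where the local
    hypothesis contradicts it. It serves Goursat's theorem, uniform continuity and boundedness
    alike. *)
Lemma bisection (P : R -> R -> R -> R -> Prop) :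
  (forall a w c h, 0 <= w -> 0 <= h ->
     P a (w / 2) c (h / 2) -> P (a + w / 2) (w / 2) c (h / 2) ->
     P a (w / 2) (c + h / 2) (h / 2) -> P (a + w / 2) (w / 2) (c + h / 2) (h / 2) ->
     P a w c h) ->
  (forall x y, exists2 d, 0 < d & forall a w c h, 0 <= w -> 0 <= h ->
     a <= x <= a + w -> c <= y <= c + h -> w < d -> h < d -> P a w c h) ->
  forall a w c h, 0 <= w -> 0 <= h -> P a w c h.
Proof.
move=> step loc a w c h w0 h0; apply: contrapT => nP.
pose bad n (p : R * R) := ~ P p.1 (w / 2 ^+ n) p.2 (h / 2 ^+ n).
(* The implication sits under the existential, so that [choice] yields a total selection; where
   nothing fails its value is arbitrary. *)
have next n p : exists q : R * R, bad n p -> [/\ bad n.+1 q,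
    q.1 = p.1 \/ q.1 = p.1 + w / 2 ^+ n.+1 & q.2 = p.2 \/ q.2 = p.2 + h / 2 ^+ n.+1].
  have [bp|nbp] := pselect (bad n p); last by exists p.
  have hw (v : R) : v / 2 ^+ n / 2 = v / 2 ^+ n.+1.
    by rewrite exprSr invfM mulrA.
  have pos (v : R) : 0 <= v -> 0 <= v / 2 ^+ n.
    by move=> v0; rewrite divr_ge0// exprn_ge0.
  have := step p.1 _ p.2 _ (pos _ w0) (pos _ h0); rewrite !hw => hstep.
  have [h1|h1] := pselect (bad n.+1 (p.1, p.2)); first by exists (p.1, p.2) => _; split=> //; left.
  have [h2|h2] := pselect (bad n.+1 (p.1 + w / 2 ^+ n.+1, p.2)).
    by exists (p.1 + w / 2 ^+ n.+1, p.2) => _; split=> //; [right|left].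
  have [h3|h3] := pselect (bad n.+1 (p.1, p.2 + h / 2 ^+ n.+1)).
    by exists (p.1, p.2 + h / 2 ^+ n.+1) => _; split=> //; [left|right].
  have [h4|h4] := pselect (bad n.+1 (p.1 + w / 2 ^+ n.+1, p.2 + h / 2 ^+ n.+1)).
    by exists (p.1 + w / 2 ^+ n.+1, p.2 + h / 2 ^+ n.+1) => _; split=> //; right.
  by exfalso; apply: bp; apply: hstep; apply: contrapT.
have [f hf] := choice (fun np : nat * (R * R) => next np.1 np.2).
pose s := fix s n : R * R := if n is m.+1 then f (m, s m) else (a, c).
have sbad n : bad n (s n).
  elim: n => [|n ih]; first by rewrite /bad/= !expr0 !divr1.
  by have [] := hf (n, s n) ih.
have hs n : ((s n.+1).1 = (s n).1 \/ (s n.+1).1 = (s n).1 + w / 2 ^+ n.+1) /\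
    ((s n.+1).2 = (s n).2 \/ (s n.+1).2 = (s n).2 + h / 2 ^+ n.+1).
  by have [_] := hf (n, s n) (sbad n).
have half (v : R) n : v / 2 ^+ n = v / 2 ^+ n.+1 + v / 2 ^+ n.+1.
  rewrite exprS invfM mulrCA -mulrDl; lra.
have pos (v : R) n : 0 <= v -> 0 <= v / 2 ^+ n.
  by move=> v0; rewrite divr_ge0// exprn_ge0.
have [x hx] : exists x, forall n, (s n).1 <= x <= (s n).1 + w / 2 ^+ n.
  apply: nested_point => // n; have := pos w n.+1 w0.
  by have [[->|->] _] := hs n; rewrite (half w n); lra.
have [y hy] : exists y, forall n, (s n).2 <= y <= (s n).2 + h / 2 ^+ n.
  apply: nested_point => // n; have := pos h n.+1 h0.
  by have [_ [->|->]] := hs n; rewrite (half h n); lra.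
have [d d0 hd] := loc x y.
have [n hn] := half_pow_small (addr_ge0 w0 h0) d0.
rewrite mulrDl in hn.
have p1 := pos w n w0; have p2 := pos h n h0.
by apply: (sbad n); apply: hd => //; lra.
Qed.

End Bisection.

Section RectangleIntegral.
Context {R : realType}.
Implicit Types (a b c d r e M x y : R) (k f : Cx R -> Cx R).

Definition cI : Cx R := 0 +i* 1.

(** The integral of k dz counterclockwise around the rectangle; on the vertical sides dz = i dy
    gives the factor [cI]. *)
Definition RectI k a b c d : Cx R :=
  CI `[a, b] (fun x => k (x +i* c)) + cI * CI `[c, d] (fun y => k (b +i* y))
  - CI `[a, b] (fun x => k (x +i* d)) - cI * CI `[c, d] (fun y => k (a +i* y)).

Definition sidesInt k a b c d :=
  [/\ CInt `[a, b] (fun x => k (x +i* c)), CInt `[c, d] (fun y => k (b +i* y)),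
      CInt `[a, b] (fun x => k (x +i* d)) & CInt `[c, d] (fun y => k (a +i* y))].

Definition on_bd a b c d (z : Cx R) :=
  (a <= Re z <= b /\ (Im z = c \/ Im z = d)) \/
  (c <= Im z <= d /\ (Re z = a \/ Re z = b)).

Lemma cabs_cI : cabs cI = 1.
Proof. by rewrite cabsE/= expr0n/= add0r expr1n sqrtr1. Qed.

Lemma CInt_cont a b (f : R -> Cx R) :
  (forall x, a <= x <= b -> forall e, 0 < e -> exists2 d, 0 < d &
     forall y, `|y - x| < d -> cabs (f y - f x) < e) -> CInt `[a, b] f.
Proof.
move=> h; split; apply: Rint_continuous; apply: continuous_in_subspaceT => x.
  rewrite inE/= in_itv/= => hx; apply/cvgrPdist_lt => e e0.
  have [d d0 hd] := h x hx e e0.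
have hb : \forall y \near x, `|x - y| < d by apply/nbhs_ballP; exists d.
near=> y.
  have := hd y; rewrite -ReN -ReD cabsC => hy.
  by rewrite (le_lt_trans (Re_le_cabs _))//=; apply: hy; rewrite distrC; near: y.
rewrite inE/= in_itv/= => hx; apply/cvgrPdist_lt => e e0.
have [d d0 hd] := h x hx e e0.
have hb : \forall y \near x, `|x - y| < d by apply/nbhs_ballP; exists d.
near=> y.
have := hd y; rewrite -ImN -ImD cabsC => hy.
by rewrite (le_lt_trans (Im_le_cabs _))//=; apply: hy; rewrite distrC; near: y.
Unshelve. all: by end_near. Qed.

Lemma sidesInt_cont k a b c d :
  (forall z, on_bd a b c d z -> {for z, continuous k}) -> a <= b -> c <= d ->
  sidesInt k a b c d.
Proof.
move=> hk ab cd.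
have H y0 : (y0 = c \/ y0 = d) -> CInt `[a, b] (fun x => k (x +i* y0)).
  move=> hy; apply: CInt_cont => x hx e e0.
  have /cx_contP/(_ e e0)[dd d0 hd] := hk (x +i* y0) (or_introl (conj hx hy)).
  exists dd => // y yx; apply: hd; rewrite cabsE/= subrr expr0n addr0 sqrtr_sqr//.
have V x0 : (x0 = a \/ x0 = b) -> CInt `[c, d] (fun y => k (x0 +i* y)).
  move=> hx; apply: CInt_cont => y hy e e0.
  have /cx_contP/(_ e e0)[dd d0 hd] := hk (x0 +i* y) (or_intror (conj hy hx)).
  exists dd => // y' yx; apply: hd; rewrite cabsE/= subrr expr0n add0r sqrtr_sqr//.
by split; [apply: H; left|apply: V; right|apply: H; right|apply: V; left].
Qed.

Lemma RectID k f a b c d : sidesInt k a b c d -> sidesInt f a b c d ->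
  RectI (fun z => k z + f z) a b c d = RectI k a b c d + RectI f a b c d.
Proof.
by move=> [? ? ? ?] [? ? ? ?]; rewrite /RectI !CID//; ring.
Qed.

Lemma RectIZ (m : Cx R) k a b c d : sidesInt k a b c d ->
  RectI (fun z => m * k z) a b c d = m * RectI k a b c d.
Proof.
by move=> [? ? ? ?]; rewrite /RectI !CIZ//; ring.
Qed.

Lemma sidesInt_D k f a b c d : sidesInt k a b c d -> sidesInt f a b c d ->
  sidesInt (fun z => k z + f z) a b c d.
Proof. by move=> [? ? ? ?] [? ? ? ?]; split; exact: CInt_D. Qed.

Lemma sidesInt_Z (m : Cx R) k a b c d : sidesInt k a b c d ->
  sidesInt (fun z => m * k z) a b c d.
Proof. by move=> [? ? ? ?]; split; exact: CInt_Z. Qed.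

Lemma eq_RectI k f a b c d : a <= b -> c <= d -> (forall z, on_bd a b c d z -> k z = f z) ->
  RectI k a b c d = RectI f a b c d.
Proof.
move=> ab cd kf; rewrite /RectI; congr (_ + _ * _ - _ - _ * _); apply: eq_CI => t;
  rewrite inE/= in_itv/= => ht; apply: kf.
- by left; split=> //; left.
- by right; split=> //; right.
- by left; split=> //; right.
- by right; split=> //; left.
Qed.

(** The perimeter, with the extra factor 2 of [CI_le_cst]. *)
Lemma RectI_le k a b c d M : a <= b -> c <= d -> sidesInt k a b c d ->
  (forall z, on_bd a b c d z -> cabs (k z) <= M) ->
  cabs (RectI k a b c d) <= 4 * (M * ((b - a) + (d - c))).
Proof.
move=> ab cd [i1 i2 i3 i4] hM.
have := CI_le_cst ab i1 (fun t ht => hM (t +i* c) (or_introl (conj ht (or_introl erefl)))).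
have := CI_le_cst ab i3 (fun t ht => hM (t +i* d) (or_introl (conj ht (or_intror erefl)))).
have := CI_le_cst cd i2 (fun t ht => hM (b +i* t) (or_intror (conj ht (or_intror erefl)))).
have := CI_le_cst cd i4 (fun t ht => hM (a +i* t) (or_intror (conj ht (or_introl erefl)))).
rewrite /RectI => h4 h2 h3 h1.
set x1 := CI _ _; set x2 := CI _ _ in h2 *; set x3 := CI _ _; set x4 := CI _ _.
have := cabsB (x1 + cI * x2 - x3) (cI * x4).
have := cabsB (x1 + cI * x2) x3.
have := cabsD x1 (cI * x2); rewrite !cabsM cabs_cI !mul1r; lra.
Qed.

Lemma CI_cst a b (m : Cx R) : a <= b -> CI `[a, b] (fun=> m) = ((b - a)%:C : Cx R) * m.
Proof.
by move=> ab; apply: eq_cx; rewrite ReImE /CI/= !Rintegral_cst_itv//=; ring.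
Qed.

Lemma CInt_cst a b (m : Cx R) : CInt `[a, b] (fun=> m).
Proof. by split; exact: Rint_cst. Qed.

(** Checked by direct integration; it allows the tangent map to be subtracted in Goursat's theorem
    and a constant in each cell of Painleve's. *)
Lemma RectI_affine (m l : Cx R) a b c d : a <= b -> c <= d ->
  RectI (fun z => m + l * z) a b c d = 0.
Proof.
move=> ab cd.
have S (f : Cx R -> Cx R) : continuous f -> sidesInt f a b c d.
  by move=> hf; apply: sidesInt_cont => // z _; exact: hf.
have cid : continuous (fun z : Cx R => z) by move=> z; exact: cvg_id.
have cc (mm : Cx R) : continuous (fun z : Cx R => mm).
  exact: cst_continuous.
rewrite RectID; [|exact: S (cc m)|exact: sidesInt_Z (S _ cid)].
rewrite RectIZ; last exact: S cid.
have -> : RectI (fun=> m) a b c d = 0.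
  by rewrite /RectI !CI_cst//; ring.
have -> : RectI id a b c d = 0; last by rewrite mulr0 addr0.
have [i1 i2 i3 i4] := S _ cid.
have E1 : CI `[a, b] (fun x => x +i* c) - CI `[a, b] (fun x => x +i* d)
    = ((b - a)%:C : Cx R) * (0 +i* (c - d)).
  rewrite -CIB// -CI_cst//; apply: eq_CI => t _.
  by apply: eq_cx => /=; ring.
have E2 : CI `[c, d] (fun y => b +i* y) - CI `[c, d] (fun y => a +i* y)
    = ((d - c)%:C : Cx R) * ((b - a)%:C : Cx R).
  rewrite -CIB// -CI_cst//; apply: eq_CI => t _.
  by apply: eq_cx => /=; ring.
rewrite /RectI; set x1 := CI _ _; set x2 := CI _ _; set x3 := CI _ _; set x4 := CI _ _.
have -> : x1 + cI * x2 - x3 - cI * x4 = (x1 - x3) + cI * (x2 - x4) by ring.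
rewrite E1 E2; apply: eq_cx; rewrite !ReImE/=; ring.
Qed.

Lemma RectI_splitx k a b c d e : continuous k -> a <= e -> e <= b -> c <= d ->
  RectI k a b c d = RectI k a e c d + RectI k e b c d.
Proof.
move=> hk ae eb cd.
have [i1 _ i3 _] : sidesInt k a b c d by apply: sidesInt_cont => //; [move=> z _; exact: hk|exact: le_trans eb].
rewrite /RectI (CI_split ae eb i1) (CI_split ae eb i3); ring.
Qed.

Lemma RectI_splity k a b c d e : continuous k -> a <= b -> c <= e -> e <= d ->
  RectI k a b c d = RectI k a b c e + RectI k a b e d.
Proof.
move=> hk ab ce ed.
have [_ i2 _ i4] : sidesInt k a b c d by apply: sidesInt_cont => //; [move=> z _; exact: hk|exact: le_trans ed].
rewrite /RectI (CI_split ce ed i2) (CI_split ce ed i4); ring.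
Qed.

End RectangleIntegral.

Section Goursat.
Context {R : realType}.
Implicit Types (a b c d w h r e M x y : R) (k f : Cx R -> Cx R).

Definition in_rect a b c d (z : Cx R) := a <= Re z <= b /\ c <= Im z <= d.

Lemma on_bd_in a b c d (z : Cx R) : a <= b -> c <= d ->
  on_bd a b c d z -> in_rect a b c d z.
Proof.
by move=> ab cd [[h [e|e]]|[h [e|e]]]; split=> //; rewrite e lexx ?ab ?cd.
Qed.

Lemma in_rect_dist a b c d (z v : Cx R) : in_rect a b c d z -> in_rect a b c d v ->
  cabs (z - v) <= (b - a) + (d - c).
Proof.
move=> [/andP[? ?] /andP[? ?]] [/andP[? ?] /andP[? ?]].
rewrite (le_trans (cabs_le_ReIm _))// ReD ImD ReN ImN lerD// ler_norml; lra.
Qed.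

Lemma affine_continuous (m l : Cx R) : continuous (fun z : Cx R => m + l * z).
Proof.
move=> z; apply/cx_contP => e e0; exists (e / (cabs l + 1)).
  by rewrite divr_gt0// ltr_wpDl// cabs_ge0.
move=> v; rewrite ltr_pdivlMr ?ltr_wpDl ?cabs_ge0// => h.
have -> : m + l * v - (m + l * z) = l * (v - z) by ring.
have := cabs_ge0 (v - z); rewrite cabsM; nra.
Qed.

(** The target e (w + h)^2 is four times its value on a quarter, so it passes from the quarters to
    the whole. Near a point of differentiability it holds once the tangent map, of integral 0, is
    subtracted. *)
Lemma goursat k a w c h : continuous k -> 0 <= w -> 0 <= h ->
  (forall z, in_rect a (a + w) c (c + h) z -> derivable k z 1) ->
  RectI k a (a + w) c (c + h) = 0.
Proof.
move=> hk w0 h0 dk.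
suff H e : 0 < e -> cabs (RectI k a (a + w) c (c + h)) <= e * (w + h) ^+ 2.
  apply/eqP; rewrite -cabs_eq0 eq_le cabs_ge0 andbT.
  have s0 : 0 <= (w + h) ^+ 2 by exact: sqr_ge0.
  apply/ler_addgt0Pr => e e0; rewrite add0r.
  apply: (le_trans (H (e / ((w + h) ^+ 2 + 1)) _)); first by rewrite divr_gt0// ltr_wpDl.
  by rewrite mulrAC ler_pdivrMr ?ltr_wpDl// ler_pM2l// lerDl.
move=> e0.
pose P a' w' c' h' := a <= a' -> a' + w' <= a + w -> c <= c' -> c' + h' <= c + h ->
  cabs (RectI k a' (a' + w') c' (c' + h')) <= e * (w' + h') ^+ 2.
suff : P a w c h by apply.
apply: bisection => //.
  move=> a' w' c' h' w0' h0' p1 p2 p3 p4 a1 a2 c1 c2.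
  rewrite (@RectI_splitx _ k _ (a' + w') _ _ (a' + w' / 2))//; [|lra..].
  rewrite (@RectI_splity _ k a' _ c' _ (c' + h' / 2))//; [|lra..].
  rewrite (@RectI_splity _ k (a' + w' / 2) _ c' _ (c' + h' / 2))//; [|lra..].
  have {p1}p1 := p1 ltac:(lra) ltac:(lra) ltac:(lra) ltac:(lra).
  have {p2}p2 := p2 ltac:(lra) ltac:(lra) ltac:(lra) ltac:(lra).
  have {p3}p3 := p3 ltac:(lra) ltac:(lra) ltac:(lra) ltac:(lra).
  have {p4}p4 := p4 ltac:(lra) ltac:(lra) ltac:(lra) ltac:(lra).
  have ew : a' + w' / 2 + w' / 2 = a' + w' by lra.
  have eh : c' + h' / 2 + h' / 2 = c' + h' by lra.
  rewrite ew in p2 p4; rewrite eh in p3 p4.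
  apply: (le_trans (cabsD _ _)).
  set X := RectI _ _ _ _ _ + _; set Y := RectI _ _ _ _ _ + _.
  have hX : cabs X <= 2 * (e * (w' / 2 + h' / 2) ^+ 2).
    by apply: (le_trans (cabsD _ _)); lra.
  have hY : cabs Y <= 2 * (e * (w' / 2 + h' / 2) ^+ 2).
    by apply: (le_trans (cabsD _ _)); lra.
  have -> : e * (w' + h') ^+ 2 = 2 * (e * (w' / 2 + h' / 2) ^+ 2) +
    2 * (e * (w' / 2 + h' / 2) ^+ 2) by field.
  lra.
move=> x y.
(* A rectangle that contains a point outside the large one is not contained in the large one, so [P]
   holds vacuously. *)
have [hz|nz] := pselect (in_rect a (a + w) c (c + h) (x +i* y)); last first.
  exists 1 => // a' w' c' h' w0' h0' hx hy _ _ a1 a2 c1 c2; exfalso; apply: nz.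
  by split=> /=; lra.
have [l hl] := (cx_derivableP _ _).1 (dk _ hz).
(* This 4 cancels the one of [RectI_le]. *)
have e8 : 0 < e / 4 by rewrite divr_gt0.
have [d d0 hd] := hl _ e8.
exists (d / 3); first by rewrite divr_gt0.
move=> a' w' c' h' w0' h0' hx hy wd hd' _ _ _ _.
set z := x +i* y in hd.
have S f : continuous f -> sidesInt f a' (a' + w') c' (c' + h').
  by move=> hf; apply: sidesInt_cont; [move=> v _; exact: hf|lra|lra].
pose A v := (k z - l * z) + l * v.
have cA : continuous A.
  exact: affine_continuous.
have E : RectI k a' (a' + w') c' (c' + h') =
    RectI (fun v => k v + (-1) * A v) a' (a' + w') c' (c' + h').
  rewrite RectID; [|exact: S|apply: sidesInt_Z; exact: S].
  rewrite RectIZ; last exact: S.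
  by rewrite /A RectI_affine ?mulr0 ?addr0//; lra.
rewrite E.
have zin : in_rect a' (a' + w') c' (c' + h') z by [].
have := @RectI_le _ (fun v => k v + (-1) * A v) a' (a' + w') c' (c' + h') (e / 4 * (w' + h')).
move=> /(_ ltac:(lra) ltac:(lra)) H.
apply: le_trans (H _ _) _.
- by apply: sidesInt_D; [exact: S|apply: sidesInt_Z; exact: S].
- move=> v /on_bd_in hv; have vin := hv ltac:(lra) ltac:(lra).
  have hvz : cabs (v - z) <= w' + h' by apply: le_trans (in_rect_dist vin zin) _; lra.
  have := hd v ltac:(lra).
  have -> : k v + -1 * A v = k v - k z - l * (v - z) by rewrite /A; ring.
  move=> hh; apply: (le_trans hh); rewrite ler_pM2l//.
- have -> : a' + w' - a' + (c' + h' - c') = w' + h' by ring.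
  by rewrite expr2; lra.
Qed.

(** Only [u] is confined to the rectangle. With [v] free, the moduli of the four quarters combine by
    a minimum even when [u] and [v] lie in different quarters. *)
Lemma unif_cont_rect k a w c h e : continuous k -> 0 <= w -> 0 <= h -> 0 < e ->
  exists2 d, 0 < d & forall u v, in_rect a (a + w) c (c + h) u ->
    cabs (v - u) < d -> cabs (k v - k u) <= e.
Proof.
move=> hk w0 h0 e0.
apply: (@bisection _ (fun a w c h => exists2 d, 0 < d & forall u v,
  in_rect a (a + w) c (c + h) u -> cabs (v - u) < d -> cabs (k v - k u) <= e)) => //.
  move=> a' w' c' h' w0' h0' [d1 ? p1] [d2 ? p2] [d3 ? p3] [d4 ? p4].
  exists (Num.min (Num.min d1 d2) (Num.min d3 d4)).
    by rewrite !lt_min; do ![apply/andP; split].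
  move=> u v [/= /andP[u1 u2] /andP[u3 u4]]; rewrite !lt_min => /andP[/andP[v1 v2] /andP[v3 v4]].
  have [r1|r1] := leP (Re u) (a' + w' / 2); have [r2|r2] := leP (Im u) (c' + h' / 2).
  - by apply: p1 => //; split; lra.
  - by apply: p3 => //; split; lra.
  - by apply: p2 => //; split; lra.
  - by apply: p4 => //; split; lra.
move=> x y.
have /cx_contP/(_ (e / 2))[|d d0 hd] := hk (x +i* y); first by rewrite divr_gt0.
exists (d / 4); first by rewrite divr_gt0.
move=> a' w' c' h' w0' h0' hx hy wd hhd; exists (d / 4); first by rewrite divr_gt0.
move=> u v uin vu.
have zin : in_rect a' (a' + w') c' (c' + h') (x +i* y) by [].
have h1 := in_rect_dist uin zin.
have h2 : cabs (k u - k (x +i* y)) < e / 2 by apply: hd; lra.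
have h3 : cabs (k v - k (x +i* y)) < e / 2.
  apply: hd; have := cabs_tri u v (x +i* y); lra.
have := cabs_tri (k (x +i* y)) (k v) (k u); rewrite (cabsC (k (x +i* y))); lra.
Qed.

Lemma bounded_rect k a w c h : continuous k -> 0 <= w -> 0 <= h ->
  exists M, forall u, in_rect a (a + w) c (c + h) u -> cabs (k u) <= M.
Proof.
move=> hk w0 h0.
apply: (@bisection _ (fun a w c h => exists M, forall u, in_rect a (a + w) c (c + h) u ->
   cabs (k u) <= M)) => //.
  move=> a' w' c' h' w0' h0' [M1 p1] [M2 p2] [M3 p3] [M4 p4].
  exists (Num.max (Num.max M1 M2) (Num.max M3 M4)).
  move=> u [/= /andP[u1 u2] /andP[u3 u4]]; rewrite !le_max.
  have [r1|r1] := leP (Re u) (a' + w' / 2); have [r2|r2] := leP (Im u) (c' + h' / 2).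
  - by rewrite p1//; split; lra.
  - by rewrite p3 ?orbT//; split; lra.
  - by rewrite p2 ?orbT//; split; lra.
  - by rewrite p4 ?orbT//; split; lra.
move=> x y.
have /cx_contP/(_ 1)[//|d d0 hd] := hk (x +i* y).
exists (d / 4); first by rewrite divr_gt0.
move=> a' w' c' h' w0' h0' hx hy wd hhd; exists (cabs (k (x +i* y)) + 1) => u uin.
have zin : in_rect a' (a' + w') c' (c' + h') (x +i* y) by [].
have h1 := in_rect_dist uin zin.
have h2 : cabs (k u - k (x +i* y)) < 1 by apply: hd; lra.
by have := cabs_sub (k u) (k (x +i* y)); lra.
Qed.

End Goursat.

(** * Counting the grid cells that meet a thin set *)

Section Painleve.
Context {R : realType}.
Implicit Types (a b c d w h r e M x y : R) (k f : Cx R -> Cx R) (G : set (Cx R)).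

(* Upper Minkowski content of dimension one: the set is within K/(n+1) of
   K(n+1) points. *)
Definition thin G := exists K : nat, forall n : nat, exists s : seq (Cx R),
  (size s <= K * n.+1)%N /\
  forall z, G z -> exists2 p, p \in s & cabs (z - p) <= K%:R / n.+1%:R.

Lemma thin0 : thin set0.
Proof. by exists 0%N => n; exists [::]; split. Qed.

Lemma thinU1 G z : thin G -> thin (G `|` [set z]).
Proof.
move=> [K hK]; exists K.+1 => n; have [s [hs hG]] := hK n.
exists (z :: s); split.
  by rewrite /= mulSn -addn1 addnC leq_add.
have np : 0 < n.+1%:R :> R by rewrite ltr0n.
move=> v [/hG[p ps hp]|->].
  exists p; first by rewrite inE ps orbT.
  by rewrite (le_trans hp)// ler_pM2r ?invr_gt0// ler_nat.
by exists z; [rewrite inE eqxx|rewrite subrr cabs0 divr_ge0].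
Qed.

(** The admissible indices lie in a window that starts at the smallest of them and spans at most 2
    M. *)
Lemma count_close (n : nat) x M (P : pred nat) : 0 <= M ->
  (forall i, P i -> `|i%:R - x| <= M) ->
  (\sum_(i < n) (P i : nat))%:R <= 2 * M + 1.
Proof.
move=> M0 hP.
have [/existsP[i0 hi0]|/existsPn none] := boolP [exists i : 'I_n, P i]; last first.
  rewrite big1 ?mulr0n; first lra.
  by move=> i _; rewrite (negbTE (none i)).
pose i1 := [arg min_(i < i0 | P i) (i : nat)].
have [Pi1 mini1] : P i1 /\ forall j : 'I_n, P j -> (i1 <= j)%N.
  by rewrite /i1; case: arg_minnP.
have [m hm] : exists m : nat, m%:R <= 2 * M < m.+1%:R.
  exists (Num.truncn (2 * M)); rewrite truncn_itv//; lra.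
have : (\sum_(i < n) (P i : nat) <= \sum_(i < n) ((i1 <= i < i1 + m.+1) : nat))%N.
  apply: leq_sum => i _; case Pi : (P i) => //=.
  rewrite mini1//= lt0b -(ltr_nat R) natrD.
  have := hP _ Pi; have := hP _ Pi1; rewrite !ler_norml; lra.
have : (\sum_(i < n) ((i1 <= i < i1 + m.+1) : nat) <= m.+1)%N.
  rewrite -(big_mkord xpredT (fun i => (i1 <= i < i1 + m.+1 : nat)%N)).
  rewrite -big_mkcond/= sum1_count -size_filter.
  rewrite -[leqRHS](size_iota i1).
  apply: uniq_leq_size; first by rewrite filter_uniq// iota_uniq.
  by move=> j; rewrite mem_filter => /andP[h _]; rewrite mem_iota.
move=> h1 h2; have := leq_trans h2 h1; rewrite -(ler_nat R) => h3.
rewrite -addn1 natrD in h3; lra.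
Qed.

Lemma RectI_gridx k a c d w n : continuous k -> 0 <= w -> c <= d ->
  RectI k a (a + n%:R * w) c d =
  \sum_(i < n) RectI k (a + i%:R * w) (a + i%:R * w + w) c d.
Proof.
move=> hk w0 cd; elim: n => [|n ih].
  rewrite big_ord0 mul0r addr0.
  have [i1 i2 i3 i4] : sidesInt k a a c d by apply: sidesInt_cont => // z _; exact: hk.
  rewrite /RectI; have Z (g : R -> Cx R) : CI `[a, a] g = 0.
    by apply: eq_cx; rewrite /= set_itv1 Rintegral_set1.
  by rewrite !Z; ring.
rewrite big_ord_recr/= -ih.
have nw : 0 <= n%:R * w by rewrite mulr_ge0.
have -> : a + n%:R * w + w = a + n.+1%:R * w by rewrite -[in RHS]addn1 natrD; ring.
rewrite -RectI_splitx// ?lerDl//.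
by rewrite -[in leRHS]addn1 natrD mulrDl mul1r addrA lerDl.
Qed.

Lemma RectI_gridy k a b c w n : continuous k -> 0 <= w -> a <= b ->
  RectI k a b c (c + n%:R * w) =
  \sum_(i < n) RectI k a b (c + i%:R * w) (c + i%:R * w + w).
Proof.
move=> hk w0 ab; elim: n => [|n ih].
  rewrite big_ord0 mul0r addr0.
  rewrite /RectI; have Z (g : R -> Cx R) : CI `[c, c] g = 0.
    by apply: eq_cx; rewrite /= set_itv1 Rintegral_set1.
  by rewrite !Z; ring.
rewrite big_ord_recr/= -ih.
have nw : 0 <= n%:R * w by rewrite mulr_ge0.
have -> : c + n%:R * w + w = c + n.+1%:R * w by rewrite -[in RHS]addn1 natrD; ring.
rewrite -RectI_splity// ?lerDl//.
by rewrite -[in leRHS]addn1 natrD mulrDl mul1r addrA lerDl.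
Qed.

End Painleve.

Section Cauchy.
Context {R : realType}.
Implicit Types (a b c d w h r e M x y : R) (k f : Cx R -> Cx R) (G : set (Cx R)).

Lemma ltC_real (n : nat) x : exists m : nat, x < m.+1%:R.
Proof.
exists (Num.bound `|x|).
have := archi_boundP (normr_ge0 x); have := ler_norm x; rewrite -natr1; lra.
Qed.

(** The square is cut into (n+1)^2 cells of side [dl]. A cell free of [G] contributes 0 by Goursat's
    theorem. The others lie near one of the K (n+1) covering points, so there are O(n) of them, and
    uniform continuity bounds each contribution by 8 e dl with dl = O(1/n). *)
Lemma painleve k G r : continuous k -> thin G -> (forall z, ~ G z -> derivable k z 1) ->
  0 < r -> RectI k (- r) r (- r) r = 0.
Proof.
move=> hk [K hK] dk r0.
(* Distance, counted in cell sides, between a cell meeting [G] and its covering point: one side for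
   the cell, and K/(n+1) divided by [dl] for the covering radius. *)
pose kap := 1 + K%:R / (2 * r) : R.
have K0 : 0 <= K%:R :> R by [].
have kap0 : 0 <= kap by rewrite addr_ge0// divr_ge0// mulr_ge0// ltW.
(* K (n+1) covering points, (2 kap + 1)^2 cells for each, 8 e dl per cell, and (n+1) dl = 2 r. *)
pose B := K%:R * (2 * kap + 1) ^+ 2 * (16 * r).
have B0 : 0 <= B.
  by apply: mulr_ge0; [apply: mulr_ge0 => //; exact: sqr_ge0|lra].
suff H e : 0 < e -> cabs (RectI k (- r) r (- r) r) <= B * e.
  apply/eqP; rewrite -cabs_eq0 eq_le cabs_ge0 andbT.
  apply/ler_addgt0Pr => e e0; rewrite add0r.
  apply: (le_trans (H (e / (B + 1)) _)); first by rewrite divr_gt0// ltr_wpDl.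
  by rewrite mulrCA ger_pMr// ler_pdivrMr ?ltr_wpDl// mul1r lerDl.
move=> e0.
have r20 : 0 <= r + r by rewrite addr_ge0// ltW.
have [d d0 hd] := @unif_cont_rect R k (- r) (r + r) (- r) (r + r) e hk r20 r20 e0.
have [n hn] := ltC_real 0 (4 * r / d).
have n0 : 0 < n.+1%:R :> R by rewrite ltr0n.
pose dl := 2 * r / n.+1%:R.
have dl0 : 0 < dl by rewrite divr_gt0// mulr_gt0.
have ed0 : 0 <= e * dl by rewrite mulr_ge0// ltW.
have p8 : 0 <= 8 * (e * dl) by rewrite mulr_ge0.
have ndl : n.+1%:R * dl = 2 * r by rewrite /dl mulrCA mulfV ?mulr1// gt_eqF.
have dld : 2 * dl < d.
  by rewrite /dl mulrA ltr_pdivrMr//; move: hn; rewrite ltr_pdivrMr//; lra.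
have [s [hs hG]] := hK n.
pose A x (i : nat) := `|i%:R - (x + r) / dl| <= kap.
have er : r = - r + n.+1%:R * dl by rewrite ndl; lra.
have idl (i : 'I_n.+1) : 0 <= i%:R * dl /\ i%:R * dl + dl <= 2 * r.
  rewrite -ndl; split; first by rewrite mulr_ge0// ltW.
  have : i.+1%:R <= n.+1%:R :> R by rewrite ler_nat.
  by rewrite -natr1; nra.
have close x y (i : nat) : - r + i%:R * dl <= x <= - r + i%:R * dl + dl ->
    `|x - y| <= K%:R / n.+1%:R -> A y i.
  move=> hx hy; rewrite /A.
  have -> : kap = (dl + K%:R / n.+1%:R) / dl.
    by rewrite /kap /dl; field; rewrite !gt_eqF.
  rewrite ler_pdivlMr// -[X in _ * X](gtr0_norm dl0) -normrM mulrBl mulfVK ?gt_eqF//.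
  move: hx hy; rewrite !ler_norml.
  move: (i%:R * dl) (K%:R / n.+1%:R) => u v hx hy; lra.
(* The factor in front counts the covering points close to the cell in both coordinates; it is at
   least 1 as soon as the cell meets [G]. Summing over cells and exchanging sums gives the count per
   covering point. *)
have cell (i j : 'I_n.+1) :
    cabs (RectI k (- r + i%:R * dl) (- r + i%:R * dl + dl)
                  (- r + j%:R * dl) (- r + j%:R * dl + dl)) <=
    (\sum_(p <- s) (A (Re p) i * A (Im p) j : nat)%N)%:R * (8 * (e * dl)).
  set a := - r + i%:R * dl; set c := - r + j%:R * dl.
  have [ia ib] := idl i; have [ja jb] := idl j.
  have [[z [Gz zin]]|none] := pselect (exists z, G z /\ in_rect a (a + dl) c (c + dl) z); last first.
    rewrite goursat//; [by rewrite cabs0 mulr_ge0|exact: ltW|exact: ltW|].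
    by move=> z zin; apply: dk => Gz; apply: none; exists z.
  have [p ps hp] := hG _ Gz.
  have Ai : A (Re p) i.
    apply: close zin.1 _; apply: le_trans hp.
    by rewrite -ReN -ReD Re_le_cabs.
  have Aj : A (Im p) j.
    apply: close zin.2 _; apply: le_trans hp.
    by rewrite -ImN -ImD Im_le_cabs.
  have S1 : 1 <= (\sum_(p <- s) (A (Re p) i * A (Im p) j : nat)%N)%:R :> R.
    by rewrite (big_rem p)//= Ai Aj ler1n.
  have S f : continuous f -> sidesInt f a (a + dl) c (c + dl).
    by move=> hf; apply: sidesInt_cont; [move=> v _; exact: hf|lra|lra].
  have ca : continuous (fun z : Cx R => k (a +i* c) + 0 * z) by exact: affine_continuous.
  have E : RectI k a (a + dl) c (c + dl) =
      RectI (fun v => k v + (-1) * (k (a +i* c) + 0 * v)) a (a + dl) c (c + dl).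
    rewrite RectID; [|exact: S|exact: sidesInt_Z (S _ ca)].
    rewrite RectIZ; last exact: S ca.
    by rewrite RectI_affine ?mulr0 ?addr0//; lra.
  have al : a <= a + dl by lra.
  have cl : c <= c + dl by lra.
  rewrite E; apply: (@le_trans _ _ (4 * (e * ((a + dl - a) + (c + dl - c))))); last first.
    apply: (@le_trans _ _ (8 * (e * dl))); first lra.
    by rewrite -[leLHS]mul1r; exact: ler_wpM2r.
  apply: RectI_le => //.
    by apply: sidesInt_D; [exact: S|exact: sidesInt_Z (S _ ca)].
  move=> v /(on_bd_in al cl) vin.
  have cin : in_rect a (a + dl) c (c + dl) (a +i* c) by split=> /=; lra.
  have -> : k v + -1 * (k (a +i* c) + 0 * v) = k v - k (a +i* c) by ring.
  apply: hd; first by split=> /=; rewrite /a /c; lra.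
  by apply: le_lt_trans (in_rect_dist vin cin) _; lra.
rewrite [in X in RectI k _ X]er RectI_gridx//; [|exact: ltW|lra].
rewrite (eq_bigr (fun i : 'I_n.+1 => \sum_(j < n.+1)
   RectI k (- r + i%:R * dl) (- r + i%:R * dl + dl)
                  (- r + j%:R * dl) (- r + j%:R * dl + dl))); last first.
  by move=> i _; rewrite [in X in RectI k _ _ _ X]er RectI_gridy//; lra.
apply: le_trans (cabs_sum _ _ _) _.
apply: (@le_trans _ _ (\sum_(i < n.+1) \sum_(j < n.+1)
  (\sum_(p <- s) (A (Re p) i * A (Im p) j : nat)%N)%:R * (8 * (e * dl)))).
  apply: ler_sum => i _; apply: le_trans (cabs_sum _ _ _) _.
  by apply: ler_sum => j _; exact: cell.
under eq_bigr do rewrite -mulr_suml.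
rewrite -mulr_suml.
have -> : \sum_(i < n.+1) \sum_(j < n.+1)
    (\sum_(p <- s) (A (Re p) i * A (Im p) j : nat)%N)%:R =
    \sum_(p <- s) (\sum_(i < n.+1) (A (Re p) i : nat))%:R *
                  (\sum_(j < n.+1) (A (Im p) j : nat))%:R :> R.
  under eq_bigr => i _ do under eq_bigr => j _ do rewrite natr_sum.
  under eq_bigr => i _ do rewrite exchange_big/=.
  rewrite exchange_big/=; apply: eq_bigr => p _.
  rewrite !natr_sum mulr_suml; apply: eq_bigr => i _.
  by rewrite mulr_sumr; apply: eq_bigr => j _; rewrite natrM.
have cnt x : (\sum_(i < n.+1) (A x i : nat))%:R <= 2 * kap + 1.
  by apply: (@count_close _ _ ((x + r) / dl) kap (A x)).
apply: (@le_trans _ _ ((size s)%:R * (2 * kap + 1) ^+ 2 * (8 * (e * dl)))).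
  apply: ler_wpM2r; first by [].
  rewrite -sum1_size natr_sum mulr_suml; apply: ler_sum => p _.
  by rewrite mul1r expr2 ler_pM.
have -> : B * e = (K * n.+1)%:R * (2 * kap + 1) ^+ 2 * (8 * (e * dl)).
  rewrite natrM /B.
  have -> : 16 * r = 8 * (n.+1%:R * dl) by rewrite ndl; ring.
  ring.
apply: ler_wpM2r; first by [].
by apply: ler_wpM2r; [exact: sqr_ge0|rewrite ler_nat].
Qed.

Definition sqI k r := RectI k (- r) r (- r) r.

Definition on_sq r (z : Cx R) := on_bd (- r) r (- r) r z.

Lemma on_sq_cabs r (z : Cx R) : 0 < r -> on_sq r z -> r <= cabs z <= 2 * r.
Proof.
move=> r0 hz; have := cabs_le_ReIm z; have := Re_le_cabs z; have := Im_le_cabs z.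
have N t : t = - r \/ t = r -> `|t| = r.
  by case=> ->; rewrite ?normrN; apply: gtr0_norm.
case: hz => -[h /N ->] h1 h2 h3.
  have h4 : `|Re z| <= r by rewrite ler_norml; lra.
  lra.
have h4 : `|Im z| <= r by rewrite ler_norml; lra.
lra.
Qed.

Lemma inv_continuous (z v : Cx R) : v != z -> {for v, continuous (fun u : Cx R => (u - z)^-1)}.
Proof.
rewrite -subr_eq0 => vz; have p : 0 < cabs (v - z) by rewrite cabs_gt0.
apply/cx_contP => e e0.
exists (Num.min (cabs (v - z) / 2) (e * (cabs (v - z)) ^+ 2 / 2)).
  by rewrite lt_min !divr_gt0// mulr_gt0// exprn_gt0.
move=> u; rewrite lt_min => /andP[h1 h2].
have h3 : cabs (v - z) / 2 < cabs (u - z).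
  have := cabs_tri u v z; rewrite (cabsC v u); lra.
have uz : u - z != 0 by rewrite -cabs_gt0; apply: lt_trans h3; rewrite divr_gt0.
have -> : (u - z)^-1 - (v - z)^-1 = - (u - v) / ((u - z) * (v - z)).
  by field; rewrite uz vz.
rewrite cabsM cabsN cabsV cabsM ltr_pdivrMr ?mulr_gt0 ?cabs_gt0//.
apply: (lt_le_trans h2).
have : cabs (v - z) / 2 * cabs (v - z) <= cabs (u - z) * cabs (v - z).
  by rewrite ler_pM2r// ltW.
rewrite expr2; nra.
Qed.

Lemma cx_derivable_continuous f (z : Cx R) : derivable f z 1 -> {for z, continuous f}.
Proof.
move=> /cx_derivableP[l hl]; apply/cx_contP => e e0.
have [d d0 hd] := hl 1 ltr01.
exists (Num.min d (e / (cabs l + 2))).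
  by rewrite lt_min d0 divr_gt0// ltr_wpDl ?cabs_ge0.
move=> w; rewrite lt_min => /andP[/hd h1].
rewrite ltr_pdivlMr ?ltr_wpDl ?cabs_ge0// => h2.
have -> : f w - f z = (f w - f z - l * (w - z)) + l * (w - z) by rewrite subrK.
apply: le_lt_trans (cabsD _ _) _; rewrite cabsM.
have := cabs_ge0 (w - z); nra.
Qed.

Lemma sides_quot k r (z : Cx R) : continuous k -> 0 < r -> cabs z < r ->
  sidesInt (fun u => k u / (u - z)) (- r) r (- r) r.
Proof.
move=> hk r0 zr; apply: sidesInt_cont; [|lra|lra].
move=> v hv; have /andP[h1 _] := on_sq_cabs r0 hv.
apply: continuousM; first exact: hk.
by apply: inv_continuous; apply: contraTneq zr => <-; rewrite -leNgt.
Qed.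

Lemma sides_inv r (z : Cx R) : 0 < r -> cabs z < r ->
  sidesInt (fun u => (u - z)^-1) (- r) r (- r) r.
Proof.
move=> r0 zr; apply: sidesInt_cont; [|lra|lra].
move=> v hv; have /andP[h1 _] := on_sq_cabs r0 hv.
by apply: inv_continuous; apply: contraTneq zr => <-; rewrite -leNgt.
Qed.

(** The difference quotient at [z], completed by the derivative, is continuous and differentiable
    off [G] and [z], which is again a thin set. Painleve's theorem then separates the two
    integrals. *)
Lemma cauchy_formula k G r (z : Cx R) : continuous k -> thin G ->
  (forall z, ~ G z -> derivable k z 1) -> ~ G z -> 0 < r -> cabs z < r ->
  sqI (fun u => k u / (u - z)) r = k z * sqI (fun u => (u - z)^-1) r.
Proof.
move=> hk tG dk Gz r0 zr.
have [l hl] := (cx_derivableP _ _).1 (dk _ Gz).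
pose q u := if u == z then l else (k u - k z) / (u - z).
have qd u : ~ (G `|` [set z]) u -> derivable q u 1.
  move=> /not_orP[Gu uz].
  have uz' : u != z by apply/eqP.
  have : derivable (fun u => (k u - k z) / (u - z)) u 1.
    apply: derivableM; first by apply: derivableB; [exact: dk|exact: derivable_cst].
    by apply: derivableV; [rewrite subr_eq0|apply: derivableB; [exact: derivable_id|exact: derivable_cst]].
  apply: near_eq_derivable.
  apply/cx_nbhsP; exists (cabs (u - z)); first by rewrite cabs_gt0 subr_eq0.
  move=> v vu; rewrite /q; case: eqVneq => // vz.
  by move: vu; rewrite vz cabsC ltxx.
have qc : continuous q.
  move=> u; have [->|uz] := eqVneq u z.
    apply/cx_contP => e e0; have [d d0 hd] := hl (e / 2) (divr_gt0 e0 (ltr0Sn _ 1)).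
    exists d => // v /hd; rewrite /q eqxx; case: eqVneq => [_ _|vz].
      by rewrite subrr cabs0.
    have p : 0 < cabs (v - z) by rewrite cabs_gt0 subr_eq0.
    rewrite -ler_pdivrMr// -cabsV -cabsM mulrBl mulfK ?subr_eq0// => h.
    by apply: le_lt_trans h _; lra.
  have : {for u, continuous (fun u => (k u - k z) / (u - z))}.
    apply: continuousM; last exact: inv_continuous.
    by apply: continuousB; [exact: hk|exact: cst_continuous].
  move/cx_contP => h; apply/cx_contP => e e0; have [d d0 hd] := h e e0.
  have p : 0 < cabs (u - z) by rewrite cabs_gt0 subr_eq0.
  exists (Num.min d (cabs (u - z))); first by rewrite lt_min d0.
  move=> v; rewrite lt_min => /andP[/hd h1 h2]; rewrite /q (negbTE uz).
  by case: eqVneq h2 => // ->; rewrite cabsC ltxx.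
have := painleve qc (thinU1 z tG) qd r0.
have rr : - r <= r by lra.
have sz u : on_bd (- r) r (- r) r u -> u != z.
  move=> /(on_sq_cabs r0)/andP[h _]; apply: contraTneq zr => <-; rewrite -leNgt//.
rewrite (@eq_RectI _ q (fun u => k u / (u - z) + (- k z) * (u - z)^-1))//; last first.
  by move=> u /sz uz; rewrite /q (negbTE uz) mulrBl mulNr.
have I1 := sides_quot hk r0 zr; have I2 := sides_inv r0 zr.
rewrite RectID//; last exact: sidesInt_Z.
by rewrite RectIZ// mulNr => /eqP; rewrite subr_eq0 => /eqP.
Qed.

(* The exact value 2 pi i is not needed. *)
Lemma sqI_inv_ge r : 0 < r -> 4 <= cabs (sqI (fun u => (u - 0)^-1) r).
Proof.
move=> r0; have rr : - r <= r by lra.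
have z0 : cabs (0 : Cx R) < r by rewrite cabs0.
have [i1 i2 i3 i4] := sides_inv r0 z0.
apply: le_trans (Im_le_cabs _); apply: le_trans (ler_norm _).
have L (f : R -> R) : (@lebesgue_measure R).-integrable `[- r, r] (EFin \o f) ->
    (forall t, - r <= t <= r -> (2 * r)^-1 <= f t) ->
    1 <= \int[@lebesgue_measure R]_(t in `[- r, r]) f t.
  move=> fi hf.
  have <- : \int[@lebesgue_measure R]_(t in `[- r, r]) (2 * r)^-1 = 1.
    by rewrite Rintegral_cst_itv//; field; lra.
  by apply: le_Rintegral => //; exact: Rint_cst.
have U (f : R -> R) : (@lebesgue_measure R).-integrable `[- r, r] (EFin \o f) ->
    (forall t, - r <= t <= r -> f t <= - (2 * r)^-1) ->
    \int[@lebesgue_measure R]_(t in `[- r, r]) f t <= -1.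
  move=> fi hf.
  have <- : \int[@lebesgue_measure R]_(t in `[- r, r]) (- (2 * r)^-1) = -1.
    by rewrite Rintegral_cst_itv//; field; lra.
  by apply: le_Rintegral => //; exact: Rint_cst.
(* On each of the four sides the integrand of Im (dz / z) is at least 1/(2r) over a length 2r, so
   each side contributes at least 1. *)
have Q t : - r <= t <= r -> (2 * r)^-1 <= r / (t ^+ 2 + r ^+ 2).
  move=> ht; have p : 0 < t ^+ 2 + r ^+ 2 by rewrite ltr_wpDl ?sqr_ge0// exprn_gt0.
  rewrite ler_pdivlMr// ler_pdivrMl ?mulr_gt0//; nra.
have h1 : 1 <= \int[@lebesgue_measure R]_(t in `[- r, r]) Im ((t +i* - r : Cx R) - 0)^-1.
  apply: L => [|t ht]; first exact: i1.2.
  by rewrite subr0 ImV/= opprK sqrrN Q.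
have h2 : 1 <= \int[@lebesgue_measure R]_(t in `[- r, r]) Re ((r +i* t : Cx R) - 0)^-1.
  apply: L => [|t ht]; first exact: i2.1.
  by rewrite subr0 ReV/= addrC Q.
have h3 : \int[@lebesgue_measure R]_(t in `[- r, r]) Im ((t +i* r : Cx R) - 0)^-1 <= -1.
  apply: U => [|t ht]; first exact: i3.2.
  by rewrite subr0 ImV/= mulNr lerN2 Q.
have h4 : \int[@lebesgue_measure R]_(t in `[- r, r]) Re ((- r +i* t : Cx R) - 0)^-1 <= -1.
  apply: U => [|t ht]; first exact: i4.1.
  by rewrite subr0 ReV/= sqrrN addrC mulNr lerN2 Q.
rewrite /sqI /RectI.
set x1 := CI _ _; set x2 := CI _ _; set x3 := CI _ _; set x4 := CI _ _.
have -> : Im (x1 + cI * x2 - x3 - cI * x4) = Im x1 + Re x2 - Im x3 - Re x4.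
  by rewrite !ReImE/=; ring.
rewrite /x1 /x2 /x3 /x4 /CI/=; lra.
Qed.

End Cauchy.

(** * Lipschitz bounds, Liouville's theorem, removable points and orders of zeros *)

Section CauchyConsequences.
Context {R : realType}.
Implicit Types (a b c d w h r e M x y : R) (k f : Cx R -> Cx R) (G : set (Cx R)).

Definition cauchy_int k r (z : Cx R) := sqI (fun u => k u / (u - z)) r.
Definition index_int r (z : Cx R) := sqI (fun u => (u - z)^-1) r.
Local Notation J := cauchy_int.
Local Notation I := index_int.

Lemma sq_far r (z u : Cx R) : 0 < r -> cabs z <= r / 2 -> on_sq r u ->
  r / 2 <= cabs (u - z) /\ u - z != 0.
Proof.
move=> r0 zr /(on_sq_cabs r0)/andP[h _]; have := cabs_sub u z => h1.
have h2 : r / 2 <= cabs (u - z) by lra.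
by split=> //; rewrite -cabs_gt0; apply: lt_le_trans h2; rewrite divr_gt0.
Qed.

Lemma sides_quot_on k r (z : Cx R) : (forall u, on_sq r u -> {for u, continuous k}) ->
  0 < r -> cabs z < r -> sidesInt (fun u => k u / (u - z)) (- r) r (- r) r.
Proof.
move=> hk r0 zr; apply: sidesInt_cont; [|lra|lra].
move=> v hv; have /andP[h1 _] := on_sq_cabs r0 hv.
apply: continuousM; first exact: hk.
by apply: inv_continuous; apply: contraTneq zr => <-; rewrite -leNgt.
Qed.

Lemma J_lip k r M (z z' : Cx R) : (forall u, on_sq r u -> {for u, continuous k}) -> 0 < r ->
  (forall u, on_sq r u -> cabs (k u) <= M) -> cabs z <= r / 2 -> cabs z' <= r / 2 ->
  cabs (J k r z - J k r z') <= 64 * M / r * cabs (z - z').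
Proof.
move=> hk r0 hM zr zr'; have rr : - r <= r by lra.
have [zr1 zr1'] : cabs z < r /\ cabs z' < r by lra.
have S1 := sides_quot_on hk r0 zr1; have S2 := sides_quot_on hk r0 zr1'.
have -> : J k r z - J k r z' =
    sqI (fun u => k u / (u - z) + (-1) * (k u / (u - z'))) r.
  by rewrite /sqI RectID//; [rewrite RectIZ// mulN1r|exact: sidesInt_Z].
(* Both distances |u - z| and |u - z'| are at least r/2, whence 4/r^2; the factor 16 r is that of
   [RectI_le]. *)
have -> : 64 * M / r * cabs (z - z') =
    4 * (4 * M / r ^+ 2 * cabs (z - z') * ((r - - r) + (r - - r))) by field; lra.
apply: RectI_le => //; first by apply: sidesInt_D => //; exact: sidesInt_Z.
move=> u hu; have [h1 n1] := sq_far r0 zr hu; have [h2 n2] := sq_far r0 zr' hu.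
have -> : k u / (u - z) + -1 * (k u / (u - z')) = k u * (z - z') / ((u - z) * (u - z')).
  by field; rewrite n1 n2.
rewrite cabsM cabsV !cabsM ler_pdivrMr; last by rewrite mulr_gt0 ?cabs_gt0.
have p : 0 <= cabs (k u) * cabs (z - z') by rewrite mulr_ge0 ?cabs_ge0.
have q : r ^+ 2 / 4 <= cabs (u - z) * cabs (u - z').
  have -> : r ^+ 2 / 4 = r / 2 * (r / 2) by field.
  by rewrite ler_pM// ltW// divr_gt0.
apply: (@le_trans _ _ (M * cabs (z - z'))).
  by rewrite ler_wpM2r ?cabs_ge0// hM.
have M0 : 0 <= M by apply: le_trans (hM _ hu); exact: cabs_ge0.
apply: (@le_trans _ _ (4 * M / r ^+ 2 * cabs (z - z') * (r ^+ 2 / 4))).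
  by rewrite le_eqVlt; apply/orP; left; apply/eqP; field; lra.
by rewrite ler_wpM2l// !mulr_ge0 ?cabs_ge0// invr_ge0 exprn_ge0// ltW.
Qed.

Lemma cst1_continuous (u : Cx R) : {for u, continuous (fun=> 1 : Cx R)}.
Proof. exact: cst_continuous. Qed.

Lemma I_J r : I r = J (fun=> 1) r.
Proof.
apply/funext => z; rewrite /I /J.
suff -> : (fun u : Cx R => (u - z)^-1) = (fun u => 1 / (u - z)) by [].
by apply/funext => u; rewrite mul1r.
Qed.

Lemma I_lip r (z z' : Cx R) : 0 < r -> cabs z <= r / 2 -> cabs z' <= r / 2 ->
  cabs (I r z - I r z') <= 64 / r * cabs (z - z').
Proof.
move=> r0 zr zr'; rewrite I_J; apply: le_trans (@J_lip _ r 1 z z' _ r0 _ zr zr') _.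
- by move=> u _; exact: cst1_continuous.
- by move=> u _; rewrite cabs1.
- by rewrite mulr1.
Qed.

(** The index integral is at least 4 at the centre and moves by at most (64/r)(r/32) = 2; this is
    where the radius r/32 comes from. *)
Lemma I_ge r (z : Cx R) : 0 < r -> cabs z <= r / 32 -> 2 <= cabs (I r z).
Proof.
move=> r0 zr; have z2 : cabs z <= r / 2 by lra.
have c0 : cabs (0 : Cx R) <= r / 2 by rewrite cabs0; lra.
have := I_lip r0 z2 c0; rewrite subr0 => h1.
have := sqI_inv_ge r0; rewrite -/(I r 0) => h2.
have := cabs_sub (I r 0) (I r 0 - I r z); rewrite subKr (cabsC (I r 0)) => h3.
have h4 : 64 / r * cabs z <= 2 by rewrite mulrAC ler_pdivrMr//; lra.
lra.
Qed.

(** Cauchy's formula reads k I = J off [G]. Both I and J are Lipschitz and |I| >= 2, so k inherits a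
    Lipschitz bound from the quotient; its decay in r is what Liouville's theorem uses. *)
Lemma cauchy_lip k G r M (z z' : Cx R) : continuous k -> thin G ->
  (forall z, ~ G z -> derivable k z 1) -> ~ G z -> ~ G z' -> 0 < r ->
  (forall u, cabs u <= 2 * r -> cabs (k u) <= M) ->
  cabs z <= r / 32 -> cabs z' <= r / 32 ->
  cabs (k z - k z') <= 64 * M / r * cabs (z - z').
Proof.
move=> hk tG dk Gz Gz' r0 hM zr zr'.
have E (v : Cx R) : ~ G v -> cabs v <= r / 32 -> k v * I r v = J k r v.
  by move=> Gv vr; rewrite /J (cauchy_formula hk tG dk Gv r0)//; lra.
have D : (k z - k z') * I r z' = (J k r z - J k r z') - k z * (I r z - I r z').
  by rewrite -!E//; ring.
have [z2 z2'] : cabs z <= r / 2 /\ cabs z' <= r / 2 by lra.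
have hJ : cabs (J k r z - J k r z') <= 64 * M / r * cabs (z - z').
  apply: J_lip => // [u _|u hu]; first exact: hk.
  by apply: hM; have := on_sq_cabs r0 hu; lra.
have hI := I_lip r0 z2 z2'.
have hkz : cabs (k z) <= M by apply: hM; have := cabs_ge0 z; lra.
have : cabs (k z - k z') * cabs (I r z') <= 2 * (64 * M / r * cabs (z - z')).
  rewrite -cabsM D; apply: le_trans (cabsB _ _) _; rewrite cabsM.
  have : cabs (k z) * cabs (I r z - I r z') <= M * (64 / r * cabs (z - z')).
    by rewrite ler_pM// cabs_ge0.
  have -> : M * (64 / r * cabs (z - z')) = 64 * M / r * cabs (z - z') by ring.
  lra.
have := I_ge r0 zr'; have := cabs_ge0 (k z - k z'); nra.
Qed.

Lemma liouville k G M (z z' : Cx R) : continuous k -> thin G ->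
  (forall z, ~ G z -> derivable k z 1) -> (forall u, cabs (k u) <= M) ->
  ~ G z -> ~ G z' -> k z = k z'.
Proof.
move=> hk tG dk hM Gz Gz'.
apply/eqP; rewrite -subr_eq0 -cabs_eq0 eq_le cabs_ge0 andbT.
have M0 : 0 <= M by apply: le_trans (hM 0); exact: cabs_ge0.
apply/ler_addgt0Pr => e e0; rewrite add0r.
pose B := 64 * M * cabs (z - z').
have B0 : 0 <= B by rewrite !mulr_ge0 ?cabs_ge0.
pose r := 32 * (cabs z + cabs z' + 1) + B / e.
have Be : 0 <= B / e by rewrite divr_ge0// ltW.
have := cabs_ge0 z; have := cabs_ge0 z' => p1 p2.
have r0 : 0 < r by rewrite /r; lra.
apply: le_trans (@cauchy_lip k G r M z z' hk tG dk Gz Gz' r0 _ _ _) _.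
- by move=> u _; exact: hM.
- by rewrite ler_pdivlMr// /r; lra.
- by rewrite ler_pdivlMr// /r; lra.
- rewrite mulrAC -/B ler_pdivrMr// -ler_pdivrMl// mulrC /r; lra.
Qed.

Definition entire k := forall z : Cx R, derivable k z 1.

Lemma entire_continuous k : entire k -> continuous k.
Proof. by move=> hk z; exact: cx_derivable_continuous. Qed.

Lemma bounded_disc k r : continuous k -> exists M, forall u : Cx R, cabs u <= r -> cabs (k u) <= M.
Proof.
move=> hk; have [r0|r0] := leP 0 r; last first.
  by exists 0 => u ur; have := cabs_ge0 u; lra.
have rr : 0 <= r + r by lra.
have [M hM] := @bounded_rect R k (- r) (r + r) (- r) (r + r) hk rr rr.
exists M => u ur; apply: hM.
have := Re_le_cabs u; have := Im_le_cabs u; rewrite !ler_norml => h1 h2.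
by split; lra.
Qed.

Lemma entire_lip k r : entire k -> exists2 L : R, 0 <= L & forall z z' : Cx R,
  cabs z <= r -> cabs z' <= r -> cabs (k z - k z') <= L * cabs (z - z').
Proof.
move=> ek; have [r0|r0] := leP 0 r; last first.
  by exists 0 => // z z' zr; have := cabs_ge0 z; lra.
have hk := entire_continuous ek.
pose s := 32 * (r + 1); have s0 : 0 < s by rewrite /s; lra.
have [M hM] := bounded_disc (2 * s) hk.
have M0 : 0 <= M by apply: le_trans (hM 0 _); [exact: cabs_ge0|rewrite cabs0; lra].
exists (64 * M / s); first by apply: divr_ge0; [exact: mulr_ge0|exact: ltW].
move=> z z' zr zr'.
have [h1 h2] : cabs z <= s / 32 /\ cabs z' <= s / 32 by rewrite /s; lra.
by apply: (@cauchy_lip k set0) => //; exact: thin0.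
Qed.

(** After the linear term is removed, the integrand is k(u) z^2 / (u^2 (u - z)), quadratic in z. The
    origin is the point at which [removable] needs the derivative. *)
Lemma J_derivable k r : (forall u, on_sq r u -> {for u, continuous k}) -> 0 < r ->
  (exists M, forall u, on_sq r u -> cabs (k u) <= M) -> derivable (J k r) 0 1.
Proof.
move=> hk r0 [M hM]; apply/cx_derivableP; have rr : - r <= r by lra.
have c0 : cabs (0 : Cx R) < r by rewrite cabs0.
have S1 := sides_quot_on hk r0 c0.
have hk2 u : on_sq r u -> {for u, continuous (fun u => k u / (u - 0))}.
  move=> hu; apply: continuousM; first exact: hk.
  apply: inv_continuous; have /andP[h _] := on_sq_cabs r0 hu.
  by rewrite -cabs_gt0; lra.
have S2 := sides_quot_on hk2 r0 c0.
exists (J (fun u => k u / (u - 0)) r 0) => e e0.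
pose B := 64 * `|M| / r ^+ 2; have B0 : 0 <= B.
  by apply: divr_ge0; [exact: mulr_ge0|rewrite exprn_ge0// ltW].
exists (Num.min (r / 2) (e / (B + 1))).
  by rewrite lt_min !divr_gt0// ltr_wpDl.
move=> z; rewrite subr0 lt_min => /andP[z1 z2].
have zr : cabs z <= r / 2 by exact: ltW.
have zr' : cabs z < r by lra.
have S3 := sides_quot_on hk r0 zr'.
have -> : J k r z - J k r 0 - J (fun u => k u / (u - 0)) r 0 * z =
   sqI (fun u => k u / (u - z) + ((-1) * (k u / (u - 0)) + (- z) * (k u / (u - 0) / (u - 0)))) r.
  rewrite /sqI RectID//; last by apply: sidesInt_D; exact: sidesInt_Z.
  rewrite RectID//; [|exact: sidesInt_Z|exact: sidesInt_Z].
  by rewrite !RectIZ// /J /sqI mulN1r mulNr [z * _]mulrC addrA.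
apply: (@le_trans _ _ (4 * (4 * `|M| / r ^+ 3 * cabs z ^+ 2 * ((r - - r) + (r - - r))))).
  apply: RectI_le => //.
    by apply: sidesInt_D => //; apply: sidesInt_D; exact: sidesInt_Z.
  move=> u hu; have [h1 n1] := sq_far r0 zr hu.
  have /andP[h2 _] := on_sq_cabs r0 hu.
  have n2 : u != 0 by rewrite -cabs_gt0; lra.
  have -> : k u / (u - z) + (-1 * (k u / (u - 0)) + - z * (k u / (u - 0) / (u - 0))) =
      k u * z ^+ 2 / (u ^+ 2 * (u - z)).
    by rewrite !subr0; field; rewrite n1 n2.
  rewrite cabsM cabsV (cabsM (k u)) (cabsM (u ^+ 2)) !cabsX ler_pdivrMr; last first.
    by rewrite mulr_gt0 ?exprn_gt0// ?cabs_gt0.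
  have q : r ^+ 2 * (r / 2) <= cabs u ^+ 2 * cabs (u - z).
    by apply: ler_pM => //; [exact: sqr_ge0|lra|rewrite ler_pXn2r// nnegrE; lra].
  apply: (@le_trans _ _ (`|M| * cabs z ^+ 2)).
    by rewrite ler_wpM2r ?exprn_ge0 ?cabs_ge0// (le_trans (hM _ hu))// ler_norm.
  apply: (@le_trans _ _ (4 * `|M| / r ^+ 3 * cabs z ^+ 2 * (r ^+ 2 * (r / 2)))).
    have -> : 4 * `|M| / r ^+ 3 * cabs z ^+ 2 * (r ^+ 2 * (r / 2)) = 2 * (`|M| * cabs z ^+ 2).
      by field; lra.
    have : 0 <= `|M| * cabs z ^+ 2 by rewrite mulr_ge0 ?exprn_ge0 ?cabs_ge0.
    lra.
  by rewrite ler_wpM2l// !mulr_ge0 ?exprn_ge0 ?cabs_ge0// invr_ge0 exprn_ge0// ltW.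
have -> : 4 * (4 * `|M| / r ^+ 3 * cabs z ^+ 2 * (r - - r + (r - - r))) = B * cabs z * cabs z.
  by rewrite /B; field; lra.
apply: ler_wpM2r; first exact: cabs_ge0.
move: z2; rewrite ltr_pdivlMr ?ltr_wpDl// => z2.
by have := cabs_ge0 z; lra.
Qed.

(** Near 0, but off it, k is the quotient J / I of two functions differentiable at 0 with I(0)
    nonzero; continuity extends the equality to 0 itself. *)
Lemma removable k : continuous k -> (forall z, z != 0 -> derivable k z 1) -> entire k.
Proof.
move=> hk dk z; have [->|/dk//] := eqVneq z 0; move=> {z}.
have r0 : 0 < 1 :> R by [].
have [M hM] := bounded_disc 2 hk.
have tG : thin (set0 `|` [set (0 : Cx R)]) by apply: thinU1; exact: thin0.
have dk' z : ~ (set0 `|` [set 0]) z -> derivable k z 1.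
  by move=> /not_orP[_ /eqP]; exact: dk.
have b2 u : on_sq 1 u -> cabs (k u) <= M.
  by move=> /(on_sq_cabs r0) h; apply: hM; lra.
have dJ : derivable (J k 1) 0 1.
  by apply: J_derivable => //; [move=> u _; exact: hk|exists M].
have dI : derivable (I 1) 0 1.
  have b1 : exists M : R, forall u : Cx R, on_sq 1 u -> cabs (1 : Cx R) <= M.
    by exists 1 => u _; rewrite cabs1.
  have := @J_derivable (fun=> 1) 1 (fun u (_ : on_sq 1 u) => @cst1_continuous u) r0 b1.
  by rewrite -I_J.
have Ige (z : Cx R) : cabs z <= 1 / 32 -> I 1 z != 0.
  by move=> /(I_ge r0) h; rewrite -cabs_gt0; lra.
have E (z : Cx R) : cabs z <= 1 / 32 -> z != 0 -> k z = J k 1 z / I 1 z.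
  move=> z1 z0; rewrite /J (cauchy_formula hk tG dk')//; last lra.
    by rewrite -/(I 1 z) mulfK// Ige.
  by move=> [//|/eqP]; rewrite (negbTE z0).
have dq : derivable (fun z => J k 1 z / I 1 z) 0 1.
  apply: derivableM; first exact: dJ.
  apply: derivableV; last exact: dI.
  by apply: Ige; rewrite cabs0; lra.
apply: (near_eq_derivable _ dq); apply/cx_nbhsP; exists (1 / 32); first by lra.
move=> w; rewrite subr0 => w1.
have [w0|w0] := eqVneq w 0; last by rewrite E// ltW.
have ck0 := hk 0; have cq0 := cx_derivable_continuous dq.
rewrite w0; apply/eqP; rewrite -subr_eq0 -cabs_eq0 eq_le cabs_ge0 andbT.
apply/ler_addgt0Pr => e e0; rewrite add0r.
have e20 : 0 < e / 2 by rewrite divr_gt0.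
have [d1 d10 h1] := (cx_contP _ _).1 ck0 _ e20.
have [d2 d20 h2] := (cx_contP _ _).1 cq0 _ e20.
pose m := Num.min (Num.min d1 d2) (1 / 16).
have m0 : 0 < m by rewrite !lt_min d10 d20 divr_gt0.
pose v : Cx R := (m / 2)%:C.
have cv : cabs v = m / 2 by rewrite cabs_real gtr0_norm// divr_gt0.
have [m1 [m2 m3]] : m <= d1 /\ m <= d2 /\ m <= 1 / 16.
  by rewrite /m !ge_min !lexx ?orbT.
have v0 : v != 0 by rewrite -cabs_gt0 cv divr_gt0.
have := h1 v; have := h2 v; rewrite !subr0 cv => /(_ ltac:(lra)) H2 /(_ ltac:(lra)) H1.
rewrite -E// in H2; last by rewrite cv; lra.
have := cabs_tri (k v) (J k 1 0 / I 1 0) (k 0); rewrite (cabsC _ (k v)); lra.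
Qed.

Lemma entire_div k : entire k -> k 0 = 0 ->
  exists2 q, entire q & forall z : Cx R, k z = z * q z.
Proof.
move=> ek k0; have [l hl] := (cx_derivableP _ _).1 (ek 0).
pose q (z : Cx R) := if z == 0 then l else k z / z.
have dq (z : Cx R) : z != 0 -> derivable q z 1.
  move=> z0; have h : derivable (fun z => k z / z) z 1.
    by apply: derivableM; [exact: ek|apply: derivableV; [exact: z0|exact: derivable_id]].
  apply: near_eq_derivable h; apply/cx_nbhsP; exists (cabs z); first by rewrite cabs_gt0.
  move=> w wz; rewrite /q; case: eqVneq => // w0.
  by move: wz; rewrite w0 sub0r cabsN ltxx.
exists q; last first.
  by move=> z; rewrite /q; case: eqVneq => [->|z0]; rewrite ?mul0r// mulrC divfK.
apply: removable; last exact: dq.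
move=> z; have [->|z0] := eqVneq z 0; last exact/cx_derivable_continuous/dq.
apply/cx_contP => e e0; have [d d0 hd] := hl (e / 2) (divr_gt0 e0 (ltr0Sn _ 1)).
exists d => // w /hd; rewrite subr0 k0 /q eqxx subr0; case: eqVneq => [_ _|w0].
  by rewrite subrr cabs0.
have p : 0 < cabs w by rewrite cabs_gt0.
rewrite -ler_pdivrMr// -cabsV -cabsM mulrBl mulfK// => h.
by apply: le_lt_trans h _; lra.
Qed.

(** If division by z never stopped, k = z^n q with q entire for every n. The Cauchy estimate on a
    square of half-side r >= 2 |z| gives |q(z)| <= 16 M / r^n, hence |k(z)| <= 16 M / 2^n for all
    n. *)
Lemma entire_order k : entire k -> (forall z, k z = 0) \/
  exists (n : nat) (q : Cx R -> Cx R), [/\ entire q, q 0 != 0 & forall z, k z = z ^+ n * q z].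
Proof.
move=> ek; have [h|none] := pselect (exists (n : nat) (q : Cx R -> Cx R),
  [/\ entire q, q 0 != 0 & forall z, k z = z ^+ n * q z]); [by right|left].
have all (n : nat) : exists2 q, entire q & forall z : Cx R, k z = z ^+ n * q z.
  elim: n => [|n [q eq kq]]; first by exists k => // z; rewrite expr0 mul1r.
  have [q0|q0] := eqVneq (q 0) 0; last by exfalso; apply: none; exists n, q.
  have [p ep qp] := entire_div eq q0; exists p => // z.
  by rewrite kq qp mulrA exprSr.
move=> z; apply/eqP; rewrite -cabs_eq0 eq_le cabs_ge0 andbT.
apply/ler_addgt0Pr => e e0; rewrite add0r.
pose r := 32 * (cabs z + 1); have z0 := cabs_ge0 z.
have r0 : 0 < r by rewrite /r; lra.
have zr : cabs z <= r / 32 by rewrite /r; lra.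
have [M hM] := bounded_disc (2 * r) (entire_continuous ek).
have M0 : 0 <= M by apply: le_trans (hM 0 _); [exact: cabs_ge0|rewrite cabs0; lra].
have M16 : 0 <= 16 * M by lra.
have [n hn] := half_pow_small M16 e0.
have [q eq kq] := all n; have cq := entire_continuous eq.
have hqz : cabs (q z) <= 16 * M / r ^+ n.
  have F : q z * I r z = J q r z.
    by rewrite /J (@cauchy_formula _ q set0)//; [exact: thin0|lra].
  have : cabs (J q r z) <= 4 * (2 * M / r ^+ n.+1 * ((r - - r) + (r - - r))).
    apply: RectI_le; [lra|lra|apply: sides_quot => //; lra|].
    move=> u hu; have [h1 n1] := @sq_far r z u r0 ltac:(lra) hu.
    have /andP[h2 h3] := on_sq_cabs r0 hu.
    have n2 : 0 < cabs u by lra.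
    have hq : cabs (q u) * cabs u ^+ n <= M by rewrite mulrC -cabsX -cabsM -kq; exact: hM.
    have hq' : cabs (q u) <= M / r ^+ n.
      rewrite ler_pdivlMr ?exprn_gt0//; apply: le_trans hq.
      rewrite ler_wpM2l ?cabs_ge0//; apply: lerXn2r => //; rewrite nnegrE; lra.
    rewrite cabsM cabsV ler_pdivrMr ?cabs_gt0//; apply: (le_trans hq').
    have -> : M / r ^+ n = 2 * M / r ^+ n.+1 * (r / 2).
      by rewrite exprS; field; rewrite expf_neq0 ?gt_eqF.
    rewrite ler_wpM2l// !mulr_ge0// invr_ge0 exprn_ge0// ltW//.
  have -> : 4 * (2 * M / r ^+ n.+1 * (r - - r + (r - - r))) = 2 * (16 * M / r ^+ n).
    by rewrite exprS; field; rewrite expf_neq0 ?gt_eqF.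
  rewrite -F cabsM; have := I_ge r0 zr; have := cabs_ge0 (q z); nra.
rewrite kq cabsM cabsX; apply: le_trans (ltW hn).
apply: (@le_trans _ _ (cabs z ^+ n * (16 * M / r ^+ n))).
  by rewrite ler_wpM2l// exprn_ge0.
rewrite mulrCA ler_wpM2l// -expr_div_n -exprVn; apply: lerXn2r.
- by rewrite nnegrE divr_ge0// ltW.
- by rewrite nnegrE invr_ge0.
- by rewrite ler_pdivrMr// /r; lra.
Qed.

End CauchyConsequences.

(** * The loop *)

Definition cont_in (R : realType) (a b : R) (f : R -> Cx R) : Prop :=
  forall x, a <= x <= b -> forall e : R, 0 < e -> exists2 d : R, 0 < d &
    forall y, a <= y <= b -> `|y - x| < d -> cabs (f y - f x) < e.

Section IntervalFunctions.
Context {R : realType}.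
Implicit Types (a b c d e t : R) (f h : R -> Cx R).

Lemma within_contP (f : R -> R) a b :
  (forall x, a <= x <= b -> forall e : R, 0 < e -> exists2 d : R, 0 < d &
    forall y, a <= y <= b -> `|y - x| < d -> `|f y - f x| < e) ->
  {within `[a, b], continuous f}.
Proof.
move=> h; apply/subspace_continuousP => x; rewrite /= in_itv/= => hx.
apply/cvgrPdist_lt => e e0; have [d d0 hd] := h x hx e e0.
apply/nbhs_ballP; exists d => //= y; rewrite /ball/= => xy.
by rewrite in_itv/= => hy; rewrite distrC; apply: hd => //; rewrite distrC.
Qed.

Lemma cont_in_within a b f : cont_in a b f ->
  {within `[a, b], continuous (Re \o f)} /\ {within `[a, b], continuous (Im \o f)}.
Proof.
move=> h; split; apply: within_contP => x hx e e0; have [d d0 hd] := h x hx e e0;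
  exists d => // y hy yx; apply: le_lt_trans (hd y hy yx).
  by rewrite -ReN -ReD Re_le_cabs.
by rewrite -ImN -ImD Im_le_cabs.
Qed.

Lemma cont_in_CInt a b f : cont_in a b f -> CInt `[a, b] f.
Proof. by move=> /cont_in_within[h1 h2]; split; exact: Rint_continuous. Qed.

Lemma cont_in_cmeas a b f : cont_in a b f -> cmeas `[a, b] f.
Proof.
by move=> /cont_in_within[h1 h2]; split; exact: measurable_realfun.subspace_continuous_measurable_fun.
Qed.

Lemma cont_in_min a b f : a <= b -> cont_in a b f ->
  exists2 t, a <= t <= b & forall s, a <= s <= b -> cabs (f t) <= cabs (f s).
Proof.
move=> ab hf.
have : {within `[a, b], continuous (fun t => cabs (f t))}.
  apply: within_contP => x hx e e0; have [d d0 hd] := hf x hx e e0.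
  exists d => // y hy yx; apply: le_lt_trans (hd y hy yx).
  rewrite ler_norml; have := cabs_sub (f y) (f x); have := cabs_sub (f x) (f y).
  rewrite (cabsC (f x)); lra.
move/(EVT_min ab) => [t]; rewrite in_itv/= => ht hmin; by exists t.
Qed.

Lemma cont_in_max a b f : a <= b -> cont_in a b f ->
  exists M, forall s, a <= s <= b -> cabs (f s) <= M.
Proof.
move=> ab hf.
have : {within `[a, b], continuous (fun t => cabs (f t))}.
  apply: within_contP => x hx e e0; have [d d0 hd] := hf x hx e e0.
  exists d => // y hy yx; apply: le_lt_trans (hd y hy yx).
  rewrite ler_norml; have := cabs_sub (f y) (f x); have := cabs_sub (f x) (f y).
  rewrite (cabsC (f x)); lra.
move/(EVT_max ab) => [t]; rewrite in_itv/= => ht hmax; by exists (cabs (f t)).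
Qed.

Lemma lip_cont_in a b f L : (forall x y, a <= x <= b -> a <= y <= b ->
  cabs (f x - f y) <= L * `|x - y|) -> cont_in a b f.
Proof.
move=> h x hx e e0; exists (e / (`|L| + 1)); first by rewrite divr_gt0// ltr_wpDl.
move=> y hy; rewrite ltr_pdivlMr ?ltr_wpDl// => yx.
apply: le_lt_trans (h y x hy hx) _; apply: le_lt_trans yx.
have := ler_norm L; have := normr_ge0 (y - x); nra.
Qed.

Lemma cont_in_M a b f h : cont_in a b f -> cont_in a b h ->
  cont_in a b (fun t => f t * h t).
Proof.
move=> cf ch x hx e e0.
pose M := cabs (f x) + cabs (h x) + 1.
have M0 : 0 < M by have := cabs_ge0 (f x); have := cabs_ge0 (h x); rewrite /M; lra.
have m0 : 0 < Num.min 1 (e / (2 * M)) by rewrite lt_min ltr01 divr_gt0// mulr_gt0.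
have [d1 d10 h1] := cf x hx _ m0; have [d2 d20 h2] := ch x hx _ m0.
exists (Num.min d1 d2); first by rewrite lt_min d10.
move=> y hy; rewrite lt_min => /andP[/(h1 y hy) + /(h2 y hy)].
rewrite !lt_min => /andP[f1 f2] /andP[g1 g2].
have -> : f y * h y - f x * h x = (f y - f x) * h y + f x * (h y - h x) by ring.
apply: le_lt_trans (cabsD _ _) _; rewrite !cabsM.
move: f2 g2; rewrite !ltr_pdivlMr ?mulr_gt0// => f2 g2.
have hy1 : cabs (h y) <= M.
  have := cabs_sub (h y) (h x); have := cabs_ge0 (f x); rewrite /M; lra.
have fx1 : cabs (f x) <= M by have := cabs_ge0 (h x); rewrite /M; lra.
have := cabs_ge0 (f y - f x); have := cabs_ge0 (h y - h x).
have := cabs_ge0 (h y); have := cabs_ge0 (f x); nra.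
Qed.

Lemma cont_in_comp a b (k : Cx R -> Cx R) f : cont_in a b f ->
  (forall t, a <= t <= b -> {for f t, continuous k}) ->
  cont_in a b (fun t => k (f t)).
Proof.
move=> cf ck x hx e e0.
have [d1 d10 h1] := (cx_contP _ _).1 (ck x hx) e e0.
have [d d0 hd] := cf x hx _ d10.
by exists d => // y hy yx; apply: h1; exact: hd.
Qed.

Lemma cont_in_sub a b a' b' f : a <= a' -> b' <= b -> cont_in a b f -> cont_in a' b' f.
Proof.
move=> aa bb h x hx e e0; have hx' : a <= x <= b by lra.
have [d d0 hd] := h x hx' e e0.
by exists d => // y hy; apply: hd; lra.
Qed.

End IntervalFunctions.

Section C2Functions.
Context {R : realType}.
Implicit Types (a b d e t : R).

Definition C2c (c : R -> Cx R) := C2 (fun t => Re (c t)) /\ C2 (fun t => Im (c t)).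

Lemma C2_derive (f : R -> R) : C2 f ->
  [/\ forall t, is_derive t 1 f (derive1 f t),
      forall t, is_derive t 1 (derive1 f) (derive1n 2 f t) &
      forall t, {for t, continuous (derive1n 2 f)}].
Proof.
move=> [h1 h2 h3]; split=> // t.
  by split; [exact: h1|rewrite derive1E].
by split; [exact: h2|rewrite /= derive1E].
Qed.

Lemma real_cont_bounded (f : R -> R) a b : a <= b -> {within `[a, b], continuous f} ->
  exists2 M, 0 <= M & forall t, a <= t <= b -> `|f t| <= M.
Proof.
move=> ab hf; have hn : {within `[a, b], continuous (fun t => `|f t|)}.
  by move=> x; apply: continuous_comp; [exact: hf|exact: norm_continuous].
have [t _ hmax] := EVT_max ab hn; by exists `|f t|.
Qed.

Lemma C2_bounds (f : R -> R) a b : a <= b -> C2 f -> exists2 M, 0 <= M &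
  [/\ forall t, a <= t <= b -> `|derive1 f t| <= M,
      forall x y, a <= x <= b -> a <= y <= b -> `|f x - f y| <= M * `|x - y| &
      forall x y, a <= x <= b -> a <= y <= b -> `|derive1 f x - derive1 f y| <= M * `|x - y|].
Proof.
move=> ab /C2_derive[h1 h2 h3].
have c1 : {within `[a, b], continuous (derive1 f)}.
  by apply: derivable_within_continuous => x _; exact: ex_derive.
have c2 : {within `[a, b], continuous (derive1n 2 f)}.
  by apply: continuous_in_subspaceT => x _; exact: h3.
have [M1 M10 hM1] := real_cont_bounded ab c1.
have [M2 M20 hM2] := real_cont_bounded ab c2.
have btw x y u : a <= x <= b -> a <= y <= b -> Num.min y x <= u <= Num.max y x -> a <= u <= b.
  by have [xy|xy] := leP y x; lra.
exists (M1 + M2); first exact: addr_ge0; split.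
- by move=> t /hM1; lra.
- move=> x y hx hy.
  have H := @derive_bound_sym R f (derive1 f) M1 y x (fun u _ => h1 u)
    (fun u hu => hM1 u (btw x y u hx hy hu)).
  by apply: le_trans H _; rewrite ler_wpM2r// lerDl.
- move=> x y hx hy.
  have H := @derive_bound_sym R (derive1 f) (derive1n 2 f) M2 y x (fun u _ => h2 u)
    (fun u hu => hM2 u (btw x y u hx hy hu)).
  by apply: le_trans H _; rewrite ler_wpM2r// lerDr.
Qed.

Lemma C2c_bounds (c : R -> Cx R) a b : a <= b -> C2c c -> exists2 M, 0 <= M &
  [/\ forall t, a <= t <= b -> cabs (cderiv c t) <= M,
      forall x y, a <= x <= b -> a <= y <= b -> cabs (c x - c y) <= M * `|x - y| &
      forall x y, a <= x <= b -> a <= y <= b -> cabs (cderiv c x - cderiv c y) <= M * `|x - y|].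
Proof.
move=> ab [h1 h2].
have [M1 M10 [p1 p2 p3]] := C2_bounds ab h1.
have [M2 M20 [q1 q2 q3]] := C2_bounds ab h2.
exists (M1 + M2); first exact: addr_ge0; split.
- by move=> t ht; apply: le_trans (cabs_le_ReIm _) _; apply: lerD; [exact: p1|exact: q1].
- move=> x y hx hy; apply: le_trans (cabs_le_ReIm _) _; rewrite !ReImE mulrDl.
  by apply: lerD; [exact: p2|exact: q2].
- move=> x y hx hy; apply: le_trans (cabs_le_ReIm _) _; rewrite !ReImE mulrDl.
  by apply: lerD; [exact: p3|exact: q3].
Qed.

(** The mean value inequality is applied twice, to the derivative of the remainder and then to the
    remainder. *)
Lemma C2_taylor (f : R -> R) e : C2 f -> 0 < e -> exists2 d, 0 < d & forall t, 0 <= t < d ->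
  `|f t - f 0 - derive1 f 0 * t - derive1n 2 f 0 / 2 * t ^+ 2| <= e * t ^+ 2.
Proof.
move=> /C2_derive[h1 h2 h3] e0.
have /cvgrPdist_lt/(_ _ e0) := h3 0; move=> /nbhs_ballP[d /= d0 hd].
have {}hd u : 0 <= u < d -> `|derive1n 2 f u - derive1n 2 f 0| <= e.
  move=> hu; rewrite distrC ltW//; apply: hd; rewrite /ball/= sub0r normrN ger0_norm; lra.
exists d => // t ht.
have H1 u : 0 <= u <= t -> `|derive1 f u - derive1 f 0 - derive1n 2 f 0 * u| <= e * t.
  move=> hu.
  have D x : 0 <= x <= u -> is_derive x 1
      (fun v => derive1 f v - derive1 f 0 - derive1n 2 f 0 * v)
      (derive1n 2 f x - derive1n 2 f 0).
    move=> _; have h := h2 x; apply: is_derive_eq; rewrite subr0; congr (_ - _).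
    by rewrite /GRing.scale/= mulr1.
  have u0 : 0 <= u by lra.
  have hb x : 0 <= x <= u -> `|derive1n 2 f x - derive1n 2 f 0| <= e.
    by move=> hx; apply: hd; lra.
  have := derive_bound u0 D hb; rewrite subrr mulr0 !subr0 => h.
  by apply: (le_trans h); rewrite ler_pM2l//; lra.
have hD x : 0 <= x <= t -> is_derive x 1
    (fun v => f v - f 0 - derive1 f 0 * v - derive1n 2 f 0 / 2 * v ^+ 2)
    (derive1 f x - derive1 f 0 - derive1n 2 f 0 * x).
  move=> _; have h := h1 x; apply: is_derive_eq.
  by rewrite subr0 /GRing.scale/= !mulr1; field.
have t0 : 0 <= t by move: ht => /andP[].
have := derive_bound t0 hD H1.
rewrite subrr expr0n/= !mulr0 !subr0 => h.
have -> : e * t ^+ 2 = e * t * t by ring.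
exact: h.
Qed.

End C2Functions.

Section ThinSets.
Context {R : realType}.

(** A disc inside [G] would hold a grid of m^2 points too far apart for two of them to share a
    covering point, against O(m) covering points. Limits taken off the trace are thereby meaningful
    at each of its points. *)
Lemma thin_dense_compl (G : set (Cx R)) (z : Cx R) (e : R) : thin G -> 0 < e ->
  exists2 w, ~ G w & cabs (w - z) < e.
Proof.
move=> [K hK] e0; apply: contrapT => none.
have inG w : cabs (w - z) < e -> G w.
  by move=> we; apply: contrapT => nG; apply: none; exists w.
(* [C] makes twice the covering radius smaller than the mesh [sg]. The size of [m] then beats the
   number K (m (C+1) + 1) <= m K (C+2) of covering points. *)
have [C hC] := ltC_real 0 (8 * K%:R / e).
pose m := (K * C.+2).+1.
have m0 : 0 < m%:R :> R by rewrite ltr0n.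
pose sg := e / (4 * m%:R); have sg0 : 0 < sg by rewrite divr_gt0// mulr_gt0.
have [s [hs hG]] := hK (m * C.+1)%N.
have n0 : 0 < (m * C.+1).+1%:R :> R by rewrite ltr0n.
have small : 2 * (K%:R / (m * C.+1).+1%:R) < sg.
  rewrite mulrA ltr_pdivrMr// /sg mulrAC ltr_pdivlMr ?mulr_gt0//.
  move: hC; rewrite ltr_pdivrMr// => hC.
  have : 8 * K%:R * m%:R <= C.+1%:R * e * m%:R by rewrite ler_wpM2r// ltW.
  rewrite -[in X in _ -> _ < X]natr1 natrM; nra.
move: hG small; move: (K%:R / (m * C.+1).+1%:R) => q hG small.
pose pt (i : 'I_m * 'I_m) : Cx R := z + ((i.1%:R * sg) +i* (i.2%:R * sg)).
have ptG i : G (pt i).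
  apply: inG; rewrite /pt addrAC subrr add0r.
  apply: le_lt_trans (cabs_le_ReIm _) _ => /=.
  have B (j : 'I_m) : `|j%:R * sg| <= e / 4.
    rewrite ger0_norm; last by rewrite mulr_ge0// ltW.
    have -> : e / 4 = m%:R * sg by rewrite /sg; field; rewrite gt_eqF.
    by rewrite ler_pM2r// ler_nat ltnW.
  have := B i.1; have := B i.2; lra.
have [f hf] := choice (fun i => let: ex_intro2 p ps hp := hG _ (ptG i) in
  ex_intro (fun p => p \in s /\ cabs (pt i - p) <= q) p (conj ps hp)).
have finj : injective f.
  move=> i j fij; have [_ hi] := hf i; have [_ hj] := hf j.
  have hij : cabs (pt i - pt j) < sg.
    apply: le_lt_trans small; apply: le_trans (cabs_tri (f i) _ _) _.
    by rewrite fij (cabsC _ (pt j)); rewrite fij in hi; lra.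
  have F (a b : 'I_m) : `|a%:R * sg - b%:R * sg| < sg -> a = b.
    rewrite -mulrBl normrM (gtr0_norm sg0) -[ltRHS]mul1r ltr_pM2r// => h.
    apply/val_inj/eqP; rewrite eqn_leq; apply/andP; split; rewrite leqNgt; apply/negP => ab.
      have : b.+1%:R <= a%:R :> R by rewrite ler_nat.
      by move: h; rewrite ltr_norml -natr1; lra.
    have : a.+1%:R <= b%:R :> R by rewrite ler_nat.
    by move: h; rewrite ltr_norml -natr1; lra.
  have E : pt i - pt j = (i.1%:R * sg - j.1%:R * sg) +i* (i.2%:R * sg - j.2%:R * sg).
    by apply: eq_cx; rewrite /pt !ReImE/=; ring.
  have h1 : i.1 = j.1.
    by apply: F; apply: le_lt_trans hij; rewrite E; exact: (le_trans _ (Re_le_cabs _)).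
  have h2 : i.2 = j.2.
    by apply: F; apply: le_lt_trans hij; rewrite E; exact: (le_trans _ (Im_le_cabs _)).
  by case: i j h1 h2 {fij hi hj hij E} => [i1 i2] [j1 j2] /= -> ->.
have : (size (map f (enum {: 'I_m * 'I_m})) <= size s)%N.
  apply: uniq_leq_size; first by rewrite map_inj_uniq// enum_uniq.
  by move=> _ /mapP[i _ ->]; have [] := hf i.
rewrite size_map -cardE card_prod card_ord => h.
have := leq_trans h hs; rewrite leqNgt => /negP; apply.
apply: (@leq_ltn_trans (m * (K * C.+2))); last by rewrite ltn_pmul2l.
by rewrite mulnCA leq_mul2l; apply/orP; right; rewrite [leqRHS]mulnS -add1n leq_add2r.
Qed.

End ThinSets.

Section Curve.
Context {R : realType} (g : R -> Cx R).
Implicit Types (s t x y : R).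

Lemma curve_lip : piecewise_C2 g -> exists2 L, 0 <= L & forall x y,
  0 <= x <= 1 -> 0 <= y <= 1 -> cabs (g x - g y) <= L * `|x - y|.
Proof.
move=> [s [/(pathP 0) ps ls hs]].
(* Induction over the break points. The nodes are [0 :: s], so piece k runs from [nth 0 (0 :: s) k]
   to [nth 0 s k]. *)
suff H k : (k <= size s)%N -> exists2 L, 0 <= L & forall x y,
    0 <= x <= nth 0 (0 :: s) k -> 0 <= y <= nth 0 (0 :: s) k ->
    cabs (g x - g y) <= L * `|x - y|.
  have [L L0 hL] := H _ (leqnn _); exists L => // x y.
  by rewrite -nth_last/= in ls; move: hL; case: (s) ls => [|a s'] //= -> => hL; exact: hL.
elim: k => [_|k ih ks].
  exists 0 => // x y /= hx hy; have -> : x = y by lra.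
  by rewrite !subrr cabs0 normr0 mulr0.
have [L L0 hL] := ih (ltnW ks).
have [c [c1 c2 hc]] := hs _ ks.
have ab := ps _ ks; move: ab hL hc => /=.
set a := nth 0 (0 :: s) k; set b := nth 0 s k => ab hL hc.
have [M M0 [_ hM _]] := C2c_bounds (ltW ab) (conj c1 c2).
have hg x y : a <= x <= b -> a <= y <= b -> cabs (g x - g y) <= M * `|x - y|.
  by move=> hx hy; rewrite (hc _ hx).1 (hc _ hy).1; exact: hM.
exists (L + M); first exact: addr_ge0.
suff W x y : 0 <= x <= b -> 0 <= y <= b -> x <= y -> cabs (g x - g y) <= (L + M) * `|x - y|.
  move=> x y hx hy; have [xy|/ltW yx] := leP x y; first exact: W.
  by rewrite cabsC distrC; exact: W.
move=> hx hy xy; rewrite distrC ger0_norm ?subr_ge0//.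
have [ya|ay] := leP y a.
  have := hL x y ltac:(lra) ltac:(lra); rewrite distrC ger0_norm ?subr_ge0//; nra.
have [ax|xa] := leP a x.
  have := hg x y ltac:(lra) ltac:(lra); rewrite distrC ger0_norm ?subr_ge0//; nra.
apply: le_trans (cabs_tri (g a) _ _) _.
have h1 := hL x a ltac:(lra) ltac:(lra); have h2 := hg a y ltac:(lra) ltac:(lra).
rewrite distrC ger0_norm in h1; last lra.
rewrite distrC ger0_norm in h2; last lra.
nra.
Qed.

(** The inequalities on t are strict because at a break point the two-sided derivative of [g] need
    not be that of either piece. *)
Lemma cderiv_eq (c : R -> Cx R) a b t : a < t < b ->
  (forall u, a <= u <= b -> g u = c u) -> cderiv g t = cderiv c t.
Proof.
move=> /andP[at_ tb] gc; rewrite /cderiv !derive1E.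
have hn : \forall u \near t, g u = c u.
  near=> u; apply: gc; apply/andP; split; apply: ltW; near: u.
    exact: lt_nbhsr.
  exact: lt_nbhsl.
congr Complex; apply: near_eq_derive.
  by apply: filterS hn => u ->.
by apply: filterS hn => u ->.
Unshelve. all: by end_near. Qed.

(** At each break point the value of [cderiv g] is arbitrary; it is added to the bound as one more
    number, and for measurability the point is split off as a singleton. *)
Lemma curve_deriv : piecewise_C2 g ->
  (exists2 B, 0 <= B & forall t, 0 <= t <= 1 -> cabs (cderiv g t) <= B) /\
  cmeas `[0, 1] (cderiv g).
Proof.
move=> [s [/(pathP 0) ps ls hs]].
suff H k : (k <= size s)%N ->
    (exists2 B, 0 <= B & forall t, 0 <= t <= nth 0 (0 :: s) k -> cabs (cderiv g t) <= B) /\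
    cmeas `[0, nth 0 (0 :: s) k] (cderiv g).
  by have := H _ (leqnn _); rewrite -nth_last/= in ls; case: (s) ls => [|a s'] //= ->.
have sing f t : @measurable_fun _ _ (measurableTypeR R) (measurableTypeR R) `[t, t] f.
  by rewrite set_itv1; exact: measurable_fun_set1.
elim: k => [_|k ih ks].
  split; last by split; exact: sing.
  exists (cabs (cderiv g 0)); first exact: cabs_ge0.
  by move=> t /= ht; have -> : t = 0 by lra.
have [[B B0 hB] [m1 m2]] := ih (ltnW ks).
have [c [c1 c2 hc]] := hs _ ks.
have x0 : 0 <= nth 0 (0 :: s) k.
  elim: (k) (ltnW ks) => [//|j ihj js]; apply: le_trans (ihj (ltnW js)) _.
  by apply: ltW; exact: ps.
have ab := ps _ ks; move: ab hB hc m1 m2 x0 => /=.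
set a := nth 0 (0 :: s) k; set b := nth 0 s k => ab hB hc m1 m2 x0.
have [M M0 [hM _ hM']] := C2c_bounds (ltW ab) (conj c1 c2).
have hg t : a < t < b -> cderiv g t = cderiv c t.
  by move=> ht; apply: cderiv_eq ht _ => u /hc[].
have [cc1 cc2] : cmeas `[a, b] (cderiv c).
  by apply: cont_in_cmeas; apply: lip_cont_in hM'.
have E : `[0, b]%classic = (`[0, a] `|` `]a, b[ `|` `[b, b])%classic :> set R.
  apply/seteqP; split=> t; rewrite /= !in_itv/=.
    move=> ht; have [ta|at_] := leP t a; first by left; left; lra.
    by have [tb|bt] := ltP t b; [left; right|right; lra].
  by move=> [[|]|]; lra.
have oo : (`]a, b[ `<=` `[a, b])%classic by exact: subset_itv_oo_cc.
split.
  exists (B + M + cabs (cderiv g b)); first by have := cabs_ge0 (cderiv g b); lra.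
  move=> t ht; have p := cabs_ge0 (cderiv g b).
  have [ta|at_] := leP t a; first by have := hB t ltac:(lra); lra.
  have [tb|bt] := ltP t b; last by (have -> : t = b by lra); lra.
  by rewrite hg ?at_//; have := hM t ltac:(lra); lra.
split; rewrite E; apply/measurable_funU => //; try exact: measurableU;
  (split; last exact: sing); apply/measurable_funU => //; split=> //.
  apply: (eq_measurable_fun (Re \o cderiv c)).
    by move=> t; rewrite inE => /= /[!in_itv]/= /hg h; rewrite -[RHS]/(Re (cderiv g t)) h.
  exact: measurable_funS cc1.
apply: (eq_measurable_fun (Im \o cderiv c)).
  by move=> t; rewrite inE => /= /[!in_itv]/= /hg h; rewrite -[RHS]/(Im (cderiv g t)) h.
exact: measurable_funS cc2.
Qed.

Lemma curve_start : piecewise_C2 g -> exists d c, [/\ 0 < d <= 1, C2c c,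
  forall t, 0 <= t <= d -> g t = c t & cderiv c 0 != 0].
Proof.
move=> [s [/(pathP 0) ps ls hs]]; case: s ps ls hs => [|a s] ps ls hs.
  by move: ls => /= /esym/eqP; rewrite oner_eq0.
have [c [c1 c2 hc]] := hs 0%N isT; have a0 := ps 0%N isT; rewrite /= in hc a0.
have a1 : a <= 1.
  have H k : (k < size (a :: s))%N -> a <= nth 0 (a :: s) k.
    elim: k => [//|k ih ks]; apply: le_trans (ih (ltnW ks)) _.
    by apply: ltW; exact: (ps k.+1 ks).
  by rewrite -ls -nth_last; apply: H.
exists a, c; split=> //; first by rewrite a0.
- by move=> t /hc[].
- by have [|_] := hc 0; first by rewrite lexx ltW.
Qed.

Lemma curve_end : piecewise_C2 g -> exists d c, [/\ 0 < d <= 1, C2c c,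
  forall t, 1 - d <= t <= 1 -> g t = c t & cderiv c 1 != 0].
Proof.
move=> [s [/(pathP 0) ps ls hs]].
have s0 : (0 < size s)%N by case: (s) ls => //= /esym/eqP; rewrite oner_eq0.
have ks : ((size s).-1 < size s)%N by rewrite prednK.
have [c [c1 c2 hc]] := hs _ ks; have ab := ps _ ks.
have b1 : nth 0 s (size s).-1 = 1.
  by rewrite -ls -nth_last; case: (s) s0.
have x0 : 0 <= nth 0 (0 :: s) (size s).-1.
  elim: (size s).-1 (ltnW ks) => [//|j ihj js]; apply: le_trans (ihj (ltnW js)) _.
  by apply: ltW; exact: ps.
move: hc ab x0; rewrite b1; set a := nth _ _ _ => hc ab x0.
exists (1 - a), c; split=> //; first lra.
- by move=> t ht; have [] := hc t; first lra.
- by have [|_] := hc 1; first lra.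
Qed.

End Curve.

Section Loop.
Context {R : realType} (g : R -> Cx R).
Implicit Types (s t x y d e : R) (z w v : Cx R).

Lemma traceP z : trace g z <-> exists2 t, 0 <= t <= 1 & g t = z.
Proof.
split=> [[t /=]|[t ht <-]]; first by rewrite in_itv/= => ht <-; exists t.
by exists t => //=; rewrite in_itv.
Qed.

Lemma trace_pt t : 0 <= t <= 1 -> trace g (g t).
Proof. by move=> ht; apply/traceP; exists t. Qed.

Lemma cx_withinP (S : set (Cx R)) (F : Cx R -> Cx R) z v :
  F w @[w --> within S (nbhs z)] --> v <->
  forall e, 0 < e -> exists2 d, 0 < d & forall w, cabs (w - z) < d -> S w -> cabs (F w - v) < e.
Proof.
split=> [/cx_cvgP h e e0|h].
  by have /cx_nbhsP[d d0 hd] := h e e0; exists d.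
by apply/cx_cvgP => e e0; apply/cx_nbhsP; exact: h.
Qed.

Context (hg : loop_at_origin g).

Lemma loop_C2 : piecewise_C2 g. Proof. by case: hg. Qed.

Lemma loop_cont : cont_in 0 1 g.
Proof. by have [L _ hL] := curve_lip loop_C2; exact: lip_cont_in hL. Qed.

Lemma loop_start : g 0 = 0. Proof. by case: hg => _ []. Qed.
Lemma loop_stop : g 1 = 0. Proof. by case: hg => _ []. Qed.

Lemma trace0 : trace g 0.
Proof. by rewrite -loop_start; apply: trace_pt; rewrite lexx ler01. Qed.

Lemma off_trace_neq0 z : ~ trace g z -> z != 0.
Proof. by move=> h; apply/eqP => z0; apply: h; rewrite z0; exact: trace0. Qed.

Lemma loop_neq0 t : 0 < t < 1 -> g t != 0.
Proof.
move=> ht; apply/eqP => gt0; case: hg => _ _ inj _ _.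
have : t = 0 by apply: inj; rewrite ?in_itv/= ?lexx ?ltr01 ?loop_start//; lra.
lra.
Qed.

(** This dichotomy, part of the definition of the loop, plays the role of the Jordan curve
    theorem. *)
Lemma trace_sides z : ~ trace g z -> plus_side g z \/ minus_side g z.
Proof. by move=> h; case: hg => _ _ _ /(_ z h)[w|w] _; [left|right]. Qed.

Lemma trace_dist z : ~ trace g z ->
  exists2 d, 0 < d & forall t, 0 <= t <= 1 -> d <= cabs (g t - z).
Proof.
move=> hz; have cf : cont_in 0 1 (fun t => g t - z).
  move=> x hx e e0; have [d d0 hd] := loop_cont hx e0; exists d => // y hy /(hd y hy).
  by have -> : g y - z - (g x - z) = g y - g x by ring.
have [t ht hmin] := cont_in_min ler01 cf; exists (cabs (g t - z)) => //.
rewrite cabs_gt0 subr_eq0; apply/eqP => gtz; apply: hz; rewrite -gtz; exact: trace_pt.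
Qed.

Lemma trace_bounded : exists M, forall z, trace g z -> cabs z <= M.
Proof.
have [M hM] := cont_in_max ler01 loop_cont; exists M => z /traceP[t ht <-]; exact: hM.
Qed.

Lemma trace_compl_open z : ~ trace g z ->
  exists2 d, 0 < d & forall w, cabs (w - z) < d -> ~ trace g w.
Proof.
move=> /trace_dist[d d0 hd]; exists d => // w wz /traceP[t ht gtw].
by have := hd t ht; rewrite gtw; lra.
Qed.

Lemma trace_thin : thin (trace g).
Proof.
have [L L0 hL] := curve_lip loop_C2.
(* The bound of [L] covers the radius L/(n+1); the added 2 covers the n + 2 <= 2 (n+1) sample
   points. *)
exists (Num.bound L).+2 => n.
have n0 : 0 < n.+1%:R :> R by rewrite ltr0n.
exists [seq g (i%:R / n.+1%:R) | i <- iota 0 n.+2]; split.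
  rewrite size_map size_iota; apply: (@leq_trans (2 * n.+1)%N); last by rewrite leq_mul2r.
  by rewrite mul2n -addnn -[leqLHS]add1n leq_add2r.
move=> z /traceP[t /andP[t0 t1] <-].
pose m := Num.truncn (t * n.+1%:R).
have tn : 0 <= t * n.+1%:R by rewrite mulr_ge0// ltW.
have /andP[m1 m2] := truncn_itv tn; rewrite -/m in m1 m2.
have mn : (m <= n.+1)%N.
  rewrite -(ler_nat R); apply: le_trans m1 _; rewrite -[leRHS]mul1r ler_wpM2r// ltW//.
have q1 : 0 <= (m%:R / n.+1%:R : R) <= 1.
  by rewrite divr_ge0 ?(ltW n0)//= ler_pdivrMr// mul1r ler_nat.
exists (g (m%:R / n.+1%:R)).
  by apply/mapP; exists m => //; rewrite mem_iota/= add0n ltnS.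
have t01 : 0 <= t <= 1 by rewrite t0.
apply: le_trans (hL _ _ t01 q1) _.
rewrite ler_pdivlMr// -mulrA -[X in _ * (_ * X)](gtr0_norm n0) -normrM mulrBl mulfVK ?gt_eqF//.
have h : `|t * n.+1%:R - m%:R| <= 1.
  by move: m1 m2; move: (t * _) => u; rewrite ler_norml -(natr1 m); lra.
have bL := archi_boundP L0.
apply: (@le_trans _ _ L); first by rewrite -[leRHS]mulr1 ler_wpM2l.
by apply: le_trans (ltW bL) _; rewrite ler_nat; do 2 apply: ltnW.
Qed.

(* Painleve's theorem for z F(z), then Liouville's. *)
Lemma no_jump_zero (F : Cx R -> Cx R) :
  (forall z, ~ trace g z -> derivable F z 1) ->
  (forall z, trace g z -> z != 0 -> exists v,
     F w @[w --> within (plus_side g) (nbhs z)] --> v /\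
     F w @[w --> within (minus_side g) (nbhs z)] --> v) ->
  (fun w => w * F w) w @[w --> within (~` trace g) (nbhs (0 : Cx R))] --> (0 : Cx R) ->
  (exists K r, forall z, ~ trace g z -> r <= cabs z -> cabs (z * F z) <= K) ->
  forall z, ~ trace g z -> F z = 0.
Proof.
move=> dF jF F0 [K [r FK]].
have jF' z : exists v, trace g z -> z != 0 ->
     F w @[w --> within (plus_side g) (nbhs z)] --> v /\
     F w @[w --> within (minus_side g) (nbhs z)] --> v.
  have [tz|nt] := pselect (trace g z); last by exists 0.
  have [z0|z0] := eqVneq z 0; first by exists 0.
  by have [v hv] := jF z tz z0; exists v.
have [V hV] := choice jF'.
(* The continuous extension of z F(z): the decay hypothesis gives the value 0 at the origin, and
   elsewhere on the trace [V] is the common boundary value. *)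
pose H z := if z \in trace g then z * (if z == 0 then 0 else V z) else z * F z.
have Hoff z : ~ trace g z -> H z = z * F z by move=> hz; rewrite /H memNset.
have H0 : H 0 = 0 by rewrite /H !mul0r; case: ifP.
have lim z : trace g z -> forall e, 0 < e -> exists2 d, 0 < d & forall w, cabs (w - z) < d ->
    ~ trace g w -> cabs (w * F w - H z) < e.
  move=> tz e e0; have [z0|z0] := eqVneq z 0.
    have [d d0 hd] := (cx_withinP _ _ _ _).1 F0 e e0; rewrite z0 H0; exists d => //.
  have [/cx_withinP hp /cx_withinP hm] := hV z tz z0.
  rewrite /H mem_set// (negbTE z0).
  pose e1 := e / (2 * (cabs z + 1)); have z1 := cabs_ge0 z; have v1 := cabs_ge0 (V z).
  have e10 : 0 < e1 by rewrite divr_gt0// mulr_gt0//; lra.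
  have [d1 d10 h1] := hp _ e10; have [d2 d20 h2] := hm _ e10.
  pose d3 := e / (2 * (cabs (V z) + 1)).
  have d30 : 0 < d3 by rewrite divr_gt0// mulr_gt0//; lra.
  exists (Num.min (Num.min d1 d2) (Num.min 1 d3)).
    by rewrite !lt_min d10 d20 d30 ltr01.
  move=> w; rewrite !lt_min => /andP[/andP[w1 w2] /andP[w3 w4]] nw.
  have Fw : cabs (F w - V z) < e1 by have [] := trace_sides nw; [exact: h1|exact: h2].
  have -> : w * F w - z * V z = w * (F w - V z) + V z * (w - z) by ring.
  apply: le_lt_trans (cabsD _ _) _; rewrite !cabsM.
  have wz : cabs w <= cabs z + 1 by have := cabs_sub w z; lra.
  have a1 : cabs w * cabs (F w - V z) < e / 2.
    apply: (@le_lt_trans _ _ ((cabs z + 1) * cabs (F w - V z))).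
      by rewrite ler_wpM2r// cabs_ge0.
    rewrite mulrC -ltr_pdivlMr; last lra.
    by apply: lt_le_trans Fw _; rewrite /e1 invfM mulrA.
  have a2 : cabs (V z) * cabs (w - z) <= e / 2.
    apply: (@le_trans _ _ ((cabs (V z) + 1) * cabs (w - z))).
      by rewrite ler_wpM2r ?cabs_ge0// lerDl.
    rewrite mulrC -ler_pdivlMr; last lra.
    by apply: le_trans (ltW w4) _; rewrite /d3 invfM mulrA.
  lra.
have cH : continuous H.
  move=> z; have [tz|nz] := pselect (trace g z); last first.
    apply: cx_derivable_continuous.
    have h : derivable (fun w => w * F w) z 1.
      by apply: derivableM; [exact: derivable_id|exact: dF].
    apply: near_eq_derivable h; apply/cx_nbhsP.
    have [d d0 hd] := trace_compl_open nz; exists d => // w /hd nw.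
    by rewrite Hoff.
  apply/cx_contP => e e0; have e2 : 0 < e / 2 by rewrite divr_gt0.
  have [d d0 hd] := lim z tz _ e2; exists (d / 2); first by rewrite divr_gt0.
  move=> w wz; have [tw|nw] := pselect (trace g w); last first.
    by rewrite Hoff//; apply: lt_trans (_ : e / 2 < e); [apply: hd => //; lra|lra].
  (* [lim] speaks of points off the trace only; two points of the trace are compared through a point
     [u] off the trace and close to [w]. *)
  have [d' d'0 hd'] := lim w tw _ e2.
  have m0 : 0 < Num.min d' (d / 2) by rewrite lt_min d'0 divr_gt0.
  have [u nu] := thin_dense_compl w trace_thin m0; rewrite lt_min => /andP[u1 u2].
  have h1 := hd' u u1 nu.
  have h2 : cabs (u * F u - H z) < e / 2.
    by apply: hd => //; have := cabs_tri w u z; lra.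
  have := cabs_tri (u * F u) (H w) (H z); rewrite (cabsC (H w) (u * F u)); lra.
have dH z : ~ trace g z -> derivable H z 1.
  move=> nz; have h : derivable (fun w => w * F w) z 1.
    by apply: derivableM; [exact: derivable_id|exact: dF].
  apply: near_eq_derivable h; apply/cx_nbhsP.
  by have [d d0 hd] := trace_compl_open nz; exists d => // w /hd nw; rewrite Hoff.
have [M hM] := trace_bounded.
have [B hB] := bounded_disc (Num.max r M + 1) cH.
have bH z : cabs (H z) <= Num.max B K.
  have [zr|zr] := leP (cabs z) (Num.max r M + 1); first by rewrite le_max hB.
  have rM : Num.max r M < cabs z by lra.
  move: rM; rewrite gt_max => /andP[z1 z2].
  have nz : ~ trace g z by move=> /hM; lra.
  by rewrite Hoff// le_max FK ?orbT// ltW.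
move=> z nz; have z0 := off_trace_neq0 nz.
suff : H z = 0 by rewrite Hoff// => /eqP; rewrite mulf_eq0 (negbTE z0) => /eqP.
apply/eqP; rewrite -cabs_eq0 eq_le cabs_ge0 andbT.
apply/ler_addgt0Pr => e e0; rewrite add0r.
have [d d0 hd] := (cx_contP _ _).1 (cH 0) e e0.
(* Liouville's theorem makes [H] constant off the trace; evaluating it near the origin, where it
   tends to 0, identifies the constant. *)
have [w nw wd] := thin_dense_compl 0 trace_thin d0.
rewrite (liouville cH trace_thin dH bH nz nw).
by have := hd w wd; rewrite H0 subr0; exact: ltW.
Qed.

End Loop.

(** * Uniqueness *)

Section SymplecticIdentities.
Context (F : fieldType).

(** The two jump matrices cancel each other through J, as in a symplectic relation; hence the + and
    - boundary values of Y J Z agree. *)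
Lemma jump_J_gen N (W : 'M[F]_N) :
  block_mx 1%:M W 0 1%:M *m block_mx 0 1%:M (- 1%:M) 0 *m block_mx 1%:M 0 W 1%:M
  = block_mx 0 1%:M (- 1%:M) 0.
Proof.
rewrite !mulmx_block !(mulmx0, mul0mx, mulmx1, mul1mx, mulmxN, mulNmx, add0r, addr0).
by rewrite addNr.
Qed.

Lemma asymp_J_gen N n (z : F) : z != 0 ->
  block_mx (z ^+ n)%:M 0 0 (z ^- n)%:M *m block_mx 0 1%:M (- 1%:M) 0 *m
  block_mx (z ^+ n)%:M 0 0 (z ^- n)%:M = block_mx 0 1%:M (- 1%:M) 0 :> 'M[F]_(N + N).
Proof.
move=> z0; have zn : z ^+ n != 0 by rewrite expf_neq0.
rewrite !mulmx_block !(mulmx0, mul0mx, mulmx1, mul1mx, mulmxN, mulNmx, add0r, addr0).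
by rewrite -!scalar_mxM mulfV// mulVf.
Qed.

Lemma JJ_gen N : block_mx 0 1%:M (- 1%:M) 0 *m (- block_mx 0 1%:M (- 1%:M) 0) = 1%:M
  :> 'M[F]_(N + N).
Proof.
rewrite mulmxN mulmx_block !(mulmx0, mul0mx, mulmx1, mul1mx, mulmxN, mulNmx, add0r, addr0).
by rewrite opp_block_mx !oppr0 !opprK -scalar_mx_block.
Qed.

End SymplecticIdentities.

Section Uniqueness.
Context {R : realType} (g : R -> Cx R).
Implicit Types (f h : Cx R -> Cx R) (z w v : Cx R) (e d K r : R).

Definition Jmx N : 'M[Cx R]_(N + N) := block_mx 0 1%:M (- 1%:M) 0.

(** J pairs the left half of [A] with the lower half of [B], and the right with the upper. Under the
    conditions at the origin, each product is thus a bounded entry times an o(1/z) entry. *)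
Lemma JmxE m n N (A : 'M[Cx R]_(m, N + N)) (B : 'M[Cx R]_(N + N, n)) i j :
  (A *m Jmx N *m B) i j =
  \sum_(k < N) (A i (lshift N k) * B (rshift N k) j - A i (rshift N k) * B (lshift N k) j).
Proof.
rewrite -(hsubmxK A) -(vsubmxK B) mul_row_block mul_row_col.
rewrite !mulmx0 mulmx1 mulmxN mulmx1 add0r addr0 mulNmx !mxE addrC -sumrB.
apply: eq_bigr => k _; rewrite (row_mxEl, row_mxEr) ?row_mxEl ?row_mxEr ?col_mxEu ?col_mxEd.
by rewrite !mxE.
Qed.

Lemma derivable_bigsum n (f : 'I_n -> Cx R -> Cx R) z :
  (forall k, derivable (f k) z 1) -> derivable (fun w => \sum_(k < n) f k w) z 1.
Proof.
elim: n f => [|n ih] f hf.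
  by under eq_fun do rewrite big_ord0; exact: derivable_cst.
under eq_fun do rewrite big_ord_recr/=.
by apply: derivableD; [apply: ih => k; exact: hf|exact: hf].
Qed.

Lemma cvg_bigsum (F : set_system (Cx R)) {FF : Filter F} n (f : 'I_n -> Cx R -> Cx R)
    (l : 'I_n -> Cx R) :
  (forall k, f k w @[w --> F] --> l k) ->
  (\sum_(k < n) f k w) @[w --> F] --> \sum_(k < n) l k.
Proof.
elim: n f l => [|n ih] f l hf.
  by rewrite big_ord0; under eq_fun do rewrite big_ord0; exact: cvg_cst.
rewrite big_ord_recr/=; under eq_fun do rewrite big_ord_recr/=.
have h1 := ih (fun k => f (widen_ord (leqnSn n) k)) (fun k => l (widen_ord (leqnSn n) k))
  (fun k => hf _).
exact: cvgD h1 (hf ord_max).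
Qed.

Definition small0 f := forall e, 0 < e -> exists2 d, 0 < d &
  forall w, ~ trace g w -> cabs w < d -> cabs (w * f w) < e.

Definition bnd0 f := exists K d, [/\ 0 <= K, 0 < d &
  forall w, ~ trace g w -> cabs w < d -> cabs (f w) <= K].

Lemma small0P f : small0 f <->
  (w * f w) @[w --> within (~` trace g) (nbhs (0 : Cx R))] --> (0 : Cx R).
Proof.
split=> [h|/cx_withinP h e /h[d d0 hd]].
  apply/cx_withinP => e /h[d d0 hd]; exists d => // w; rewrite !subr0 => wd nw.
  exact: hd.
by exists d => // w nw wd; have := hd w; rewrite !subr0; apply.
Qed.

Lemma small0D f h : small0 f -> small0 h -> small0 (fun w => f w + h w).
Proof.
move=> hf hh e e0; have e2 : 0 < e / 2 by rewrite divr_gt0.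
have [d1 d10 h1] := hf _ e2; have [d2 d20 h2] := hh _ e2.
exists (Num.min d1 d2); first by rewrite lt_min d10.
move=> w nw; rewrite lt_min => /andP[/(h1 _ nw) + /(h2 _ nw)].
rewrite mulrDr; have := cabsD (w * f w) (w * h w); lra.
Qed.

Lemma small0M f h : bnd0 f -> small0 h -> small0 (fun w => f w * h w).
Proof.
move=> [K [d [K0 d0 hd]]] hh e e0.
have e2 : 0 < e / (K + 1) by rewrite divr_gt0// ltr_wpDl.
have [d2 d20 h2] := hh _ e2.
exists (Num.min d d2); first by rewrite lt_min d0.
move=> w nw; rewrite lt_min => /andP[/(hd _ nw) p /(h2 _ nw)].
rewrite ltr_pdivlMr ?ltr_wpDl// => q.
rewrite mulrCA (cabsM (f w)).
have q0 := cabs_ge0 (w * h w).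
have : cabs (f w) * cabs (w * h w) <= K * cabs (w * h w) by rewrite ler_wpM2r.
lra.
Qed.

Lemma small0N f : small0 f -> small0 (fun w => - f w).
Proof. by move=> h e /h[d d0 hd]; exists d => // w nw /(hd _ nw); rewrite mulrN cabsN. Qed.

Lemma small0_sum n (f : 'I_n -> Cx R -> Cx R) :
  (forall k, small0 (f k)) -> small0 (fun w => \sum_(k < n) f k w).
Proof.
move=> hf; elim: n f hf => [|n ih] f hf.
  move=> e e0; exists 1 => // w _ _; by rewrite big_ord0 mulr0 cabs0.
have h1 := ih (fun k => f (widen_ord (leqnSn n) k)) (fun k => hf _).
move=> e e0; have [d d0 hd] := small0D h1 (hf ord_max) e0.
by exists d => // w nw /(hd _ nw); rewrite big_ord_recr.
Qed.

Lemma bigO_one_bnd0 m n (F : Cx R -> 'M[Cx R]_(m, n)) i j :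
  bigO_one_at0 g F -> bnd0 (fun z => F z i j).
Proof.
move=> [K /cx_nbhsP[d d0 hd]]; exists `|K|, d; split=> // w nw wd.
have := hd w; rewrite subr0 => /(_ wd nw i j) /cabs_le_real h.
by apply: le_trans h _; exact: ler_norm.
Qed.

Lemma littleo_small0 m n (F : Cx R -> 'M[Cx R]_(m, n)) :
  littleo_inv_at0 g F <-> forall i j, small0 (fun z => F z i j).
Proof.
rewrite /littleo_inv_at0; split=> [/mx_cvgP h i j|h].
  apply/small0P; have := h i j; rewrite mxE.
  by under eq_fun do rewrite mxE.
apply/mx_cvgP => i j; rewrite mxE; under eq_fun do rewrite mxE.
exact/small0P.
Qed.

Definition Oinv f := exists K r, [/\ 0 <= K, 0 < r &
  forall z, r <= cabs z -> cabs (f z) <= K / cabs z].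

Lemma OinvD f h : Oinv f -> Oinv h -> Oinv (fun z => f z + h z).
Proof.
move=> [K [r [K0 r0 hK]]] [K' [r' [K0' r0' hK']]].
exists (K + K'), (r + r'); split; [exact: addr_ge0|exact: addr_gt0|].
move=> z zr; rewrite mulrDl; apply: le_trans (cabsD _ _) _.
by apply: lerD; [apply: hK|apply: hK']; lra.
Qed.

Lemma OinvZ v f : Oinv f -> Oinv (fun z => v * f z).
Proof.
move=> [K [r [K0 r0 hK]]]; exists (cabs v * K), r.
split=> //; first by rewrite mulr_ge0 ?cabs_ge0.
by move=> z zr; rewrite cabsM -mulrA ler_wpM2l ?cabs_ge0// hK.
Qed.

Lemma OinvM f h : Oinv f -> Oinv h -> Oinv (fun z => f z * h z).
Proof.
move=> [K [r [K0 r0 hK]]] [K' [r' [K0' r0' hK']]].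
exists (K * K'), (r + r' + 1); split; [exact: mulr_ge0|lra|].
move=> z zr; have z1 : 1 <= cabs z by lra.
rewrite cabsM; have p := hK z ltac:(lra); have q := hK' z ltac:(lra).
apply: (@le_trans _ _ (K / cabs z * (K' / cabs z))).
  by rewrite ler_pM ?cabs_ge0.
have -> : K / cabs z * (K' / cabs z) = K * K' / cabs z * (cabs z)^-1 by ring.
rewrite ler_piMr ?divr_ge0 ?mulr_ge0 ?cabs_ge0// invf_le1//; lra.
Qed.

Lemma Oinv0 : Oinv (fun=> 0).
Proof. by exists 0, 1; split=> // z _; rewrite cabs0 mul0r. Qed.

Lemma Oinv_ext f h : (forall z, f z = h z) -> Oinv f -> Oinv h.
Proof. by move=> fh [K [r [? ? hK]]]; exists K, r; split=> // z; rewrite -fh; exact: hK. Qed.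

Lemma Oinv_sum n (f : 'I_n -> Cx R -> Cx R) :
  (forall k, Oinv (f k)) -> Oinv (fun w => \sum_(k < n) f k w).
Proof.
elim: n f => [|n ih] f hf.
  by apply: Oinv_ext Oinv0 => z; rewrite big_ord0.
apply: Oinv_ext (OinvD (ih (fun k => f (widen_ord (leqnSn n) k)) _) (hf ord_max)).
  by move=> z; rewrite big_ord_recr.
by move=> k; exact: hf.
Qed.

Lemma bigO_invP m n (E : Cx R -> 'M[Cx R]_(m, n)) :
  bigO_inv E <-> forall i j, Oinv (fun z => E z i j).
Proof.
have conv K z x : (`|x| <= (K%:C : Cx R) / `|z|) = (cabs x <= K / cabs z).
  by rewrite !normcE -fmorphV -rmorphM/= lecR.
split=> [[K [r [r0 h]]] i j|h].
  exists `|K|, r; split=> // z zr; have := h z; rewrite normcE lecR => /(_ zr i j).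
  rewrite conv => hh; apply: le_trans hh _.
  by rewrite ler_wpM2r ?ler_norm// invr_ge0 cabs_ge0.
have [K hK] := choice (fun ij : 'I_m * 'I_n => h ij.1 ij.2).
have [r hr] := choice hK.
(* Sums of the nonnegative entrywise constants dominate each of them; the added 1 keeps the radius
   positive for a matrix without entries. *)
exists (\sum_ij K ij), (1 + \sum_ij r ij); split.
  by apply: ltr_pwDl => //; apply: sumr_ge0 => ij _; apply: ltW; case: (hr ij).
move=> z; rewrite normcE lecR => zr i j; rewrite conv.
have [K0 r0 hij] := hr (i, j).
apply: le_trans (hij z _) _.
  apply: le_trans zr; rewrite (bigD1 (i, j))//= addrA addrAC.
  apply: le_trans (_ : 1 + \sum_(i0 | i0 != (i, j)) r i0 + r (i, j) >= _); last by [].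
  rewrite lerDr addr_ge0//; apply: sumr_ge0 => ij _; apply: ltW; by case: (hr ij).
rewrite ler_wpM2r ?invr_ge0 ?cabs_ge0// (bigD1 (i, j))//= lerDl.
by apply: sumr_ge0 => ij _; case: (hr ij).
Qed.

Lemma jump_J N (W : 'M[Cx R]_N) :
  block_mx 1%:M W 0 1%:M *m Jmx N *m block_mx 1%:M 0 W 1%:M = Jmx N.
Proof. exact: jump_J_gen. Qed.

Lemma asymp_J N n z : z != 0 -> asymp N n z *m Jmx N *m asymp N n z = Jmx N.
Proof. exact: asymp_J_gen. Qed.

Context (hg : loop_at_origin g).

Lemma RHP_product N (W : Cx R -> 'M[Cx R]_N) n (X Z : Cx R -> 'M[Cx R]_(N + N)) :
  left_RHP g W n X -> right_RHP g W n Z ->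
  forall z, ~ trace g z -> X z *m Jmx N *m Z z = Jmx N.
Proof.
move=> [dX jX [EX [EX1 [rX hX]]] [s1 [s2 [b1 [b2 [X0 [Xb1 Xb2] [Xs1 Xs2]]]]]]].
move=> [dZ jZ [EZ [EZ1 [rZ hZ]]] [t1 [t2 [c1 [c2 [Z0 [Zb1 Zb2] [Zs1 Zs2]]]]]]].
move=> z nz; apply/matrixP => i j; apply/eqP; rewrite -subr_eq0; apply/eqP.
(* Subtracting J makes F = O(1/z) at infinity, the form required by [no_jump_zero], and costs
   nothing at 0 since a constant is o(1/z). *)
pose F z := (X z *m Jmx N *m Z z) i j - Jmx N i j.
apply: (@no_jump_zero _ _ hg F) nz.
- move=> w nw; apply: derivableB; last exact: derivable_cst.
  under eq_fun do rewrite JmxE.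
  apply: (@derivable_bigsum _ (fun k w => X w i (lshift N k) * Z w (rshift N k) j
     - X w i (rshift N k) * Z w (lshift N k) j)) => k.
  exact: (derivableB (derivableM (dX _ _ _ nw) (dZ _ _ _ nw))
    (derivableM (dX _ _ _ nw) (dZ _ _ _ nw))).
- move=> w tw w0; have [Xp [Xm [hXp hXm EXpm]]] := jX w tw w0.
  have [Zp [Zm [hZp hZm EZpm]]] := jZ w tw w0.
  have L S (A B : 'M[Cx R]_(N + N)) : boundary_value S X w A -> boundary_value S Z w B ->
      F u @[u --> within S (nbhs w)] --> (A *m Jmx N *m B) i j - Jmx N i j.
    move=> /mx_cvgP hA /mx_cvgP hB; apply: cvgB; last exact: cvg_cst.
    rewrite JmxE; under eq_fun do rewrite JmxE.
    apply: (@cvg_bigsum _ _ _ (fun k w => X w i (lshift N k) * Z w (rshift N k) j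
       - X w i (rshift N k) * Z w (lshift N k) j)
       (fun k => A i (lshift N k) * B (rshift N k) j - A i (rshift N k) * B (lshift N k) j)) => k.
    exact: (cvgB (cvgM (hA _ _) (hB _ _)) (cvgM (hA _ _) (hB _ _))).
  exists ((Xm *m Jmx N *m Zm) i j - Jmx N i j); split; last exact: L.
  have := L _ _ _ hXp hZp; rewrite EXpm EZpm -!mulmxA (mulmxA (Jmx N)).
  by rewrite (mulmxA (block_mx _ _ _ _)) (mulmxA (block_mx _ _ _ _)) jump_J.
- apply/small0P.
  have XL (l : 'I_(N + N)) k : bnd0 (fun z => X z l (lshift N k)).
    have [K [d [K0 d0 hd]]] : bnd0 (fun z => col_mx (b1 z) (b2 z) l k).
      have := bigO_one_bnd0; case: (split_ordP l) => m -> h.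
        by have [K [d [? ? hd]]] := h _ _ _ m k Xb1; exists K, d; split=> // w; rewrite col_mxEu; exact: hd.
      by have [K [d [? ? hd]]] := h _ _ _ m k Xb2; exists K, d; split=> // w; rewrite col_mxEd; exact: hd.
    exists K, d; split=> // w nw wd; rewrite X0//.
    by rewrite /block_mx; move: (hd w nw wd); case: (split_ordP l) => m ->;
      rewrite ?col_mxEu ?col_mxEd row_mxEl.
  have XR (l : 'I_(N + N)) k : small0 (fun z => X z l (rshift N k)).
    case: (split_ordP l) => m -> e e0.
      have [d d0 hd] := (littleo_small0 _).1 Xs1 m k e e0; exists d => // w nw wd.
      by rewrite X0// block_mxEur hd.
    have [d d0 hd] := (littleo_small0 _).1 Xs2 m k e e0; exists d => // w nw wd.
    by rewrite X0// block_mxEdr hd.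
  have ZL (l : 'I_(N + N)) k : bnd0 (fun z => Z z (lshift N k) l).
    case: (split_ordP l) => m ->.
      have [K [d [K0 d0 hd]]] := bigO_one_bnd0 k m Zb1; exists K, d; split=> // w nw wd.
      by rewrite Z0// block_mxEul hd.
    have [K [d [K0 d0 hd]]] := bigO_one_bnd0 k m Zb2; exists K, d; split=> // w nw wd.
    by rewrite Z0// block_mxEur hd.
  have ZR (l : 'I_(N + N)) k : small0 (fun z => Z z (rshift N k) l).
    case: (split_ordP l) => m -> e e0.
      have [d d0 hd] := (littleo_small0 _).1 Zs1 k m e e0; exists d => // w nw wd.
      by rewrite Z0// block_mxEdl hd.
    have [d d0 hd] := (littleo_small0 _).1 Zs2 k m e e0; exists d => // w nw wd.
    by rewrite Z0// block_mxEdr hd.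
  have : small0 (fun z => \sum_(k < N) (X z i (lshift N k) * Z z (rshift N k) j
       + - (Z z (lshift N k) j * X z i (rshift N k))) + - Jmx N i j).
    apply: small0D.
      by apply: small0_sum => k; apply: small0D; [|apply: small0N]; exact: small0M.
    apply: small0N => e e0; exists (e / (cabs (Jmx N i j) + 1)).
      by rewrite divr_gt0// ltr_wpDl// cabs_ge0.
    move=> w _; rewrite ltr_pdivlMr ?ltr_wpDl ?cabs_ge0// cabsM.
    have := cabs_ge0 w; nra.
  move=> h e /h[d d0 hd]; exists d => // w nw /(hd w nw).
  rewrite /F JmxE; congr (cabs (_ * (_ - _)) < _).
  by apply: eq_bigr => k _; rewrite [in RHS]mulrC; congr (_ - _); rewrite mulrC.
- have O1 : Oinv (fun z => (EX z *m Jmx N) i j + (Jmx N *m EZ z) i j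
     + (EX z *m Jmx N *m EZ z) i j).
    move/bigO_invP : EX1 => EX1; move/bigO_invP : EZ1 => EZ1.
    apply: OinvD; first apply: OinvD.
    + apply: (@Oinv_ext (fun z => \sum_k Jmx N k j * EX z i k)).
        by move=> w; rewrite mxE; apply: eq_bigr => k _; rewrite mulrC.
      by apply: Oinv_sum => k; apply: OinvZ; exact: EX1.
    + apply: (@Oinv_ext (fun z => \sum_k Jmx N i k * EZ z k j)).
        by move=> w; rewrite mxE.
      by apply: Oinv_sum => k; apply: OinvZ; exact: EZ1.
    + apply: (@Oinv_ext (fun z => \sum_(k < N) (EX z i (lshift N k) * EZ z (rshift N k) j
         + -1 * (EX z i (rshift N k) * EZ z (lshift N k) j)))).
        by move=> w; rewrite JmxE; apply: eq_bigr => k _; rewrite mulN1r.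
      by apply: Oinv_sum => k; apply: OinvD; [|apply: OinvZ]; exact: OinvM.
  have [K [r [K0 r0 hK]]] := O1.
  exists K, (r + `|rX| + `|rZ|) => w nw wr.
  have [nX nZ] := (ler_norm rX, ler_norm rZ).
  have [pX pZ] := (normr_ge0 rX, normr_ge0 rZ).
  have w0 := off_trace_neq0 hg nw; have w1 : 0 < cabs w by rewrite cabs_gt0.
  have := hK w ltac:(lra).
  rewrite ler_pdivlMr// mulrC -cabsM => hh; apply: le_trans hh.
  rewrite /F hX//; last by rewrite normcE lecR; lra.
  rewrite hZ//; last by rewrite normcE lecR; lra.
  have -> : (1%:M + EX w) *m asymp N n w *m Jmx N *m (asymp N n w *m (1%:M + EZ w)) =
     Jmx N + EX w *m Jmx N + Jmx N *m EZ w + EX w *m Jmx N *m EZ w.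
    rewrite mulmxA -(mulmxA (1%:M + EX w)) -(mulmxA (1%:M + EX w)) asymp_J//.
    rewrite mulmxDr mulmx1 mulmxDl mul1mx mulmxDl.
    by rewrite -!addrA; congr (_ + _); rewrite addrCA.
  rewrite !mxE le_eqVlt; apply/orP; left; apply/eqP; congr (cabs (_ * _)); ring.
Qed.

Lemma left_right_unique N (W : Cx R -> 'M[Cx R]_N) n (Y Z : Cx R -> 'M[Cx R]_(N + N)) :
  left_RHP g W n Y -> right_RHP g W n Z ->
  unique_solution_off (trace g) (left_RHP g W n) Y /\
  unique_solution_off (trace g) (right_RHP g W n) Z.
Proof.
move=> hY hZ.
have JJ : Jmx N *m (- Jmx N) = 1%:M by exact: JJ_gen.
split; split=> // X hX z nz.
  have := RHP_product hX hZ nz; have := RHP_product hY hZ nz => h1 h2.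
  (* From Y J Z (-J) = I, a one-sided inverse of a square matrix being two-sided; this supplies the
     invertibility used to cancel factors. *)
  have u : (Z z *m (- Jmx N)) *m (Y z *m Jmx N) = 1%:M.
    by apply: mulmx1C; rewrite mulmxA h1 JJ.
  have AJ : X z *m Jmx N = Y z *m Jmx N.
    by rewrite -[LHS]mulmx1 -u mulmxA (mulmxA (X z *m Jmx N)) h2 JJ mul1mx.
  by rewrite -[X z]mulmx1 -JJ mulmxA AJ -mulmxA JJ mulmx1.
have := RHP_product hY hX nz; have := RHP_product hY hZ nz => h1 h2.
have u : (Z z *m (- Jmx N)) *m (Y z *m Jmx N) = 1%:M.
  by apply: mulmx1C; rewrite mulmxA h1 JJ.
have E A : Y z *m Jmx N *m A = Jmx N -> A = Z z *m (- Jmx N) *m Jmx N.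
  by move=> hA; rewrite -[LHS]mul1mx -u -(mulmxA (Z z *m (- Jmx N))) hA.
by rewrite (E _ h2) -(E _ h1).
Qed.

End Uniqueness.

(** * Asymptotics of the weight at the base point *)

Section Arc.
Context {R : realType}.
Implicit Types (a b d e t s k L : R) (c : R -> Cx R).

(** Quantitative form of a regular arc leaving 0: bi-Lipschitz, with derivative bounded above and
    below and Lipschitz. The later integral estimates depend on the arc mainly through [k] and
    [L]. *)
Definition good_arc c k L d := [/\ 0 < k, 0 < L, 0 < d <= 1, c 0 = 0 &
  [/\ forall s t, 0 <= s <= d -> 0 <= t <= d -> k * `|s - t| <= cabs (c s - c t) <= L * `|s - t|,
      forall t, 0 <= t <= d -> k <= cabs (cderiv c t) <= L &
      forall s t, 0 <= s <= d -> 0 <= t <= d -> cabs (cderiv c s - cderiv c t) <= L * `|s - t|]].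

Lemma C2_taylor0 (f : R -> R) e : C2 f -> f 0 = 0 -> 0 < e ->
  exists2 d, 0 < d & forall t, 0 <= t < d ->
  `|f t - derive1 f 0 * t - derive1n 2 f 0 / 2 * t ^+ 2| <= e * t ^+ 2.
Proof.
move=> hf f0 e0; have [d d0 hd] := C2_taylor hf e0; exists d => // t /hd.
by rewrite f0 subr0.
Qed.

Lemma C2c_derive c : C2c c ->
  (forall t, is_derive t 1 (fun s => Re (c s)) (Re (cderiv c t))) /\
  (forall t, is_derive t 1 (fun s => Im (c s)) (Im (cderiv c t))).
Proof. by move=> [/C2_derive[h1 _ _] /C2_derive[h2 _ _]]. Qed.

Lemma good_arc_ex c : C2c c -> c 0 = 0 -> cderiv c 0 != 0 ->
  exists k L d, good_arc c k L d.
Proof.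
move=> hc c0 c1; have [M M0 [m1 m2 m3]] := C2c_bounds ler01 hc.
pose k := cabs (cderiv c 0) / 2; have k0 : 0 < k by rewrite divr_gt0// cabs_gt0.
(* On [0, d] the derivative moves by at most k/4 from its value at 0, whose modulus is 2 k; enough
   of it is left for the lower bounds by k. *)
pose d := Num.min 1 (k / (4 * (M + 1))).
have M4 : 0 < 4 * (M + 1) by lra.
have d0 : 0 < d by rewrite lt_min ltr01 divr_gt0.
have d1 : d <= 1 by rewrite ge_min lexx.
have dk : M * d <= k / 4.
  have : d <= k / (4 * (M + 1)) by rewrite ge_min lexx orbT.
  by rewrite ler_pdivlMr// => h; lra.
exists k, (M + 1), d; split=> //; [lra|by rewrite d0|split].
- move=> s t hs ht; apply/andP; split; last first.
    apply: le_trans (m2 s t _ _) _; [lra|lra|].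
    by rewrite ler_wpM2r//; lra.
  have [dr di] := C2c_derive hc.
  have low u : 0 <= u <= d -> cabs (cderiv c u - cderiv c 0) <= M * d.
    move=> hu; apply: le_trans (m3 u 0 _ _) _; [lra|lra|].
    by rewrite ler_wpM2l// subr0 ger0_norm; lra.
  have btw u : Num.min t s <= u <= Num.max t s -> 0 <= u <= d.
    by have [st|st] := leP t s; lra.
  have h1 : `|Re (c s) - s * Re (cderiv c 0) - (Re (c t) - t * Re (cderiv c 0))| <= M * d * `|s - t|.
    apply: (@derive_bound_sym R (fun u => Re (c u) - u * Re (cderiv c 0))
       (fun u => Re (cderiv c u) - Re (cderiv c 0))).
      by move=> u _; have h := dr u; apply: is_derive_eq; rewrite scaler0 add0r /GRing.scale/= mulr1.
    move=> u /btw/low; apply: le_trans; rewrite -ReN -ReD; exact: Re_le_cabs.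
  have h2 : `|Im (c s) - s * Im (cderiv c 0) - (Im (c t) - t * Im (cderiv c 0))| <= M * d * `|s - t|.
    apply: (@derive_bound_sym R (fun u => Im (c u) - u * Im (cderiv c 0))
       (fun u => Im (cderiv c u) - Im (cderiv c 0))).
      by move=> u _; have h := di u; apply: is_derive_eq; rewrite scaler0 add0r /GRing.scale/= mulr1.
    move=> u /btw/low; apply: le_trans; rewrite -ImN -ImD; exact: Im_le_cabs.
  pose D := c s - c t - ((s - t)%:C : Cx R) * cderiv c 0.
  have hD : cabs D <= 2 * (M * d) * `|s - t|.
    apply: le_trans (cabs_le_ReIm _) _; rewrite -mulrA mulr_natl mulr2n.
    have E1 : Re D = Re (c s) - s * Re (cderiv c 0) - (Re (c t) - t * Re (cderiv c 0)).
      by rewrite /D; move: (c s) (c t) (cderiv c 0) => [? ?] [? ?] [? ?] /=; ring.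
    have E2 : Im D = Im (c s) - s * Im (cderiv c 0) - (Im (c t) - t * Im (cderiv c 0)).
      by rewrite /D; move: (c s) (c t) (cderiv c 0) => [? ?] [? ?] [? ?] /=; ring.
    by rewrite E1 E2; exact: lerD.
  have := cabs_sub (((s - t)%:C : Cx R) * cderiv c 0) (- D).
  rewrite cabsN cabsM cabs_real.
  have -> : ((s - t)%:C : Cx R) * cderiv c 0 - - D = c s - c t by rewrite /D; ring.
  have e2k : cabs (cderiv c 0) = 2 * k by rewrite /k; lra.
  move: hD dk; rewrite e2k; move: (cabs D) (cabs _) (M * d) (normr_ge0 (s - t)) => x y m n0.
  move: (`|s - t|) n0 => n n0; nra.
- move=> t ht; apply/andP; split; last by apply: le_trans (m1 t _) _; lra.
  have h : cabs (cderiv c t - cderiv c 0) <= M * d.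
    apply: le_trans (m3 t 0 _ _) _; [lra|lra|].
    by rewrite ler_wpM2l// subr0 ger0_norm; lra.
  have := cabs_sub (cderiv c 0) (cderiv c t); rewrite (cabsC (cderiv c 0)).
  have -> : cabs (cderiv c 0) = 2 * k by rewrite /k; lra.
  lra.
- move=> s t hs ht; apply: le_trans (m3 s t _ _) _; [lra|lra|].
  by rewrite ler_wpM2r//; lra.
Qed.

Lemma good_arc_sub c k L d d' : 0 < d' <= d -> good_arc c k L d -> good_arc c k L d'.
Proof.
move=> hd [? ? ? ? [h1 h2 h3]]; split=> //; first lra.
by split=> [s t hs ht|t ht|s t hs ht]; [apply: h1|apply: h2|apply: h3]; lra.
Qed.

Lemma good_arc_bounds c k L d t : good_arc c k L d -> 0 <= t <= d ->
  k * t <= cabs (c t) <= L * t.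
Proof.
move=> [_ _ hd c0 [h _ _]] ht; have := h t 0 ht; rewrite c0 !subr0 ger0_norm; last lra.
by apply; lra.
Qed.

Lemma good_arc_neq0 c k L d t : good_arc c k L d -> 0 < t <= d -> c t != 0.
Proof.
move=> hc ht; rewrite -cabs_gt0; case: (hc) => k0 _ _ _ _.
have /andP[h _] := @good_arc_bounds c k L d t hc ltac:(lra).
by apply: lt_le_trans h; rewrite mulr_gt0//; lra.
Qed.

Lemma Re_quad (x v w : Cx R) t :
  Re (x - v * (t%:C : Cx R) - w * (t%:C : Cx R) ^+ 2) = Re x - Re v * t - Re w * t ^+ 2.
Proof. by case: x v w => [? ?] [? ?] [? ?]; rewrite !expr2 /=; ring. Qed.

Lemma Im_quad (x v w : Cx R) t :
  Im (x - v * (t%:C : Cx R) - w * (t%:C : Cx R) ^+ 2) = Im x - Im v * t - Im w * t ^+ 2.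
Proof. by case: x v w => [? ?] [? ?] [? ?]; rewrite !expr2 /=; ring. Qed.

(* 1/c(t) = 1/(c'(0) t) + kappa + o(1); this is where C^2 is needed. *)
Lemma inv_arc_asymp c : C2c c -> c 0 = 0 -> cderiv c 0 != 0 ->
  exists kap : Cx R, forall e, 0 < e -> exists2 d, 0 < d & forall t, 0 < t < d ->
    cabs ((c t)^-1 - (cderiv c 0 * (t%:C : Cx R))^-1 - kap) < e.
Proof.
move=> hc c0 c1; set v := cderiv c 0.
have [k [L [dl ga]]] := good_arc_ex hc c0 c1; case: (ga) => k0 L0 hdl _ _.
pose w : Cx R := (derive1n 2 (fun s => Re (c s)) 0 / 2) +i* (derive1n 2 (fun s => Im (c s)) 0 / 2).
have v0 : 0 < cabs v by rewrite cabs_gt0.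
have taylor e : 0 < e -> exists2 d, 0 < d & forall t, 0 < t < d ->
    cabs (c t - v * (t%:C : Cx R) - w * (t%:C : Cx R) ^+ 2) <= e * t ^+ 2.
  move=> e0; have e2 : 0 < e / 2 by rewrite divr_gt0.
  have [d1 d10 h1] := C2_taylor0 hc.1 (congr1 Re c0) e2.
  have [d2 d20 h2] := C2_taylor0 hc.2 (congr1 Im c0) e2.
  exists (Num.min d1 d2); first by rewrite lt_min d10.
  move=> t; rewrite lt_min => ht; have {}h1 := h1 t ltac:(lra); have {}h2 := h2 t ltac:(lra).
  apply: le_trans (cabs_le_ReIm _) _.
  apply: (@le_trans _ _ (e / 2 * t ^+ 2 + e / 2 * t ^+ 2)); last by rewrite -mulrDl -splitr.
  by rewrite Re_quad Im_quad; apply: lerD; [exact: h1|exact: h2].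
(* With w = c''(0)/2 and v = c'(0), this is the constant term in the expansion of 1/(v t + w
   t^2). *)
exists (- w / v ^+ 2) => e e0.
pose A := (cabs v * k); have A0 : 0 < A by rewrite mulr_gt0.
pose e1 := e * A / 2 ; have e10 : 0 < e1 by rewrite divr_gt0// mulr_gt0.
have [d1 d10 h1] := taylor _ e10.
(* 1/c - 1/(vt) = - (c - v t) / (c v t), and c = v t + O(t^2) *)
pose E t := c t - v * (t%:C : Cx R) - w * (t%:C : Cx R) ^+ 2.
have [d2 d20 h2] := taylor _ ltr01.
pose P := cabs w * (cabs w + 1) / (A * cabs v).
have p0 : 0 <= P by rewrite /P divr_ge0 ?mulr_ge0 ?cabs_ge0 ?addr_ge0 ?cabs_ge0// ltW.
exists (Num.min (Num.min dl d1) (Num.min d2 (e / (2 * (P + 1))))).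
  by have /andP[dl0 _] := hdl; rewrite !lt_min d10 d20 dl0 divr_gt0// mulr_gt0// ltr_wpDl.
move=> t /andP[t0]; rewrite !lt_min => /andP[/andP[t1 t2] /andP[t3 t4]].
have ct0 := @good_arc_neq0 c k L dl t ga ltac:(lra).
have /andP[ct1 ct2] := @good_arc_bounds c k L dl t ga ltac:(lra).
have tc0 : (t%:C : Cx R) != 0 by rewrite -cabs_gt0 cabs_real gtr0_norm.
have vn : v != 0 by [].
have EE : (c t)^-1 - (v * (t%:C : Cx R))^-1 - - w / v ^+ 2 =
   - E t / (c t * v * (t%:C : Cx R)) + w * (E t + w * (t%:C : Cx R) ^+ 2) / (c t * v ^+ 2).
  by rewrite /E; field; rewrite ct0 tc0 vn.
rewrite EE; apply: le_lt_trans (cabsD _ _) _.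
have b1 : cabs (- E t / (c t * v * (t%:C : Cx R))) <= e / 2.
  rewrite cabsM cabsN cabsV !cabsM cabs_real (gtr0_norm t0) ler_pdivrMr; last first.
    by rewrite !mulr_gt0// cabs_gt0.
  apply: le_trans (h1 t _) _; first lra.
  rewrite /e1 /A.
  have : k * t * (cabs v * t) <= cabs (c t) * (cabs v * t).
    by rewrite ler_wpM2r// mulr_ge0// ltW.
  have : 0 <= e / 2 by lra.
  rewrite expr2; nra.
have b2 : cabs (w * (E t + w * (t%:C : Cx R) ^+ 2) / (c t * v ^+ 2)) < e / 2.
  rewrite cabsM cabsV (cabsM w) (cabsM (c t)) cabsX.
  have hE : cabs (E t + w * (t%:C : Cx R) ^+ 2) <= (cabs w + 1) * t ^+ 2.
    apply: le_trans (cabsD _ _) _; rewrite cabsM cabsX cabs_real (gtr0_norm t0).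
    by have := h2 t ltac:(lra); rewrite mulrDl mul1r -/(E t); lra.
  rewrite ltr_pdivrMr; last by rewrite mulr_gt0 ?exprn_gt0// cabs_gt0.
  apply: (@le_lt_trans _ _ (cabs w * ((cabs w + 1) * t ^+ 2))).
    by rewrite ler_wpM2l// cabs_ge0.
  apply: (@lt_le_trans _ _ (e / 2 * (k * t * cabs v ^+ 2))); last first.
    apply: ler_wpM2l; first by rewrite divr_ge0// ltW.
    by apply: ler_wpM2r => //; rewrite exprn_ge0// cabs_ge0.
  have -> : cabs w * ((cabs w + 1) * t ^+ 2) = P * t * (k * t * cabs v ^+ 2).
    by rewrite /P /A; field; rewrite !gt_eqF.
  rewrite ltr_pM2r; last by rewrite !mulr_gt0// exprn_gt0.
  move: t4; rewrite ltr_pdivlMr; last lra.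
  lra.
lra.
Qed.

End Arc.

Section LogBranch.
Context {R : realType}.
Implicit Types (a b d e t s k L : R).

(* A continuous logarithm of a function that stays close to its initial value
   cannot jump by a multiple of 2 pi i. *)
Lemma log_path (l u : R -> Cx R) a b : a <= b -> cont_in a b l ->
  (forall t, a <= t <= b -> cexp (l t) = u t) ->
  (forall t, a <= t <= b -> cabs (u t / u a - 1) < 50^-1) ->
  forall t, a <= t <= b -> cabs (l t - l a) <= 2 * cabs (u t / u a - 1).
Proof.
move=> ab cl lu small t ht.
have D x : a <= x <= b -> cexp (l x - l a) = u x / u a.
  by move=> hx; rewrite cexpB !lu// lexx.
(* At modulus exactly 1/20 the lower bound would give |exp h - 1| >= 1/40, above the allowed 1/50.
   The intermediate value theorem then keeps the increment below 1/20 along the whole path. *)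
have no x : a <= x <= b -> cabs (l x - l a) != 20^-1.
  move=> hx; apply/eqP => h.
  have h20 : cabs (l x - l a) <= 20^-1 by rewrite h.
  have := cexp_sub1_lb h20; rewrite D// h; have := small x hx; lra.
have lt20 : cabs (l t - l a) <= 20^-1.
  rewrite leNgt; apply/negP => big.
  have cf : {within `[a, t], continuous (fun x => cabs (l x - l a))}.
    apply: within_contP => x hx e e0.
    have [d d0 hd] := cl x ltac:(lra) e e0; exists d => // y hy yx.
    have := hd y ltac:(lra) yx; apply: le_lt_trans.
    have := cabs_sub (l y - l a) (l x - l a); have := cabs_sub (l x - l a) (l y - l a).
    have E p q r : p - r - (q - r) = p - q :> Cx R by ring.
    by rewrite !E ler_norml (cabsC (l x) (l y)); lra.
  have at_ : a <= t by case/andP: ht.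
  have [|x] := IVT at_ cf (_ : Num.min _ _ <= 20^-1 <= _).
    rewrite subrr cabs0 ge_min le_max; apply/andP; split; apply/orP; last by right; exact: ltW.
    by left; rewrite invr_ge0.
  rewrite in_itv/= => hx h; have := no x ltac:(lra); rewrite h eqxx//.
by have := cexp_sub1_lb lt20; rewrite D.
Qed.

Lemma cvg_of_cauchy (f : R -> R) :
  (forall e, 0 < e -> exists2 d, 0 < d & forall s t, 0 < s < d -> 0 < t < d -> `|f s - f t| < e) ->
  exists l : R, forall e, 0 < e -> exists2 d, 0 < d & forall t, 0 < t < d -> `|f t - l| < e.
Proof.
move=> h.
have cf : cauchy (f t @[t --> (0 : R)^'+]).
  apply/cauchy_exP => e e0; have [d d0 hd] := h e e0.
  exists (f (d / 2)); rewrite /fmap/=.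
  near=> t; rewrite /ball/=; apply: hd; first by rewrite divr_gt0//= ltr_pdivrMr//; lra.
  by apply/andP; split; near: t; [exact: nbhs_right_gt|exact: nbhs_right_lt].
have /cvg_ex[l hl] : cvg (f t @[t --> (0 : R)^'+]) by apply/cauchy_cvgP.
exists l => e e0; have /cvgrPdist_lt/(_ e e0) := hl.
move=> [d /= d0 hd]; exists d => // t /andP[t0 td].
by rewrite distrC; apply: hd => //; rewrite /ball_/= sub0r normrN gtr0_norm.
Unshelve. all: by end_near. Qed.

(** [l t - ln t] is a continuous logarithm of c(t)/t, which has a nonzero limit; by [log_path] it
    satisfies the Cauchy criterion at 0. *)
Lemma log_asymp c k L dl (l : R -> Cx R) : good_arc c k L dl ->
  (forall a b, 0 < a -> b < dl -> cont_in a b l) ->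
  (forall t, 0 < t < dl -> cexp (l t) = c t) ->
  (exists v : Cx R, v != 0 /\ forall e, 0 < e -> exists2 d, 0 < d & forall t, 0 < t < d ->
     cabs (c t / (t%:C : Cx R) - v) < e) ->
  exists Lam : Cx R, forall e, 0 < e -> exists2 d, 0 < d & forall t, 0 < t < d ->
    cabs (l t - (ln t)%:C - Lam) < e.
Proof.
move=> ga cl el [v [v0 hv]].
pose u t := c t / (t%:C : Cx R); pose h t := l t - (ln t)%:C.
have t0c t : 0 < t -> (t%:C : Cx R) != 0 by move=> t0; rewrite -cabs_gt0 cabs_real gtr0_norm.
have uh t : 0 < t < dl -> cexp (h t) = u t.
  move=> ht; rewrite cexpB el//; congr (_ / _).
  have t0 : 0 < t by lra.
  by apply: eq_cx; rewrite /= ?cos0 ?sin0 ?mulr1 ?mulr0 ?lnK.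
have ch a b : 0 < a -> b < dl -> cont_in a b h.
  move=> a0 bd x hx e e0; have e2 : 0 < e / 2 by rewrite divr_gt0.
  have [d d0 hd] := cl a b a0 bd x hx _ e2.
  have x0 : 0 < x by lra.
  have /cvgrPdist_lt/(_ _ e2) := continuous_ln x0.
  move=> /nbhs_ballP[d2 /= d20 hd2]; exists (Num.min d d2); first by rewrite lt_min d0.
  move=> y hy; rewrite lt_min => /andP[/(hd y hy) y1 y2].
  have -> : h y - h x = (l y - l x) - ((ln y - ln x)%:C : Cx R).
    by apply: eq_cx; rewrite /h !ReImE/=; ring.
  apply: le_lt_trans (cabsB _ _) _; rewrite cabs_real.
  have : `|ln x - ln y| < e / 2 by apply: hd2; rewrite /ball/= distrC.
  by rewrite distrC; lra.
have vp : 0 < cabs v by rewrite cabs_gt0.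
have close e : 0 < e -> e <= 50^-1 -> exists2 d, 0 < d <= dl & forall s t, 0 < s < d -> 0 < t < d ->
    cabs (u t / u s - 1) < e.
  move=> e0 e50; have m0 : 0 < cabs v * e / 4 by rewrite divr_gt0// mulr_gt0.
  have [d d0 hd] := hv _ m0; case: (ga) => _ _ hdl _ _.
  exists (Num.min d dl); first by rewrite lt_min d0 ge_min lexx orbT; lra.
  move=> s t; rewrite !lt_min => hs ht.
  have h1 := hd s ltac:(lra); have h2 := hd t ltac:(lra); rewrite -/(u s) in h1; rewrite -/(u t) in h2.
  have us : cabs v / 2 < cabs (u s).
    have := cabs_sub v (u s); rewrite (cabsC v); have : cabs v * e <= cabs v by rewrite ler_piMr; lra.
    lra.
  have us0 : u s != 0 by rewrite -cabs_gt0; lra.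
  have -> : u t / u s - 1 = (u t - u s) / u s by rewrite mulrBl divff.
  rewrite cabsM cabsV ltr_pdivrMr ?cabs_gt0//.
  have := cabs_tri v (u t) (u s); rewrite (cabsC v); nra.
have C e : 0 < e -> exists2 d, 0 < d & forall s t, 0 < s < d -> 0 < t < d -> cabs (h s - h t) < e.
  (* 1/50 is the threshold of [log_path], and e/4 leaves room for its factor 2. *)
  move=> e0; pose e' := Num.min (50^-1) (e / 4).
  have e'0 : 0 < e' by rewrite lt_min divr_gt0//; lra.
  have [e'1 e'2] : e' <= 50^-1 /\ e' <= e / 4 by rewrite !ge_min !lexx ?orbT.
  have [d /andP[d0 ddl] hd] := close _ e'0 e'1; exists d => //.
  suff W s t : 0 < s < d -> 0 < t < d -> s <= t -> cabs (h t - h s) < e.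
    move=> s t hs ht; have [st|/ltW ts] := leP s t; last exact: W.
    by rewrite cabsC; exact: W.
  move=> hs ht st.
  have := @log_path h u s t st (ch s t ltac:(lra) ltac:(lra)) (fun x hx => uh x ltac:(lra)) _ t ltac:(lra).
  move=> P; have {}P := P (fun x hx => lt_le_trans (hd s x ltac:(lra) ltac:(lra)) e'1).
  by apply: le_lt_trans P _; have := hd s t hs ht; lra.
have [lr hlr] : exists l : R, forall e, 0 < e -> exists2 d, 0 < d & forall t, 0 < t < d -> `|Re (h t) - l| < e.
  apply: cvg_of_cauchy => e e0; have [d d0 hd] := C e e0; exists d => // s t hs ht.
  by apply: le_lt_trans (hd s t hs ht); rewrite -ReN -ReD Re_le_cabs.
have [li hli] : exists l : R, forall e, 0 < e -> exists2 d, 0 < d & forall t, 0 < t < d -> `|Im (h t) - l| < e.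
  apply: cvg_of_cauchy => e e0; have [d d0 hd] := C e e0; exists d => // s t hs ht.
  by apply: le_lt_trans (hd s t hs ht); rewrite -ImN -ImD Im_le_cabs.
exists (lr +i* li) => e e0; have e2 : 0 < e / 2 by rewrite divr_gt0.
have [d1 d10 h1] := hlr _ e2; have [d2 d20 h2] := hli _ e2.
exists (Num.min d1 d2); first by rewrite lt_min d10.
move=> t; rewrite lt_min => ht; apply: le_lt_trans (cabs_le_ReIm _) _.
have := h1 t ltac:(lra); have := h2 t ltac:(lra).
by rewrite -/(h t) !(ReD, ImD, ReN, ImN)/=; lra.
Qed.

Lemma quad_quot (x y w M t e : R) : 0 < t -> t < 1 -> `|w| <= M -> t * (4 * M) < e -> 0 <= e ->
  `|x - y * t - w / 2 * t ^+ 2| <= e / 4 * t ^+ 2 -> `|x / t - y| < e / 2.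
Proof.
move=> t0 t1 wM tM e0.
have -> : x - y * t - w / 2 * t ^+ 2 = t * (x / t - y - w / 2 * t) by field; rewrite gt_eqF.
rewrite normrM (gtr0_norm t0) expr2 mulrCA ler_pM2l// => hx.
have h1 : `|w / 2 * t| <= M / 2 * t.
  have -> : `|w / 2 * t| = `|w| / 2 * t.
    by rewrite !normrM normfV (gtr0_norm t0) (ger0_norm (ler0n _ 2)).
  by apply: ler_wpM2r (ltW t0) _ _ _; apply: ler_wpM2r wM; rewrite invr_ge0.
have := ler_normD (x / t - y - w / 2 * t) (w / 2 * t); rewrite subrK.
have : e / 4 * t <= e / 4 by rewrite ler_piMr ?divr_ge0// ltW.
move: hx h1; move: (Num.norm _) => u; move: (Num.norm (w / 2 * t)) => v; lra.
Qed.

Lemma Re_quot (x v : Cx R) t : t != 0 -> Re (x / (t%:C : Cx R) - v) = Re x / t - Re v.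
Proof. by case: x v => [? ?] [? ?] t0; rewrite !ReImE ReV ImV/=; field; rewrite ?expf_neq0. Qed.

Lemma Im_quot (x v : Cx R) t : t != 0 -> Im (x / (t%:C : Cx R) - v) = Im x / t - Im v.
Proof. by case: x v => [? ?] [? ?] t0; rewrite !ReImE ReV ImV/=; field; rewrite ?expf_neq0. Qed.

Lemma arc_quot_cvg c : C2c c -> c 0 = 0 -> forall e, 0 < e -> exists2 d, 0 < d &
  forall t, 0 < t < d -> cabs (c t / (t%:C : Cx R) - cderiv c 0) < e.
Proof.
move=> hc c0 e e0; have e3 : 0 < e / 4 by rewrite divr_gt0.
have [d1 d10 h1] := C2_taylor0 hc.1 (congr1 Re c0) e3.
have [d2 d20 h2] := C2_taylor0 hc.2 (congr1 Im c0) e3.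
pose w1 := derive1n 2 (fun s => Re (c s)) 0; pose w2 := derive1n 2 (fun s => Im (c s)) 0.
pose M := `|w1| + `|w2| + 1; have M0 : 0 < M by rewrite ltr_wpDl// addr_ge0.
exists (Num.min (Num.min d1 d2) (Num.min 1 (e / (4 * M)))).
  by rewrite !lt_min d10 d20 ltr01 divr_gt0// mulr_gt0.
move=> t; rewrite !lt_min => ht.
have t0 : 0 < t by lra.
have tn : t != 0 by rewrite gt_eqF.
have tM : t * (4 * M) < e by rewrite -ltr_pdivlMr ?mulr_gt0//; lra.
have {}h1 := h1 t ltac:(lra); have {}h2 := h2 t ltac:(lra).
have Mw1 : `|w1| <= M by rewrite /M -addrA lerDl addr_ge0.
have Mw2 : `|w2| <= M by rewrite /M addrAC lerDr addr_ge0.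
have t1 : t < 1 by case/andP: ht => _ /andP[_ /andP[]].
have q1 := quad_quot t0 t1 Mw1 tM (ltW e0) h1.
have q2 := quad_quot t0 t1 Mw2 tM (ltW e0) h2.
apply: le_lt_trans (cabs_le_ReIm _) _.
by rewrite Re_quot// Im_quot// [ltRHS]splitr; apply: ltrD.
Qed.

End LogBranch.

(** * Comparison of the sizes t^a |log t|^q exp (- b / t) at 0 *)

Section Magnitudes.
Context {R : realType}.
Implicit Types (a b d e t s x y M K : R) (n q : nat).

Lemma pow_exp_bound n e : 0 < e -> exists2 C, 0 < C & forall x, 0 <= x -> x ^+ n <= C * expR (e * x).
Proof.
(* [n.+1] instead of [n] keeps the divisions legal when n = 0, at the harmless cost of the exponent
   n/(n+1) <= 1. *)
move=> e0; pose m := n.+1; have m0 : 0 < m%:R :> R by rewrite ltr0n.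
exists ((m%:R / e) ^+ n + 1); first by rewrite ltr_wpDl// exprn_ge0// divr_ge0// ltW.
move=> x x0; have ex := expR_ge1Dx (e * x / m%:R).
have p : 0 <= e * x / m%:R by rewrite divr_ge0 ?mulr_ge0// ltW.
have h : e * x / m%:R <= expR (e * x / m%:R) by lra.
have h2 : (e * x / m%:R) ^+ n <= expR (e * x / m%:R) ^+ n by apply: lerXn2r; rewrite ?nnegrE ?expR_ge0.
have h3 : expR (e * x / m%:R) ^+ n <= expR (e * x).
  rewrite -expRM_natl ler_expR.
  have -> : n%:R * (e * x / m%:R) = (e * x) * (n%:R / m%:R) by ring.
  rewrite ler_piMr//; first by rewrite mulr_ge0// ltW.
  by rewrite ler_pdivrMr// mul1r ler_nat.
have -> : x ^+ n = (m%:R / e) ^+ n * (e * x / m%:R) ^+ n.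
  by rewrite -exprMn; congr (_ ^+ _); field; rewrite !gt_eqF.
apply: (@le_trans _ _ ((m%:R / e) ^+ n * expR (e * x))).
  by apply: ler_wpM2l; [rewrite exprn_ge0// divr_ge0// ltW|exact: le_trans h3].
by rewrite ler_wpM2r ?expR_ge0// lerDl.
Qed.

Lemma lnpow_small n a e : 0 < a -> 0 < e -> exists2 d, 0 < d <= 1 &
  forall t, 0 < t < d -> `|ln t| ^+ n * expR (a * ln t) < e.
Proof.
move=> a0 e0; have a2 : 0 < a / 2 by rewrite divr_gt0.
have [C C0 hC] := pow_exp_bound n a2.
have Ce : 0 < e / C by rewrite divr_gt0.
exists (Num.min 1 (expR (2 / a * ln (e / C)))).
  by rewrite lt_min ltr01 expR_gt0 ge_min lexx.
move=> t; rewrite lt_min => /andP[t0 /andP[t1 td]].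
have lt0 : ln t < 0 by apply: ln_lt0; rewrite t0.
rewrite ltr0_norm//.
have h := hC (- ln t) ltac:(lra).
apply: (@le_lt_trans _ _ (C * expR (a / 2 * - ln t) * expR (a * ln t))).
  by rewrite ler_wpM2r// expR_ge0.
rewrite -mulrA -expRD mulrC -ltr_pdivlMr// -[ltRHS]lnK// ltr_expR.
have -> : a / 2 * - ln t + a * ln t = a / 2 * ln t by field.
have : ln t < 2 / a * ln (e / C) by rewrite -[ltRHS]expRK ltr_ln// posrE expR_gt0.
rewrite -(ltr_pM2l a2).
have -> : a / 2 * (2 / a * ln (e / C)) = ln (e / C) by field; rewrite gt_eqF.
by [].
Qed.

Lemma inv_beats_ln b M : 0 < b -> exists2 d, 0 < d <= 1 &
  forall t, 0 < t < d -> M * `|ln t| <= b / t.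
Proof.
move=> b0; have e0 : 0 < b / (`|M| + 1) by rewrite divr_gt0// ltr_wpDl.
have [d d0 hd] := lnpow_small 1 ltr01 e0; exists d => // t ht; have := hd t ht.
have t0 : 0 < t by case/andP: ht.
rewrite expr1 mul1r lnK// ltr_pdivlMr ?ltr_wpDl// => h.
rewrite ler_pdivlMr//.
have w0 : 0 <= `|ln t| * t by rewrite mulr_ge0// ltW.
have hw : M * (`|ln t| * t) <= `|M| * (`|ln t| * t) by rewrite ler_wpM2r ?ler_norm.
rewrite -mulrA; move: h w0 hw; move: (`|ln t| * t) (`|M|) => u v; lra.
Qed.

Definition mag a b q t := expR (a * ln t - b / t) * `|ln t| ^+ q.

Lemma ln_big x : exists2 d, 0 < d <= 1 & forall t, 0 < t < d -> x <= - ln t /\ ln t < 0.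
Proof.
exists (Num.min 1 (expR (- x))); first by rewrite lt_min ltr01 expR_gt0 ge_min lexx.
move=> t; rewrite lt_min => /andP[t0 /andP[t1 td]]; split; last by apply: ln_lt0; rewrite t0.
have : ln t < - x by rewrite -[ltRHS]expRK ltr_ln// posrE expR_gt0.
lra.
Qed.

Lemma mag_gt0 a b q t : 0 < t < 1 -> 0 < mag a b q t.
Proof.
by move=> ht; rewrite mulr_gt0 ?expR_gt0// exprn_gt0// normr_gt0 lt_eqF// ln_lt0.
Qed.

(** Lexicographic order of decay at 0: the exponential decides first, then the power of t, and for
    equal ones the lower power of the logarithm is smaller. *)
Definition smaller (k k0 : R * R * nat) :=
  [|| k0.1.2 < k.1.2, (k0.1.2 == k.1.2) && (k0.1.1 < k.1.1) |
      (k0.1 == k.1) && (k.2 < k0.2)%N].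

Lemma mag_small a b q a0 b0 q0 e : smaller (a, b, q) (a0, b0, q0) -> 0 < e ->
  exists2 d, 0 < d <= 1 & forall t, 0 < t < d -> mag a b q t < e * mag a0 b0 q0 t.
Proof.
move=> /or3P[/= bb|/= /andP[/eqP be aa]|/= /andP[/eqP[ae be] qq]] e0.
- have p : 0 < b - b0 by lra.
  have [d1 d10 h1] := inv_beats_ln (`|a - a0| + 1) p.
  have [d2 d20 h2] := lnpow_small q ltr01 e0.
  have [d3 d30 h3] := ln_big 1.
  exists (Num.min (Num.min d1 d2) d3); first by rewrite !lt_min !ge_min; lra.
  move=> t; rewrite !lt_min => ht.
  have {}h1 := h1 t ltac:(lra); have {}h2 := h2 t ltac:(lra); have [h3' h4] := h3 t ltac:(lra).
  rewrite /mag.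
  have E : expR (a * ln t - b / t) <= expR (ln t) * expR (a0 * ln t - b0 / t).
    rewrite -expRD ler_expR; rewrite (ltr0_norm h4) in h1.
    have : (a - a0) * ln t <= `|a - a0| * - ln t.
      have q1 : - `|a - a0| <= a - a0 by rewrite lerNl -normrN ler_norm.
      by rewrite mulrN -mulNr; apply: ler_wnM2r q1; exact: ltW.
    have -> : b / t = (b - b0) / t + b0 / t by rewrite -mulrDl subrK.
    lra.
  apply: (@le_lt_trans _ _ (expR (ln t) * expR (a0 * ln t - b0 / t) * `|ln t| ^+ q)).
    by rewrite ler_wpM2r// exprn_ge0.
  have P : 1 <= `|ln t| ^+ q0 by rewrite exprn_ege1// (ltr0_norm h4); lra.
  rewrite mul1r in h2; have e1 := expR_gt0 (a0 * ln t - b0 / t).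
  apply: (@lt_le_trans _ _ (e * expR (a0 * ln t - b0 / t))).
    by rewrite mulrAC mulrC mulrC ltr_pM2r// mulrC.
  by rewrite ler_pM2l// ler_peMr// ltW.
- have p : 0 < a - a0 by lra.
  have [d2 d20 h2] := lnpow_small q p e0.
  have [d3 d30 h3] := ln_big 1.
  exists (Num.min d2 d3); first by rewrite !lt_min !ge_min; lra.
  move=> t; rewrite !lt_min => ht.
  have {}h2 := h2 t ltac:(lra); have [h3' h4] := h3 t ltac:(lra).
  rewrite /mag -be.
  have -> : a * ln t - b0 / t = (a - a0) * ln t + (a0 * ln t - b0 / t) by ring.
  rewrite expRD mulrAC [X in X * _]mulrC.
  have P : 1 <= `|ln t| ^+ q0 by rewrite exprn_ege1// (ltr0_norm h4); lra.
  have e1 := expR_gt0 (a0 * ln t - b0 / t).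
  apply: (@lt_le_trans _ _ (e * expR (a0 * ln t - b0 / t))); first by rewrite ltr_pM2r.
  by rewrite ler_pM2l// ler_peMr// ltW.
- have [d3 d30 h3] := ln_big (1 + 2 / e).
  exists d3 => // t ht; have [h3' h4] := h3 t ht.
  have e2 : 0 < 2 / e by rewrite divr_gt0.
  rewrite /mag -ae -be mulrCA ltr_pM2l ?expR_gt0// ltr0_norm//.
  have l0 : 0 < - ln t by lra.
  apply: (@lt_le_trans _ _ (e * (- ln t) ^+ q.+1)).
    rewrite exprS mulrA -[ltLHS]mul1r ltr_pM2r ?exprn_gt0//.
    have E2 : e * (2 / e) = 2 by field; rewrite gt_eqF.
    have : e * (2 / e) <= e * (- ln t) by rewrite ler_pM2l//; lra.
    rewrite E2; lra.
  by rewrite ler_pM2l// ler_weXn2l//; lra.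
Qed.

Lemma mag_bad a b q : b < 0 \/ (b = 0 /\ a <= -1) ->
  exists2 d, 0 < d <= 1 & forall t, 0 < t < d -> t^-1 <= mag a b q t.
Proof.
move=> hb; have [d3 d30 h3] := ln_big 1.
suff [d d0 hd] : exists2 d, 0 < d <= 1 & forall t, 0 < t < d -> - ln t <= a * ln t - b / t.
  exists (Num.min d d3); first by rewrite !lt_min !ge_min; lra.
  move=> t; rewrite !lt_min => ht; have t0 : 0 < t by lra.
  have [h3' h4] := h3 t ltac:(lra); have {}hd := hd t ltac:(lra).
  have P : 1 <= `|ln t| ^+ q by rewrite exprn_ege1// (ltr0_norm h4); lra.
  rewrite /mag; apply: (@le_trans _ _ (expR (a * ln t - b / t))); last first.
    by rewrite ler_peMr// expR_ge0.
  by rewrite -[leLHS]lnK ?posrE ?invr_gt0// lnV ?posrE// ler_expR.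
case: hb => [b0|[-> a1]]; last first.
  exists d3 => // t ht; have [h3' h4] := h3 t ht; rewrite mul0r subr0; nra.
have p : 0 < - b by lra.
have [d1 d10 h1] := inv_beats_ln (`|a| + 1) p.
exists (Num.min d1 d3); first by rewrite !lt_min !ge_min; lra.
move=> t; rewrite !lt_min => ht; have [h3' h4] := h3 t ltac:(lra).
have := h1 t ltac:(lra); rewrite (ltr0_norm h4) mulNr.
have : - (`|a| * - ln t) <= a * ln t.
  rewrite mulrN opprK ler_wnM2r ?(ltW h4)//; exact: ler_norm.
lra.
Qed.

Lemma mag_good a b q : 0 < b \/ (b = 0 /\ -1 < a) ->
  exists e, 0 < e /\ exists C d, [/\ 0 < C, 0 < d <= 1 &
    forall t, 0 < t < d -> mag a b q t <= C * (expR (e * ln t) / t)].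
Proof.
move=> hb.
have [e e0 hs] : exists2 e, 0 < e & smaller (a, b, q) (e - 1, 0, 0%N).
  case: hb => [b0|[-> a1]]; first by exists 1 => //; rewrite /smaller /= b0.
  (* Half of the margin a + 1 becomes the gain e; the other half, a - (e - 1), absorbs the power of
     the logarithm. *)
  exists ((a + 1) / 2); first lra.
  by rewrite /smaller /= ltxx eqxx /=; apply/orP; left; lra.
exists e; split=> //; exists 1.
have [d d0 hd] := mag_small hs ltr01.
exists d; split=> // t ht; have t0 : 0 < t by case/andP: ht.
apply: le_trans (ltW (hd t ht)) _; rewrite !mul1r /mag expr0 mulr1 mul0r subr0.
by rewrite mulrBl mul1r expRB lnK.
Qed.

End Magnitudes.

(** * Pure oscillations integrated against dt/t *)

Section OscillatoryIntegrals.
Context {R : realType}.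
Implicit Types (a b d e t s x y M K al om : R).
Local Notation mu := (@lebesgue_measure R).

Lemma Rint_abs_le a b (f : R -> R) M : a <= b -> mu.-integrable `[a, b] (EFin \o f) ->
  (forall t, a <= t <= b -> `|f t| <= M) ->
  `|\int[mu]_(t in `[a, b]) f t| <= M * (b - a).
Proof.
move=> ab fi hM; apply: le_trans (le_normr_Rintegral _ fi) _; first exact: measurable_itv.
rewrite -Rintegral_cst_itv//; apply: le_Rintegral => //.
- exact: integrable_norm fi.
- exact: Rint_cst.
Qed.

Definition osc al om t := al * ln t - om / t.

Lemma is_derive_osc al om t : 0 < t -> is_derive t 1 (osc al om) (al / t + om / t ^+ 2).
Proof.
move=> t0; have h1 := is_derive1_ln t0.
have h2 : is_derive t 1 (fun x : R => x^-1) (- t ^- 2).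
  have := @is_deriveV R id t 1 1; rewrite /= => h; apply: (is_derive_eq (h _ _)).
    by rewrite gt_eqF.
  by rewrite /GRing.scale/= mulr1.
rewrite /osc; apply: is_derive_eq.
by rewrite /GRing.scale/=; ring.
Qed.

(** If om = 0 the phase is linear in log t and dt/t integrates to a sine or cosine, bounded by
    2/|al| in total. Otherwise t times a sine or cosine is a primitive of om f/t up to bounded
    terms: two boundary values, an integral of F and |al| times one of f over a length at most 1
    give (3 + |al|)/|om|. *)
Lemma osc_int_bound al om : (al != 0) || (om != 0) -> exists K, forall x d, 0 < x <= d -> d <= 1 ->
  `|\int[mu]_(t in `[x, d]) (cos (osc al om t) / t)| <= K /\
  `|\int[mu]_(t in `[x, d]) (sin (osc al om t) / t)| <= K.
Proof.
move=> hne.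
have dcos t : 0 < t -> is_derive t 1 (fun t => cos (osc al om t)) (- sin (osc al om t) * (al / t + om / t ^+ 2)).
  by move=> t0; have h := is_derive_osc al om t0; exact: is_derive1_comp.
have dsin t : 0 < t -> is_derive t 1 (fun t => sin (osc al om t)) (cos (osc al om t) * (al / t + om / t ^+ 2)).
  by move=> t0; have h := is_derive_osc al om t0; exact: is_derive1_comp.
have dinv t : 0 < t -> is_derive t 1 (fun x : R => x^-1) (- t ^- 2).
  move=> t0; have := @is_deriveV R id t 1 1; rewrite /= => h; apply: (is_derive_eq (h _ _)).
    by rewrite gt_eqF.
  by rewrite /GRing.scale/= mulr1.
have cc t : 0 < t -> {for t, continuous (fun t => cos (osc al om t) / t)}.
  move=> t0; have h1 := dcos t t0; have h2 := dinv t t0.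
  by apply/differentiable_continuous/derivable1_diffP; apply: derivableM; exact: ex_derive.
have cs t : 0 < t -> {for t, continuous (fun t => sin (osc al om t) / t)}.
  move=> t0; have h1 := dsin t t0; have h2 := dinv t t0.
  by apply/differentiable_continuous/derivable1_diffP; apply: derivableM; exact: ex_derive.
have [om0|om0] := eqVneq om 0.
  have al0 : al != 0 by move: hne; rewrite om0 eqxx orbF.
  exists (2 / `|al|) => x d hx d1.
  have xd : x <= d by lra.
  have W (f F : R -> R) : (forall t, `|F t| <= 1) ->
      (forall t, 0 < t -> is_derive t 1 F (al * (f t / t))) ->
      (forall t, 0 < t -> {for t, continuous (fun t => f t / t)}) ->
      `|\int[mu]_(t in `[x, d]) (f t / t)| <= 2 / `|al|.
    move=> F1 dF cf.
    have D t : x <= t <= d -> is_derive t 1 (fun t => al^-1 * F t) (f t / t).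
      move=> ht; have t0 : 0 < t by lra.
      have h := dF t t0; apply: is_derive_eq.
      by rewrite ?scaler0 ?add0r /GRing.scale/= mulKf.
    rewrite (Rint_FTC xd D); last first.
      by apply: continuous_in_subspaceT => t; rewrite inE/= in_itv/= => ht; apply: cf; lra.
    rewrite -mulrBr normrM normfV mulrC ler_wpM2r ?invr_ge0//.
    by apply: le_trans (ler_normB _ _) _; have := F1 d; have := F1 x; lra.
  split; [apply: (W _ (fun t => sin (osc al om t)))|apply: (W _ (fun t => - cos (osc al om t)))].
  - by move=> t; exact: sin_le1.
  - move=> t t0; have h := dsin t t0; apply: is_derive_eq.
    by rewrite om0; ring.
  - exact: cc.
  - by move=> t; rewrite normrN; exact: cos_le1.
  - move=> t t0; have h := dcos t t0; apply: is_derive_eq.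
    by rewrite om0; ring.
  - exact: cs.
exists ((3 + `|al|) / `|om|) => x d hx d1.
have xd : x <= d by lra.
have o0 : 0 < `|om| by rewrite normr_gt0.
(* d(t F) = F + (al F' + om F'/t) with F a sine or cosine of the phase *)
have W (f F : R -> R) : (forall t, `|F t| <= 1) -> (forall t, `|f t| <= 1) ->
    (forall t, 0 < t -> is_derive t 1 F (f t * (al / t + om / t ^+ 2))) ->
    (forall t, 0 < t -> {for t, continuous f}) ->
    (forall t, 0 < t -> {for t, continuous (fun t => f t / t)}) ->
    `|\int[mu]_(t in `[x, d]) (f t / t)| <= (3 + `|al|) / `|om|.
  move=> F1 f1 dF cf cft.
  have cF t : 0 < t -> {for t, continuous F}.
    move=> t0; have h := dF t t0.
    by apply/differentiable_continuous/derivable1_diffP; exact: ex_derive.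
  have D t : x <= t <= d -> is_derive t 1 (fun t => t * F t) (F t + al * f t + om * (f t / t)).
    move=> ht; have t0 : 0 < t by lra.
    have h := dF t t0; apply: is_derive_eq.
    by rewrite /GRing.scale/= mulr1; field; rewrite gt_eqF.
  have sub (h : R -> R) : (forall t, 0 < t -> {for t, continuous h}) ->
      mu.-integrable `[x, d] (EFin \o h).
    move=> ch; apply: Rint_continuous; apply: continuous_in_subspaceT => t.
    by rewrite inE/= in_itv/= => ht; apply: ch; lra.
  have iF := sub _ cF; have if_ := sub _ cf; have ift := sub _ cft.
  have := Rint_FTC xd D _.
  have cD : {within `[x, d], continuous (fun t => F t + al * f t + om * (f t / t))}.
    apply: continuous_in_subspaceT => t; rewrite inE/= in_itv/= => ht.
    have t0 : 0 < t by lra.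
    have c1 := continuousM (@cst_continuous _ _ al t) (cf t t0).
    have c2 := continuousM (@cst_continuous _ _ om t) (cft t t0).
    exact: continuousD (continuousD (cF t t0) c1) c2.
  move=> /(_ cD).
  have mi : measurable (`[x, d]%classic : set (measurableTypeR R)) by exact: measurable_itv.
  have i2 := Rint_Z mi al if_; have i3 := Rint_Z mi om ift; have i12 := Rint_D mi iF i2.
  rewrite (RintegralD mi i12 i3) (RintegralD mi iF i2).
  rewrite !RintegralZl//.
  set I1 := Rintegral _ _ _; set I2 := Rintegral _ _ _; set I3 := Rintegral _ _ _ => E.
  have b1 : `|I1| <= 1 * (d - x) by apply: Rint_abs_le.
  have b2 : `|I2| <= 1 * (d - x) by apply: Rint_abs_le.
  have E3 : om * I3 = d * F d - x * F x - I1 - al * I2 by lra.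
  rewrite ler_pdivlMr// mulrC -normrM E3.
  apply: le_trans (ler_normB _ _) _; rewrite normrM.
  have q1 : `|al| * `|I2| <= `|al| * 1 by rewrite ler_wpM2l//; lra.
  have q2 : `|d * F d| <= 1.
    by rewrite normrM -[leRHS]mulr1 ler_pM// ger0_norm; lra.
  have q3 : `|x * F x| <= 1.
    by rewrite normrM -[leRHS]mulr1 ler_pM// ger0_norm; lra.
  have q4 : `|d * F d - x * F x - I1| <= `|d * F d| + `|x * F x| + `|I1|.
    by apply: le_trans (ler_normB _ _) _; rewrite lerD2r; exact: ler_normB.
  lra.
have ccos t : 0 < t -> {for t, continuous (fun t => cos (osc al om t))}.
  move=> t0; have h := dcos t t0.
  by apply/differentiable_continuous/derivable1_diffP; exact: ex_derive.
have csin t : 0 < t -> {for t, continuous (fun t => sin (osc al om t))}.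
  move=> t0; have h := dsin t t0.
  by apply/differentiable_continuous/derivable1_diffP; exact: ex_derive.
split; [apply: (W _ (fun t => sin (osc al om t)))|apply: (W _ (fun t => - cos (osc al om t)))].
- by move=> t; exact: sin_le1.
- by move=> t; exact: cos_le1.
- exact: ccos.
- exact: cc.
- by move=> t; rewrite normrN; exact: cos_le1.
- by move=> t; exact: sin_le1.
- by move=> t t0; have h := dcos t t0; apply: is_derive_eq; ring.
- exact: csin.
- exact: cs.
Qed.

End OscillatoryIntegrals.

(** * Integrability of a sum bounds the exponents of its dominant term *)

Section Dominance.
Context {R : realType}.
Implicit Types (a b d e t s x y M K : R) (z : Cx R) (f h : R -> Cx R).
Local Notation mu := (@lebesgue_measure R).
Local Notation triple := (Cx R * Cx R * nat)%type.

Definition lim0 f z := forall e, 0 < e -> exists2 d, 0 < d & forall t, 0 < t < d -> cabs (f t - z) < e.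

Lemma lim0P f z : lim0 f z <-> f t @[t --> (0 : R)^'+] --> z.
Proof.
split=> [h|/cx_cvgP h e e0].
  apply/cx_cvgP => e e0; have [d d0 hd] := h e e0; near=> t; apply: hd.
  by apply/andP; split; near: t; [exact: nbhs_right_gt|exact: nbhs_right_lt].
have [d /= d0 hd] := h e e0; exists d => // t /andP[t0 td].
by apply: hd => //; rewrite /ball_/= sub0r normrN gtr0_norm.
Unshelve. all: by end_near. Qed.

Lemma lim0_cst z : lim0 (fun=> z) z.
Proof. by move=> e e0; exists 1 => // t _; rewrite subrr cabs0. Qed.

Lemma lim0D f h z v : lim0 f z -> lim0 h v -> lim0 (fun t => f t + h t) (z + v).
Proof. by move=> /lim0P p /lim0P q; apply/lim0P; exact: cvgD p q. Qed.

Lemma lim0M f h z v : lim0 f z -> lim0 h v -> lim0 (fun t => f t * h t) (z * v).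
Proof. by move=> /lim0P p /lim0P q; apply/lim0P; exact: cvgM p q. Qed.

Lemma lim0X f z n : lim0 f z -> lim0 (fun t => f t ^+ n) (z ^+ n).
Proof.
move=> h; elim: n => [|n ih]; first exact: lim0_cst.
have := lim0M h ih; rewrite -exprS => hh e e0; have [d d0 hd] := hh e e0.
by exists d => // t /hd; rewrite -exprS.
Qed.

Lemma lim0_comp (k : Cx R -> Cx R) f z : {for z, continuous k} -> lim0 f z ->
  lim0 (fun t => k (f t)) (k z).
Proof.
move=> /cx_contP hk hf e e0; have [d d0 hd] := hk e e0.
by have [d1 d10 h1] := hf d d0; exists d1 => // t /h1; exact: hd.
Qed.

Lemma lim0_ext f h z d : 0 < d -> (forall t, 0 < t < d -> f t = h t) -> lim0 f z -> lim0 h z.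
Proof.
move=> d0 fh hf e e0; have [d1 d10 h1] := hf e e0.
exists (Num.min d d1); first by rewrite lt_min d0.
move=> t; rewrite lt_min => /andP[t0 /andP[td td1]].
by rewrite -fh ?t0//; apply: h1; rewrite t0.
Qed.

Lemma lim0_sum (I : eqType) (r : seq I) (f : I -> R -> Cx R) (z : I -> Cx R) :
  (forall i, i \in r -> lim0 (f i) (z i)) ->
  lim0 (fun t => \sum_(i <- r) f i t) (\sum_(i <- r) z i).
Proof.
elim: r => [_|i r ih hf].
  by rewrite big_nil => e e0; exists 1 => // t _; rewrite big_nil subrr cabs0.
rewrite big_cons; apply: (lim0_ext ltr01) (lim0D (hf i (mem_head _ _)) (ih _)).
  by move=> t _; rewrite big_cons.
by move=> j jr; apply: hf; rewrite inE jr orbT.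
Qed.

Lemma lim0_mag f M : (exists2 d, 0 < d & forall t, 0 < t < d -> cabs (f t) <= M) ->
  lim0 (fun t => f t / ((ln t)%:C : Cx R)) 0.
Proof.
move=> [d d0 hd] e e0; pose N := `|M| / e + 1.
have [d1 d10 h1] := @ln_big R N.
exists (Num.min d d1); first by rewrite lt_min d0; case/andP: d10.
move=> t; rewrite lt_min => /andP[t0 /andP[td td1]].
have [h2 h3] := h1 t ltac:(by rewrite t0); have h4 := hd t ltac:(by rewrite t0).
rewrite subr0 cabsM cabsV cabs_real (ltr0_norm h3).
have N0 : 0 <= `|M| / e by rewrite divr_ge0// ltW.
rewrite ltr_pdivrMr; last by rewrite /N in h2; lra.
apply: le_lt_trans h4 _; apply: le_lt_trans (ler_norm M) _.
by rewrite mulrC -ltr_pdivrMr//; apply: lt_le_trans h2; rewrite /N ltrDl.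
Qed.

(** The model t^p (log t)^q exp (- nu / t) on the half-line. An arc with c'(0) = c1 turns exp (-
    lambda / z) into the case nu = lambda / c1. *)
Definition unit_term (nu p : Cx R) (q : nat) t : Cx R :=
  cexp (p * ((ln t)%:C : Cx R)) * ((ln t)%:C : Cx R) ^+ q * cexp (- (nu / (t%:C : Cx R))).

Lemma Re_divr (z : Cx R) t : t != 0 -> Re (z / (t%:C : Cx R)) = Re z / t /\ Im (z / (t%:C : Cx R)) = Im z / t.
Proof.
move=> t0; have := Re_quot z 0 t0; have := Im_quot z 0 t0.
by rewrite !subr0 => -> ->.
Qed.

Lemma cabs_unit_term nu p q t : 0 < t -> cabs (unit_term nu p q t) = mag (Re p) (Re nu) q t.
Proof.
move=> t0; have tn : t != 0 by rewrite gt_eqF.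
rewrite /unit_term /mag !cabsM cabsX !cabs_cexp cabs_real mulrAC -expRD; congr (expR _ * _).
rewrite ReN (Re_divr nu tn).1 ReM/= mulr0 subr0//.
Qed.

Lemma unit_term_neq0 nu p q t : 0 < t < 1 -> unit_term nu p q t != 0.
Proof.
move=> ht; rewrite -cabs_gt0 cabs_unit_term; first exact: mag_gt0.
by case/andP: ht.
Qed.

Lemma unit_term_ratio nu p q nu0 p0 q0 t : 0 < t < 1 -> Re nu = Re nu0 -> Re p = Re p0 -> q = q0 ->
  unit_term nu p q t / unit_term nu0 p0 q0 t =
  cos (osc (Im p - Im p0) (Im nu - Im nu0) t) +i* sin (osc (Im p - Im p0) (Im nu - Im nu0) t).
Proof.
move=> ht en ep ->; have t0 : t != 0 by rewrite gt_eqF//; case/andP: ht.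
have := unit_term_neq0 nu0 p0 q0 ht; rewrite /unit_term.
set l : Cx R := (ln t)%:C; rewrite !mulf_eq0 !negb_or => /andP[/andP[h1 h2] h3].
have -> : cexp (p * l) * l ^+ q0 * cexp (- (nu / (t%:C : Cx R))) /
   (cexp (p0 * l) * l ^+ q0 * cexp (- (nu0 / (t%:C : Cx R)))) =
   cexp (p * l) / cexp (p0 * l) * (cexp (- (nu / (t%:C : Cx R))) / cexp (- (nu0 / (t%:C : Cx R)))).
  by field; rewrite h1 h2 h3.
rewrite -!cexpB -cexpD.
have -> : p * l - p0 * l + (- (nu / (t%:C : Cx R)) - - (nu0 / (t%:C : Cx R))) =
   0 +i* osc (Im p - Im p0) (Im nu - Im nu0) t.
  have [r1 i1] := Re_divr nu t0; have [r2 i2] := Re_divr nu0 t0.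
  apply: eq_cx; rewrite !(ReD, ImD, ReN, ImN) ?r1 ?i1 ?r2 ?i2 !(ReM, ImM)/= ?en ?ep /osc; ring.
by apply: eq_cx; rewrite /= expR0 mul1r.
Qed.

Lemma real_inv_continuous t : t != 0 -> {for t, continuous (fun x : R => x^-1)}.
Proof.
move=> t0; have h : is_derive t 1 (fun x : R => x^-1) (- t ^- 2).
  by have := @is_deriveV R id t 1 1; rewrite /= => h; apply: (is_derive_eq (h _ _)); rewrite // /GRing.scale/= mulr1.
by apply/differentiable_continuous/derivable1_diffP; exact: ex_derive.
Qed.

(** The real part of the sum of (x_i + i y_i) exp (i phase_i) / t. *)
Definition osc_sum (I : Type) (r : seq I) (x y al om : I -> R) t : R :=
  \sum_(i <- r) (x i * (cos (osc (al i) (om i) t) / t) - y i * (sin (osc (al i) (om i) t) / t)).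

Lemma osc_sum_bound (I : Type) (r : seq I) (x y al om : I -> R) :
  (forall i, (al i != 0) || (om i != 0)) ->
  exists K, forall a d, 0 < a <= d -> d <= 1 ->
  mu.-integrable `[a, d] (EFin \o (osc_sum r x y al om)) /\
  `|\int[mu]_(t in `[a, d]) (osc_sum r x y al om t)| <= K.
Proof.
move=> hne; elim: r => [|i r [K ih]].
  have -> : osc_sum [::] x y al om = fun=> 0.
    by apply/funext => t; rewrite /osc_sum big_nil.
  exists 0 => a d /andP[a0 ad] d1; split; first exact: Rint_cst.
  by rewrite Rintegral_cst_itv// mul0r normr0.
have -> : osc_sum (i :: r) x y al om = fun t => (x i * (cos (osc (al i) (om i) t) / t) -
    y i * (sin (osc (al i) (om i) t) / t)) + osc_sum r x y al om t.
  by apply/funext => t; rewrite /osc_sum big_cons.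
have [K1 hK1] := osc_int_bound (hne i).
exists (`|x i| * K1 + `|y i| * K1 + K) => a d had d1; have [ir hr] := ih a d had d1.
have [c1 s1] := hK1 a d had d1.
have ad : a <= d by case/andP: had.
have ci (f : R -> R) : (forall t, 0 < t -> {for t, continuous f}) -> mu.-integrable `[a, d] (EFin \o f).
  move=> cf; apply: Rint_continuous; apply: continuous_in_subspaceT => t.
  by rewrite inE/= in_itv/= => ht; apply: cf; lra.
have cosc t : 0 < t -> {for t, continuous (osc (al i) (om i))}.
  move=> t0; have h := is_derive_osc (al i) (om i) t0.
  by apply/differentiable_continuous/derivable1_diffP; exact: ex_derive.
have cinv t : 0 < t -> {for t, continuous (fun x : R => x^-1)}.
  by move=> t0; apply: real_inv_continuous; rewrite gt_eqF.
have ic : mu.-integrable `[a, d] (EFin \o (fun t => cos (osc (al i) (om i) t) / t)).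
  apply: ci => t t0; apply: continuousM; last exact: cinv.
  by apply: continuous_comp; [exact: cosc|exact: continuous_cos].
have is_ : mu.-integrable `[a, d] (EFin \o (fun t => sin (osc (al i) (om i) t) / t)).
  apply: ci => t t0; apply: continuousM; last exact: cinv.
  by apply: continuous_comp; [exact: cosc|exact: continuous_sin].
have mi : measurable (`[a, d]%classic : set (measurableTypeR R)) by exact: measurable_itv.
have j1 := Rint_Z mi (x i) ic; have j2 := Rint_Z mi (y i) is_; have j3 := Rint_B mi j1 j2.
have j4 := Rint_D mi j3 ir; split; first exact: j4.
rewrite (RintegralD mi j3 ir) (RintegralB mi j1 j2) !RintegralZl//.
apply: le_trans (ler_normD _ _) _; apply: lerD => //.
by apply: le_trans (ler_normB _ _) _; rewrite !normrM; apply: lerD; apply: ler_wpM2l.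
Qed.

Lemma log_divergence d M K c : 0 < c -> 0 < d <= 1 ->
  ~ (forall a, 0 < a <= d -> c * (2^-1 * (ln d - ln a) - K) <= M).
Proof.
move=> c0 /andP[d0 d1] h.
(* At a = d exp (- N) the left side is at least |M| + c, more than [M]. *)
pose N := 2 * (`|M| / c + `|K| + 1); pose a := d * expR (- N).
have Mc : 0 <= `|M| / c by rewrite divr_ge0// ltW.
have N0 : 0 <= N by rewrite /N mulr_ge0// !addr_ge0.
have a0 : 0 < a by rewrite mulr_gt0// expR_gt0.
have ad : a <= d by rewrite ler_piMr ?(ltW d0)// -expR0 ler_expR oppr_le0.
have := h a; rewrite a0 ad => /(_ isT).
rewrite /a lnM ?posrE ?expR_gt0// expRK.
have -> : 2^-1 * (ln d - (ln d + - N)) - K = `|M| / c + 1 + (`|K| - K) by rewrite /N; field; rewrite gt_eqF.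
rewrite !mulrDr mulrCA mulfV ?gt_eqF// !mulr1.
have : 0 <= c * `|K| + c * - K by rewrite -mulrDr mulr_ge0 ?(ltW c0)// subr_ge0 ler_norm.
have := ler_norm M; lra.
Qed.

(** Integrated over [a, d], the bound has the integral of [B] above, and below it c times (ln d - ln
    a)/2 - K, which diverges as a tends to 0. *)
Lemma log_lower_bound_contra c d dl K (B S : R -> R) : 0 < c -> 0 < d <= 1 -> d <= dl ->
  mu.-integrable `[0, dl] (EFin \o B) -> (forall t, 0 <= B t) ->
  (forall a, 0 < a <= d -> mu.-integrable `[a, d] (EFin \o S) /\
     `|\int[mu]_(t in `[a, d]) (S t)| <= K) ->
  ~ (forall t, 0 < t <= d -> c * (2^-1 * t^-1 + S t) <= B t).
Proof.
move=> c0 dd ddl iB B0 hS point; have dp : 0 < d by case/andP: dd.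
apply: (@log_divergence d (\int[mu]_(t in `[0, dl]) B t) K c c0 dd) => a had.
have [iS bS] := hS a had.
have [a0 ad] : 0 < a /\ a <= d by split; case/andP: had.
have pos t : t \in `[a, d]%classic -> 0 < t.
  by rewrite inE/= in_itv/= => /andP[h _]; exact: lt_le_trans h.
have mi : measurable (`[a, d]%classic : set (measurableTypeR R)) by exact: measurable_itv.
have cinv : {within `[a, d], continuous (fun t : R => t^-1)}.
  apply: continuous_in_subspaceT => t /pos ht.
  by apply: real_inv_continuous; rewrite gt_eqF.
have iinv := Rint_continuous cinv.
have Einv : \int[mu]_(t in `[a, d]) t^-1 = ln d - ln a.
  apply: (Rint_FTC ad _ cinv) => t ht; apply: is_derive1_ln.
  by case/andP: ht => h _; exact: lt_le_trans h.
have j1 := Rint_Z mi 2^-1 iinv; have j2 := Rint_D mi j1 iS; have j3 := Rint_Z mi c j2.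
have a0' := ltW a0.
have i1 : mu.-integrable `[0, d] (EFin \o B).
  by apply: integrableS iB => //; apply: subset_itvScc; rewrite bnd_simp.
have iB' : mu.-integrable `[a, d] (EFin \o B).
  by apply: integrableS i1 => //; apply: subset_itvScc; rewrite bnd_simp.
apply: (@le_trans _ _ (\int[mu]_(t in `[a, d]) B t)); last first.
  rewrite (@Rint_split R 0 dl d B (ltW dp) ddl iB) (@Rint_split R 0 d a B a0' ad i1).
  have n1 : 0 <= \int[mu]_(t in `[0, a]) B t by apply: Rintegral_ge0.
  have n2 : 0 <= \int[mu]_(t in `[d, dl]) B t by apply: Rintegral_ge0.
  by rewrite -addrA addrCA lerDl addr_ge0.
apply: (@le_trans _ _ (\int[mu]_(t in `[a, d]) (c * (2^-1 * t^-1 + S t)))).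
  rewrite (RintegralZl _ _ j2)// (RintegralD mi j1 iS) (RintegralZl _ _ iinv)// Einv ler_pM2l// lerD2l.
  by move: bS; rewrite ler_norml => /andP[].
apply: (le_Rintegral mi j3 iB') => t /= ht; apply: point.
by move: ht; rewrite in_itv/= => /andP[h ->]; rewrite (lt_le_trans a0 h).
Qed.

Lemma seq_min (T : eqType) (le : rel T) (r : seq T) : (forall i j : T, le i j || le j i) ->
  (forall j i k : T, le i j -> le j k -> le i k) -> r != [::] ->
  exists2 i, i \in r & forall j, j \in r -> le i j.
Proof.
move=> tot tr; elim: r => [//|x r ih _].
have lexx (z : T) : le z z by have := tot z z; rewrite orbb.
have [->|rn] := eqVneq r [::].
  by exists x; rewrite ?inE// => y; rewrite inE => /eqP ->.
have [m mr hm] := ih rn; case/orP: (tot x m) => h.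
  exists x; first by rewrite inE eqxx.
  by move=> y; rewrite inE => /orP[/eqP ->//|/hm]; exact: tr.
exists m; first by rewrite inE mr orbT.
by move=> y; rewrite inE => /orP[/eqP ->//|/hm].
Qed.

(** A triple is (lambda, p, q), while a key lists the power first and the exponential rate second,
    as [mag] does. The rate is divided by c1 because c(t) behaves like c1 t. *)
Definition key (c1 : Cx R) (tau : triple) : R * R * nat := (Re tau.1.2, Re (tau.1.1 / c1), tau.2).

Definition key_le (k0 k : R * R * nat) := smaller k k0 || (k0 == k).

Lemma key_le_total k k0 : key_le k k0 || key_le k0 k.
Proof.
case: k => [[a b] q]; case: k0 => [[a0 b0] q0]; rewrite /key_le /smaller /=.
case: (ltrgtP b b0) => [//|_|->]; rewrite ?orbT//.
case: (ltrgtP a a0) => [||->]; rewrite ?orbT ?ltxx//= ?eqxx ?orbT//.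
by case: (ltngtP q q0) => [||->]; rewrite ?eqxx ?ltxx ?orbT//=.
Qed.

Lemma smaller_trans (k1 k0 k2 : R * R * nat) : smaller k1 k0 -> smaller k2 k1 -> smaller k2 k0.
Proof.
case: k0 k1 k2 => [[a0 b0] q0] [[a1 b1] q1] [[a2 b2] q2]; rewrite /smaller /=.
move=> /or3P[h1|/andP[/eqP e1 h1]|/andP[/eqP[e1 e1'] h1]];
move=> /or3P[h2|/andP[/eqP e2 h2]|/andP[/eqP[e2 e2'] h2]].
- by rewrite (lt_trans h1 h2).
- by rewrite -e2 h1.
- by rewrite -e2' h1.
- by rewrite e1 h2.
- by rewrite e1 e2 eqxx (lt_trans h1 h2) orbT.
- by rewrite e1 -e2 e2' eqxx h1 orbT.
- by rewrite e1' h2.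
- by rewrite e1' e2 eqxx e1 h2 orbT.
- by apply/or3P; apply: Or33; rewrite e1 e1' e2 e2' eqxx (ltn_trans h2 h1).
Qed.

Lemma key_le_trans k1 k0 k2 : key_le k0 k1 -> key_le k1 k2 -> key_le k0 k2.
Proof.
move=> /orP[h1|/eqP ->//] /orP[h2|/eqP <-]; rewrite /key_le ?h1//.
by rewrite (smaller_trans h1 h2).
Qed.

(* The exponents for which t^a |log t|^q exp (- b / t) is integrable at 0. *)
Definition good_exps a b := 0 < b \/ (b = 0 /\ -1 < a).

Lemma good_key_le k0 k : key_le k0 k -> good_exps k0.1.1 k0.1.2 -> good_exps k.1.1 k.1.2.
Proof.
case: k0 k => [[a0 b0] q0] [[a b] q]; rewrite /key_le /smaller /good_exps /=.
move=> /orP[/or3P[h|/andP[/eqP e h]|/andP[/eqP[e1 e2] _]]|/eqP[e1 e2 _]] g.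
- by left; case: g => [|[]]; lra.
- by case: g => [|[]] g; [left; lra|move=> g'; right; split; lra].
- by rewrite -e1 -e2.
- by rewrite -e1 -e2.
Qed.

Lemma bad_exps a b : ~ good_exps a b -> b < 0 \/ (b = 0 /\ a <= -1).
Proof.
move=> h; have [b0|b0|b0] := ltrgtP b 0; [by left|by exfalso; apply: h; left|right; split=> //].
by rewrite leNgt; apply/negP => a1; apply: h; right.
Qed.

Lemma dominant_good (c1 : Cx R) (T : seq triple) (f : triple -> R -> Cx R) (A : triple -> Cx R)
    (B : R -> R) dl :
  uniq T -> c1 != 0 -> (forall tau, tau \in T -> A tau != 0) ->
  (forall tau, tau \in T -> lim0 (fun t => f tau t / unit_term (tau.1.1 / c1) tau.1.2 tau.2 t) (A tau)) ->
  0 < dl <= 1 -> mu.-integrable `[0, dl] (EFin \o B) -> (forall t, 0 <= B t) ->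
  (forall t, 0 < t < dl -> cabs (\sum_(tau <- T) f tau t) <= B t) ->
  forall tau, tau \in T -> good_exps (Re tau.1.2) (Re (tau.1.1 / c1)).
Proof.
move=> uT c10 A0 hA hdl iB B0 hB.
have [->//|Tn] := eqVneq T [::].
have [t0 t0T hmin] := @seq_min _ (fun i j : triple => key_le (key c1 i) (key c1 j)) T
  (fun i j => key_le_total _ _) (fun j i k => @key_le_trans (key c1 j) (key c1 i) (key c1 k)) Tn.
suff g0 : good_exps (Re t0.1.2) (Re (t0.1.1 / c1)).
  by move=> tau /hmin /good_key_le; exact.
apply: contrapT => /bad_exps hbad.
pose U (tau : triple) t := unit_term (tau.1.1 / c1) tau.1.2 tau.2 t.
pose cis (al om t : R) : Cx R := cos (osc al om t) +i* sin (osc al om t).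
(* every other term is a constant times a unimodular oscillation, up to o(1),
   relative to the dominant one *)
have other tau : exists p : Cx R * (R * R), tau \in T -> tau != t0 ->
    ((p.2.1 != 0) || (p.2.2 != 0)) /\
    lim0 (fun t => f tau t / U t0 t - p.1 * cis p.2.1 p.2.2 t) 0.
  have [tT|nT] := boolP (tau \in T); last by exists (0, (0, 0)).
  have [->|tn] := eqVneq tau t0; first by exists (0, (0, 0)).
  have L := hA _ tT.
  have R0 (w : R -> Cx R) (a : Cx R) : (forall t, 0 < t < 1 -> U tau t / U t0 t = w t) ->
      (forall t, 0 < t < 1 -> cabs (w t) <= 1) ->
      lim0 (fun t => f tau t / U t0 t - A tau * w t) 0.
    move=> hw w1 e e0; have [d d0 hd] := L e e0; exists (Num.min 1 d); first by rewrite lt_min ltr01.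
    move=> t; rewrite lt_min => /andP[tt0 /andP[t1 td]].
    have ht : 0 < t < 1 by rewrite tt0.
    have Ut : U tau t != 0 by exact: unit_term_neq0.
    have -> : f tau t / U t0 t - A tau * w t - 0 = (f tau t / U tau t - A tau) * w t.
      by rewrite -hw//; field; rewrite Ut unit_term_neq0.
    rewrite cabsM; apply: le_lt_trans (hd t _); last by rewrite tt0.
    by rewrite ler_piMr ?cabs_ge0// w1.
  have := hmin _ tT => /orP[sm|/eqP ek].
    (* A term that decays faster gets the coefficient 0; its frequency (1, 0) only has to be
       nonzero. *)
    exists (0, (1, 0)) => _ _; split; first by rewrite oner_neq0.
    have Z : lim0 (fun t => U tau t / U t0 t) 0.
      move=> e e0; have [d /andP[d0 d1] hd] := mag_small sm e0; exists d => // t ht.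
      have tt0 : 0 < t by case/andP: ht.
      rewrite subr0 cabsM cabsV !cabs_unit_term// ltr_pdivrMr ?hd// mag_gt0// tt0/=.
      by apply: lt_le_trans d1; case/andP: ht.
    have := lim0M L Z; rewrite mulr0; apply: lim0_ext (ltr01) _ => t ht.
    by rewrite mul0r subr0 mulrA divfK// unit_term_neq0.
  case: ek => ep en eq.
  exists (A tau, (Im tau.1.2 - Im t0.1.2, Im (tau.1.1 / c1) - Im (t0.1.1 / c1))) => _ _; split=> /=.
    (* Equal keys and vanishing frequency differences would make the two triples equal, since lambda
       is recovered from lambda / c1. *)
    rewrite -negb_and; apply/negP => /andP[/eqP h1 /eqP h2]; move/eqP: tn; apply.
    have e1 : tau.1.2 = t0.1.2 by apply: eq_cx => //; lra.
    have e2 : tau.1.1 / c1 = t0.1.1 / c1 by apply: eq_cx => //; lra.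
    have e3 : tau.1.1 = t0.1.1 by rewrite -[LHS](divfK c10) e2 divfK.
    by case: tau t0 e1 e3 eq {tT t0T hmin hbad U L R0 ep en h1 h2 e2} => [[? ?] ?] [[? ?] ?] /= -> -> ->.
  apply: R0 => // t ht; first exact: unit_term_ratio.
  rewrite cabsE/= cos2Dsin2 sqrtr1//.
have [P hP] := choice other.
pose r := rem t0 T.
have rT tau : tau \in r -> tau \in T /\ tau != t0.
  by rewrite mem_rem_uniq// inE => /andP[].
have A00 := A0 _ t0T; have Ap : 0 < cabs (A t0) by rewrite cabs_gt0.
have LS : lim0 (fun t => (\sum_(tau <- T) f tau t) / U t0 t - \sum_(tau <- r) (P tau).1 * cis (P tau).2.1 (P tau).2.2 t)
    (A t0).
  have L1 : lim0 (fun t => \sum_(tau <- r) (f tau t / U t0 t - (P tau).1 * cis (P tau).2.1 (P tau).2.2 t)) (\sum_(tau <- r) 0).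
    by apply: lim0_sum => tau /rT[h1 h2]; have [] := hP tau h1 h2.
  have := lim0D (hA _ t0T) L1; rewrite big1_eq addr0; apply: lim0_ext ltr01 _ => t _.
  rewrite (perm_big _ (perm_to_rem t0T)) big_cons/= mulrDl -addrA; congr (_ + _).
  by rewrite -/r mulr_suml -sumrB.
have A2 : 0 < cabs (A t0) / 2 by rewrite divr_gt0.
have [d1 d10 h1] := LS _ A2.
have [d2 d20 h2] := @mag_bad R _ _ t0.2 hbad.
(* replace irrelevant phases so that the nondegeneracy holds for every index *)
pose al tau := if (tau \in T) && (tau != t0) then (P tau).2.1 else 1.
pose om tau := if (tau \in T) && (tau != t0) then (P tau).2.2 else 0.
have hne tau : (al tau != 0) || (om tau != 0).
  by rewrite /al /om; case: ifP => [/andP[p q]|_]; [have [] := hP tau p q|rewrite oner_neq0].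
pose x tau := Re ((P tau).1 / A t0); pose y tau := Im ((P tau).1 / A t0).
have [K hK] := osc_sum_bound r x y hne.
pose S t := osc_sum r x y al om t.
pose d := Num.min (Num.min d1 d2) dl / 2.
have d0 : 0 < d /\ d < d1 /\ d < d2 /\ d < dl /\ d <= 1.
  have m0 : 0 < Num.min (Num.min d1 d2) dl.
    by rewrite !lt_min d10; case/andP: hdl => -> _; case/andP: d20 => ->.
  have : Num.min (Num.min d1 d2) dl <= d1 /\ Num.min (Num.min d1 d2) dl <= d2 /\ Num.min (Num.min d1 d2) dl <= dl.
    by rewrite !ge_min !lexx ?orbT.
  by rewrite /d; case/andP: hdl => _; move: (Num.min _ dl) m0 => m; lra.
have [dp [dd1 [dd2 [ddl d1']]]] := d0.
have point t : 0 < t <= d -> cabs (A t0) * (2^-1 * t^-1 + S t) <= B t.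
  move=> /andP[tt0 td].
  apply: le_trans (hB t _); last by rewrite tt0 (le_lt_trans td).
  have ht1 : 0 < t < 1 by rewrite tt0 (lt_le_trans (le_lt_trans td ddl))//; case/andP: hdl.
  have Un := unit_term_neq0 (t0.1.1 / c1) t0.1.2 t0.2 ht1; rewrite -/(U t0 t) in Un.
  have {}h1 := h1 t ltac:(by rewrite tt0 (le_lt_trans td)).
  have {}h2 := h2 t ltac:(by rewrite tt0 (le_lt_trans td)).
  set F := \sum_(tau <- T) f tau t in h1 *.
  set G := \sum_(tau <- r) (P tau).1 * cis (P tau).2.1 (P tau).2.2 t in h1.
  have EG : Re (G / A t0) = t * S t.
    rewrite /G /S /osc_sum mulr_suml Re_sum mulr_sumr big_seq [in RHS]big_seq; apply: eq_bigr => tau /rT[p q].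
    rewrite mulrAC ReM /al /om p q /x /y /cis /=; field; rewrite gt_eqF//.
  (* F/U differs from A (1 + G/A) by at most |A|/2, and the modulus of 1 + G/A is at least its real
     part 1 + t S. The half lost to the error is the 1/2 in front of 1/t. *)
  have E : cabs (F / U t0 t) >= cabs (A t0) * (2^-1 + t * S t).
    have -> : F / U t0 t = A t0 * (1 + G / A t0) + (F / U t0 t - G - A t0) by field; rewrite A00 Un.
    have := cabs_sub (A t0 * (1 + G / A t0)) (- (F / U t0 t - G - A t0)).
    rewrite opprK cabsN cabsM.
    have : 1 + t * S t <= cabs (1 + G / A t0).
      by rewrite -EG -[X in X + _]/(Re (1 : Cx R)) -ReD (le_trans (ler_norm _))// Re_le_cabs.
    move=> h3; have : cabs (A t0) * (1 + t * S t) <= cabs (A t0) * cabs (1 + G / A t0) by rewrite ler_pM2l.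
    move: h1; move: (cabs (F / U t0 t - G - A t0)) (cabs (1 + G / A t0)) (cabs _) => u v w.
    by move: (t * S t) (cabs (A t0)) => m n; lra.
  have -> : F = U t0 t * (F / U t0 t) by rewrite mulrC divfK.
  rewrite cabsM; apply: (@le_trans _ _ (t^-1 * cabs (F / U t0 t))); last first.
    by rewrite ler_wpM2r ?cabs_ge0// /U cabs_unit_term.
  have -> : cabs (A t0) * (2^-1 * t^-1 + S t) = t^-1 * (cabs (A t0) * (2^-1 + t * S t)).
    by field; rewrite gt_eqF.
  by rewrite ler_wpM2l// invr_ge0 ltW.
have dd : 0 < d <= 1 by rewrite dp.
by apply: (log_lower_bound_contra Ap dd (ltW ddl) iB B0 _ point) => a had; exact: hK a d had d1'.
Qed.

End Dominance.

(** * Merging equal terms and factoring out zeros of the coefficients *)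

Section NormalForm.
Context {R : realType}.
Implicit Types (z l : Cx R) (f h psi : Cx R -> Cx R).
Local Notation triple := (Cx R * Cx R * nat)%type.
Implicit Types (tau sig : triple) (T : seq triple) (Phi : triple -> Cx R -> Cx R).

(** The value [l] of the logarithm is a separate argument, so that identities between sums need only
    [cexp l = z] and no branch. *)
Definition bterm tau z l := cexp (tau.1.2 * l) * l ^+ tau.2 * cexp (- (tau.1.1 / z)).

Definition normal_sum T Phi z l := \sum_(tau <- T) Phi tau z * bterm tau z l.

Definition normalized T Phi :=
  uniq T /\ forall tau, tau \in T -> entire (Phi tau) /\ Phi tau 0 != 0.

Lemma entireD f h : entire f -> entire h -> entire (fun z => f z + h z).
Proof. by move=> hf hh z; exact: derivableD (hf z) (hh z). Qed.

Lemma normal_cons T Phi (q : Cx R -> Cx R) sig : normalized T Phi -> entire q -> q 0 != 0 ->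
  sig \notin T -> exists T' Phi', normalized T' Phi' /\
    forall z l, normal_sum T' Phi' z l = normal_sum T Phi z l + q z * bterm sig z l.
Proof.
move=> [uT hT] eq q0 nT; exists (sig :: T), (fun tau => if tau == sig then q else Phi tau).
have ne tau : tau \in T -> tau == sig = false.
  by move=> tT; apply/negbTE; apply: contraNneq nT => <-.
split; first split; first by rewrite /= nT uT.
  move=> tau; rewrite inE => /orP[/eqP ->|tT]; first by rewrite eqxx; exact: (conj eq q0).
  by rewrite (ne _ tT); exact: hT.
move=> z l; rewrite /normal_sum big_cons eqxx addrC; congr (_ + _).
by rewrite big_seq [RHS]big_seq; apply: eq_bigr => tau /ne ->.
Qed.

(** The zero of psi at the origin is moved into the exponent: z^k q changes p into p + k. If the new
    triple is already present, the two coefficients add up and may vanish at 0 again; the old term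
    is then removed and the sum inserted into a list shorter by one, whence the induction on the
    size. *)
Lemma normal_insert n T Phi : size T = n -> normalized T Phi ->
  forall psi sig, entire psi -> exists T' Phi', normalized T' Phi' /\
    forall z l, cexp l = z -> normal_sum T' Phi' z l = normal_sum T Phi z l + psi z * bterm sig z l.
Proof.
elim: n T Phi => [|n ih] T Phi sT nT psi sig epsi;
  (case: (entire_order epsi) => [psi0|[k [q [eq q0 psiE]]]];
  first by exists T, Phi; split=> // z l _; rewrite psi0 mul0r addr0);
  pose sig' : triple := (sig.1.1, sig.1.2 + k%:R, sig.2);
  (have bE z l : cexp l = z -> psi z * bterm sig z l = q z * bterm sig' z l by
  move=> lz; rewrite psiE /bterm /sig' /= mulrDl cexpD cexpMn lz; ring);
  (have [sT'|/(normal_cons nT eq q0)[T' [Phi' [h1 h2]]]] := boolP (sig' \in T);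
   last by exists T', Phi'; split=> // z l lz; rewrite h2 bE).
  by move: sT' sT; case: (T).
have sr : size (rem sig' T) = n by rewrite size_rem// sT.
case: (nT) => uT hT.
have nr : normalized (rem sig' T) Phi.
  by split; [exact: rem_uniq|move=> tau /mem_rem /hT].
have [T' [Phi' [h1 h2]]] := ih _ _ sr nr _ sig' (entireD eq (hT _ sT').1).
exists T', Phi'; split=> // z l lz; rewrite h2// bE// /normal_sum (perm_big _ (perm_to_rem sT')) big_cons/=.
by rewrite mulrDl; ring.
Qed.

End NormalForm.

Section ArcTerms.
Context {R : realType}.
Implicit Types (t d : R) (c l : R -> Cx R).
Local Notation mu := (@lebesgue_measure R).
Local Notation triple := (Cx R * Cx R * nat)%type.
Implicit Types (tau : triple) (T : seq triple) (Phi : triple -> Cx R -> Cx R).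

Lemma lim0_bounded (f : R -> Cx R) (z : Cx R) : lim0 f z ->
  exists M, exists2 d, 0 < d & forall t, 0 < t < d -> cabs (f t) <= M.
Proof.
move=> h; have [d d0 hd] := h 1 ltr01; exists (1 + cabs z), d => // t ht.
have := hd t ht; have := cabsD (f t - z) z; rewrite subrK; lra.
Qed.

Lemma bterm_ratio (tau : triple) (c1 u l : Cx R) t : 0 < t < 1 -> c1 != 0 ->
  bterm tau u l / unit_term (tau.1.1 / c1) tau.1.2 tau.2 t =
  cexp (tau.1.2 * (l - ((ln t)%:C : Cx R))) * (1 + (l - ((ln t)%:C : Cx R)) / ((ln t)%:C : Cx R)) ^+ tau.2 *
  cexp (- (tau.1.1 * (u^-1 - (c1 * (t%:C : Cx R))^-1))).
Proof.
move=> ht c10; have /andP[t0 t1] := ht.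
have ln0 : ((ln t)%:C : Cx R) != 0 by rewrite -cabs_gt0 cabs_real normr_gt0 lt_eqF// ln_lt0.
have tc : (t%:C : Cx R) != 0 by rewrite -cabs_gt0 cabs_real normr_gt0 gt_eqF.
have -> : 1 + (l - ((ln t)%:C : Cx R)) / ((ln t)%:C : Cx R) = l / ((ln t)%:C : Cx R).
  by rewrite mulrBl mulfV// addrC subrK.
have -> : - (tau.1.1 * (u^-1 - (c1 * (t%:C : Cx R))^-1)) = - (tau.1.1 / u) - - (tau.1.1 / c1 / (t%:C : Cx R)).
  by rewrite invfM; ring.
rewrite mulrBr !cexpB expr_div_n /bterm /unit_term !invfM; ring.
Qed.

(** Compared with the model, the logarithm is shifted by Lam and 1/c by kap, each contributing a
    nonzero constant factor, while (l / ln t)^q tends to 1. *)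
Lemma bterm_asymp (tau : triple) c l (c1 Lam kap : Cx R) : c1 != 0 ->
  lim0 (fun t => l t - ((ln t)%:C : Cx R)) Lam ->
  lim0 (fun t => (c t)^-1 - (c1 * (t%:C : Cx R))^-1) kap ->
  lim0 (fun t => bterm tau (c t) (l t) / unit_term (tau.1.1 / c1) tau.1.2 tau.2 t)
    (cexp (tau.1.2 * Lam) * cexp (- (tau.1.1 * kap))).
Proof.
move=> c10 hl hc.
have sc (k : Cx R) (f : R -> Cx R) (z : Cx R) : lim0 f z -> lim0 (fun t => cexp (k * f t)) (cexp (k * z)).
  by move=> hf; apply: lim0_comp; [exact: cexp_continuous|exact: lim0M (lim0_cst k) hf].
have [M hM] := lim0_bounded hl.
have h1 := lim0X tau.2 (lim0D (lim0_cst 1) (lim0_mag hM)).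
rewrite addr0 expr1n in h1.
have h2 := lim0M (lim0M (sc tau.1.2 _ _ hl) h1) (sc (- tau.1.1) _ _ hc).
rewrite mulr1 mulNr in h2; apply: lim0_ext ltr01 _ h2 => t ht.
by rewrite bterm_ratio// mulNr.
Qed.

(** Normalisation enters twice: distinct triples give distinct oscillations, and coefficients
    nonzero at 0 give nonzero limits [A]. *)
Lemma arc_terms_good c k L dl l T Phi (B : R -> R) d :
  C2c c -> good_arc c k L dl -> cderiv c 0 != 0 ->
  (forall a b, 0 < a -> b < dl -> cont_in a b l) ->
  (forall t, 0 < t < dl -> cexp (l t) = c t) ->
  normalized T Phi -> 0 < d <= 1 ->
  mu.-integrable `[0, d] (EFin \o B) -> (forall t, 0 <= B t) ->
  (forall t, 0 < t < d -> cabs (normal_sum T Phi (c t) (l t)) <= B t) ->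
  forall tau, tau \in T -> good_exps (Re tau.1.2) (Re (tau.1.1 / cderiv c 0)).
Proof.
move=> hc ga c1 cl el [uT hT] hd iB B0 hB.
have [_ _ hdl c0 _] := ga.
have [kap hkap] := inv_arc_asymp hc c0 c1.
have [Lam hLam] : exists Lam : Cx R, lim0 (fun t => l t - ((ln t)%:C : Cx R)) Lam.
  by apply: log_asymp ga cl el _; exists (cderiv c 0); split=> //; exact: arc_quot_cvg.
pose A tau := Phi tau 0 * (cexp (tau.1.2 * Lam) * cexp (- (tau.1.1 * kap))).
have lc : lim0 c 0.
  have [k0 L0 _ _ _] := ga.
  move=> e e0; exists (Num.min dl (e / L)); first by rewrite lt_min divr_gt0//; case/andP: hdl => ->.
  move=> t; rewrite lt_min => /andP[t0 /andP[td te]]; rewrite subr0.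
  have ht : 0 <= t <= dl by rewrite (ltW t0) (ltW td).
  have /andP[_ h] := good_arc_bounds ga ht.
  by apply: le_lt_trans h _; rewrite mulrC -ltr_pdivlMr.
apply: (@dominant_good R (cderiv c 0) T (fun tau t => Phi tau (c t) * bterm tau (c t) (l t)) A B d) => //.
- by move=> tau /hT[_ h]; rewrite !mulf_neq0// cexp_neq0.
- move=> tau /hT[h _].
  have h0 : {for 0, continuous (Phi tau)} by apply: entire_continuous; exact: h.
  have h1 := lim0_comp h0 lc.
  have := lim0M h1 (bterm_asymp tau c1 hLam hkap); apply: lim0_ext ltr01 _ => t _.
  by rewrite mulrA.
Qed.

End ArcTerms.

(** * Increments on the scale t^2 *)

Section NiceFunctions.
Context {R : realType}.
Implicit Types (s t d e a b K k L : R) (f h u c l : R -> Cx R).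
Local Notation triple := (Cx R * Cx R * nat)%type.

(* One large parameter K controls the range 1/K, the relative closeness
   t^2/K, the constants K and the exponent 1/K of the estimates below. *)
Definition close_pair K s t :=
  [/\ 0 < s, s * K < 1, 0 < t, t * K < 1 & K * `|s - t| <= t ^+ 2].

(** The phase 1/t has derivative of size t^-2, so t^2 is the unit in which its increments are
    measured. *)
Definition rdist s t := `|s - t| / t ^+ 2.

Definition rel_lip f := exists2 K, 2 <= K & forall s t, close_pair K s t ->
  cabs (f s - f t) <= K * rdist s t.

(** Relative increments are stable under products and powers. They come from [rel_lip], the absolute
    kind, by taking exponentials. *)
Definition mult_lip f := exists2 K, 2 <= K & forall s t, close_pair K s t ->
  cabs (f s - f t) <= K * (cabs (f t) * rdist s t).

Definition small_bound K t := expR (ln t / K) / t.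

(** With e = 1/K: |f| = O(t^(e-1)) and |f(s) - f(t)| = O(t^(e-3) |s - t|) for close parameters. Both
    are linear conditions, hence the sums below. *)
Definition nice f := exists2 K, 2 <= K &
  (forall t, 0 < t -> t * K < 1 -> cabs (f t) <= K * small_bound K t) /\
  (forall s t, close_pair K s t -> cabs (f s - f t) <= K * (small_bound K t * rdist s t)).

Lemma close_pair_le K K' s t : K <= K' -> close_pair K' s t -> close_pair K s t.
Proof.
move=> KK [s0 sK t0 tK h]; split=> //.
- by apply: le_lt_trans sK; rewrite ler_pM2l.
- by apply: le_lt_trans tK; rewrite ler_pM2l.
- by apply: le_trans h; rewrite ler_wpM2r.
Qed.

Lemma rdist_ge0 s t : 0 <= rdist s t.
Proof. by rewrite /rdist divr_ge0// sqr_ge0. Qed.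

Lemma lt1_of K t : 2 <= K -> 0 < t -> t * K < 1 -> t < 2^-1.
Proof.
move=> K2 t0 h; have : t * 2 <= t * K by rewrite ler_pM2l.
lra.
Qed.

Lemma rdist_le K s t : 2 <= K -> close_pair K s t -> K * rdist s t <= 1.
Proof.
move=> K2 [s0 sK t0 tK h]; rewrite /rdist mulrA ler_pdivrMr ?exprn_gt0// mul1r//.
Qed.

Lemma close_half K s t : 2 <= K -> close_pair K s t -> t / 2 <= s.
Proof.
move=> K2 [s0 sK t0 tK h]; have t1 := lt1_of K2 t0 tK.
have h1 : 2 * `|s - t| <= t ^+ 2 by apply: le_trans h; rewrite ler_wpM2r.
have h2 : t ^+ 2 <= t by rewrite expr2 ler_piMr ?ltW//; lra.
have := ler_norm (t - s); rewrite distrC; lra.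
Qed.

Lemma rdist_lin s t : 0 < t -> t <= 1 -> `|s - t| / t <= rdist s t.
Proof.
move=> t0 t1; rewrite /rdist ler_wpM2l// lef_pV2 ?posrE ?exprn_gt0//.
by rewrite expr2 ler_piMr// ltW.
Qed.

Lemma rdist_abs s t : 0 < t -> t <= 1 -> `|s - t| <= rdist s t.
Proof.
move=> t0 t1; apply: le_trans (rdist_lin s t0 t1).
by rewrite ler_pdivlMr// ler_piMr.
Qed.

Lemma small_bound_ge0 K t : 0 < t -> 0 <= small_bound K t.
Proof. by move=> t0; rewrite /small_bound divr_ge0 ?expR_ge0 ?ltW. Qed.

Lemma small_bound_le K K' t : 0 < K -> K <= K' -> 0 < t -> t <= 1 -> small_bound K t <= small_bound K' t.
Proof.
move=> K0 KK t0 t1; apply: ler_wpM2r; first by rewrite invr_ge0 ltW.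
rewrite ler_expR; apply: ler_wnM2l; first exact: ln_le0.
by rewrite lef_pV2 ?posrE//; exact: lt_le_trans KK.
Qed.

Lemma mult_lip_M f h : mult_lip f -> mult_lip h -> mult_lip (fun t => f t * h t).
Proof.
move=> [K1 k1 h1] [K2 k2 h2]; exists (K1 * 2 + K2); first lra.
move=> s t st.
have KK1 : K1 <= K1 * 2 + K2 by lra.
have KK2 : K2 <= K1 * 2 + K2 by lra.
have c1 := close_pair_le KK1 st; have c2 := close_pair_le KK2 st.
have {h1} := h1 s t c1; have {h2} := h2 s t c2; have := rdist_le k2 c2; have := rdist_ge0 s t.
have := cabsD ((f s - f t) * h s) (f t * (h s - h t)).
have -> : (f s - f t) * h s + f t * (h s - h t) = f s * h s - f t * h t by ring.
have := cabsD (h s - h t) (h t); rewrite subrK !cabsM.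
have := cabs_ge0 (f t); have := cabs_ge0 (h t); have := cabs_ge0 (f s - f t); have := cabs_ge0 (h s).
move: (cabs (f t)) (cabs (h t)) (cabs (f s - f t)) (cabs (h s)) (cabs (h s - h t)) (rdist s t).
move=> F H D Hs E r p1 p2 p3 p4 q1 q2 q3 q4 q5 q6.
have a1 : Hs <= 2 * H.
  have : H * (K2 * r) <= H * 1 by apply: ler_wpM2l.
  rewrite mulrCA; lra.
have a2 : D * Hs <= K1 * (F * r) * (2 * H).
  by apply: ler_pM.
have a3 : F * E <= F * (K2 * (H * r)) by apply: ler_wpM2l.
by apply: le_trans q2 _; apply: le_trans (lerD a2 a3) _; rewrite le_eqVlt; apply/orP; left; apply/eqP; ring.
Qed.

Lemma mult_lip_X f n : mult_lip f -> mult_lip (fun t => f t ^+ n).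
Proof.
move=> hf; elim: n => [|n ih].
  exists 2 => // s t _; rewrite !expr0 subrr cabs0 mulr_ge0// mulr_ge0 ?cabs_ge0//; exact: rdist_ge0.
have [K k hK] := mult_lip_M hf ih; exists K => // s t st.
by rewrite !exprS; exact: hK.
Qed.

(** The constant 20 K forces the increment h of u below 1/20, where |exp h - 1| <= 2 |h|. *)
Lemma mult_lip_cexp u : rel_lip u -> mult_lip (fun t => cexp (u t)).
Proof.
move=> [K k hK]; exists (20 * K); first lra.
move=> s t st; have KK : K <= 20 * K by lra.
have c1 := close_pair_le KK st.
have K2 : 2 <= 20 * K by lra.
have r1 := rdist_le K2 st; have h1 := hK s t c1.
have h2 : cabs (u s - u t) <= 20^-1 by lra.
have -> : cexp (u s) - cexp (u t) = cexp (u t) * (cexp (u s - u t) - 1).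
  by rewrite mulrBr -cexpD (addrC (u t)) subrK mulr1.
rewrite cabsM mulrCA ler_wpM2l ?cabs_ge0//.
have := cexp_sub1_ub h2; have := rdist_ge0 s t; nra.
Qed.

Lemma rel_lip_Z (z : Cx R) u : rel_lip u -> rel_lip (fun t => z * u t).
Proof.
move=> [K k hK]; exists ((cabs z + 1) * K); first by have := cabs_ge0 z; nra.
move=> s t st; have KK : K <= (cabs z + 1) * K by have := cabs_ge0 z; nra.
have := hK s t (close_pair_le KK st); rewrite -mulrBr cabsM => h.
have z0 := cabs_ge0 z; have r0 := rdist_ge0 s t.
apply: le_trans (ler_wpM2l z0 h) _; rewrite mulrA ler_wpM2r//.
by rewrite ler_wpM2r ?lerDl//; lra.
Qed.

(** Meant for the logarithm, whose modulus is large near 0, so that absolute increments are also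
    relative ones. *)
Lemma rel_lip_of_ge1 f : rel_lip f -> (exists2 d, 0 < d & forall t, 0 < t < d -> 1 <= cabs (f t)) ->
  mult_lip f.
Proof.
move=> [K k hK] [d d0 hd]; exists (K + d^-1); first by have := invr_ge0 d; lra.
have di : 0 < d^-1 by rewrite invr_gt0.
move=> s t st; have KK : K <= K + d^-1 by lra.
have {hK} h := hK s t (close_pair_le KK st).
case: st => s0 _ t0 tK _; have td : t < d.
  have : t * d^-1 < 1 by nra.
  by rewrite ltr_pdivrMr ?mul1r.
have f1 := hd t ltac:(by rewrite t0); have r0 := rdist_ge0 s t.
apply: le_trans h _; apply: ler_pM => //; first lra.
by rewrite ler_peMl.
Qed.

Lemma niceD f h : nice f -> nice h -> nice (fun t => f t + h t).
Proof.
move=> [K1 k1 [f1 f2]] [K2 k2 [h1 h2]]; exists (K1 + K2); first lra.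
have KK1 : K1 <= K1 + K2 by lra.
have KK2 : K2 <= K1 + K2 by lra.
split=> [t t0 tK|s t st].
  have t1 : t <= 1 by have := @lt1_of (K1 + K2) t ltac:(lra) t0 tK; lra.
  have e1 : t * K1 < 1 by apply: le_lt_trans tK; rewrite ler_pM2l.
  have e2 : t * K2 < 1 by apply: le_lt_trans tK; rewrite ler_pM2l.
  have b1 : small_bound K1 t <= small_bound (K1 + K2) t by apply: small_bound_le => //; lra.
  have b2 : small_bound K2 t <= small_bound (K1 + K2) t by apply: small_bound_le => //; lra.
  apply: le_trans (cabsD _ _) _; rewrite mulrDl; apply: lerD.
    by apply: le_trans (f1 t t0 e1) _; rewrite ler_wpM2l//; lra.
  by apply: le_trans (h1 t t0 e2) _; rewrite ler_wpM2l//; lra.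
have [_ _ t0 tK _] := st.
have t1 : t <= 1 by have := @lt1_of (K1 + K2) t ltac:(lra) t0 tK; lra.
have b1 : small_bound K1 t <= small_bound (K1 + K2) t by apply: small_bound_le => //; lra.
have b2 : small_bound K2 t <= small_bound (K1 + K2) t by apply: small_bound_le => //; lra.
have -> : f s + h s - (f t + h t) = (f s - f t) + (h s - h t) by ring.
apply: le_trans (cabsD _ _) _; rewrite mulrDl; have r0 := rdist_ge0 s t; apply: lerD.
  by apply: le_trans (f2 s t (close_pair_le KK1 st)) _; apply: ler_wpM2l; [lra|exact: ler_wpM2r].
by apply: le_trans (h2 s t (close_pair_le KK2 st)) _; apply: ler_wpM2l; [lra|exact: ler_wpM2r].
Qed.

Lemma nice0 : nice (fun=> 0).
Proof.
exists 2 => //; split=> [t t0 _|s t [_ _ t0 _ _]].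
  by rewrite cabs0 mulr_ge0// small_bound_ge0.
by rewrite subrr cabs0 mulr_ge0// mulr_ge0 ?small_bound_ge0 ?rdist_ge0.
Qed.

Lemma nice_sum (I : eqType) (r : seq I) (f : I -> R -> Cx R) :
  (forall i, i \in r -> nice (f i)) -> nice (fun t => \sum_(i <- r) f i t).
Proof.
have ext f1 f2 : f1 =1 f2 -> nice f1 -> nice f2 by move=> /funext ->.
elim: r => [_|i r ih h]; first by apply: ext nice0 => t; rewrite big_nil.
apply: ext (niceD (h i (mem_head _ _)) (ih _)) => [t|j jr]; first by rewrite big_cons.
by apply: h; rewrite inE jr orbT.
Qed.

Lemma nice_M M d f h : 0 < d -> (forall t, 0 < t < d -> cabs (h t) <= M) ->
  (forall s t, 0 < s < d -> 0 < t < d -> cabs (h s - h t) <= M * `|s - t|) ->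
  nice f -> nice (fun t => h t * f t).
Proof.
move=> d0 hM hL [K k [f1 f2]].
have M0 : 0 <= M by apply: le_trans (cabs_ge0 _) (hM (d / 2) _); lra.
have di : 0 < d^-1 by rewrite invr_gt0.
pose K' := 2 * (M + 1) * K + d^-1.
have MK : 0 <= M * K by apply: mulr_ge0 => //; lra.
have KK : K <= K' by rewrite /K'; nra.
have K2 : 2 <= K' by lra.
have K0 : 0 < K by lra.
have aux t : 0 < t -> t * K' < 1 -> [/\ 0 < t < d, t * K < 1, t <= 1 & small_bound K t <= small_bound K' t].
  move=> t0 tK; have t1 := lt1_of K2 t0 tK; split.
  - have : t * d^-1 < 1.
      by apply: le_lt_trans tK; rewrite ler_pM2l// /K' lerDr mulrDr mulrDl; nra.
    by rewrite ltr_pdivrMr// mul1r t0.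
  - by apply: le_lt_trans tK; rewrite ler_pM2l.
  - lra.
  - apply: small_bound_le => //; lra.
exists K' => //; split=> [t t0 tK|s t st].
  have [td tK' t1 b] := aux t t0 tK.
  rewrite cabsM; apply: le_trans (ler_pM (cabs_ge0 _) (cabs_ge0 _) (hM t td) (f1 t t0 tK')) _.
  have s0 := small_bound_ge0 K t0.
  by rewrite mulrA; apply: ler_pM => //; rewrite /K'; lra.
have [s0 sK t0 tK _] := st.
have [sd sK' s1 _] := aux s s0 sK; have [td tK' t1 b] := aux t t0 tK.
have c1 := close_pair_le KK st.
have -> : h s * f s - h t * f t = h s * (f s - f t) + (h s - h t) * f t by ring.
apply: le_trans (cabsD _ _) _; rewrite !cabsM.
have b0 := small_bound_ge0 K t0; have r0 := rdist_ge0 s t.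
have e1 := ler_pM (cabs_ge0 _) (cabs_ge0 _) (hM s sd) (f2 s t c1).
have e2 : cabs (h s - h t) <= M * rdist s t.
  by apply: le_trans (hL s t sd td) _; rewrite ler_wpM2l// rdist_abs.
have e3 := ler_pM (cabs_ge0 _) (cabs_ge0 _) e2 (f1 t t0 tK').
apply: le_trans (lerD e1 e3) _.
have -> : M * (K * (small_bound K t * rdist s t)) + M * rdist s t * (K * small_bound K t) =
  2 * (M * K) * (small_bound K t * rdist s t) by ring.
apply: ler_pM; [lra|exact: mulr_ge0|rewrite /K'; lra|by rewrite ler_wpM2r].
Qed.

Lemma nice_mult f a b q : mult_lip f -> good_exps a b ->
  (exists M, exists2 d, 0 < d & forall t, 0 < t < d -> cabs (f t) <= M * mag a b q t) -> nice f.
Proof.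
move=> [K k hK] /(mag_good q)[e [e0 [C [d1 [C0 hd1 hC]]]]] [M [d d0 hM]].
have M0 : 0 <= `|M| * C by apply: mulr_ge0 => //; exact: ltW.
have i0 : 0 < d^-1 by rewrite invr_gt0.
have i1 : 0 < d1^-1 by rewrite invr_gt0; case/andP: hd1.
have i2 : 0 < e^-1 by rewrite invr_gt0.
(* The inverses of [d] and [d1] put t into both ranges; that of [e] makes 1/K' at most e, and t^e at
   most t^(1/K') for t < 1. *)
pose K' := K * (`|M| * C + 1) + d^-1 + d1^-1 + e^-1.
have KMC : 0 <= K * (`|M| * C) by apply: mulr_ge0 => //; lra.
have KK : K <= K' by rewrite /K'; lra.
have KMC' : `|M| * C <= K * (`|M| * C) by rewrite ler_peMl//; lra.
have K2 : 2 <= K' by lra.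
have bnd t : 0 < t -> t * K' < 1 -> cabs (f t) <= `|M| * C * small_bound K' t.
  move=> t0 tK; have t1 := lt1_of K2 t0 tK.
  have lt_of x : 0 < x -> x^-1 <= K' -> t < x.
    move=> x0 xK; have : t * x^-1 < 1 by apply: le_lt_trans tK; rewrite ler_pM2l.
    by rewrite ltr_pdivrMr// mul1r.
  have td : t < d by apply: lt_of => //; rewrite /K'; lra.
  have td1 : t < d1 by apply: lt_of; [case/andP: hd1|rewrite /K'; lra].
  apply: le_trans (hM t _) _; first by rewrite t0.
  have m0 : 0 <= mag a b q t by rewrite /mag mulr_ge0 ?expR_ge0// exprn_ge0.
  apply: (@le_trans _ _ (`|M| * mag a b q t)); first by rewrite ler_wpM2r// ler_norm.
  rewrite -mulrA ler_wpM2l//; apply: le_trans (hC t _) _; first by rewrite t0.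
  apply: ler_wpM2l; first exact: ltW.
  apply: ler_wpM2r; first by rewrite invr_ge0 ltW.
  rewrite ler_expR mulrC; apply: ler_wnM2l; first by apply: ln_le0; lra.
  by rewrite -(invrK e) lef_pV2 ?posrE//; [rewrite /K'; lra|lra].
exists K' => //; split=> [t t0 tK|s t st].
  apply: le_trans (bnd t t0 tK) _; rewrite ler_wpM2r ?small_bound_ge0//.
  by rewrite /K'; lra.
have [_ _ t0 tK _] := st.
apply: le_trans (hK s t (close_pair_le KK st)) _.
have r0 := rdist_ge0 s t; rewrite mulrA [leRHS]mulrA; apply: ler_wpM2r => //.
have Kp : 0 <= K by lra.
apply: le_trans (ler_wpM2l Kp (bnd t t0 tK)) _.
rewrite mulrA; apply: ler_wpM2r; first exact: small_bound_ge0.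
by rewrite /K'; lra.
Qed.

End NiceFunctions.

Section NiceArc.
Context {R : realType}.
Implicit Types (s t d e a b K M : R).
Local Notation triple := (Cx R * Cx R * nat)%type.
Context (c l : R -> Cx R) (k L dl : R).
Hypotheses (hc : C2c c) (ga : good_arc c k L dl).
Hypothesis cl : forall a b, 0 < a -> b < dl -> cont_in a b l.
Hypothesis el : forall t, 0 < t < dl -> cexp (l t) = c t.

Lemma arc_consts : [/\ 0 < k, 0 < L, 0 < dl & dl <= 1].
Proof. by case: ga => ? ? /andP[? ?] _ _. Qed.

Lemma arc_lt K t : dl^-1 <= K -> 0 < t -> t * K < 1 -> t < dl.
Proof.
have [_ _ d0 _] := arc_consts; move=> dK t0 tK.
have : t * dl^-1 < 1 by apply: le_lt_trans tK; rewrite ler_pM2l.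
by rewrite ltr_pdivrMr// mul1r.
Qed.

(** The increment of 1/c is that of c over c(s) c(t), at least k^2 t^2 / 2 in modulus because s >=
    t/2. *)
Lemma rel_lip_inv : rel_lip (fun t => (c t)^-1).
Proof.
have [k0 L0 d0 d1] := arc_consts; have i0 : 0 < dl^-1 by rewrite invr_gt0.
have p0 : 0 < L / (k * k) by apply: divr_gt0 => //; exact: mulr_gt0.
exists (2 * (L / (k * k)) + 2 + dl^-1); first lra.
set K := _ + dl^-1; have K2 : 2 <= K by rewrite /K; lra.
have Kd : dl^-1 <= K by rewrite /K; lra.
move=> s t st; have hs := close_half K2 st; case: (st) => s0 sK t0 tK _.
have sd := arc_lt Kd s0 sK; have td := arc_lt Kd t0 tK.
have cs := good_arc_neq0 ga (t := s) ltac:(by rewrite s0 ltW).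
have ct := good_arc_neq0 ga (t := t) ltac:(by rewrite t0 ltW).
have -> : (c s)^-1 - (c t)^-1 = - ((c s - c t) / (c s * c t)) by field; rewrite cs ct.
rewrite cabsN cabsM cabsV cabsM.
have /andP[b1 _] := good_arc_bounds ga (t := s) ltac:(by rewrite !ltW).
have /andP[b2 _] := good_arc_bounds ga (t := t) ltac:(by rewrite !ltW).
have b3 : cabs (c s - c t) <= L * `|s - t|.
  by case: ga => _ _ _ _ [h _ _]; have /andP[] := h s t ltac:(by rewrite !ltW) ltac:(by rewrite !ltW).
have b4 : (cabs (c s) * cabs (c t))^-1 <= (k * (t / 2) * (k * t))^-1.
  have e1 : 0 < k * (t / 2) * (k * t) by rewrite !mulr_gt0.
  have e2 : k * (t / 2) * (k * t) <= cabs (c s) * cabs (c t).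
    apply: ler_pM => //; [by rewrite ltW// !mulr_gt0|by rewrite ltW// mulr_gt0|].
    by apply: le_trans b1; rewrite ler_pM2l.
  by rewrite lef_pV2 ?posrE//; exact: lt_le_trans e2.
have b5 : 0 <= (cabs (c s) * cabs (c t))^-1 by rewrite invr_ge0 mulr_ge0 ?cabs_ge0.
apply: le_trans (ler_pM (cabs_ge0 _) b5 b3 b4) _.
have -> : L * `|s - t| / (k * (t / 2) * (k * t)) = 2 * (L / (k * k)) * rdist s t.
  by rewrite /rdist; field; rewrite !gt_eqF.
by rewrite ler_wpM2r ?rdist_ge0// /K; lra.
Qed.

Lemma log_rel_lip : rel_lip l.
Proof.
have [k0 L0 d0 d1] := arc_consts; have i0 : 0 < dl^-1 by rewrite invr_gt0.
have p0 : 0 < L / k by apply: divr_gt0.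
(* With 101, the quantity 2 (L/k) rdist is at most 2/101, below the threshold 1/50 of [log_path];
   [dl^-1] keeps s and t below [dl]. *)
exists (101 * (L / k) + 2 + dl^-1); first lra.
set K := _ + dl^-1; have K2 : 2 <= K by rewrite /K; lra.
have Kd : dl^-1 <= K by rewrite /K; lra.
move=> s t st; have hs := close_half K2 st; have hr := rdist_le K2 st; case: (st) => s0 sK t0 tK _.
have sd := arc_lt Kd s0 sK; have td := arc_lt Kd t0 tK.
have r0 := rdist_ge0 s t.
have rl := @rdist_lin R s t t0 ltac:(lra).
(* Stated for an ordered interval, along which [log_path] runs; s and t may come in either order. *)
have main a b : a <= b -> t / 2 <= a -> b < dl -> b - a = `|s - t| ->
    cabs (l b - l a) <= 4 * (L / k) * rdist s t.
  move=> ab ta bd ba; have a0 : 0 < a by lra.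
  have ha : 0 < a <= dl by rewrite a0; lra.
  have ca := good_arc_neq0 ga ha.
  have q x : a <= x <= b -> cabs (c x / c a - 1) <= 2 * (L / k) * rdist s t.
    move=> /andP[ax xb].
    have -> : c x / c a - 1 = (c x - c a) / c a by rewrite mulrBl mulfV.
    rewrite cabsM cabsV.
    have h0 : 0 <= x <= dl by apply/andP; split; lra.
    have h1 : 0 <= a <= dl by apply/andP; split; lra.
    have /andP[b1 _] := good_arc_bounds ga h1.
    have b3 : cabs (c x - c a) <= L * `|x - a|.
      by case: ga => _ _ _ _ [h _ _]; have /andP[] := h x a h0 h1.
    have xa : `|x - a| <= `|s - t| by rewrite ger0_norm; lra.
    have b4 : (cabs (c a))^-1 <= (k * (t / 2))^-1.
      have e1 : 0 < k * (t / 2) by rewrite !mulr_gt0.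
      have e2 : k * (t / 2) <= cabs (c a) by apply: le_trans b1; rewrite ler_pM2l.
      by rewrite lef_pV2 ?posrE//; exact: lt_le_trans e2.
    have b5 : 0 <= (cabs (c a))^-1 by rewrite invr_ge0 cabs_ge0.
    apply: le_trans (ler_pM (cabs_ge0 _) b5 b3 b4) _.
    have Lx : L * `|x - a| <= L * `|s - t| by rewrite ler_pM2l.
    apply: (@le_trans _ _ (L * `|s - t| / (k * (t / 2)))).
      by rewrite ler_wpM2r// invr_ge0 ltW// !mulr_gt0.
    have -> : L * `|s - t| / (k * (t / 2)) = 2 * (L / k) * (`|s - t| / t).
      by field; rewrite !gt_eqF.
    by rewrite ler_wpM2l// mulr_ge0// ltW.
  have cb : forall x, a <= x <= b -> cexp (l x) = c x by move=> x hx; apply: el; lra.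
  have small x : a <= x <= b -> cabs (c x / c a - 1) < 50^-1.
    move=> /q h; apply: le_lt_trans h _.
    have : 101 * (L / k) * rdist s t <= K * rdist s t by rewrite ler_wpM2r// /K; lra.
    have := mulr_ge0 (ltW p0) r0; move: (L / k * _) (K * _) hr => ? ? hr; rewrite -!mulrA; nra.
  have ab' : a <= b <= b by rewrite ab lexx.
  have := log_path ab (cl a0 bd) cb small ab'; have := q b ab'; lra.
have fin : 4 * (L / k) * rdist s t <= K * rdist s t by rewrite ler_wpM2r// /K; lra.
apply: le_trans fin; have [le_st|le_ts] := leP s t.
  by rewrite cabsC; apply: main => //; rewrite ler0_norm ?opprB// subr_le0.
by apply: main => //; [exact: ltW|lra|rewrite gtr0_norm ?subr_gt0].
Qed.

Lemma log_ge1 : exists2 d, 0 < d & forall t, 0 < t < d -> 1 <= cabs (l t).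
Proof.
have [k0 L0 d0 d1] := arc_consts.
exists (Num.min dl (expR (-1) / L)); first by rewrite lt_min d0 divr_gt0// expR_gt0.
move=> t; rewrite lt_min => /andP[t0 /andP[td te]].
have /andP[_ h] := good_arc_bounds ga (t := t) ltac:(by rewrite !ltW).
have h1 : cabs (c t) < expR (-1) by apply: le_lt_trans h _; rewrite mulrC -ltr_pdivlMr.
move: h1; rewrite -el ?t0// cabs_cexp ltr_expR => h1.
by apply: le_trans (Re_le_cabs _); rewrite ltr0_norm; lra.
Qed.

(** The three factors are multiplicatively Lipschitz, and the size comes from the comparison with
    the model term, whose exponents are good. *)
Lemma nice_bterm (tau : triple) : cderiv c 0 != 0 ->
  good_exps (Re tau.1.2) (Re (tau.1.1 / cderiv c 0)) -> nice (fun t => bterm tau (c t) (l t)).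
Proof.
move=> c1 hg; have [_ _ _ c0 _] := ga.
have ml : mult_lip (fun t => bterm tau (c t) (l t)).
  have h1 := mult_lip_cexp (rel_lip_Z tau.1.2 log_rel_lip).
  have h2 := mult_lip_X tau.2 (rel_lip_of_ge1 log_rel_lip log_ge1).
  have h3 := mult_lip_cexp (rel_lip_Z (- tau.1.1) rel_lip_inv).
  have := mult_lip_M (mult_lip_M h1 h2) h3.
  by congr mult_lip; apply/funext => t; rewrite /bterm mulNr.
apply: (@nice_mult R _ _ _ tau.2 ml hg).
have [kap hkap] := inv_arc_asymp hc c0 c1.
have [Lam hLam] : exists Lam : Cx R, lim0 (fun t => l t - ((ln t)%:C : Cx R)) Lam.
  by apply: log_asymp ga cl el _; exists (cderiv c 0); split=> //; exact: arc_quot_cvg.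
have [M [d d0 hM]] := lim0_bounded (bterm_asymp tau c1 hLam hkap).
exists M, (Num.min d 1); first by rewrite lt_min d0 ltr01.
move=> t; rewrite lt_min => /andP[t0 /andP[td t1]].
have u0 : 0 < cabs (unit_term (tau.1.1 / cderiv c 0) tau.1.2 tau.2 t).
  by rewrite cabs_gt0 unit_term_neq0// t0.
have := hM t ltac:(by rewrite t0); rewrite -(cabs_unit_term _ tau.1.2 _ t0) cabsM cabsV.
by rewrite (ler_pdivrMr _ _ u0).
Qed.

Lemma nice_entire (h : Cx R -> Cx R) (F : R -> Cx R) : entire h -> nice F ->
  nice (fun t => h (c t) * F t).
Proof.
have [k0 L0 d0 d1] := arc_consts; move=> eh nF.
have ct t : 0 < t < dl -> cabs (c t) <= L.
  move=> ht; have /andP[_ h1] := good_arc_bounds ga (t := t) ltac:(lra).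
  by apply: le_trans h1 _; rewrite -[leRHS]mulr1 ler_pM2l//; lra.
have [M hM] := bounded_disc L (entire_continuous eh).
have [L' L'0 hL] := entire_lip L eh.
have M0 : 0 <= M by apply: le_trans (cabs_ge0 _) (hM 0 _); rewrite cabs0 ltW.
have LL : 0 <= L' * L by rewrite mulr_ge0// ltW.
apply: (@nice_M R (M + L' * L) dl) nF => //.
  by move=> t /ct /hM h1; lra.
move=> s t hs ht; apply: le_trans (hL _ _ (ct s hs) (ct t ht)) _.
case: ga => _ _ _ _ [/(_ s t)h1 _ _].
have /andP[_ h2] := h1 ltac:(lra) ltac:(lra).
by apply: le_trans (ler_wpM2l L'0 h2) _; rewrite mulrA; apply: ler_wpM2r => //; lra.
Qed.

Lemma nice_normal_sum (T : seq triple) (Phi : triple -> Cx R -> Cx R) : cderiv c 0 != 0 ->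
  normalized T Phi ->
  (forall tau, tau \in T -> good_exps (Re tau.1.2) (Re (tau.1.1 / cderiv c 0))) ->
  nice (fun t => normal_sum T Phi (c t) (l t)).
Proof.
move=> c1 [_ hT] hg; apply: nice_sum => tau tT; apply: nice_entire; first exact: (hT _ tT).1.
by apply: nice_bterm => //; exact: hg.
Qed.

End NiceArc.

Lemma nice_ext (R : realType) (d : R) (f h : R -> Cx R) : 0 < d -> (forall t, 0 < t < d -> f t = h t) ->
  nice f -> nice h.
Proof.
move=> d0 fh [K k [f1 f2]]; have i0 : 0 < d^-1 by rewrite invr_gt0.
have KK : K <= K + d^-1 by lra.
have aux t : 0 < t -> t * (K + d^-1) < 1 -> [/\ 0 < t < d, t * K < 1 & small_bound K t <= small_bound (K + d^-1) t].
  move=> t0 tK; have t1 := @lt1_of R (K + d^-1) t ltac:(lra) t0 tK; split.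
  - have : t * d^-1 < 1 by apply: le_lt_trans tK; rewrite ler_pM2l//; lra.
    by rewrite ltr_pdivrMr// mul1r t0.
  - by apply: le_lt_trans tK; rewrite ler_pM2l.
  - by apply: small_bound_le => //; lra.
exists (K + d^-1); first lra.
split=> [t t0 tK|s t st].
  have [td tK' b] := aux t t0 tK; rewrite -fh//.
  apply: le_trans (f1 t t0 tK') _; apply: ler_pM => //; [lra|exact: small_bound_ge0].
have [s0 sK t0 tK _] := st; have [sd _ _] := aux s s0 sK; have [td _ b] := aux t t0 tK.
rewrite -!fh//; apply: le_trans (f2 s t (close_pair_le KK st)) _.
have r0 := rdist_ge0 s t; have b0 := small_bound_ge0 K t0.
apply: ler_pM => //; [lra|exact: mulr_ge0|exact: ler_wpM2r].
Qed.

(** * Cauchy integrals near the base point *)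

Section CoreIntegral.
Context {R : realType}.
Implicit Types (s t a b h x y : R) (z u v w : Cx R).
Local Notation mu := (@lebesgue_measure R).

(** The imaginary part of v times the conjugate of u, hence the numerator of Im (v / u). *)
Definition cross v u := Im v * Re u - Re v * Im u.

Lemma Re_quotE v u : Re (v / u) = (Re v * Re u + Im v * Im u) / (Re u ^+ 2 + Im u ^+ 2).
Proof. rewrite ReM ReV ImV; ring. Qed.

Lemma Im_quotE v u : Im (v / u) = cross v u / (Re u ^+ 2 + Im u ^+ 2).
Proof. rewrite ImM ReV ImV /cross; ring. Qed.

Lemma cross_le v u : `|cross v u| <= cabs v * cabs u.
Proof.
have [->|u0] := eqVneq u 0; first by rewrite /cross !mulr0 subrr normr0 mulr_ge0// cabs_ge0.
have up : 0 < cabs u by rewrite cabs_gt0.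
have -> : cross v u = Im (v / u) * cabs u ^+ 2.
  by rewrite Im_quotE -cabs_sqr divfK// expf_neq0// gt_eqF.
rewrite normrM (ger0_norm (sqr_ge0 _)).
have := Im_le_cabs (v / u); rewrite cabsM cabsV ler_pdivlMr// => h.
by rewrite expr2 mulrA ler_wpM2r// ltW.
Qed.

(** Because [cross v v = 0], the linear Taylor term v s of u - u1 may be removed for free, which
    leaves a quadratic remainder. *)
Lemma crossE v w u u1 s : cross w u = cross (w - v) u + cross v u1 + cross v (u - u1 - v * (s%:C : Cx R)).
Proof. by case: v w u u1 => [? ?] [? ?] [? ?] [? ?]; rewrite /cross /=; ring. Qed.

Lemma is_derive_half_ln (A B : R -> R) a b x : is_derive x 1 A a -> is_derive x 1 B b ->
  0 < A x ^+ 2 + B x ^+ 2 ->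
  is_derive x 1 (fun t => ln (A t ^+ 2 + B t ^+ 2) / 2) ((a * A x + b * B x) / (A x ^+ 2 + B x ^+ 2)).
Proof.
move=> dA dB p.
have h1 : is_derive x 1 (fun t => A t ^+ 2 + B t ^+ 2) (2 * (a * A x + b * B x)).
  have -> : (fun t => A t ^+ 2 + B t ^+ 2) = (A * A + B * B).
    by apply/funext => t; rewrite !expr2.
  apply: (is_derive_eq (is_deriveD (is_deriveM dA dA) (is_deriveM dB dB))).
  rewrite /GRing.scale/=; move: (A x) (B x) => p1 p2; ring.
have h2 := is_derive1_ln p.
have h3 := @is_derive1_comp _ (@ln R) (fun t => A t ^+ 2 + B t ^+ 2) _ _ _ h2 h1.
have -> : (fun t => ln (A t ^+ 2 + B t ^+ 2) / 2) = 2^-1 *: (@ln R \o (fun t => A t ^+ 2 + B t ^+ 2)).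
  by apply/funext => t; rewrite /= /GRing.scale/= mulrC.
apply: (is_derive_eq (is_deriveZ 2^-1 h3)); rewrite /GRing.scale/=.
by move: (A x) (B x) p => p1 p2 p; field; rewrite gt_eqF.
Qed.

Lemma is_derive_atan_lin m t0 x : is_derive x 1 (fun t => atan (m * (t - t0))) (m / (1 + (m * (x - t0)) ^+ 2)).
Proof.
have h1 : is_derive x 1 (fun t => m * (t - t0)) m.
  have -> : (fun t => m * (t - t0)) = m *: (id - cst t0).
    by apply/funext => t.
  apply: is_derive_eq; rewrite /GRing.scale/= subr0 mulr1//.
have h3 := @is_derive1_comp _ (@atan R) (fun t => m * (t - t0)) _ _ _ (is_derive1_atan _) h1.
by apply: is_derive_eq; rewrite mulrC.
Qed.

(** Here r is |t - t0|, y the least distance to z and u the distance at t. The terms in r are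
    absorbed by k r / 2 <= u; the term L y becomes a Poisson kernel because y^2 + (k r / 2)^2 <= 2
    u^2. *)
Lemma core_pointwise (k L y r u : R) : 0 < k -> 0 < L -> 0 < y -> 0 <= r -> y <= u -> k / 2 * r <= u ->
  L * r * u + L * y + L * (2 * L * r ^+ 2) <=
  (2 * (L / k) + 8 * (L / k) ^+ 2 + 4 * (L / k) * (k / (2 * y) / (1 + (k / (2 * y) * r) ^+ 2))) * u ^+ 2.
Proof.
move=> k0 L0 y0 r0 yu ru; set p := L / k; have p0 : 0 < p by apply: divr_gt0.
have LE : L = p * k by rewrite /p divfK// gt_eqF.
have u0 : 0 < u by lra.
have a1 : L * r * u <= 2 * p * u ^+ 2.
  rewrite LE expr2 mulrA; apply: ler_wpM2r; first exact: ltW.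
  have -> : p * k * r = 2 * p * (k / 2 * r) by field.
  by apply: ler_wpM2l => //; lra.
have a2 : L * (2 * L * r ^+ 2) <= 8 * p ^+ 2 * u ^+ 2.
  have -> : L * (2 * L * r ^+ 2) = 8 * p ^+ 2 * (k / 2 * r) ^+ 2 by rewrite LE; field.
  apply: ler_wpM2l; first by rewrite mulr_ge0// exprn_ge0// ltW.
  by apply: lerXn2r; rewrite ?nnegrE// ?mulr_ge0// ?divr_ge0// ltW.
have a3 : L * y <= 4 * p * (k / (2 * y) / (1 + (k / (2 * y) * r) ^+ 2)) * u ^+ 2.
  have q0 : 0 < 1 + (k / (2 * y) * r) ^+ 2 by rewrite ltr_pwDl// sqr_ge0.
  have -> : 4 * p * (k / (2 * y) / (1 + (k / (2 * y) * r) ^+ 2)) * u ^+ 2 =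
     L * y * (2 * u ^+ 2 / (y ^+ 2 * (1 + (k / (2 * y) * r) ^+ 2))).
    rewrite LE; move: (1 + _) q0 => q q0; field; rewrite !gt_eqF//.
  rewrite ler_peMr//; first by rewrite ltW// mulr_gt0.
  rewrite ler_pdivlMr ?mulr_gt0 ?exprn_gt0// mul1r.
  have -> : y ^+ 2 * (1 + (k / (2 * y) * r) ^+ 2) = y ^+ 2 + (k / 2 * r) ^+ 2.
    by field; rewrite gt_eqF.
  have : y ^+ 2 <= u ^+ 2 by apply: lerXn2r; rewrite ?nnegrE// ltW.
  have : (k / 2 * r) ^+ 2 <= u ^+ 2.
    by apply: lerXn2r; rewrite ?nnegrE// ?mulr_ge0// ?divr_ge0// ltW.
  by move: (y ^+ 2) (u ^+ 2) (_ ^+ 2) => ? ? ?; lra.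
rewrite [leRHS]mulrDl [X in _ <= X + _]mulrDl -addrA (addrC (L * y)) addrA.
by apply: lerD => //; exact: lerD.
Qed.

Context (c : R -> Cx R) (k L dl : R).
Hypotheses (hc : C2c c) (ga : good_arc c k L dl).

Lemma arc_cont a b : 0 <= a -> b <= dl -> cont_in a b c /\ cont_in a b (cderiv c).
Proof.
case: ga => _ _ _ _ [h1 _ h3] a0 bd; split; apply: (@lip_cont_in _ _ _ _ L) => x y hx hy.
  by have /andP[] := h1 x y ltac:(lra) ltac:(lra).
by apply: h3; lra.
Qed.

Lemma arc_inv_cont a b z : 0 <= a -> b <= dl -> (forall t, a <= t <= b -> c t != z) ->
  cont_in a b (fun t => (c t - z)^-1).
Proof.
move=> a0 bd hz; apply: (@cont_in_comp _ a b (fun u => (u - z)^-1) c (arc_cont a0 bd).1) => t ht.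
by apply: inv_continuous; exact: hz.
Qed.

Lemma arc_taylor s t : 0 <= s <= dl -> 0 <= t <= dl ->
  cabs (c t - c s - cderiv c s * ((t - s)%:C : Cx R)) <= 2 * L * `|t - s| ^+ 2.
Proof.
move=> hs ht; case: ga => _ L0 _ _ [_ _ h3]; have [dR dI] := C2c_derive hc.
have H (f df : R -> R) : (forall x, is_derive x 1 f (df x)) ->
   (forall x, 0 <= x <= dl -> `|df x - df s| <= L * `|x - s|) ->
   `|f t - f s - df s * (t - s)| <= L * `|t - s| ^+ 2.
  move=> hf hL; pose g x := f x - df s * x.
  have -> : f t - f s - df s * (t - s) = g t - g s by rewrite /g; ring.
  rewrite expr2 mulrA; apply: (@derive_bound_sym R g (fun x => df x - df s)) => x hx.
    have -> : g = f - df s *: id by apply/funext.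
    by have hfx := hf x; apply: is_derive_eq; rewrite /GRing.scale/= mulr1.
  have hx' : 0 <= x <= dl /\ `|x - s| <= `|t - s|.
    move: hx; case: (leP s t) => st /andP[x1 x2]; split.
    - by lra.
    - by rewrite !ger0_norm; lra.
    - by lra.
    - by rewrite !ler0_norm; lra.
  by apply: le_trans (hL x hx'.1) _; rewrite ler_pM2l// hx'.2.
have ts v : Re (v * ((t - s)%:C : Cx R)) = Re v * (t - s) /\ Im (v * ((t - s)%:C : Cx R)) = Im v * (t - s).
  by case: v => [? ?] /=; split; ring.
have e1 : `|Re (c t) - Re (c s) - Re (cderiv c s) * (t - s)| <= L * `|t - s| ^+ 2.
  apply: (H _ _ dR) => x hx; apply: le_trans (h3 x s hx hs).
  by apply: le_trans (Re_le_cabs _); rewrite ReD ReN.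
have e2 : `|Im (c t) - Im (c s) - Im (cderiv c s) * (t - s)| <= L * `|t - s| ^+ 2.
  apply: (H _ _ dI) => x hx; apply: le_trans (h3 x s hx hs).
  by apply: le_trans (Im_le_cabs _); rewrite ImD ImN.
apply: le_trans (cabs_le_ReIm _) _.
rewrite -(ts (cderiv c s)).1 -?ReN -?ReD in e1; rewrite -(ts (cderiv c s)).2 -?ImN -?ImD in e2.
by have := lerD e1 e2; move: (L * _) => X; lra.
Qed.

(* The logarithmic kernel over an interval symmetric about the parameter t0
   nearest to z: the real part is a difference of logarithms of comparable
   moduli, the imaginary part a Poisson kernel up to a bounded function. *)
Lemma core_bound t0 h z : 0 < h <= 1 -> 0 <= t0 - h -> t0 + h <= dl -> c t0 != z ->
  (forall t, 0 <= t <= dl -> cabs (c t0 - z) <= cabs (c t - z)) ->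
  (forall t, 0 <= t <= dl -> k / 2 * `|t - t0| <= cabs (c t - z)) ->
  CInt `[t0 - h, t0 + h] (fun t => cderiv c t / (c t - z)) /\
  cabs (CI `[t0 - h, t0 + h] (fun t => cderiv c t / (c t - z))) <=
    2 * (L / k) + 2 * (2 * (L / k) + 8 * (L / k) ^+ 2) + 4 * (L / k) * pi.
Proof.
move=> /andP[h0 h1] a0 bd cz hy hk; have [k0 L0 /andP[d0 d1] _ [hl _ hd]] := ga.
set y := cabs (c t0 - z) in hy; have y0 : 0 < y by rewrite cabs_gt0 subr_eq0.
set a := t0 - h; set b := t0 + h; have ab : a <= b by rewrite /a /b; lra.
have inn t : a <= t <= b -> 0 <= t <= dl by rewrite /a /b; lra.
have upos t : a <= t <= b -> 0 < cabs (c t - z) by move=> /inn /hy; exact: lt_le_trans.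
have unz t : a <= t <= b -> c t != z by move=> /upos; rewrite cabs_gt0 subr_eq0.
have dz t : a <= t <= b -> 0 < (Re (c t) - Re z) ^+ 2 + (Im (c t) - Im z) ^+ 2.
  by move=> /upos ut; have := cabs_sqr (c t - z); rewrite ReD ReN ImD ImN => <-; rewrite exprn_gt0.
have ct : cont_in a b (fun t => cderiv c t / (c t - z)).
  by apply: cont_in_M; [exact: (arc_cont a0 bd).2|exact: arc_inv_cont].
have [cR cI] := cont_in_within ct.
have [dR dI] := C2c_derive hc.
split; first exact: cont_in_CInt.
have p : 0 < L / k by apply: divr_gt0.
have t0in : 0 <= t0 <= dl by lra.
apply: le_trans (cabs_le_ReIm _) _; rewrite -addrA; apply: lerD => /=.
  pose A t := Re (c t) - Re z; pose B t := Im (c t) - Im z.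
  have -> : \int[mu]_(t in `[a, b]) Re (cderiv c t / (c t - z)) =
      ln (A b ^+ 2 + B b ^+ 2) / 2 - ln (A a ^+ 2 + B a ^+ 2) / 2.
    apply: (@Rint_FTC R a b _ (fun t => ln (A t ^+ 2 + B t ^+ 2) / 2)) => // t ht.
    have dA : is_derive t 1 A (Re (cderiv c t)).
      by have h2 := dR t; apply: (is_derive_eq (is_deriveB h2 (is_derive_cst (Re z) t 1))); rewrite subr0.
    have dB : is_derive t 1 B (Im (cderiv c t)).
      by have h2 := dI t; apply: (is_derive_eq (is_deriveB h2 (is_derive_cst (Im z) t 1))); rewrite subr0.
    by rewrite Re_quotE !(ReD, ReN, ImD, ImN); exact: (is_derive_half_ln dA dB (dz t ht)).
  have E t : a <= t <= b -> ln (A t ^+ 2 + B t ^+ 2) / 2 = ln (cabs (c t - z)).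
    move=> ht; have := cabs_sqr (c t - z); rewrite ReD ReN ImD ImN -/(A t) -/(B t) => <-.
    by rewrite lnXn ?upos// mulr2n; move: (ln _) => ?; lra.
  have ha : a <= a <= b by rewrite lexx. have hb : a <= b <= b by rewrite lexx andbT.
  rewrite !E//.
  (* Both endpoints are at parameter distance h from t0. One modulus is at most y + L h, the other
     at least y and at least k h / 2, so their ratio is at most 1 + 2 L/k; the symmetry of the
     interval is used here. *)
  have M x x' : a <= x <= b -> a <= x' <= b -> `|x - t0| = h -> `|x' - t0| = h ->
     ln (cabs (c x - z)) <= 2 * (L / k) + ln (cabs (c x' - z)).
    move=> hx hx' xh xh'; have ux := upos x hx; have ux' := upos x' hx'.
    have q1 : cabs (c x - z) <= y + L * h.
      have := cabs_tri (c t0) (c x) z; have /andP[_] := hl x t0 (inn x hx) t0in.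
      by rewrite xh -/y; lra.
    have q2 : k / 2 * h <= cabs (c x' - z) by rewrite -xh'; apply: hk; exact: inn.
    have q3 : y <= cabs (c x' - z) by apply: hy; exact: inn.
    have q4 : cabs (c x - z) <= expR (2 * (L / k)) * cabs (c x' - z).
      have e1 : 1 + 2 * (L / k) <= expR (2 * (L / k)) by exact: expR_ge1Dx.
      have e2 : L * h = 2 * (L / k) * (k / 2 * h) by field; rewrite gt_eqF.
      have e3 : 2 * (L / k) * (k / 2 * h) <= 2 * (L / k) * cabs (c x' - z).
        by apply: ler_wpM2l => //; lra.
      have e4 : (1 + 2 * (L / k)) * cabs (c x' - z) <= expR (2 * (L / k)) * cabs (c x' - z).
        by rewrite ler_pM2r.
      by rewrite e2 in q1; lra.
    apply: (@le_trans _ _ (ln (expR (2 * (L / k)) * cabs (c x' - z)))).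
      by rewrite ler_ln// posrE// mulr_gt0// expR_gt0.
    by rewrite lnM ?posrE ?expR_gt0// expRK.
  have ea : `|a - t0| = h by rewrite ler0_norm /a; lra.
  have eb : `|b - t0| = h by rewrite ger0_norm /b; lra.
  by have := M a b ha hb ea eb; have := M b a hb ha eb ea; rewrite ler_norml; lra.
pose M0 := 2 * (L / k) + 8 * (L / k) ^+ 2.
have M00 : 0 <= M0 by rewrite /M0 addr_ge0// mulr_ge0// ?exprn_ge0// ltW.
pose m := k / (2 * y); have m0 : 0 < m by rewrite divr_gt0// mulr_gt0.
(* A constant plus a Poisson kernel of width 2 y / k. Its arctangent primitive varies by at most pi
   however small y is, so the bound does not depend on z. *)
pose B t := M0 + 4 * (L / k) * (m / (1 + (m * (t - t0)) ^+ 2)).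
pose G t := M0 * t + 4 * (L / k) * atan (m * (t - t0)).
have dG t : is_derive t 1 G (B t).
  have -> : G = (M0 *: id + (4 * (L / k)) *: (fun t => atan (m * (t - t0)))) by apply/funext.
  apply: (is_derive_eq (is_deriveD (is_deriveZ M0 (is_derive_id t 1)) (is_deriveZ (4 * (L / k)) (is_derive_atan_lin m t0 t)))).
  by rewrite /GRing.scale/= mulr1.
have cB : {within `[a, b], continuous B}.
  apply: continuous_subspaceT => t.
  have ca : {for t, continuous (fun t => 1 + (m * (t - t0)) ^+ 2)}.
    apply: continuousD; first exact: cst_continuous.
    have cl : {for t, continuous (fun t => m * (t - t0))}.
      by apply: continuousM; [exact: cst_continuous|apply: continuousB; [exact: cvg_id|exact: cst_continuous]].
    by apply: (@continuousM _ _ (fun t => m * (t - t0)) (fun t => m * (t - t0))).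
  change {for t, continuous (fun t => M0 + 4 * (L / k) * (m / (1 + (m * (t - t0)) ^+ 2)))}.
  apply: continuousD; first exact: cst_continuous.
  apply: continuousM; first exact: cst_continuous.
  apply: continuousM; first exact: cst_continuous.
  apply: (@continuous_comp _ _ _ (fun t => 1 + (m * (t - t0)) ^+ 2) (fun x : R => x^-1)) => //.
  by apply: real_inv_continuous; rewrite gt_eqF// ltr_pwDl// sqr_ge0.
have EB : \int[mu]_(t in `[a, b]) B t = G b - G a by apply: (Rint_FTC ab).
have iB := Rint_continuous cB.
have [_ iI] := cont_in_CInt ct.
apply: le_trans (le_normr_Rintegral _ iI) _; first exact: measurable_itv.
apply: (@le_trans _ _ (\int[mu]_(t in `[a, b]) B t)).
  apply: le_Rintegral => //; first exact: integrable_norm.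
  move=> t; rewrite /= in_itv/= => ht; have ut := upos t ht.
  have e1 := hd t t0 (inn t ht) t0in.
  have e2 := arc_taylor t0in (inn t ht).
  have e3 : cabs (cderiv c t0) <= L by case: ga => _ _ _ _ [_ /(_ t0 t0in)/andP[]].
  have e4 := hk t (inn t ht); have e5 := hy t (inn t ht).
  rewrite Im_quotE -cabs_sqr normrM normfV (ger0_norm (sqr_ge0 _)).
  rewrite ler_pdivrMr ?exprn_gt0//.
  rewrite (crossE (cderiv c t0) (cderiv c t) (c t - z) (c t0 - z) (t - t0)).
  have -> : c t - z - (c t0 - z) - cderiv c t0 * ((t - t0)%:C : Cx R) =
     c t - c t0 - cderiv c t0 * ((t - t0)%:C : Cx R) by ring.
  apply: le_trans (ler_normD _ _) _; apply: le_trans (lerD (ler_normD _ _) (lexx _)) _.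
  have f1 := le_trans (cross_le _ _) (ler_pM (cabs_ge0 _) (cabs_ge0 _) e1 (lexx _)).
  have f2 := le_trans (cross_le _ _) (ler_pM (cabs_ge0 _) (cabs_ge0 _) e3 (lexx (cabs (c t0 - z)))).
  have f3 := le_trans (cross_le _ _) (ler_pM (cabs_ge0 _) (cabs_ge0 _) e3 e2).
  apply: le_trans (lerD (lerD (f1 _) f2) f3) _; rewrite -/y.
  rewrite /B; have -> : (m * (t - t0)) ^+ 2 = (m * `|t - t0|) ^+ 2 by rewrite !exprMn real_normK ?num_real.
  by apply: core_pointwise.
rewrite EB /G /a /b.
have := atan_gtNpi2 (m * (t0 - h - t0)); have := atan_ltpi2 (m * (t0 + h - t0)).
have -> : 4 * (L / k) * pi = 4 * (L / k) * (pi / 2) + 4 * (L / k) * (pi / 2) by rewrite -mulrDr -splitr.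
move=> h2 h3.
have p4 : 0 <= 4 * (L / k) by rewrite mulr_ge0 ?ltW.
have f1 := ler_wpM2l p4 (ltW h2).
have f2 : 4 * (L / k) * - atan (m * (t0 - h - t0)) <= 4 * (L / k) * (pi / 2).
  by apply: ler_wpM2l => //; rewrite lerNl ltW.
have f3 : M0 * h <= M0 by rewrite ler_piMr.
rewrite -/M0; move: f1 f2 f3; rewrite mulrN; move: (_ * atan _) (_ * atan _) (_ * (pi / 2)) => X1 X2 X3.
by rewrite -/M0 mulrDr mulrBr; move: (M0 * t0) (M0 * h) => X4 X5; lra.
Qed.

End CoreIntegral.

(** * The Cauchy integral along one arc, zone by zone around the nearest parameter *)

Section ArcCauchyIntegral.
Context {R : realType}.
Implicit Types (s t a b h x y e eta : R) (z u v w : Cx R).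
Local Notation mu := (@lebesgue_measure R).
Context (c F : R -> Cx R) (k L dl K : R).
Hypotheses (hc : C2c c) (ga : good_arc c k L dl) (K2 : 2 <= K).
Hypothesis F1 : forall t, 0 < t -> t * K < 1 -> cabs (F t) <= K * small_bound K t.
Hypothesis F2 : forall s t, close_pair K s t -> cabs (F s - F t) <= K * (small_bound K t * rdist s t).
Hypothesis iF : CInt `[0, dl] (fun t => F t * cderiv c t).

Let N t := norm1 (F t * cderiv c t).
Let ker z t := z * (F t * cderiv c t / (c t - z)).

Lemma consts_pos : [/\ 0 < k, 0 < L, 0 < dl, dl <= 1 & 0 < K].
Proof.
by case: ga => ? ? /andP[? ?] _ _; split=> //; apply: lt_le_trans K2; rewrite ltr0n.
Qed.

Lemma cderiv_le t : 0 <= t <= dl -> cabs (cderiv c t) <= L.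
Proof. by case: ga => _ _ _ _ [_ h _] /h/andP[]. Qed.

Lemma near_point z : (forall t, 0 <= t <= dl -> c t != z) -> exists t0,
  [/\ 0 <= t0 <= dl, forall t, 0 <= t <= dl -> cabs (c t0 - z) <= cabs (c t - z),
      forall t, 0 <= t <= dl -> k / 2 * `|t - t0| <= cabs (c t - z) &
      k * t0 <= 2 * cabs z /\ cabs z <= L * t0 + cabs (c t0 - z)].
Proof.
move=> hz; have [k0 L0 d0 d1 _] := consts_pos.
have cu : cont_in 0 dl (fun t => c t - z).
  move=> x hx e e0; have [r r0 hr] := (arc_cont ga (lexx 0) (lexx dl)).1 x hx e e0.
  by exists r => // y hy /(hr y hy); rewrite opprB addrA subrK.
have [t0 ht hmin] := cont_in_min (ltW d0) cu; exists t0; split=> //.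
  move=> t h; case: (ga) => _ _ _ _ [/(_ t t0 h ht)/andP[h1 _] _ _].
  have := cabs_tri z (c t) (c t0); rewrite (cabsC z); have := hmin t h; lra.
have /andP[h1 h2] := good_arc_bounds ga ht.
have c0 : c 0 = 0 by case: ga.
have h3 := hmin 0 ltac:(lra); rewrite c0 sub0r cabsN in h3.
have h4 := cabs_tri z (c t0) 0; rewrite !subr0 in h4.
have h5 := cabs_tri (c t0) z 0; rewrite !subr0 (cabsC z) in h5.
split; lra.
Qed.

Lemma CInt_ker z a b : 0 <= a -> b <= dl -> (forall t, a <= t <= b -> c t != z) ->
  CInt `[a, b] (ker z).
Proof.
move=> a0 bd hz; have ci := arc_inv_cont ga a0 bd hz.
have iab := CInt_subitv a0 bd iF.
have [ab|ba] := leP a b; last first.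
  by rewrite set_itv_ge -?leNgt ?bnd_simp ?ltW//; split; exact: integrable_set0.
have [M hM] := cont_in_max ab ci.
apply: CInt_Z.
  exact: measurable_itv.
have := CInt_M (measurable_itv `[a, b]) (cont_in_cmeas ci) _ iab.
move=> /(_ M) h; apply: eq_CInt (h _) => [|t _|t]; first exact: measurable_itv.
  by rewrite mulrC.
by rewrite /= in_itv/=; exact: hM.
Qed.

Lemma integrable_N a b : 0 <= a -> b <= dl -> mu.-integrable `[a, b] (EFin \o N).
Proof.
by move=> a0 bd; apply: integrable_norm1; [exact: measurable_itv|exact: CInt_subitv iF].
Qed.

Lemma ker_le_cst z a b M : 0 <= a -> b <= dl -> (forall t, a <= t <= b -> c t != z) ->
  (forall t, a <= t <= b -> cabs z <= M * cabs (c t - z)) ->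
  cabs (CI `[a, b] (ker z)) <= 2 * (M * \int[mu]_(t in `[a, b]) N t).
Proof.
move=> a0 bd hz hM; have iN := integrable_N a0 bd.
have mi : measurable (`[a, b]%classic : set (measurableTypeR R)) by exact: measurable_itv.
have i1 := CInt_ker a0 bd hz; have i2 := Rint_Z mi M iN.
rewrite -(RintegralZl M mi iN); apply: (CI_le mi i1 i2) => t; rewrite /= in_itv/= => ht; rewrite /ker cabsM cabsM cabsV mulrA.
have p : 0 < cabs (c t - z) by rewrite cabs_gt0 subr_eq0 hz.
rewrite ler_pdivrMr// mulrAC; apply: ler_pM; rewrite ?cabs_ge0 ?hM//.
exact: cabs_le_norm1.
Qed.

Lemma small_bound_near t t0 : 0 < t0 -> t0 / 2 <= t <= 2 * t0 ->
  small_bound K t <= 4 * small_bound K t0.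
Proof.
have [_ _ _ _ K0] := consts_pos; move=> p /andP[h1 h2]; rewrite /small_bound.
have t0' : 0 < t by apply: lt_le_trans h1; rewrite divr_gt0.
have e1 : expR (ln t / K) <= 2 * expR (ln t0 / K).
  have e2 : ln t <= ln 2 + ln t0 by rewrite -lnM ?posrE// ler_ln ?posrE// mulr_gt0.
  have l2 : 0 <= ln (2 : R) by rewrite ln_ge0// ler1n.
  have e3 : ln t / K <= ln 2 + ln t0 / K.
    apply: (@le_trans _ _ ((ln 2 + ln t0) / K)); first by rewrite ler_wpM2r// invr_ge0 ltW.
    by rewrite mulrDl lerD2r ler_pdivrMr// ler_peMr//; have := K2; lra.
  by apply: le_trans (_ : expR (ln 2 + ln t0 / K) <= _); rewrite ?ler_expR// expRD lnK ?posrE.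
have e2 : t^-1 <= 2 * t0^-1 by rewrite -[2]invrK -invfM lef_pV2 ?posrE ?mulr_gt0 ?invr_gt0//; lra.
have i0 : 0 <= t^-1 by rewrite invr_ge0 ltW.
apply: le_trans (ler_pM (expR_ge0 _) i0 e1 e2) _.
by rewrite le_eqVlt; apply/orP; left; apply/eqP; ring.
Qed.

Lemma F_near t t0 : 0 < t0 -> t0 * (2 * K) < 1 -> t0 / 2 <= t <= 2 * t0 ->
  cabs (F t) <= 4 * K * small_bound K t0.
Proof.
have [_ _ _ _ K0] := consts_pos; move=> p q h.
have t0' : 0 < t by case/andP: h => h _; apply: lt_le_trans h; rewrite divr_gt0.
have tK : t * K < 1.
  by case/andP: h => _ h; apply: le_lt_trans q; rewrite mulrA (mulrC t0); apply: ler_wpM2r => //; exact: ltW.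
apply: le_trans (F1 t0' tK) _; rewrite (mulrC 4) -mulrA; apply: ler_wpM2l; first exact: ltW.
exact: small_bound_near.
Qed.

(** The sign m is -1 to the left of t0 and 1 to its right, so one primitive ln (m (t - t0)) covers
    both sides. The kernel is bounded through |z| / |c t - z| <= 2 (L/k) t0 / |t - t0| + 1. *)
Lemma mid_part z t0 a b m : 0 < t0 -> t0 * (2 * K) < 1 ->
  t0 / 2 <= a -> a <= b -> b <= 2 * t0 -> b <= dl ->
  (forall t, 0 <= t <= dl -> c t != z) ->
  (forall t, 0 <= t <= dl -> cabs (c t0 - z) <= cabs (c t - z)) ->
  (forall t, 0 <= t <= dl -> k / 2 * `|t - t0| <= cabs (c t - z)) ->
  cabs z <= L * t0 + cabs (c t0 - z) ->
  (forall t, a <= t <= b -> 0 < m * (t - t0)) -> `|m| = 1 ->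
  cabs (CI `[a, b] (ker z)) <= 2 * (4 * K * L * expR (ln t0 / K) *
    (2 * (L / k) * (m * (ln (m * (b - t0)) - ln (m * (a - t0)))) + (b - a) / t0)).
Proof.
have [k0 L0 d0 d1 K0] := consts_pos; move=> t00 tK ta ab bt bd hz hy hk zl hm m1.
have a0 : 0 <= a by apply: le_trans ta; rewrite divr_ge0// ltW.
set E := expR _; have E0 : 0 < E by exact: expR_gt0.
pose B t := 4 * K * L * E * (2 * (L / k) * (m * (m / (m * (t - t0)))) + t0^-1).
pose G t := 4 * K * L * E * (2 * (L / k) * (m * ln (m * (t - t0))) + t / t0).
have dm t : is_derive t 1 (fun t => m * (t - t0)) m.
  have -> : (fun t => m * (t - t0)) = m *: (id - cst t0) by apply/funext.
  apply: (is_derive_eq (is_deriveZ m (is_deriveB (is_derive_id t 1) (is_derive_cst t0 t 1)))).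
  by rewrite /GRing.scale/= subr0 mulr1.
have dG t : a <= t <= b -> is_derive t 1 G (B t).
  move=> ht; have h1 := is_derive1_ln (hm t ht).
  have h2 := @is_derive1_comp _ (@ln R) (fun t => m * (t - t0)) _ _ _ h1 (dm t).
  have -> : G = (4 * K * L * E) *: ((2 * (L / k) * m) *: (@ln R \o (fun t => m * (t - t0))) + t0^-1 *: id).
    apply/funext => u; congr (_ * (_ + _)); last exact: mulrC.
    exact: mulrA.
  apply: (is_derive_eq (is_deriveZ _ (is_deriveD (is_deriveZ _ h2) (is_deriveZ _ (is_derive_id t 1))))).
  rewrite /B /GRing.scale/= !mulr1 (mulrC _^-1 m); congr (_ * (_ + _)).
  by rewrite !mulrA.
have cB : {within `[a, b], continuous B}.
  apply: continuous_in_subspaceT => t; rewrite inE/= in_itv/= => ht.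
  have cl : {for t, continuous (fun t => m * (t - t0))}.
    by apply/differentiable_continuous/derivable1_diffP; have h := dm t; exact: ex_derive.
  change {for t, continuous (fun t => 4 * K * L * E * (2 * (L / k) * (m * (m / (m * (t - t0)))) + t0^-1))}.
  apply: continuousM; first exact: cst_continuous.
  apply: continuousD; last exact: cst_continuous.
  apply: continuousM; first exact: cst_continuous.
  apply: continuousM; first exact: cst_continuous.
  apply: continuousM; first exact: cst_continuous.
  apply: (@continuous_comp _ _ _ (fun t => m * (t - t0)) (fun x : R => x^-1)) => //.
  by apply: real_inv_continuous; rewrite gt_eqF// hm.
have iB := Rint_continuous cB; have EB := Rint_FTC ab dG cB.
have hz' t : a <= t <= b -> c t != z by move=> ht; apply: hz; lra.
have i1 := CInt_ker a0 bd hz'.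
have -> : 4 * K * L * E * (2 * (L / k) * (m * (ln (m * (b - t0)) - ln (m * (a - t0)))) + (b - a) / t0) =
  G b - G a by rewrite /G; ring.
rewrite -EB; apply: (CI_le (measurable_itv _) i1 iB) => t.
rewrite /= in_itv/= => ht; have htd : 0 <= t <= dl by lra.
have FL := F_near (t := t) t00 tK ltac:(lra).
have e1 := hy t htd; have e2 := hk t htd; have e3 := cderiv_le htd.
have p : 0 < cabs (c t - z) by rewrite cabs_gt0 subr_eq0 hz.
have q : 0 < `|t - t0| by have := hm t ht; rewrite -(mul1r `|_|) -m1 -normrM normr_gt0 => /gt_eqF ->.
have mt : m * (m / (m * (t - t0))) = `|t - t0|^-1.
  have m0 := hm t ht; have -> : `|t - t0| = m * (t - t0) by rewrite -(gtr0_norm m0) normrM m1 mul1r.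
  have : m * m = 1 by rewrite -expr2 -real_normK ?num_real// m1 expr1n.
  by move=> mm; rewrite mulrA mm mul1r.
rewrite /ker cabsM cabsM cabsV cabsM /B mt.
have f1 := ler_pM (cabs_ge0 _) (cabs_ge0 _) FL e3.
have f2 : cabs z / cabs (c t - z) <= t0 * (2 * (L / k) * `|t - t0|^-1 + t0^-1).
  rewrite mulrDr mulfV ?gt_eqF// ler_pdivrMr// mulrDl mul1r.
  apply: le_trans zl _; apply: lerD => //.
  have -> : t0 * (2 * (L / k) * `|t - t0|^-1) * cabs (c t - z) = L * t0 * (cabs (c t - z) / (k / 2 * `|t - t0|)).
    by field; rewrite !gt_eqF.
  apply: ler_peMr; first by rewrite mulr_ge0// ltW.
  by rewrite ler_pdivlMr ?mul1r// mulr_gt0// divr_gt0.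
have z1 : 0 <= cabs z / cabs (c t - z) by apply: divr_ge0; exact: cabs_ge0.
have f3 := ler_pM z1 (mulr_ge0 (cabs_ge0 _) (cabs_ge0 _)) f2 f1.
have -> : 4 * K * L * E * (2 * (L / k) * `|t - t0|^-1 + t0^-1) =
  t0 * (2 * (L / k) * `|t - t0|^-1 + t0^-1) * (4 * K * small_bound K t0 * L).
  by rewrite /small_bound -/E; field; rewrite !gt_eqF.
by apply: le_trans f3; rewrite le_eqVlt; apply/orP; left; apply/eqP; ring.
Qed.

Definition core_cst := 2 * (L / k) + 2 * (2 * (L / k) + 8 * (L / k) ^+ 2) + 4 * (L / k) * pi.

(** On the range t0^2 / K of [close_pair], z and F(t) are replaced by c(t0) and F(t0). The main part
    is then a constant times the integral of [core_bound], of total size t0 small_bound(t0) =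
    t0^(1/K). *)
Lemma core_part z t0 : 0 < t0 -> t0 * (2 * K) < 1 -> 3 / 2 * t0 <= dl ->
  (forall t, 0 <= t <= dl -> c t != z) ->
  (forall t, 0 <= t <= dl -> cabs (c t0 - z) <= cabs (c t - z)) ->
  (forall t, 0 <= t <= dl -> k / 2 * `|t - t0| <= cabs (c t - z)) ->
  cabs (CI `[t0 - t0 ^+ 2 / K, t0 + t0 ^+ 2 / K] (ker z)) <=
  expR (ln t0 / K) * (8 * (L ^+ 2 / k) + K * L * core_cst + 16 * L).
Proof.
have [k0 L0 d0 d1 K0] := consts_pos; have K2' := K2; move=> t00 tK td hz hy hk.
set h := t0 ^+ 2 / K; set E := expR _; have E0 : 0 < E by exact: expR_gt0.
have h0 : 0 < h by rewrite divr_gt0// exprn_gt0.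
have t04 : t0 < 4^-1.
  have : t0 * 4 <= t0 * (2 * K) by rewrite ler_pM2l//; lra.
  by move: (t0 * (2 * K)) tK => ? ?; lra.
have h2 : h <= t0 / 2.
  rewrite ler_pdivrMr// expr2 mulrAC -mulrA; apply: ler_wpM2l; first exact: ltW.
  by rewrite mulrC; lra.
have t0h : t0 * h <= h by rewrite ler_piMl// ltW//; lra.
have ab : t0 - h <= t0 + h by lra.
have a0 : 0 <= t0 - h by lra.
have bd : t0 + h <= dl by lra.
have t0d : 0 <= t0 <= dl by lra.
have hz' t : t0 - h <= t <= t0 + h -> c t != z by move=> ht; apply: hz; lra.
have h1 : 0 < h <= 1 by lra.
have [ic bc] := core_bound hc ga h1 a0 bd (hz t0 t0d) hy hk.
have ik := CInt_ker a0 bd hz'.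
have mi : measurable (`[t0 - h, t0 + h]%classic : set (measurableTypeR R)) by exact: measurable_itv.
pose w := c t0 - z; set sb := small_bound K t0.
have sb0 : 0 <= sb by exact: small_bound_ge0.
have sE : t0 * sb = E by rewrite /sb /small_bound mulrCA mulfV ?mulr1// gt_eqF.
have F0 : cabs (F t0) <= K * sb.
  by apply: F1 => //; apply: le_lt_trans tK; apply: ler_wpM2l; lra.
pose q t := cderiv c t / (c t - z).
(* The integrand with its regular factors frozen at the nearest parameter. *)
pose P t := c t0 * (F t0) * q t.
have iP : CInt `[t0 - h, t0 + h] P by exact: CInt_Z.
have iD := CInt_B mi ik iP.
have -> : CI `[t0 - h, t0 + h] (ker z) = CI `[t0 - h, t0 + h] P + CI `[t0 - h, t0 + h] (fun t => ker z t - P t).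
  by rewrite -CID//; apply: eq_CI => t _; rewrite addrC subrK.
have ct0 : cabs (c t0) <= L * t0 by have /andP[] := good_arc_bounds ga t0d.
apply: le_trans (cabsD _ _) _.
have p1 : cabs (CI `[t0 - h, t0 + h] P) <= E * (K * L * core_cst).
  rewrite CIZ// cabsM cabsM -sE.
  have e1 := ler_pM (cabs_ge0 _) (cabs_ge0 _) ct0 F0.
  have e2 := ler_pM (mulr_ge0 (cabs_ge0 _) (cabs_ge0 _)) (cabs_ge0 _) e1 bc.
  by apply: le_trans e2 _; rewrite -/core_cst le_eqVlt; apply/orP; left; apply/eqP; ring.
have p2 : cabs (CI `[t0 - h, t0 + h] (fun t => ker z t - P t)) <=
   2 * ((2 * L ^+ 2 * K * sb / (k * t0) + 4 * K * sb * L) * (t0 + h - (t0 - h))).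
  apply: CI_le_cst => // t ht; have htd : 0 <= t <= dl by lra.
  have e1 := hy t htd; have e2 := hk t htd; have e3 := cderiv_le htd.
  have p : 0 < cabs (c t - z) by rewrite cabs_gt0 subr_eq0 hz.
  have cz0 : c t - z != 0 by rewrite subr_eq0 hz.
  (* In the first error the increment of F cancels the singularity. In the second |w| <= |c t - z|
     does, since t0 is the nearest parameter. *)
  have -> : ker z t - P t = c t0 * (F t - F t0) * q t - w * (F t * q t).
    by rewrite /ker /P /q /w; field.
  have FL := F_near (t := t) t00 tK ltac:(lra).
  have td' : `|t - t0| <= h by rewrite ler_norml; lra.
  have cp : close_pair K t t0.
    have tK' : 2 * t0 * K < 1 by rewrite mulrAC mulrC mulrCA mulrC -mulrA (mulrC K).
    have [tp tt] : 0 < t /\ t <= 2 * t0 by split; lra.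
    have t0t : t0 <= 2 * t0 by rewrite ler_peMl ?ler1n// ltW.
    split=> //; [exact: le_lt_trans (ler_wpM2r (ltW K0) tt) tK'|exact: le_lt_trans (ler_wpM2r (ltW K0) t0t) tK'|].
    by rewrite mulrC -ler_pdivlMr.
  have FD := F2 cp; rewrite -/sb in FD FL.
  apply: le_trans (cabsB _ _) _; apply: lerD; rewrite /q !cabsM cabsV.
    have e4 : cabs (cderiv c t) / cabs (c t - z) * rdist t t0 <= L * (2 / k) * (t0 ^+ 2)^-1.
      rewrite /rdist mulrA; apply: ler_wpM2r; first by rewrite invr_ge0 exprn_ge0// ltW.
      rewrite -mulrA; apply: ler_pM => //; rewrite ?cabs_ge0 ?mulr_ge0 ?invr_ge0 ?cabs_ge0//.
      rewrite mulrC ler_pdivrMr// -ler_pdivrMl ?divr_gt0// invf_div.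
      by [].
    have e5 := ler_pM (cabs_ge0 _) (cabs_ge0 _) ct0 FD.
    have q0 : 0 <= cabs (cderiv c t) / cabs (c t - z) by rewrite divr_ge0 ?cabs_ge0.
    have e6 := ler_wpM2r q0 e5.
    apply: le_trans e6 _.
    have e7 : 0 <= L * t0 * (K * sb) by apply: mulr_ge0; apply: mulr_ge0 => //; exact: ltW.
    have := ler_wpM2l e7 e4.
    have -> : L * t0 * (K * sb) * (L * (2 / k) * (t0 ^+ 2)^-1) = 2 * L ^+ 2 * K * sb / (k * t0).
      by field; rewrite !gt_eqF.
    by apply: le_trans; rewrite le_eqVlt; apply/orP; left; apply/eqP; ring.
  have e4 : cabs w / cabs (c t - z) <= 1 by rewrite ler_pdivrMr// mul1r.
  have e5 := ler_pM (cabs_ge0 _) (cabs_ge0 _) FL e3.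
  have w0 : 0 <= cabs w / cabs (c t - z) by apply: divr_ge0; exact: cabs_ge0.
  have := ler_pM w0 (mulr_ge0 (cabs_ge0 _) (cabs_ge0 _)) e4 e5; rewrite mul1r.
  by apply: le_trans; rewrite le_eqVlt; apply/orP; left; apply/eqP; ring.
apply: le_trans (lerD p1 p2) _.
have -> : E * (8 * (L ^+ 2 / k) + K * L * core_cst + 16 * L) =
  E * (K * L * core_cst) + (E * (8 * (L ^+ 2 / k)) + E * (16 * L)) by ring.
rewrite lerD2l.
have -> : t0 + h - (t0 - h) = 2 * (t0 ^+ 2 / K) by rewrite /h; ring.
have -> : 2 * ((2 * L ^+ 2 * K * sb / (k * t0) + 4 * K * sb * L) * (2 * (t0 ^+ 2 / K))) =
   E * (8 * (L ^+ 2 / k)) + E * t0 * (16 * L).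
  by rewrite -sE; field; rewrite !gt_eqF.
rewrite lerD2l; apply: ler_wpM2r; first by apply: mulr_ge0 => //; exact: ltW.
by apply: ler_piMr; [exact: ltW|lra].
Qed.

Lemma integral_N_small e : 0 < e -> exists2 eta, 0 < eta <= dl & \int[mu]_(t in `[0, eta]) N t < e.
Proof.
have [_ _ d0 _ _] := consts_pos; move=> e0.
have iN : mu.-integrable `[0, dl] (EFin \o N) by exact: integrable_N.
have := parameterized_integral_cvg_left d0 iN; move=> /cvgrPdist_lt/(_ e e0) [r /= r0 hr].
exists (Num.min dl (r / 2)); first by rewrite lt_min d0 divr_gt0// ge_min lexx.
set eta := Num.min _ _.
have e1 : 0 < eta by rewrite lt_min d0 divr_gt0.
have e2 : eta < r by rewrite gt_min; apply/orP; right; lra.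
have := hr eta; rewrite /ball_/= !sub0r !normrN gtr0_norm// => /(_ e2).
by apply: le_lt_trans; exact: ler_norm.
Qed.

Lemma osc_factor_small A e : 0 <= A -> 0 < e -> exists2 d, 0 < d <= 1 &
  forall t, 0 < t < d -> expR (ln t / K) * (A + A * `|ln t|) < e.
Proof.
have [_ _ _ _ K0] := consts_pos; move=> A0 e0; have iK : 0 < K^-1 by rewrite invr_gt0.
have A1 : 0 < A + 1 by lra.
have e2 : 0 < e / (2 * (A + 1)) by rewrite divr_gt0// mulr_gt0.
have [d1 /andP[d10 d11] h1] := lnpow_small 0 iK e2; have [d2 /andP[d20 d21] h2] := lnpow_small 1 iK e2.
exists (Num.min d1 d2); first by rewrite lt_min d10 d20 ge_min d11.
move=> t; rewrite lt_min => /andP[t0 /andP[td1 td2]].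
have := h1 t ltac:(by rewrite t0); have := h2 t ltac:(by rewrite t0).
rewrite expr0 expr1 mul1r (mulrC K^-1) => q2 q1.
have -> : expR (ln t / K) * (A + A * `|ln t|) = A * expR (ln t / K) + A * (`|ln t| * expR (ln t / K)) by ring.
have q3 := ler_wpM2l A0 (ltW q1); have q4 := ler_wpM2l A0 (ltW q2).
have : A * (e / (2 * (A + 1))) * 2 < e.
  have -> : A * (e / (2 * (A + 1))) * 2 = e * (A / (A + 1)) by field; rewrite gt_eqF.
  by rewrite gtr_pMr// ltr_pdivrMr// mul1r ltrDl.
by apply: le_lt_trans; rewrite mulr2n mulrDr mulr1; exact: lerD.
Qed.

Lemma middle_bound z t0 : 0 < t0 -> t0 * (2 * K) < 1 -> 3 / 2 * t0 <= dl ->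
  (forall t, 0 <= t <= dl -> c t != z) ->
  (forall t, 0 <= t <= dl -> cabs (c t0 - z) <= cabs (c t - z)) ->
  (forall t, 0 <= t <= dl -> k / 2 * `|t - t0| <= cabs (c t - z)) ->
  cabs z <= L * t0 + cabs (c t0 - z) ->
  cabs (CI `[t0 / 2, 3 / 2 * t0] (ker z)) <= expR (ln t0 / K) *
   ((8 * (L ^+ 2 / k) + K * L * core_cst + 16 * L) + 2 * (8 * K * L * (2 * (L / k) * (K + `|ln t0|) + 1))).
Proof.
have [k0 L0 d0 d1 K0] := consts_pos; move=> t00 tK td hz hy hk zl.
set h := t0 ^+ 2 / K; set E := expR _; have E0 : 0 < E by exact: expR_gt0.
have h0 : 0 < h by rewrite divr_gt0// exprn_gt0.
have h2 : h < t0 / 2.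
  have -> : h = t0 / 2 * (t0 * 2 / K) by rewrite /h; field; rewrite gt_eqF.
  rewrite gtr_pMr ?divr_gt0// ltr_pdivrMr// mul1r.
  have := K2; have : t0 * 4 <= t0 * (2 * K) by rewrite ler_pM2l//; have := K2; lra.
  move: tK; move: (t0 * (2 * K)) => ? ? ?; lra.
(* The side zones reach from distance t0^2 / K to t0 / 2; the ratio K / (2 t0) is the source of the
   single logarithm of t0. *)
have lnh : ln (t0 / 2) - ln h <= K + `|ln t0|.
  have t02 : 0 < t0 / 2 by rewrite divr_gt0.
  rewrite -ln_div ?posrE//.
  have -> : t0 / 2 / h = K / 2 / t0 by rewrite /h; field; rewrite !gt_eqF.
  rewrite ln_div ?posrE ?divr_gt0//.
  have lK : ln (K / 2) <= K.
    apply: le_trans (ltW (ln_sublinear _)) _; first by rewrite divr_gt0.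
    by rewrite ler_pdivrMr//; move: K0; lra.
  have := ler_norm (- ln t0); rewrite normrN; lra.
have b0 : 0 <= t0 / 2 by rewrite divr_ge0// ltW.
have iab : CInt `[t0 / 2, 3 / 2 * t0] (ker z).
  by apply: CInt_ker => // t ht; apply: hz; lra.
have s1 := CI_split (a := t0 / 2) (c := t0 - h) (b := 3 / 2 * t0) ltac:(lra) ltac:(lra) iab.
have i2 : CInt `[t0 - h, 3 / 2 * t0] (ker z) by apply: CInt_subitv iab; lra.
have s2 := CI_split (a := t0 - h) (c := t0 + h) (b := 3 / 2 * t0) ltac:(lra) ltac:(lra) i2.
rewrite s1 s2.
have c1 := core_part t00 tK td hz hy hk.
have neg t : t0 / 2 <= t <= t0 - h -> 0 < -1 * (t - t0) by lra.
have posi t : t0 + h <= t <= 3 / 2 * t0 -> 0 < 1 * (t - t0) by lra.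
have m1 := @mid_part z t0 (t0 / 2) (t0 - h) (-1) t00 tK (lexx _) ltac:(lra) ltac:(lra) ltac:(lra) hz hy hk zl neg ltac:(by rewrite normrN1).
have m2 := @mid_part z t0 (t0 + h) (3 / 2 * t0) 1 t00 tK ltac:(lra) ltac:(lra) ltac:(lra) ltac:(lra) hz hy hk zl posi (normr1 _).
have r1 : -1 * (ln (-1 * (t0 - h - t0)) - ln (-1 * (t0 / 2 - t0))) <= K + `|ln t0|.
  have -> : -1 * (t0 - h - t0) = h by ring.
  have -> : -1 * (t0 / 2 - t0) = t0 / 2 by field.
  by rewrite mulN1r opprB.
have r2 : 1 * (ln (1 * (3 / 2 * t0 - t0)) - ln (1 * (t0 + h - t0))) <= K + `|ln t0|.
  have -> : 1 * (3 / 2 * t0 - t0) = t0 / 2 by field.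
  have -> : 1 * (t0 + h - t0) = h by ring.
  by rewrite mul1r.
have len x : x <= t0 -> x / t0 <= 1 by move=> hx; rewrite ler_pdivrMr// mul1r.
have l1 := len (t0 - h - t0 / 2) ltac:(lra); have l2 := len (3 / 2 * t0 - (t0 + h)) ltac:(lra).
have pc : 0 <= 2 * (L / k) by rewrite mulr_ge0// divr_ge0// ltW.
have pK : 0 <= 4 * K * L * E by rewrite !mulr_ge0// ltW.
have fin x y : x <= K + `|ln t0| -> y <= 1 ->
  2 * (4 * K * L * E * (2 * (L / k) * x + y)) <= E * (8 * K * L * (2 * (L / k) * (K + `|ln t0|) + 1)).
  move=> hx hy'.
  have -> : E * (8 * K * L * (2 * (L / k) * (K + `|ln t0|) + 1)) =
    2 * (4 * K * L * E * (2 * (L / k) * (K + `|ln t0|) + 1)) by ring.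
  by apply: ler_wpM2l => //; apply: ler_wpM2l => //; apply: lerD => //; exact: ler_wpM2l.
have {}m1 := le_trans m1 (fin _ _ r1 l1); have {}m2 := le_trans m2 (fin _ _ r2 l2).
apply: le_trans (cabsD _ _) _; apply: le_trans (lerD (lexx _) (cabsD _ _)) _.
apply: le_trans (lerD m1 (lerD c1 m2)) _.
by rewrite -/E le_eqVlt; apply/orP; left; apply/eqP; ring.
Qed.

End ArcCauchyIntegral.

Section ArcSmall.
Context {R : realType}.
Implicit Types (s t a b h x y e eta : R) (z u v w : Cx R).
Local Notation mu := (@lebesgue_measure R).

Lemma Rint_mono_itv a b a' b' (f : R -> R) : a' <= a -> a <= b -> b <= b' -> (forall t, 0 <= f t) ->
  mu.-integrable `[a', b'] (EFin \o f) ->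
  \int[mu]_(t in `[a, b]) f t <= \int[mu]_(t in `[a', b']) f t.
Proof.
move=> aa ab bb f0 fi.
have i2 : mu.-integrable `[a, b'] (EFin \o f).
  by apply: integrableS fi => //; apply: subset_itvScc; rewrite bnd_simp.
rewrite (Rint_split aa (le_trans ab bb) fi) (Rint_split ab bb i2).
have p x y : 0 <= \int[mu]_(t in `[x, y]) f t by apply: Rintegral_ge0.
by rewrite addrCA lerDl addr_ge0.
Qed.

Lemma far_pointwise k L t0 t y (z u : R) : 0 < k -> 0 < L -> k / 2 * `|t - t0| <= u ->
  t0 <= 2 * `|t - t0| -> y <= u -> z <= L * t0 + y -> z <= (4 * (L / k) + 1) * u.
Proof.
move=> k0 L0 f2 f3 f1 zl.
have f4 : L * t0 <= 4 * (L / k) * u.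
  have -> : L * t0 = 4 * (L / k) * (k / 2 * (t0 / 2)) by field; rewrite gt_eqF.
  apply: ler_wpM2l; first by rewrite mulr_ge0// divr_ge0// ltW.
  apply: le_trans f2; apply: ler_wpM2l; first by rewrite divr_ge0// ltW.
  by lra.
by rewrite mulrDl mul1r; lra.
Qed.

Lemma middle_consts (A1 A2 P Q x : R) : 0 <= A2 -> 0 <= P -> 0 <= Q -> 0 <= x ->
  A1 + 2 * (P + A2 * x + 8 * Q) <=
  (`|A1| + 2 * P + 16 * Q + 2 * A2) + (`|A1| + 2 * P + 16 * Q + 2 * A2) * x.
Proof.
move=> A20 P0 Q0 x0; set B := _ + 2 * A2.
have q1 : 2 * A2 * x <= B * x by apply: ler_wpM2r => //; have := normr_ge0 A1; rewrite /B; lra.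
have q2 : A1 + 2 * P + 16 * Q <= B by have := ler_norm A1; rewrite /B; lra.
have -> : A1 + 2 * (P + A2 * x + 8 * Q) = A1 + 2 * P + 16 * Q + 2 * A2 * x by ring.
exact: lerD.
Qed.

Lemma outer_pointwise k eta t (z u ct : R) : 0 < k -> 0 < eta -> 0 <= z -> k * t <= ct -> eta <= t ->
  z <= k * eta / 2 -> ct - z <= u -> z <= 2 * z / (k * eta) * u.
Proof.
move=> k0 e0 z0 h1 te z1 h3; have ke := mulr_gt0 k0 e0.
have h2 : k * eta <= k * t by rewrite ler_pM2l.
have h4 : k * eta / 2 <= u by lra.
have -> : 2 * z / (k * eta) * u = z * (u / (k * eta / 2)) by field; rewrite !gt_eqF.
by apply: ler_peMr => //; rewrite ler_pdivlMr ?mul1r// divr_gt0.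
Qed.

Lemma far_left t t0 : t <= t0 / 2 -> t0 <= 2 * `|t - t0|.
Proof. by move=> h; have := ler_norm (t0 - t); rewrite distrC; lra. Qed.

Lemma far_right t t0 : 3 / 2 * t0 <= t -> t0 <= 2 * `|t - t0|.
Proof. by move=> h; have := ler_norm (t - t0); lra. Qed.

Lemma quarters t0 eta : 0 < t0 -> t0 < eta / 2 ->
  [/\ t0 / 2 <= eta, t0 / 2 <= 3 / 2 * t0 & 3 / 2 * t0 <= eta].
Proof. by move=> h1 h2; split; lra. Qed.

(** [eta] comes from absolute integrability alone, before z is given; then k t0 <= 2 |z| makes t0 as
    small as desired. The budget is e/8 for each of the far pieces of [0, eta], e/4 for the middle
    and e/4 beyond [eta]. *)
Lemma arc_small (c F : R -> Cx R) (k L dl e : R) : C2c c -> good_arc c k L dl -> nice F ->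
  CInt `[0, dl] (fun t => F t * cderiv c t) -> 0 < e ->
  exists2 rho, 0 < rho & forall z, cabs z < rho -> (forall t, 0 <= t <= dl -> c t != z) ->
    CInt `[0, dl] (fun t => z * (F t * cderiv c t / (c t - z))) /\
    cabs (CI `[0, dl] (fun t => z * (F t * cderiv c t / (c t - z)))) <= e.
Proof.
move=> hc ga [K K2 [F1 F2]] iF e0.
have [k0 L0 d0 d1 K0] := consts_pos ga K2.
pose N t := norm1 (F t * cderiv c t).
pose C1 := 4 * (L / k) + 1; have C10 : 0 < C1 by rewrite ltr_wpDl// mulr_ge0// divr_ge0// ltW.
pose A1 := 8 * (L ^+ 2 / k) + K * L * core_cst k L + 16 * L.
pose A2 := 8 * K * L * (2 * (L / k)).
pose A := `|A1| + 2 * (A2 * K) + 16 * (K * L) + 2 * A2.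
have [k0' L0' K0'] : [/\ 0 <= k, 0 <= L & 0 <= K] by split; exact: ltW.
have p1 : 0 <= A2.
  apply: mulr_ge0; first by apply: mulr_ge0 => //; exact: mulr_ge0.
  by apply: mulr_ge0 => //; exact: divr_ge0.
have p2 : 0 <= A2 * K by rewrite mulr_ge0// ltW.
have p3 : 0 <= K * L by rewrite mulr_ge0// ltW.
have A0 : 0 <= A.
  by rewrite /A; apply: addr_ge0; [apply: addr_ge0; [apply: addr_ge0|]|] => //; exact: mulr_ge0.
(* On the far pieces |z| <= C1 |c t - z|, and the bound 2 C1 times this amount is e/8. *)
have e8 : 0 < e / (16 * C1) by rewrite divr_gt0// mulr_gt0.
have [eta /andP[eta0 etad] hN] := integral_N_small ga K2 iF e8.
have e4 : 0 < e / 4 by rewrite divr_gt0.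
have [d2 /andP[d20 d21] hA] := osc_factor_small ga K2 A0 e4.
pose IN := \int[mu]_(t in `[0, dl]) N t.
have IN0 : 0 <= IN by apply: Rintegral_ge0 => t _; exact: norm1_ge0.
(* d3 bounds the parameter nearest to z *)
pose d3 := Num.min (Num.min d2 (eta / 2)) (2 * K)^-1.
have d30 : 0 < d3 by rewrite !lt_min d20 divr_gt0//= invr_gt0 mulr_gt0.
(* For |z| below [r1], the arc beyond [eta] stays at distance at least k eta / 2 from z; [r2] then
   makes its contribution at most e/4. *)
pose r1 := k * eta / 2; have r10 : 0 < r1 by rewrite divr_gt0// mulr_gt0.
pose r2 := e * (k * eta) / (16 * (IN + 1)).
have r20 : 0 < r2 by rewrite divr_gt0 ?mulr_gt0//; lra.
exists (Num.min (Num.min r1 r2) (k * d3 / 2)).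
  by rewrite !lt_min r10 r20 divr_gt0// mulr_gt0.
move=> z; rewrite !lt_min => /andP[/andP[z1 z2] z3] hz.
have iker a b : 0 <= a -> b <= dl -> CInt `[a, b] (fun t => z * (F t * cderiv c t / (c t - z))).
  move=> a0 bd; apply: (CInt_ker ga iF a0 bd) => t /andP[h1 h2]; apply: hz.
  by rewrite (le_trans a0 h1) (le_trans h2 bd).
split; first exact: iker.
have kle a b M := @ker_le_cst R c F k L dl ga iF z a b M.
have [t0 [t0d hy hk [kt0 zl]]] := near_point ga K2 hz.
have t03 : t0 < d3 by rewrite -(ltr_pM2l k0); apply: le_lt_trans kt0 _; rewrite mulrC -ltr_pdivlMr.
have [t02 t0e t0K] : [/\ t0 < d2, t0 < eta / 2 & t0 * (2 * K) < 1].
  move: t03; rewrite !lt_min => /andP[/andP[-> ->]] h; split=> //.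
  by rewrite -ltr_pdivlMr ?mulr_gt0// mul1r.
have iN a b : 0 <= a -> b <= dl -> mu.-integrable `[a, b] (EFin \o N).
  by move=> a0 bd; exact: (integrable_N iF a0 bd).
have N0 t : 0 <= N t by exact: norm1_ge0.
have far a b : 0 <= a -> a <= b -> b <= eta -> (forall t, a <= t <= b -> t0 <= 2 * `|t - t0|) ->
   cabs (CI `[a, b] (fun t => z * (F t * cderiv c t / (c t - z)))) <= e / 8.
  move=> a0 ab be ht0; have bd : b <= dl by exact: le_trans etad.
  have hd t : a <= t <= b -> 0 <= t <= dl.
    by move=> /andP[h1 h2]; rewrite (le_trans a0 h1) (le_trans h2 bd).
  apply: le_trans (kle a b C1 a0 bd _ _) _ => [t /hd/hz//|t ht|].
    exact: (far_pointwise k0 L0 (hk t (hd t ht)) (ht0 t ht) (hy t (hd t ht)) zl).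
  have -> : e / 8 = 2 * (C1 * (e / (16 * C1))) by field; rewrite gt_eqF.
  apply: ler_wpM2l => //; apply: ler_wpM2l; first exact: ltW.
  by apply: le_trans (ltW hN); apply: Rint_mono_itv (iN 0 eta (lexx 0) etad).
have out : cabs (CI `[eta, dl] (fun t => z * (F t * cderiv c t / (c t - z)))) <= e / 4.
  have [ke bd] := (mulr_gt0 k0 eta0, lexx dl).
  have hd t : eta <= t <= dl -> 0 <= t <= dl.
    by move=> /andP[h1 ->]; rewrite (le_trans (ltW eta0) h1).
  apply: le_trans (kle eta dl (2 * cabs z / (k * eta)) (ltW eta0) bd _ _) _ => [t /hd/hz//|t ht|].
    have /andP[h1 _] := good_arc_bounds ga (hd t ht); have /andP[te _] := ht.
    exact: (outer_pointwise k0 eta0 (cabs_ge0 z) h1 te (ltW z1) (cabs_sub _ _)).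
  have f1 : \int[mu]_(t in `[eta, dl]) N t <= IN + 1.
    apply: (@le_trans _ _ IN); last by rewrite lerDl.
    by apply: Rint_mono_itv (iN 0 dl (lexx 0) bd) => //; exact: ltW.
  have q0 : 0 <= 2 * cabs z / (k * eta).
    by apply: divr_ge0; [apply: mulr_ge0 => //; exact: cabs_ge0|exact: ltW].
  have IN1 : 0 < IN + 1 by rewrite ltr_wpDl.
  have -> : e / 4 = 2 * (2 * r2 / (k * eta) * (IN + 1)).
    by rewrite /r2; field; rewrite !gt_eqF.
  apply: ler_wpM2l => //; apply: ler_pM => //.
    by apply: Rintegral_ge0 => t _; exact: norm1_ge0.
  by apply: ler_wpM2r; [rewrite invr_ge0 ltW|rewrite ler_pM2l// ltW].
have t00 : 0 <= t0 by case/andP: t0d.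
have eta2 := ltW eta0.
rewrite (CI_split eta2 etad (iker 0 dl (lexx 0) (lexx dl))).
apply: le_trans (cabsD _ _) _.
suff inner : cabs (CI `[0, eta] (fun t => z * (F t * cderiv c t / (c t - z)))) <= e / 2.
  by have -> : e = e / 2 + e / 4 + e / 4 by [field]; rewrite -addrA; apply: lerD => //; apply: le_trans out _; rewrite lerDl ltW.
(* If the origin is the nearest point, all of [0, eta] counts as far and there is no middle zone. *)
have [t0z|t0n] := eqVneq t0 0.
  apply: le_trans (far 0 eta (lexx 0) eta2 (lexx _) _) _; last by rewrite ler_pM2l// lef_pV2 ?posrE ?ler_nat.
  by move=> t _; rewrite t0z mulr_ge0.
have tp : 0 < t0 by rewrite lt_def t0n.
have i0 := iker 0 eta (lexx 0) etad.
have g1 : 0 <= t0 / 2 by rewrite divr_ge0.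
have [g2 g3 g4] := quarters tp t0e.
have i1 := iker (t0 / 2) eta g1 etad.
rewrite (CI_split g1 g2 i0) (CI_split g3 g4 i1).
have m1 := middle_bound hc ga K2 F1 F2 iF tp t0K (le_trans g4 etad) hz hy hk zl.
have m2 : cabs (CI `[t0 / 2, 3 / 2 * t0] (fun t => z * (F t * cderiv c t / (c t - z)))) <= e / 4.
  apply: le_trans m1 _; apply: le_trans (ltW (hA t0 _)); last by rewrite tp.
  apply: ler_wpM2l; first exact: expR_ge0.
  rewrite -/A1.
  have -> : 8 * K * L * (2 * (L / k) * (K + `|ln t0|) + 1) = A2 * K + A2 * `|ln t0| + 8 * (K * L).
    by rewrite /A2; ring.
  exact: middle_consts.
have f1 : cabs (CI `[0, t0 / 2] (fun t => z * (F t * cderiv c t / (c t - z)))) <= e / 8.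
  by apply: far => // t /andP[_ h]; exact: far_left.
have f2 : cabs (CI `[3 / 2 * t0, eta] (fun t => z * (F t * cderiv c t / (c t - z)))) <= e / 8.
  apply: far => //; first exact: le_trans g3.
  by move=> t /andP[h _]; exact: far_right.
apply: le_trans (cabsD _ _) _; apply: le_trans (lerD f1 (cabsD _ _)) _.
have -> : e / 2 = e / 8 + (e / 4 + e / 8) by field.
by rewrite lerD2l; exact: lerD.
Qed.

End ArcSmall.

Section EndpointChange.
Context {R : realType}.
Local Notation mu := (@lebesgue_measure R).
Implicit Types (a b d s t e : R).

(** At the base point the integrand on the loop and the one on its C^2 piece may differ: [W 0] is
    unspecified and [cderiv g] is a two-sided derivative there. *)
Lemma Rint_except_left a b (f h : R -> R) : (forall t, a < t <= b -> f t = h t) ->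
  mu.-integrable `[a, b] (EFin \o f) ->
  mu.-integrable `[a, b] (EFin \o h) /\
  \int[mu]_(t in `[a, b]) f t = \int[mu]_(t in `[a, b]) h t.
Proof.
move=> fh fi.
have fh' : {in `]a, b]%classic, (EFin \o f) =1 (EFin \o h)}.
  by move=> t; rewrite inE/= in_itv/= => ht; rewrite /= fh.
have mo : measurable (`]a, b]%classic : set (measurableTypeR R)) by exact: measurable_itv.
have fo : mu.-integrable `]a, b] (EFin \o f).
  by apply: integrableS fi => //; apply: subset_itvr; rewrite bnd_simp.
have ho : mu.-integrable `]a, b] (EFin \o h) by exact: (@eq_integrable _ (measurableTypeR R) R mu _ mo _ _ fh' fo).
split.
  have /integrableP[m1 m2] := ho; apply/integrableP; split.
    exact/emeasurable_fun_itv_obnd_cbndP.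
  rewrite -integral_itv_obnd_cbnd//; exact: measurableT_comp.
rewrite -!(@Rintegral_itv_obnd_cbnd R a (BRight b))//.
by apply: eq_Rintegral => t /fh' [].
Qed.

Lemma CI_except_left a b (f h : R -> Cx R) : (forall t, a < t <= b -> f t = h t) ->
  CInt `[a, b] f -> CInt `[a, b] h /\ CI `[a, b] f = CI `[a, b] h.
Proof.
move=> fh [f1 f2].
have [h1 e1] := Rint_except_left (f := Re \o f) (h := Re \o h) (fun t ht => congr1 Re (fh t ht)) f1.
have [h2 e2] := Rint_except_left (f := Im \o f) (h := Im \o h) (fun t ht => congr1 Im (fh t ht)) f2.
by split; [split|apply: eq_cx].
Qed.

Lemma C2_reflect (f : R -> R) : C2 f -> C2 (fun t => f (1 - t)) /\
  forall t, derive1 (fun t => f (1 - t)) t = - derive1 f (1 - t).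
Proof.
have dr t : is_derive t 1 (fun t => 1 - t) (-1 : R).
  have -> : (fun t => 1 - t) = (cst (1 : R) - @id R) by apply/funext.
  have h1 : is_derive t 1 (cst (1 : R)) 0 by exact: is_derive_cst.
  have h2 : is_derive t 1 (@id R) 1 by exact: is_derive_id.
  by apply: (is_derive_eq (is_deriveB h1 h2)); rewrite sub0r.
have H (h dh : R -> R) : (forall t, is_derive t 1 h (dh t)) ->
   forall t, is_derive t 1 (fun t => h (1 - t)) (- dh (1 - t)).
  move=> hh t; have h3 := @is_derive1_comp _ h (fun t => 1 - t) _ _ _ (hh (1 - t)) (dr t).
  by apply: is_derive_eq h3 _; rewrite mulrN1.
move=> /C2_derive[h1 h2 h3].
have d1 t := H _ _ h1 t; have d2 t := H _ _ h2 t.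
have e1 : derive1 (fun t => f (1 - t)) = fun t => - derive1 f (1 - t).
  by apply/funext => t; rewrite derive1E; apply: derive_val.
have dn t : is_derive t 1 (fun t => - derive1 f (1 - t)) (derive1n 2 f (1 - t)).
  by have h := d2 t; apply: (is_derive_eq (is_deriveN h)); rewrite opprK.
have e2 : derive1n 2 (fun t => f (1 - t)) = fun t => derive1n 2 f (1 - t).
  by apply/funext => t; rewrite -[LHS]/(derive1 (derive1 (fun t => f (1 - t))) t) e1 derive1E; have h := dn t; apply: derive_val.
split=> [|t]; last by rewrite e1.
split=> [t|t|].
- by have h := d1 t; exact: ex_derive.
- by rewrite e1; have h := dn t; exact: ex_derive.
- rewrite e2 => t; apply: (@continuous_comp _ _ _ (fun t => 1 - t) (derive1n 2 f)); last exact: h3.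
  by have h := dr t; apply/differentiable_continuous/derivable1_diffP; exact: ex_derive.
Qed.

Lemma C2c_reflect (c : R -> Cx R) : C2c c -> C2c (fun t => c (1 - t)) /\
  forall t, cderiv (fun t => c (1 - t)) t = - cderiv c (1 - t).
Proof.
move=> [/C2_reflect[h1 e1] /C2_reflect[h2 e2]]; split=> // t.
by apply: eq_cx; rewrite ?ReN ?ImN; [exact: e1|exact: e2].
Qed.

End EndpointChange.

Section BesselSums.
Context {R : realType}.
Local Notation mu := (@lebesgue_measure R).
Local Notation triple := (Cx R * Cx R * nat)%type.
Local Notation bessel := (seq (triple * {k : Cx R -> Cx R | entire k})).
Implicit Types (s : bessel) (z l : Cx R) (a b d t e : R).

Definition bessel_sum s z l := \sum_(x <- s) sval x.2 z * bterm x.1 z l.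

Lemma bessel_normal s : exists T Phi, normalized T Phi /\
  forall z l, cexp l = z -> normal_sum T Phi z l = bessel_sum s z l.
Proof.
elim: s => [|x s [T [Phi [nT hT]]]].
  by exists [::], (fun _ _ => 0); split=> // z l _; rewrite /normal_sum /bessel_sum !big_nil.
have [T' [Phi' [nT' hT']]] := normal_insert erefl nT x.1 (proj2_sig x.2).
by exists T', Phi'; split=> // z l lz; rewrite hT'// hT// /bessel_sum big_cons addrC.
Qed.

Lemma bessel_sum_cat s1 s2 z l : bessel_sum (s1 ++ s2) z l = bessel_sum s1 z l + bessel_sum s2 z l.
Proof. by rewrite /bessel_sum big_cat. Qed.

Lemma entireM (h k : Cx R -> Cx R) : entire h -> entire k -> entire (fun z => h z * k z).
Proof. by move=> hh hk z; exact: derivableM (hh z) (hk z). Qed.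

Lemma bessel_sum_mul (h : Cx R -> Cx R) s : entire h -> exists s',
  forall z l, bessel_sum s' z l = h z * bessel_sum s z l.
Proof.
move=> eh; exists [seq (x.1, exist _ _ (entireM eh (proj2_sig x.2))) | x <- s] => z l.
by rewrite /bessel_sum big_map big_distrr/=; apply: eq_bigr => x _; rewrite mulrA.
Qed.

(** [dl] is chosen before e, so that the rest of the loop is cut off at a fixed parameter, away from
    the origin. *)
Lemma germ_small (c : R -> Cx R) d (lg f : Cx R -> Cx R) s : C2c c -> c 0 = 0 -> cderiv c 0 != 0 ->
  0 < d <= 1 -> (forall a b, 0 < a -> b <= d -> cont_in a b (fun t => lg (c t))) ->
  (forall t, 0 < t <= d -> cexp (lg (c t)) = c t) ->
  (forall t, 0 < t <= d -> f (c t) = bessel_sum s (c t) (lg (c t))) ->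
  CInt `[0, d] (fun t => f (c t) * cderiv c t) ->
  exists2 dl, 0 < dl <= d & forall e, 0 < e -> exists2 rho, 0 < rho &
    forall z, cabs z < rho -> (forall t, 0 <= t <= dl -> c t != z) ->
      CInt `[0, dl] (fun t => z * (f (c t) * cderiv c t / (c t - z))) /\
      cabs (CI `[0, dl] (fun t => z * (f (c t) * cderiv c t / (c t - z)))) <= e.
Proof.
move=> hc c0 c1 /andP[d0 d1] cl el fE iF.
have [k [L [dl0 ga0]]] := good_arc_ex hc c0 c1.
have [k0 L0 /andP[dl00 dl01] _ _] := ga0.
pose dl := Num.min d dl0.
have dlp : 0 < dl by rewrite lt_min d0.
have [dld dldl] : dl <= d /\ dl <= dl0 by rewrite !ge_min !lexx orbT.
have ga : good_arc c k L dl by apply: (good_arc_sub _ ga0); rewrite dlp.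
have [T [Phi [nT hT]]] := bessel_normal s.
have sub t : 0 < t < dl -> 0 < t <= d.
  by move=> /andP[h1 h2]; rewrite h1 (le_trans (ltW h2)).
have nE t : 0 < t < dl -> normal_sum T Phi (c t) (lg (c t)) = f (c t).
  by move=> /sub ht; rewrite hT ?fE// el.
have cl' a b : 0 < a -> b < dl -> cont_in a b (fun t => lg (c t)).
  by move=> a0 bd; apply: cl => //; exact: le_trans (ltW bd) dld.
have el' t : 0 < t < dl -> cexp (lg (c t)) = c t by move=> /sub; exact: el.
have iF' : CInt `[0, dl] (fun t => f (c t) * cderiv c t) by apply: CInt_subitv iF.
(* |c'| >= k transfers the absolute integrability of f c' to f itself. *)
pose B t := k^-1 * norm1 (f (c t) * cderiv c t).
have mi : measurable (`[0, dl]%classic : set (measurableTypeR R)) by exact: measurable_itv.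
have iB : mu.-integrable `[0, dl] (EFin \o B).
  by have := Rint_Z mi k^-1 (integrable_norm1 mi iF').
have ki : 0 <= k^-1 by rewrite invr_ge0 ltW.
have B0 t : 0 <= B t by rewrite mulr_ge0// norm1_ge0.
have dl1 : 0 < dl <= 1 by rewrite dlp (le_trans dldl).
have bnd t : 0 < t < dl -> cabs (normal_sum T Phi (c t) (lg (c t))) <= B t.
  move=> ht; rewrite nE// /B mulrC ler_pdivlMr//.
  apply: le_trans (cabs_le_norm1 _); rewrite cabsM; apply: ler_wpM2l; first exact: cabs_ge0.
  case: ga => _ _ _ _ [_ h _].
  have ht' : 0 <= t <= dl by case/andP: ht => h1 h2; rewrite !ltW.
  by have /andP[] := h t ht'.
have good := arc_terms_good hc ga c1 cl' el' nT dl1 iB B0 bnd.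
have nF : nice (fun t => f (c t)).
  by apply: (nice_ext dlp nE); exact: (nice_normal_sum hc ga cl' el' c1 nT good).
exists dl; first by rewrite dlp.
by move=> e e0; exact: (arc_small hc ga nF iF' e0).
Qed.

End BesselSums.

(** * The Cauchy integral over the whole loop near its base point *)

Section LoopCauchy.
Context {R : realType} (g : R -> Cx R).
Local Notation mu := (@lebesgue_measure R).
Local Notation triple := (Cx R * Cx R * nat)%type.
Local Notation bessel := (seq (triple * {k : Cx R -> Cx R | entire k})).
Implicit Types (s : bessel) (z w l : Cx R) (a b d t e : R) (f : Cx R -> Cx R).

Definition cauchy f z := cint g (fun w => (w - z)^-1 * f w).

Context (hg : loop_at_origin g).

Lemma inv_loop_cont a b z : 0 <= a -> b <= 1 -> (forall t, a <= t <= b -> g t != z) ->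
  cont_in a b (fun t => (g t - z)^-1).
Proof.
move=> a0 b1 hz.
apply: (@cont_in_comp _ a b (fun w => (w - z)^-1) g) (cont_in_sub a0 b1 (loop_cont hg)) _ => t ht.
by apply: inv_continuous; exact: hz.
Qed.

Lemma off_trace_neq z t : ~ trace g z -> 0 <= t <= 1 -> g t != z.
Proof. by move=> nz ht; apply/eqP => e; apply: nz; rewrite -e; exact: trace_pt. Qed.

Lemma CInt_cauchy f z : cintegrable g f -> ~ trace g z ->
  CInt `[0, 1] (fun t => (g t - z)^-1 * (f (g t) * cderiv g t)).
Proof.
move=> hf nz; have [d d0 hd] := trace_dist hg nz.
have ci : cont_in 0 1 (fun t => (g t - z)^-1) by apply: inv_loop_cont => // t; exact: off_trace_neq.
apply: (@CInt_M _ `[0, 1] (measurable_itv _) d^-1 _ _ (cont_in_cmeas ci)) => [t|]; last exact: hf.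
by rewrite /= in_itv/= => ht; rewrite cabsV lef_pV2 ?posrE ?hd// (lt_le_trans d0)// hd.
Qed.

Lemma cauchyE f z : cauchy f z = CI `[0, 1] (fun t => (g t - z)^-1 * (f (g t) * cderiv g t)).
Proof. by apply: eq_CI => t _; rewrite /pullback mulrA. Qed.

Lemma inner_trace t : 0 < t < 1 -> trace g (g t) /\ g t != 0.
Proof. by move=> ht; split; [apply: trace_pt; lra|exact: (loop_neq0 hg ht)]. Qed.

Lemma log_cont lg a b : log_branch g lg -> 0 < a -> b < 1 -> cont_in a b (fun t => lg (g t)).
Proof.
move=> [_ cl] a0 b1 x hx e e0.
have in0 t : 0 < t < 1 -> (trace g `\ 0) (g t).
  by move=> /inner_trace[h1 /eqP h2].
have gx : (trace g `\ 0) (g x) by apply: in0; lra.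
have /subspace_continuousP/(_ (g x) gx)/cx_withinP/(_ e e0)[d d0 hd] := cl.
have hx' : 0 <= x <= 1 by lra.
have [r r0 hr] := loop_cont hg hx' d0; exists r => // y hy yx.
by apply: hd; [apply: hr => //; lra|apply: in0; lra].
Qed.

Lemma eq_cont_in a b (u v : R -> Cx R) : (forall t, a <= t <= b -> u t = v t) ->
  cont_in a b u -> cont_in a b v.
Proof.
move=> uv h x hx e e0; have [d d0 hd] := h x hx e e0; exists d => // y hy yx.
by rewrite -!uv//; exact: hd.
Qed.

Lemma germ_at_start lg f s : log_branch g lg ->
  (forall z, trace g z -> z != 0 -> f z = bessel_sum s z (lg z)) -> cintegrable g f ->
  exists2 dl, 0 < dl <= 4^-1 & forall e, 0 < e -> exists2 rho, 0 < rho & forall z, cabs z < rho ->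
    ~ trace g z -> cabs (CI `[0, dl] (fun t => z * ((g t - z)^-1 * (f (g t) * cderiv g t)))) <= e.
Proof.
move=> hl fE iF; have [d [c [/andP[d0 d1] hc gc c1]]] := curve_start (loop_C2 hg).
have c0 : c 0 = 0 by rewrite -gc ?(loop_start hg)// lexx ltW.
(* With a quarter of the arc, the closed parameter interval stays strictly inside the piece, where
   [cderiv g] is the derivative of the piece, and the arcs at the two ends of the loop do not
   overlap. *)
have d2 : 0 < d / 4 <= 1 by lra.
have gc2 t : 0 <= t <= d / 4 -> g t = c t by move=> ht; apply: gc; lra.
have gc2' t : 0 < t <= d / 4 -> g t = c t by move=> ht; apply: gc; lra.
have dc t : 0 < t <= d / 4 -> cderiv g t = cderiv c t.
  by move=> ht; apply: (@cderiv_eq _ g c 0 d) gc; lra.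
have tr t : 0 < t <= d / 4 -> trace g (c t) /\ c t != 0.
  by move=> ht; rewrite -gc2'//; apply: inner_trace; lra.
have cl a b : 0 < a -> b <= d / 4 -> cont_in a b (fun t => lg (c t)).
  move=> a0 bd; have b1 : b < 1 by lra.
  by apply: eq_cont_in (log_cont hl a0 b1) => t ht; rewrite gc2'//; lra.
have el t : 0 < t <= d / 4 -> cexp (lg (c t)) = c t.
  by move=> /tr[h1 h2]; exact: hl.1.
have fE' t : 0 < t <= d / 4 -> f (c t) = bessel_sum s (c t) (lg (c t)).
  by move=> /tr[h1 h2]; exact: fE.
have iF' : CInt `[0, d / 4] (fun t => f (c t) * cderiv c t).
  have i0 : CInt `[0, d / 4] (pullback g f).
    by apply: (@CInt_subitv _ 0 1 0 (d / 4) (pullback g f)) iF; lra.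
  have E0 t : 0 < t <= d / 4 -> pullback g f t = f (c t) * cderiv c t.
    by move=> ht; rewrite /pullback gc2'// dc.
  by have [] := CI_except_left E0 i0.
have [dl /andP[dl0 dld] h] := germ_small hc c0 c1 d2 cl el fE' iF'.
exists dl; first by rewrite dl0; lra.
move=> e e0; have [rho rho0 hr] := h e e0; exists rho => // z zr nz.
have nz' t : 0 <= t <= dl -> c t != z.
  by move=> ht; rewrite -gc2; [apply: off_trace_neq => //; lra|lra].
have [i1 b1] := hr z zr nz'.
have E t : 0 < t <= dl -> z * (f (c t) * cderiv c t / (c t - z)) = z * ((g t - z)^-1 * (f (g t) * cderiv g t)).
  move=> /andP[h1 h2]; have ht : 0 < t <= d / 4 by rewrite h1 (le_trans h2).
  by rewrite gc2'// dc// (mulrC (_ - _)^-1).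
by have [_ <-] := CI_except_left E i1.
Qed.

(** Reflection turns the arc arriving at 0 into one leaving it, so [germ_small] applies again. *)
Lemma germ_at_end lg f s : log_branch g lg ->
  (forall z, trace g z -> z != 0 -> f z = bessel_sum s z (lg z)) -> cintegrable g f ->
  exists2 dl, 0 < dl <= 4^-1 & forall e, 0 < e -> exists2 rho, 0 < rho & forall z, cabs z < rho ->
    ~ trace g z -> cabs (CI `[1 - dl, 1] (fun t => z * ((g t - z)^-1 * (f (g t) * cderiv g t)))) <= e.
Proof.
move=> hl fE iF; have [d [c' [/andP[d0 d1] hc' gc c1']]] := curve_end (loop_C2 hg).
have [hc dcE] := C2c_reflect hc'; pose c t := c' (1 - t).
have c0 : c 0 = 0 by rewrite /c subr0 -gc ?(loop_stop hg)// lexx; lra.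
have c1 : cderiv c 0 != 0 by rewrite dcE oppr_eq0 subr0.
have d2 : 0 < d / 4 <= 1 by lra.
have gc2 t : 0 <= t <= d / 4 -> g (1 - t) = c t by move=> ht; apply: gc; lra.
have gc2' t : 0 < t <= d / 4 -> g (1 - t) = c t by move=> ht; apply: gc; lra.
have dc t : 0 < t <= d / 4 -> cderiv g (1 - t) = - cderiv c t.
  by move=> ht; rewrite dcE opprK; apply: (@cderiv_eq _ g c' (1 - d) 1) gc; lra.
have tr t : 0 < t <= d / 4 -> trace g (c t) /\ c t != 0.
  by move=> ht; rewrite -gc2'//; apply: inner_trace; lra.
have cl a b : 0 < a -> b <= d / 4 -> cont_in a b (fun t => lg (c t)).
  move=> a0 bd x hx e e0.
  have a1 : 0 < 1 - b by lra. have b1 : 1 - a < 1 by lra.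
  have hx' : 1 - b <= 1 - x <= 1 - a by lra.
  have [r r0 hr] := log_cont hl a1 b1 hx' e0; exists r => // y hy yx.
  rewrite -!gc2'; [|lra|lra]; apply: hr; first lra.
  by have -> : 1 - y - (1 - x) = - (y - x) by [ring]; rewrite normrN.
have el t : 0 < t <= d / 4 -> cexp (lg (c t)) = c t.
  by move=> /tr[h1 h2]; exact: hl.1.
have fE' t : 0 < t <= d / 4 -> f (c t) = bessel_sum s (c t) (lg (c t)).
  by move=> /tr[h1 h2]; exact: fE.
have iF' : CInt `[0, d / 4] (fun t => f (c t) * cderiv c t).
  have i0 : CInt `[1 - d / 4, 1] (pullback g f).
    by apply: (@CInt_subitv _ 0 1 _ _ (pullback g f)) iF; lra.
  have ab : 1 - d / 4 <= 1 by lra.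
  have [] := CI_reflection ab i0; rewrite subrr subKr => i1 _.
  have i2 := CInt_N (measurable_itv _) i1.
  (* Reversing the arc changes the sign of its derivative, hence the opposite integrand; moduli are
     unaffected. *)
  have E0 t : 0 < t <= d / 4 -> - pullback g f (1 - t) = f (c t) * cderiv c t.
    by move=> ht; rewrite /pullback gc2'// dc// mulrN opprK.
  by have [] := CI_except_left E0 i2.
have [dl /andP[dl0 dld] h] := germ_small hc c0 c1 d2 cl el fE' iF'.
exists dl; first by rewrite dl0; lra.
move=> e e0; have [rho rho0 hr] := h e e0; exists rho => // z zr nz.
have nz' t : 0 <= t <= dl -> c t != z.
  by move=> ht; rewrite -gc2; [apply: off_trace_neq => //; lra|lra].
have [i1 b1] := hr z zr nz'.
have E t : 0 < t <= dl -> z * (f (c t) * cderiv c t / (c t - z)) =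
    - (z * ((g (1 - t) - z)^-1 * (f (g (1 - t)) * cderiv g (1 - t)))).
  move=> /andP[h1 h2]; have ht : 0 < t <= d / 4 by rewrite h1 (le_trans h2).
  by rewrite gc2'// dc// (mulrC (_ - _)^-1) mulrN mulNr mulrN opprK.
have [i2 e2] := CI_except_left E i1; rewrite e2 in b1.
pose H t := z * ((g t - z)^-1 * (f (g t) * cderiv g t)).
have iH : CInt `[1 - dl, 1] H.
  by apply: (@CInt_subitv _ 0 1); [lra|lra|apply: CInt_Z => //; exact: CInt_cauchy].
have ab : 1 - dl <= 1 by lra.
have [i3 e3] := CI_reflection ab iH; rewrite subrr subKr in i3 e3.
by rewrite e3 -cabsN -CIN.
Qed.

(** The parts of the loop near its two ends are handled by the germs; the rest is at distance at
    least m from 0, where the Cauchy integral is bounded and the factor z suffices. *)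
Lemma cauchy_small0 lg f s : log_branch g lg ->
  (forall z, trace g z -> z != 0 -> f z = bessel_sum s z (lg z)) -> cintegrable g f ->
  small0 g (cauchy f).
Proof.
move=> hl fE iF e e0.
have [a /andP[a0 a1] ha] := germ_at_start hl fE iF.
have [b /andP[b0 b1] hb] := germ_at_end hl fE iF.
have e4 : 0 < e / 4 by rewrite divr_gt0.
have [r1 r10 h1] := ha _ e4; have [r2 r20 h2] := hb _ e4.
have ab : a <= 1 - b by lra. have b1' : 1 - b <= 1 by lra.
have cg : cont_in a (1 - b) g by apply: cont_in_sub (loop_cont hg); lra.
have [t0 ht0 hmin] := cont_in_min ab cg.
set m := cabs (g t0) in hmin; have m0 : 0 < m.
  by rewrite cabs_gt0; have [] := @inner_trace t0 ltac:(lra).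
pose N t := norm1 (pullback g f t); pose IN := \int[mu]_(t in `[a, 1 - b]) N t.
have iP : CInt `[a, 1 - b] (pullback g f).
  by apply: (@CInt_subitv _ 0 1 _ _ (pullback g f)) iF; lra.
have iN := integrable_norm1 (measurable_itv _) iP; rewrite -/N in iN.
have IN0 : 0 <= IN by apply: Rintegral_ge0 => t _; exact: norm1_ge0.
have mi : measurable (`[a, 1 - b]%classic : set (measurableTypeR R)) by exact: measurable_itv.
pose r3 := Num.min (m / 2) (e * m / (32 * (IN + 1))).
have r30 : 0 < r3.
  by rewrite lt_min !divr_gt0// ?mulr_gt0//; lra.
exists (Num.min (Num.min r1 r2) r3); first by rewrite lt_min r30 andbT lt_min r10.
move=> z nz; rewrite !lt_min => /andP[/andP[z1 z2] /andP[z3 z4]].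
pose H t := z * ((g t - z)^-1 * (f (g t) * cderiv g t)).
have iH : CInt `[0, 1] H by apply: CInt_Z; [exact: measurable_itv|exact: CInt_cauchy].
have -> : z * cauchy f z = CI `[0, 1] H.
  by rewrite cauchyE -CIZ//; exact: CInt_cauchy.
have iH1 : CInt `[a, 1] H by apply: CInt_subitv iH; lra.
have iH2 : CInt `[a, 1 - b] H by apply: CInt_subitv iH; lra.
have s1 := CI_split (ltW a0) (le_trans ab b1') iH.
have s2 := CI_split ab b1' iH1.
rewrite s1 s2.
have q1 := h1 z z1 nz; have q2 := h2 z z2 nz.
have q3 : cabs (CI `[a, 1 - b] H) <= e / 8.
  have i2 := Rint_Z (measurable_itv _) (2 * cabs z / m) iN.
  apply: le_trans (CI_le (measurable_itv _) iH2 i2 _) _ => [t|].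
    rewrite /= in_itv/= => ht; have h3 := hmin t ht; have h4 := cabs_sub (g t) z.
    have h5 : m / 2 <= cabs (g t - z) by lra.
    rewrite /H !cabsM cabsV mulrA; apply: ler_pM.
    - by apply: divr_ge0; exact: cabs_ge0.
    - by apply: mulr_ge0; exact: cabs_ge0.
    - have -> : 2 * cabs z / m = cabs z / (m / 2) by field; rewrite gt_eqF.
      apply: ler_wpM2l; first exact: cabs_ge0.
      have m2 : 0 < m / 2 by rewrite divr_gt0.
      by rewrite lef_pV2 ?posrE//; exact: lt_le_trans h5.
    - by rewrite -cabsM; exact: cabs_le_norm1.
  rewrite (RintegralZl _ mi iN) -/IN.
  have IN1 : 0 < IN + 1 by rewrite ltr_wpDl.
  have -> : e / 8 = 2 * (2 * (e * m / (32 * (IN + 1))) / m * (IN + 1)).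
    by field; rewrite !gt_eqF.
  apply: ler_wpM2l => //; apply: ler_pM => //.
  - by apply: divr_ge0; [apply: mulr_ge0 => //; exact: cabs_ge0|exact: ltW].
  - by apply: ler_wpM2r; [rewrite invr_ge0 ltW|rewrite ler_pM2l// ltW].
  - by rewrite lerDl.
apply: le_lt_trans (cabsD _ _) _; apply: le_lt_trans (lerD q1 (cabsD _ _)) _.
apply: le_lt_trans (lerD (lexx _) (lerD q3 q2)) _; lra.
Qed.

End LoopCauchy.

(** * Cauchy transform and Plemelj's formula *)

Section CauchyTransform.
Context {R : realType} (g : R -> Cx R).
Local Notation mu := (@lebesgue_measure R).
Implicit Types (z w l : Cx R) (a b d t e : R) (f h : Cx R -> Cx R).
Context (hg : loop_at_origin g).

Lemma mi01 : measurable (`[0, 1]%classic : set (measurableTypeR R)).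
Proof. exact: measurable_itv. Qed.

Lemma CInt_kernel f (ker : R -> Cx R) M : cintegrable g f -> cont_in 0 1 ker ->
  (forall t, 0 <= t <= 1 -> cabs (ker t) <= M) ->
  CInt `[0, 1] (fun t => ker t * pullback g f t) /\
  cabs (CI `[0, 1] (fun t => ker t * pullback g f t)) <=
    2 * (M * \int[mu]_(t in `[0, 1]) norm1 (pullback g f t)).
Proof.
move=> hf ck hM; have iN := integrable_norm1 mi01 hf.
have i1 : CInt `[0, 1] (fun t => ker t * pullback g f t).
  apply: (CInt_M mi01 (cont_in_cmeas ck) _ hf) => t.
  by rewrite /= in_itv/=; exact: hM.
split=> //; rewrite -(RintegralZl M mi01 iN); apply: (CI_le mi01 i1 (Rint_Z mi01 M iN)) => t.
rewrite /= in_itv/= => ht; rewrite cabsM; apply: ler_pM; rewrite ?cabs_ge0//; first exact: hM.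
exact: cabs_le_norm1.
Qed.

Lemma cauchy_pullback f z : cauchy g f z = CI `[0, 1] (fun t => (g t - z)^-1 * pullback g f t).
Proof. exact: cauchyE. Qed.

Lemma cauchy_derivable f z : cintegrable g f -> ~ trace g z -> derivable (cauchy g f) z 1.
Proof.
move=> hf nz; apply/cx_derivableP; have [m m0 hm] := trace_dist hg nz.
pose IN := \int[mu]_(t in `[0, 1]) norm1 (pullback g f t).
have IN0 : 0 <= IN by apply: Rintegral_ge0 => t _; exact: norm1_ge0.
have ci w : ~ trace g w -> cont_in 0 1 (fun t => (g t - w)^-1).
  by move=> nw; apply: inv_loop_cont => // t; exact: off_trace_neq.
have ci2 := cont_in_M (ci z nz) (ci z nz).
have bz t : 0 <= t <= 1 -> cabs (g t - z)^-1 <= m^-1.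
  by move=> ht; rewrite cabsV lef_pV2 ?posrE ?hm// (lt_le_trans m0)// hm.
have bz2 t : 0 <= t <= 1 -> cabs ((g t - z)^-1 * (g t - z)^-1) <= m^-1 * m^-1.
  by move=> ht; rewrite cabsM; apply: ler_pM; rewrite ?cabs_ge0 ?bz.
have [i2 _] := CInt_kernel hf ci2 bz2.
have [i1 _] := CInt_kernel hf (ci z nz) bz.
exists (CI `[0, 1] (fun t => ((g t - z)^-1 * (g t - z)^-1) * pullback g f t)) => e e0.
pose K := 2 * (2 * m^-1 * (m^-1 * m^-1) * IN).
have mi0 : 0 <= m^-1 by rewrite invr_ge0 ltW.
have K0 : 0 <= K by rewrite /K; do !apply: mulr_ge0 => //.
exists (Num.min (m / 2) (e / (K + 1))).
  by rewrite lt_min !divr_gt0//; lra.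
move=> w; rewrite lt_min => /andP[w1 w2].
have bw t : 0 <= t <= 1 -> m / 2 <= cabs (g t - w).
  by move=> ht; have := hm t ht; have := cabs_tri w (g t) z; lra.
have m2 : 0 < m / 2 by rewrite divr_gt0.
have nw : ~ trace g w by move=> /traceP[t ht gw]; have := bw t ht; rewrite gw subrr cabs0; lra.
have bw' t : 0 <= t <= 1 -> cabs (g t - w)^-1 <= 2 * m^-1.
  move=> ht; have -> : 2 * m^-1 = (m / 2)^-1 by rewrite invf_div.
  by rewrite cabsV lef_pV2 ?posrE ?bw// (lt_le_trans m2)// bw.
have [iw _] := CInt_kernel hf (ci w nw) bw'.
have b3 t : 0 <= t <= 1 -> cabs ((g t - w)^-1 * ((g t - z)^-1 * (g t - z)^-1)) <= 2 * m^-1 * (m^-1 * m^-1).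
  by move=> ht; rewrite cabsM; apply: ler_pM; rewrite ?cabs_ge0 ?bw' ?bz2.
have [i3 h3] := CInt_kernel hf (cont_in_M (ci w nw) ci2) b3.
(* The remainder of the first-order expansion is exactly (w - z)^2 times an integral with kernel
   bounded by 2 / m^3. *)
have -> : cauchy g f w - cauchy g f z -
    CI `[0, 1] (fun t => ((g t - z)^-1 * (g t - z)^-1) * pullback g f t) * (w - z) =
    (w - z) ^+ 2 * CI `[0, 1] (fun t => (g t - w)^-1 * ((g t - z)^-1 * (g t - z)^-1) * pullback g f t).
  rewrite !cauchy_pullback -(CIZ mi01 _ i3) mulrC -(CIZ mi01 _ i2) -(CIB mi01 iw i1).
  rewrite -(CIB mi01 (CInt_B mi01 iw i1) (CInt_Z mi01 _ i2)).
  apply: eq_CI => t; rewrite inE/= in_itv/= => ht.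
  have n1 : g t - w != 0 by rewrite subr_eq0; exact: off_trace_neq.
  have n2 : g t - z != 0 by rewrite subr_eq0; exact: off_trace_neq.
  by field; rewrite n1 n2.
rewrite cabsM cabsX expr2 -mulrA mulrCA [leRHS]mulrC; apply: ler_wpM2l; first exact: cabs_ge0.
rewrite -/IN in h3; have K1 : 0 < K + 1 by lra.
have w3 : cabs (w - z) <= e / (K + 1) by exact: ltW.
apply: le_trans (ler_pM (cabs_ge0 _) (cabs_ge0 _) w3 h3) _.
by rewrite -/K -mulrA; apply: ler_piMr; [exact: ltW|rewrite mulrC ler_pdivrMr// mul1r lerDl].
Qed.

(** Integrates 1/(w - z) = (w/(w - z) - 1)/z: the moment of order 0 splits off together with a
    factor 1/z. *)
Lemma cauchy_expand h z : cintegrable g h -> cintegrable g (fun w => w * h w) -> ~ trace g z ->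
  cauchy g h z = z^-1 * (cauchy g (fun w => w * h w) z - cint g h).
Proof.
move=> ih iwh nz; have z0 := off_trace_neq0 hg nz.
have i1 := CInt_cauchy hg ih nz; have i2 := CInt_cauchy hg iwh nz.
rewrite !cauchyE -[cint g h]/(CI `[0, 1] (pullback g h)) -(CIB mi01 i2 ih) -(CIZ mi01 _ (CInt_B mi01 i2 ih)).
apply: eq_CI => t; rewrite inE/= in_itv/= => ht; rewrite /pullback.
by have n1 : g t - z != 0 by [rewrite subr_eq0; exact: off_trace_neq]; field; rewrite n1 z0.
Qed.

(** Each vanishing moment gains one factor 1/z; this is how orthogonality becomes decay at
    infinity. *)
Lemma cauchy_expand_n h n z : (forall k, cintegrable g (fun w => w ^+ k * h w)) -> ~ trace g z ->
  (forall k, (k < n)%N -> cint g (fun w => w ^+ k * h w) = 0) ->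
  cauchy g h z = z ^- n * cauchy g (fun w => w ^+ n * h w) z.
Proof.
move=> ih nz; elim: n => [_|n IH hk].
  have -> : (fun w => w ^+ 0 * h w) = h by apply/funext => w; rewrite mul1r.
  by rewrite invr1 mul1r.
have E k : (fun w => w * (w ^+ k * h w)) = (fun w => w ^+ k.+1 * h w).
  by apply/funext => w; rewrite mulrA exprS.
have i1 := ih n.+1; rewrite -E in i1.
rewrite IH => [|k kn]; last by apply: hk; rewrite ltnS ltnW.
by rewrite (cauchy_expand (ih n) i1 nz) E hk// subr0 mulrA exprSr invfM.
Qed.

Lemma cauchy_inf h : cintegrable g h -> exists K r, 0 < r /\ forall z, r <= cabs z ->
  ~ trace g z /\ cabs (cauchy g h z) <= K / cabs z.
Proof.
move=> ih; have [M hM] := trace_bounded hg.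
pose IN := \int[mu]_(t in `[0, 1]) norm1 (pullback g h t).
have M0 : 0 <= M by apply: le_trans (cabs_ge0 _) (hM _ (trace0 hg)).
exists (4 * IN), (2 * M + 1); split; first lra.
move=> z hz; have z0 : 0 < cabs z by lra.
have nz : ~ trace g z by move=> /hM; lra.
split=> //; have bz t : 0 <= t <= 1 -> cabs (g t - z)^-1 <= 2 / cabs z.
  move=> ht; have gM := hM _ (trace_pt g ht); have := cabs_sub z (g t); rewrite cabsC => h1.
  have z2 : 0 < cabs z / 2 by rewrite divr_gt0.
  have h2 : cabs z / 2 <= cabs (g t - z) by lra.
  by rewrite cabsV -invf_div lef_pV2 ?posrE// (lt_le_trans z2).
have ci : cont_in 0 1 (fun t => (g t - z)^-1).
  by apply: inv_loop_cont => // t; exact: off_trace_neq.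
have [_ h1] := CInt_kernel ih ci bz; rewrite cauchy_pullback; apply: le_trans h1 _.
by rewrite -/IN le_eqVlt; apply/orP; left; apply/eqP; field; rewrite gt_eqF.
Qed.

End CauchyTransform.

(** * Local Lipschitz regularity of the weight away from its base point *)

Section LocallyLipschitz.
Context {R : realType}.
Implicit Types (z w v : Cx R) (r M e : R) (f h : Cx R -> Cx R) (S : set (Cx R)).
Local Notation triple := (Cx R * Cx R * nat)%type.

(** Boundedness is part of the notion, which makes it stable under products. *)
Definition loc_lip S z0 f := exists M r, [/\ 0 <= M, 0 < r &
  forall z w, S z -> S w -> cabs (z - z0) < r -> cabs (w - z0) < r ->
    cabs (f z) <= M /\ cabs (f z - f w) <= M * cabs (z - w)].

Lemma loc_lipD S z0 f h : loc_lip S z0 f -> loc_lip S z0 h -> loc_lip S z0 (fun z => f z + h z).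
Proof.
move=> [M1 [r1 [M10 r10 h1]]] [M2 [r2 [M20 r20 h2]]].
exists (M1 + M2), (Num.min r1 r2); split; [exact: addr_ge0|by rewrite lt_min r10|].
move=> z w Sz Sw; rewrite !lt_min => /andP[z1 z2] /andP[w1 w2].
have [a1 b1] := h1 z w Sz Sw z1 w1; have [a2 b2] := h2 z w Sz Sw z2 w2; split.
  by apply: le_trans (cabsD _ _) _; exact: lerD.
have -> : f z + h z - (f w + h w) = (f z - f w) + (h z - h w) by ring.
by apply: le_trans (cabsD _ _) _; rewrite mulrDl; exact: lerD.
Qed.

Lemma loc_lipM S z0 f h : loc_lip S z0 f -> loc_lip S z0 h -> loc_lip S z0 (fun z => f z * h z).
Proof.
move=> [M1 [r1 [M10 r10 h1]]] [M2 [r2 [M20 r20 h2]]].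
exists (2 * (M1 * M2) + 0), (Num.min r1 r2); split; [by rewrite addr0 !mulr_ge0|by rewrite lt_min r10|].
move=> z w Sz Sw; rewrite !lt_min => /andP[z1 z2] /andP[w1 w2]; rewrite addr0.
have [a1 b1] := h1 z w Sz Sw z1 w1; have [a2 b2] := h2 z w Sz Sw z2 w2.
have [a3 _] := h2 w z Sw Sz w2 z2.
have M12 : 0 <= M1 * M2 by exact: mulr_ge0.
split.
  rewrite cabsM; apply: le_trans (ler_pM (cabs_ge0 _) (cabs_ge0 _) a1 a2) _.
  by rewrite ler_peMl// ler1n.
have -> : f z * h z - f w * h w = f z * (h z - h w) + (f z - f w) * h w by ring.
apply: le_trans (cabsD _ _) _; rewrite !cabsM.
have q1 := ler_pM (cabs_ge0 _) (cabs_ge0 _) a1 b2; have q2 := ler_pM (cabs_ge0 _) (cabs_ge0 _) b1 a3.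
by apply: le_trans (lerD q1 q2) _; rewrite le_eqVlt; apply/orP; left; apply/eqP; ring.
Qed.

Lemma loc_lip_cst S z0 v : loc_lip S z0 (fun=> v).
Proof.
exists (cabs v), 1; split; [exact: cabs_ge0|exact: ltr01|].
by move=> z w _ _ _ _; rewrite subrr cabs0 mulr_ge0 ?cabs_ge0.
Qed.

Lemma loc_lip_X S z0 f n : loc_lip S z0 f -> loc_lip S z0 (fun z => f z ^+ n).
Proof.
move=> hf; elim: n => [|n ih]; first exact: (loc_lip_cst S z0 1).
have [M [r [M0 r0 h]]] := loc_lipM hf ih; exists M, r; split=> // z w Sz Sw zr wr.
by rewrite !exprS; exact: h.
Qed.

Lemma loc_lip_entire S z0 h : entire h -> loc_lip S z0 h.
Proof.
move=> eh; have [M hM] := bounded_disc (cabs z0 + 1) (entire_continuous eh).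
have [L L0 hL] := entire_lip (cabs z0 + 1) eh.
have M0 : 0 <= M by apply: le_trans (cabs_ge0 _) (hM z0 _); rewrite lerDl.
exists (M + L), 1; split; [exact: addr_ge0|exact: ltr01|].
have in_ z : cabs (z - z0) < 1 -> cabs z <= cabs z0 + 1.
  by have := cabsD (z - z0) z0; rewrite subrK; lra.
move=> z w _ _ /in_ zr /in_ wr; split; first by apply: le_trans (hM z zr) _; rewrite lerDl.
by apply: le_trans (hL z w zr wr) _; apply: ler_wpM2r; [exact: cabs_ge0|rewrite lerDr].
Qed.

Lemma loc_lip_cexp S z0 f : loc_lip S z0 f -> loc_lip S z0 (fun z => cexp (f z)).
Proof.
move=> [M [r [M0 r0 h]]]; pose E := expR M; have E0 : 0 < E by exact: expR_gt0.
(* Two points of the smaller disc are at distance at most 2 / (80 (M + 1)), so the increment of f is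
   at most 1/40, inside the range of [cexp_sub1_ub]. *)
exists (E + E * (2 * M)), (Num.min r (80 * (M + 1))^-1).
have M1 : 0 < M + 1 by lra.
have E2 : 0 <= E * (2 * M) by rewrite mulr_ge0 ?mulr_ge0// ltW.
have i0 : 0 < (80 * (M + 1))^-1 by rewrite invr_gt0 mulr_gt0.
split; [by rewrite addr_ge0// ltW|by rewrite lt_min r0|].
have bnd z : cabs (f z) <= M -> cabs (cexp (f z)) <= E.
  move=> fM; rewrite cabs_cexp ler_expR; apply: le_trans fM.
  by apply: le_trans (ler_norm _) _; exact: Re_le_cabs.
move=> z w Sz Sw; rewrite !lt_min => /andP[z1 z2] /andP[w1 w2].
have [a1 b1] := h z w Sz Sw z1 w1; have [a2 _] := h w z Sw Sz w1 z1.
split; first by apply: le_trans (bnd z a1) _; rewrite lerDl.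
have -> : cexp (f z) - cexp (f w) = cexp (f w) * (cexp (f z - f w) - 1).
  by rewrite mulrBr -cexpD (addrC (f w)) subrK mulr1.
have zw : cabs (z - w) <= 2 * (80 * (M + 1))^-1.
  by have := cabs_tri z0 z w; rewrite (cabsC z0); lra.
have sm : cabs (f z - f w) <= 20^-1.
  apply: le_trans b1 _; apply: le_trans (ler_wpM2l M0 zw) _.
  have -> : M * (2 * (80 * (M + 1))^-1) = 40^-1 * (M / (M + 1)) by field; rewrite gt_eqF.
  have : M / (M + 1) <= 1 by rewrite ler_pdivrMr// mul1r lerDl.
  lra.
have q1 := cexp_sub1_ub sm; rewrite cabsM.
apply: le_trans (ler_pM (cabs_ge0 _) (cabs_ge0 _) (bnd w a2) q1) _.
apply: (@le_trans _ _ (E * (2 * M) * cabs (z - w))).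
  by rewrite -!mulrA; apply: ler_wpM2l; [exact: ltW|apply: ler_wpM2l].
by apply: ler_wpM2r; [exact: cabs_ge0|rewrite lerDr ltW].
Qed.

Lemma loc_lip_inv S z0 : z0 != 0 -> loc_lip S z0 (fun z => z^-1).
Proof.
rewrite -cabs_gt0; set k := cabs z0 => k0; have k2 : 0 < k / 2 by rewrite divr_gt0.
have i0 : 0 <= (k / 2)^-1 by rewrite invr_ge0 ltW.
exists ((k / 2)^-1 + (k / 2)^-1 * (k / 2)^-1), (k / 2); split=> //.
  by rewrite addr_ge0// mulr_ge0.
have in_ z : cabs (z - z0) < k / 2 -> k / 2 <= cabs z.
  by have := cabs_tri z z0 0; rewrite !subr0 (cabsC z0) -/k; lra.
have bi z : k / 2 <= cabs z -> cabs z^-1 <= (k / 2)^-1.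
  by move=> hz; rewrite cabsV lef_pV2 ?posrE// (lt_le_trans k2).
have nz z : k / 2 <= cabs z -> z != 0 by move=> hz; rewrite -cabs_gt0 (lt_le_trans k2).
move=> z w _ _ /in_ zr /in_ wr; split; first by apply: le_trans (bi z zr) _; rewrite lerDl mulr_ge0.
have -> : z^-1 - w^-1 = - (z^-1 * w^-1 * (z - w)) by field; rewrite !nz.
rewrite cabsN cabsM; apply: ler_wpM2r; first exact: cabs_ge0.
rewrite cabsM; apply: le_trans (ler_pM (cabs_ge0 _) (cabs_ge0 _) (bi z zr) (bi w wr)) _.
by rewrite lerDr.
Qed.

(** Continuity brings the increments of the logarithm below 1/20, where the local injectivity of exp
    turns them into increments of z. *)
Lemma loc_lip_log S z0 (lg : Cx R -> Cx R) : S z0 -> z0 != 0 ->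
  (forall z, S z -> z != 0 -> cexp (lg z) = z) -> {within S `\ 0, continuous lg} ->
  loc_lip S z0 lg.
Proof.
move=> S0 z0n el cl; have S0' : (S `\ 0) z0 by split=> //; exact/eqP.
have e0 : 0 < 40^-1 :> R by rewrite invr_gt0.
have /subspace_continuousP/(_ z0 S0')/cx_withinP/(_ _ e0)[d d0 hd] := cl.
have k0 : 0 < cabs z0 by rewrite cabs_gt0.
set k := cabs z0 in k0; have k2 : 0 < k / 2 by rewrite divr_gt0.
have i0 : 0 <= (k / 2)^-1 by rewrite invr_ge0 ltW.
exists (cabs (lg z0) + 1 + 2 * (k / 2)^-1), (Num.min d (k / 2)); split.
- by rewrite !addr_ge0 ?cabs_ge0 ?mulr_ge0.
- by rewrite lt_min d0.
have in_ z : cabs (z - z0) < k / 2 -> k / 2 <= cabs z.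
  by have := cabs_tri z z0 0; rewrite !subr0 (cabsC z0) -/k; lra.
have nz z : k / 2 <= cabs z -> z != 0 by move=> hz; rewrite -cabs_gt0 (lt_le_trans k2).
move=> z w Sz Sw; rewrite !lt_min => /andP[z1 /in_ z2] /andP[w1 /in_ w2].
have hz := hd z z1 (conj Sz (elimN eqP (nz z z2))).
have hw := hd w w1 (conj Sw (elimN eqP (nz w w2))).
have c0 := cabs_ge0 (lg z0).
split.
  have := cabsD (lg z - lg z0) (lg z0); rewrite subrK.
  have : 0 <= 2 * (k / 2)^-1 by rewrite mulr_ge0.
  lra.
have sm : cabs (lg z - lg w) <= 20^-1.
  by have := cabs_tri (lg z0) (lg z) (lg w); rewrite (cabsC (lg z0)); lra.
apply: le_trans (cexp_sub1_lb sm) _; rewrite cexpB !el ?nz//.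
have -> : z / w - 1 = (z - w) / w by rewrite mulrBl mulfV// nz.
rewrite cabsM cabsV.
have : (cabs w)^-1 <= (k / 2)^-1 by rewrite lef_pV2 ?posrE// (lt_le_trans k2).
move=> h; have := ler_wpM2l (cabs_ge0 (z - w)) h => h'.
apply: (@le_trans _ _ (2 * (k / 2)^-1 * cabs (z - w))); first by rewrite -mulrA (mulrC _^-1) ler_wpM2l.
by apply: ler_wpM2r; [exact: cabs_ge0|rewrite lerDr addr_ge0].
Qed.

Lemma loc_lip_ext S z0 f h : (forall z, S z -> z != 0 -> f z = h z) -> z0 != 0 ->
  loc_lip S z0 f -> loc_lip S z0 h.
Proof.
move=> fh z0n [M [r [M0 r0 hf]]]; have k0 : 0 < cabs z0 by rewrite cabs_gt0.
exists M, (Num.min r (cabs z0)); split=> //; first by rewrite lt_min r0.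
have nz z : cabs (z - z0) < cabs z0 -> z != 0.
  by apply: contraTneq => ->; rewrite sub0r cabsN ltxx.
move=> z w Sz Sw; rewrite !lt_min => /andP[z1 /nz z2] /andP[w1 /nz w2].
by rewrite -!fh//; exact: hf.
Qed.

Lemma loc_lip_bessel S z0 (lg : Cx R -> Cx R) s : z0 != 0 -> loc_lip S z0 lg ->
  loc_lip S z0 (fun z => bessel_sum s z (lg z)).
Proof.
move=> z0n hl; elim: s => [|x s ih].
  have [M [r [M0 r0 h]]] := loc_lip_cst S z0 0; exists M, r; split=> // z w Sz Sw zr wr.
  by rewrite /bessel_sum !big_nil; exact: h.
have ei := loc_lip_entire S z0 (proj2_sig x.2).
have t1 := loc_lip_cexp (loc_lipM (loc_lip_cst S z0 x.1.1.2) hl).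
have t2 := loc_lip_X x.1.2 hl.
have t3 := loc_lip_cexp (loc_lipM (loc_lip_cst S z0 (- x.1.1.1)) (loc_lip_inv S z0n)).
have t4 := loc_lipD (loc_lipM ei (loc_lipM (loc_lipM t1 t2) t3)) ih.
have [M [r [M0 r0 h]]] := t4; exists M, r; split=> // z w Sz Sw zr wr.
have E v : bessel_sum (x :: s) v (lg v) = proj1_sig x.2 v * (cexp (x.1.1.2 * lg v) * lg v ^+ x.1.2 *
   cexp (- x.1.1.1 * v^-1)) + bessel_sum s v (lg v).
  by rewrite /bessel_sum big_cons /bterm mulNr.
by rewrite !E; exact: h.
Qed.

End LocallyLipschitz.

Section Plemelj.
Context {R : realType} (g : R -> Cx R).
Local Notation mu := (@lebesgue_measure R).
Implicit Types (z w l : Cx R) (a b d t e : R) (h : Cx R -> Cx R).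

(** Completeness is used along one selected path [u t] in [S]; the Cauchy condition carries its
    limit over to all of [S]. *)
Lemma cx_cauchy_limit (S : set (Cx R)) z0 (F : Cx R -> Cx R) :
  (forall e, 0 < e -> exists2 d, 0 < d & forall w w', S w -> S w' -> cabs (w - z0) < d ->
     cabs (w' - z0) < d -> cabs (F w - F w') < e) ->
  (forall d, 0 < d -> exists2 w, S w & cabs (w - z0) < d) ->
  exists A, forall e, 0 < e -> exists2 d, 0 < d & forall w, S w -> cabs (w - z0) < d ->
    cabs (F w - A) < e.
Proof.
move=> hF hS.
have [u hu] : exists u : R -> Cx R, forall t, 0 < t -> S (u t) /\ cabs (u t - z0) < t.
  have /choice[u hu] t : exists w, 0 < t -> S w /\ cabs (w - z0) < t.
    have [t0|t0] := ltP 0 t; last by exists 0 => t1; lra.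
    by have [w Sw wt] := hS t t0; exists w.
  by exists u.
have lim (P : Cx R -> R) : (forall v, `|P v| <= cabs v) -> (forall v w, P (v - w) = P v - P w) ->
    exists l : R, forall e, 0 < e -> exists2 d, 0 < d & forall t, 0 < t < d -> `|P (F (u t)) - l| < e.
  move=> hP PB; apply: cvg_of_cauchy => e e0; have [d d0 hd] := hF e e0; exists d => // s t.
  move=> /andP[s0 sd] /andP[t0 td]; have [S1 q1] := hu s s0; have [S2 q2] := hu t t0.
  rewrite -PB; apply: le_lt_trans (hP _) _; apply: hd => //; [exact: lt_trans sd|exact: lt_trans td].
have [l1 h1] := lim Re (@Re_le_cabs R) (fun v w => etrans (ReD _ _) (congr1 _ (ReN _))).
have [l2 h2] := lim Im (@Im_le_cabs R) (fun v w => etrans (ImD _ _) (congr1 _ (ImN _))).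
exists (l1 +i* l2) => e e0; have e4 : 0 < e / 4 by rewrite divr_gt0.
have [d d0 hd] := hF _ e4; have [d1 d10 k1] := h1 _ e4; have [d2 d20 k2] := h2 _ e4.
exists d => // w Sw wd; pose t := Num.min d (Num.min d1 d2) / 2.
have [t0 td t1 t2] : [/\ 0 < t, t < d, t < d1 & t < d2].
  have m0 : 0 < Num.min d (Num.min d1 d2) by rewrite !lt_min d0 d10.
  have mt : t < Num.min d (Num.min d1 d2) by rewrite /t; lra.
  by move: (mt); rewrite !lt_min => /andP[-> /andP[-> ->]]; rewrite divr_gt0.
have [St ut] := hu t t0; have q := hd w (u t) Sw St wd (lt_trans ut td).
have q1 := k1 t ltac:(by rewrite t0); have q2 := k2 t ltac:(by rewrite t0).
have q3 : cabs (F (u t) - (l1 +i* l2)) < e / 4 + e / 4.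
  apply: le_lt_trans (cabs_le_ReIm _) _; rewrite !(ReD, ImD, ReN, ImN)/=; exact: ltrD.
by have := cabs_tri (F (u t)) (F w) (l1 +i* l2); lra.
Qed.

Lemma near_const (P e eta : R) : 0 <= P -> 0 < e -> eta <= e / (64 * (P + 1)) ->
  2 * (2 * P * (2 * eta)) <= e / 8.
Proof.
move=> P0 e0 h; have P1 : 0 < P + 1 by lra.
have h1 : 8 * P * eta <= 8 * P * (e / (64 * (P + 1))) by apply: ler_wpM2l => //; exact: mulr_ge0.
have h2 : 8 * P * (e / (64 * (P + 1))) = e / 8 * (P / (P + 1)) by field; rewrite gt_eqF.
have h3 : e / 8 * (P / (P + 1)) <= e / 8.
  by apply: ler_piMr; [rewrite divr_ge0// ltW|rewrite ler_pdivrMr// mul1r lerDl].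
have -> : 2 * (2 * P * (2 * eta)) = 8 * P * eta by ring.
by apply: le_trans h1 _; rewrite h2.
Qed.

Lemma far_const (I e d : R) : 0 <= I -> 0 < e -> d <= e / (16 * (I + 1)) -> 2 * (d * I) <= e / 8.
Proof.
move=> I0 e0 h; have I1 : 0 < I + 1 by lra.
have h1 : d * I <= e / (16 * (I + 1)) * I by apply: ler_wpM2r.
have h2 : e / (16 * (I + 1)) * I = e / 16 * (I / (I + 1)) by field; rewrite gt_eqF.
have h3 : e / 16 * (I / (I + 1)) <= e / 16.
  by apply: ler_piMr; [rewrite divr_ge0// ltW|rewrite ler_pdivrMr// mul1r lerDl].
by rewrite h2 in h1; move: (_ * (I / _)) h1 h3 => ? ? ?; lra.
Qed.

Lemma four_eighths e (x1 x2 x3 y1 y2 y3 : Cx R) : 0 < e -> cabs x2 <= e / 8 -> cabs y2 <= e / 8 ->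
  cabs (x1 - y1) <= e / 8 -> cabs (x3 - y3) <= e / 8 ->
  cabs (x1 + (x2 + x3) - (y1 + (y2 + y3))) < e.
Proof.
move=> e0 h1 h2 h3 h4.
have -> : x1 + (x2 + x3) - (y1 + (y2 + y3)) = (x1 - y1) + ((x3 - y3) + (x2 - y2)) by ring.
have q1 := cabsD (x1 - y1) ((x3 - y3) + (x2 - y2)); have q2 := cabsD (x3 - y3) (x2 - y2).
have q3 := cabsB x2 y2; lra.
Qed.

Context (hg : loop_at_origin g).

(** With v the nearest point, |g t - v| <= 2 |g t - w|, so (f(g t) - f v)/(g t - w) stays bounded
    for every approach of w to the curve. With f(z0) in place of f(v) this would fail for tangential
    approach. *)
Definition nearest w v := trace g v /\ forall v', trace g v' -> cabs (v - w) <= cabs (v' - w).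

Lemma nearest_ex w : exists v, nearest w v.
Proof.
have cu : cont_in 0 1 (fun t => g t - w).
  move=> x hx e e0; have [r r0 hr] := loop_cont hg hx e0.
  by exists r => // y hy /(hr y hy); rewrite opprB addrA subrK.
have [t ht hmin] := cont_in_min ler01 cu; exists (g t); split; first exact: trace_pt.
by move=> v' /traceP[s hs <-]; exact: hmin.
Qed.

Lemma nearest_kernel w v t : nearest w v -> 0 <= t <= 1 -> cabs (g t - v) <= 2 * cabs (g t - w).
Proof.
move=> [Tv hv] ht; have h1 := hv _ (trace_pt g ht).
by have := cabs_tri w (g t) v; rewrite (cabsC w); lra.
Qed.

Lemma nearest_close w v z0 : trace g z0 -> nearest w v -> cabs (v - z0) <= 2 * cabs (w - z0).
Proof.
move=> T0 [Tv hv]; have h1 := hv _ T0; rewrite (cabsC z0) in h1.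
by have := cabs_tri w v z0; lra.
Qed.

Lemma cintegrable_1 : cintegrable g (fun=> 1).
Proof.
have [[B B0 hB] cm] := curve_deriv (loop_C2 hg).
have hB' t : `[0, 1]%classic t -> cabs (cderiv g t) <= B by rewrite /= in_itv/=; exact: hB.
have i1 := CInt_M (@mi01 R) cm hB' (CInt_cst 0 1 (1 : Cx R)).
have i2 : CInt `[0, 1] (pullback g (fun=> 1)).
  by apply: (eq_CInt (@mi01 R) _ i1) => t _; rewrite /pullback mul1r mulr1.
exact: i2.
Qed.

Context (f : Cx R -> Cx R) (z0 : Cx R).
Hypotheses (T0 : trace g z0) (z0n : z0 != 0) (lf : loc_lip (trace g) z0 f) (hf : cintegrable g f).

(** The subtracted integral is 2 pi i times the index of w, the only source of the jump. *)
Definition regular_part w v := cauchy g f w - f v * cauchy g (fun=> 1) w.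

Let ker w v t := (g t - w)^-1 * ((f (g t) - f v) * cderiv g t).

Lemma CInt_ker_reg w v : ~ trace g w -> CInt `[0, 1] (ker w v) /\ regular_part w v = CI `[0, 1] (ker w v).
Proof.
move=> nw; have i1 := CInt_cauchy hg hf nw; have i2 := CInt_cauchy hg cintegrable_1 nw.
have i3 := CInt_Z (@mi01 R) (f v) i2.
have E t : (g t - w)^-1 * (f (g t) * cderiv g t) - f v * ((g t - w)^-1 * (1 * cderiv g t)) = ker w v t.
  by rewrite /ker; ring.
split; first by apply: (eq_CInt (@mi01 R)) (CInt_B (@mi01 R) i1 i3) => t _; rewrite E.
rewrite /regular_part !cauchyE -(CIZ (@mi01 R) _ i2) -(CIB (@mi01 R) i1 i3).
by apply: eq_CI => t _; rewrite E.
Qed.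

(** Uniform in the side: parameters close to that of z0 contribute little since the integrand is
    bounded there, and on the rest the two kernels differ by O(d). *)
Lemma regular_part_cauchy e : 0 < e -> exists2 d, 0 < d & forall w w' v v', ~ trace g w -> ~ trace g w' ->
  cabs (w - z0) < d -> cabs (w' - z0) < d -> nearest w v -> nearest w' v' ->
  cabs (regular_part w v - regular_part w' v') < e.
Proof.
move=> e0; have [M [r [M0 r0 hM]]] := lf; have [[B B0 hB] _] := curve_deriv (loop_C2 hg).
have [t0 ht0 gt0] := (traceP g z0).1 T0.
have t0p : 0 < t0 < 1.
  have n0 : t0 != 0 by apply: contraNneq z0n => h; rewrite -gt0 h (loop_start hg).
  have n1 : t0 != 1 by apply: contraNneq z0n => h; rewrite -gt0 h (loop_stop hg).
  by case/andP: ht0 => h1 h2; rewrite lt_def n0 h1 lt_neqAle n1.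
have [r1 r10 hr1] := loop_cont hg ht0 r0; rewrite gt0 in hr1.
have MB : 0 <= M * B by exact: mulr_ge0.
pose q := e / (64 * (M * B + 1)); have q0 : 0 < q by rewrite divr_gt0// mulr_gt0//; lra.
(* [r1] keeps the near arc where f is Lipschitz and [q] makes its contribution at most e/8; the last
   two bounds keep it inside [0, 1]. *)
pose eta := Num.min (Num.min (r1 / 2) q) (Num.min (t0 / 2) ((1 - t0) / 2)).
have eta0 : 0 < eta by rewrite !lt_min divr_gt0// q0 !divr_gt0//; lra.
have [eta1 etaq etal etar] : [/\ eta <= r1 / 2, eta <= q, eta <= t0 / 2 & eta <= (1 - t0) / 2].
  by rewrite !ge_min !lexx !orbT.
set a := t0 - eta; set b := t0 + eta.
have [a0 ab b1] : [/\ 0 <= a, a <= b & b <= 1] by rewrite /a /b; split; lra.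
have a1 : a <= 1 by exact: le_trans ab b1.
have cu x y : 0 <= x -> y <= 1 -> cont_in x y (fun t => g t - z0).
  move=> x0 y1; apply: (cont_in_sub x0 y1) => u hu e' e'0.
  have [s s0 hs] := loop_cont hg hu e'0.
  by exists s => // y' hy /(hs y' hy); rewrite opprB addrA subrK.
have far_neq t : 0 <= t <= 1 -> t != t0 -> 0 < cabs (g t - z0).
  move=> ht tn; rewrite cabs_gt0 subr_eq0 -gt0.
  have [->|t1] := eqVneq t 1.
    by rewrite (loop_stop hg) eq_sym gt0.
  apply: contra_neq tn; case: hg => _ _ inj _ _; apply: inj; rewrite in_itv/=; last lra.
  by case/andP: ht => -> h; rewrite lt_neqAle t1.
(* The loop is simple and z0 is not its base point, so z0 is attained at t0 only. *)
have [m m0 hm] : exists2 m, 0 < m & forall t, 0 <= t <= a \/ b <= t <= 1 -> m <= cabs (g t - z0).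
  have [u hu hmu] := cont_in_min a0 (cu 0 a (lexx 0) a1).
  have [v hv hmv] := cont_in_min b1 (cu b 1 (le_trans a0 ab) (lexx 1)).
  exists (Num.min (cabs (g u - z0)) (cabs (g v - z0))).
    rewrite lt_min; apply/andP; split; apply: far_neq; try (by rewrite /a /b in hu hv; lra);
    by apply/eqP => h; rewrite /a /b h in hu hv; lra.
  by move=> t [/hmu|/hmv] h; rewrite ge_min h ?orbT.
pose N t := norm1 (pullback g f t).
(* [bd] collects what multiplies d in the difference of the kernels: |w - w'| <= 2 d and |v - v'| <=
   4 d, with inverse distances at most 2/m. *)
pose C := 4 / m ^+ 2 * (2 * (M * B)) + 2 / m * (4 * (M * B)).
pose bd t := 8 / m ^+ 2 * N t + C.
have m2 : 0 < m ^+ 2 by rewrite exprn_gt0.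
have k80 (x : R) : 0 <= x -> 0 <= x / m ^+ 2 by move=> x0; apply: divr_ge0 => //; exact: ltW.
have C0 : 0 <= C.
  rewrite /C addr_ge0//; first by apply: mulr_ge0; [exact: k80|exact: mulr_ge0].
  by apply: mulr_ge0; [apply: divr_ge0 => //; exact: ltW|exact: mulr_ge0].
have bd0 t : 0 <= bd t by rewrite /bd addr_ge0//; apply: mulr_ge0; [exact: k80|exact: norm1_ge0].
have ibd : mu.-integrable `[0, 1] (EFin \o bd).
  exact: (Rint_D (@mi01 R) (Rint_Z (@mi01 R) _ (integrable_norm1 (@mi01 R) hf)) (Rint_cst 0 1 C)).
pose IB := \int[mu]_(t in `[0, 1]) bd t.
have IB0 : 0 <= IB by exact: Rintegral_ge0.
pose d := Num.min (Num.min (r / 2) (m / 2)) (e / (16 * (IB + 1))).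
have d0 : 0 < d by rewrite !lt_min !divr_gt0//; lra.
have [dr dm de] : [/\ d <= r / 2, d <= m / 2 & d <= e / (16 * (IB + 1))].
  by rewrite !ge_min !lexx !orbT.
exists d => // w w' v v' nw nw' wd wd' nv nv'.
have [i1 E1] := CInt_ker_reg v nw; have [i2 E2] := CInt_ker_reg v' nw'.
(* near z0 the Lipschitz quotient is bounded *)
have near w1 v1 : ~ trace g w1 -> cabs (w1 - z0) < d -> nearest w1 v1 -> CInt `[0, 1] (ker w1 v1) ->
   cabs (CI `[a, b] (ker w1 v1)) <= e / 8.
  move=> nw1 w1d nv1 ik.
  have v1r : cabs (v1 - z0) < r by have := nearest_close T0 nv1; lra.
  have iab : CInt `[a, b] (ker w1 v1) by apply: CInt_subitv ik.
  have bk t : a <= t <= b -> cabs (ker w1 v1 t) <= 2 * (M * B).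
    move=> /andP[ta tb]; have ht : 0 <= t <= 1 by rewrite (le_trans a0 ta) (le_trans tb b1).
    have tr : `|t - t0| < r1 by rewrite ltr_norml; rewrite /a /b in ta tb; lra.
    have [_ h1] := hM _ _ (trace_pt g ht) nv1.1 (hr1 t ht tr) v1r.
    have h2 := nearest_kernel nv1 ht; have h3 := hB t ht.
    have u0 : 0 < cabs (g t - w1) by rewrite cabs_gt0 subr_eq0; exact: off_trace_neq.
    rewrite /ker !cabsM cabsV mulrC ler_pdivrMr//.
    have h4 := le_trans h1 (ler_wpM2l M0 h2).
    apply: le_trans (ler_pM (cabs_ge0 _) (cabs_ge0 _) h4 h3) _.
    by rewrite le_eqVlt; apply/orP; left; apply/eqP; ring.
  apply: le_trans (CI_le_cst ab iab bk) _.
  have -> : b - a = 2 * eta by rewrite /a /b; ring.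
  exact: near_const.
have far x y : 0 <= x -> x <= y -> y <= 1 -> (forall t, x <= t <= y -> m <= cabs (g t - z0)) ->
   cabs (CI `[x, y] (ker w v) - CI `[x, y] (ker w' v')) <= e / 8.
  move=> x0 xy y1 hxy.
  have mxy : measurable (`[x, y]%classic : set (measurableTypeR R)) by exact: measurable_itv.
  have j1 : CInt `[x, y] (ker w v) by apply: CInt_subitv i1.
  have j2 : CInt `[x, y] (ker w' v') by apply: CInt_subitv i2.
  have jb : mu.-integrable `[x, y] (EFin \o bd).
    by apply: integrableS ibd => //; apply: subset_itvScc; rewrite bnd_simp.
  rewrite -(CIB mxy j1 j2).
  apply: le_trans (CI_le mxy (CInt_B mxy j1 j2) (Rint_Z mxy d jb) _) _ => [t|]; last first.
    rewrite (RintegralZl d mxy jb).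
    have h1 : \int[mu]_(t in `[x, y]) bd t <= IB by apply: Rint_mono_itv.
    apply: le_trans (ler_wpM2l _ (ler_wpM2l (ltW d0) h1)) _ => //.
    exact: far_const.
  rewrite /= in_itv/= => ht; have ht1 : 0 <= t <= 1.
    by case/andP: ht => h1 h2; rewrite (le_trans x0 h1) (le_trans h2 y1).
  have h3 := hB t ht1; have hmt := hxy t ht.
  have inv_le w1 : cabs (w1 - z0) < d -> cabs (g t - w1)^-1 <= 2 / m.
    move=> w1d; have mm : 0 < m / 2 by rewrite divr_gt0.
    have : m / 2 <= cabs (g t - w1) by have := cabs_tri w1 (g t) z0; lra.
    by move=> h; rewrite cabsV -(invf_div m 2) lef_pV2 ?posrE// (lt_le_trans mm).
  have u1 := inv_le w wd; have u2 := inv_le w' wd'.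
  have nz w1 : ~ trace g w1 -> g t - w1 != 0 by move=> h; rewrite subr_eq0; exact: off_trace_neq.
  have -> : ker w v t - ker w' v' t =
     (w - w') * ((g t - w)^-1 * (g t - w')^-1) * (pullback g f t - f v * cderiv g t) +
     (g t - w')^-1 * ((f v' - f v) * cderiv g t).
    by rewrite /ker /pullback; have n1 := nz w nw; have n2 := nz w' nw'; field; rewrite n1 n2.
  have cv := nearest_close T0 nv; have cv' := nearest_close T0 nv'.
  have vr : cabs (v - z0) < r by lra.
  have vr' : cabs (v' - z0) < r by lra.
  have [fv _] := hM v v' nv.1 nv'.1 vr vr'; have [_ fvv] := hM v' v nv'.1 nv.1 vr' vr.
  have ww : cabs (w - w') <= 2 * d by have := cabs_tri z0 w w'; rewrite (cabsC z0); lra.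
  have vv : cabs (v' - v) <= 4 * d by have := cabs_tri z0 v' v; rewrite (cabsC z0); lra.
  apply: le_trans (cabsD _ _) _; rewrite !cabsM.
  have p1 : cabs (pullback g f t - f v * cderiv g t) <= N t + M * B.
    apply: le_trans (cabsB _ _) _; apply: lerD; first exact: cabs_le_norm1.
    by rewrite cabsM; apply: ler_pM; rewrite ?cabs_ge0.
  have c0 (z : Cx R) := cabs_ge0 z.
  have p2 := ler_pM (mulr_ge0 (c0 _) (mulr_ge0 (c0 _) (c0 _))) (c0 _) (ler_pM (c0 _) (mulr_ge0 (c0 _) (c0 _)) ww (ler_pM (c0 _) (c0 _) u1 u2)) p1.
  have p3 := ler_pM (c0 _) (mulr_ge0 (c0 _) (c0 _)) u2 (ler_pM (c0 _) (c0 _) (le_trans fvv (ler_wpM2l M0 vv)) h3).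
  apply: le_trans (lerD p2 p3) _.
  by rewrite /bd /C le_eqVlt; apply/orP; left; apply/eqP; field; rewrite gt_eqF.
rewrite E1 E2.
have s1 w1 v1 : CInt `[0, 1] (ker w1 v1) -> CI `[0, 1] (ker w1 v1) =
    CI `[0, a] (ker w1 v1) + (CI `[a, b] (ker w1 v1) + CI `[b, 1] (ker w1 v1)).
  move=> ik; rewrite (CI_split a0 a1 ik); congr (_ + _).
  by apply: CI_split => //; apply: CInt_subitv ik.
rewrite (s1 _ _ i1) (s1 _ _ i2).
have n1 := near w v nw wd nv i1; have n2 := near w' v' nw' wd' nv' i2.
have f1 := far 0 a (lexx 0) a0 a1 (fun t ht => hm t (or_introl ht)).
have f2 := far b 1 (le_trans a0 ab) b1 (lexx 1) (fun t ht => hm t (or_intror ht)).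
exact: four_eighths.
Qed.

(** Where the index is 0, the Cauchy integral equals its regular part; where it is -1, it differs
    from it by - 2 pi i f(v), with v tending to z0. *)
Lemma plemelj : exists A : Cx R,
  cauchy g f w @[w --> within (plus_side g) (nbhs z0)] --> A /\
  cauchy g f w @[w --> within (minus_side g) (nbhs z0)] --> A - twopii R * f z0.
Proof.
have [near hnear] := choice nearest_ex.
have [A hA] : exists A, forall e, 0 < e -> exists2 d, 0 < d & forall w, (~` trace g) w ->
    cabs (w - z0) < d -> cabs (regular_part w (near w) - A) < e.
  apply: cx_cauchy_limit => [e e0|d d0].
    have [d d0 hd] := regular_part_cauchy e0; exists d => // w w' nw nw' wd wd'.
    by apply: hd.
  by have [w nw wd] := thin_dense_compl z0 (trace_thin hg) d0; exists w.
have tpi : twopii R != 0.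
  by rewrite -cabs_gt0 cabsE/= expr0n/= add0r sqrtr_sqr normr_gt0 mulf_neq0// gt_eqF// pi_gt0.
have wE w : cauchy g (fun=> 1) w = twopii R * winding g w.
  rewrite /winding mulrA mulfV// mul1r; apply: eq_CI => t _.
  by rewrite /pullback mulr1.
exists A; split; apply/cx_withinP => e e0.
  have [d d0 hd] := hA e e0; exists d => // w wd [nw w0].
  by have := hd w nw wd; rewrite /regular_part wE w0 !mulr0 subr0.
have [M [r [M0 r0 hM]]] := lf.
have e2 : 0 < e / 2 by rewrite divr_gt0.
have [d d0 hd] := hA _ e2.
pose P := cabs (twopii R); have P0 : 0 <= P by exact: cabs_ge0.
have PM : 0 <= P * M by exact: mulr_ge0.
exists (Num.min d (Num.min (r / 2) (e / (8 * (P * M + 1))))).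
  by rewrite !lt_min d0 !divr_gt0//; lra.
move=> w; rewrite !lt_min => /andP[wd /andP[wr we]] [nw w1].
have h1 := hd w nw wd; rewrite /regular_part wE w1 in h1.
have -> : cauchy g f w - (A - twopii R * f z0) =
  (cauchy g f w - f (near w) * (twopii R * -1) - A) - twopii R * (f (near w) - f z0) by ring.
have c1 := nearest_close T0 (hnear w).
have r1 : cabs (near w - z0) < r by lra.
have r2 : cabs (z0 - z0) < r by rewrite subrr cabs0.
have [_ h2] := hM _ _ (hnear w).1 T0 r1 r2.
apply: le_lt_trans (cabsB _ _) _; rewrite (cabsM (twopii R)) -/P.
have h3 : P * cabs (f (near w) - f z0) <= e / 4.
  apply: le_trans (ler_wpM2l P0 h2) _; rewrite mulrA.
  apply: le_trans (ler_wpM2l PM (le_trans c1 (ler_wpM2l _ (ltW we)))) _ => //.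
  have -> : P * M * (2 * (e / (8 * (P * M + 1)))) = e / 4 * (P * M / (P * M + 1)).
    by field; rewrite gt_eqF//; lra.
  apply: ler_piMr; first by rewrite divr_ge0// ltW.
  by rewrite ler_pdivrMr ?mul1r ?lerDl//; lra.
by lra.
Qed.

End Plemelj.

(** * Existence *)

Section BlockIdentities.
Context (F : fieldType) (N : nat).
Implicit Types (P Q X S W : 'M[F]_N) (z : F).

Lemma rows_asymp n z P Q X S : z != 0 -> block_mx P Q X S =
  (1%:M + block_mx (z ^- n *: P - 1%:M) (z ^+ n *: Q) (z ^- n *: X) (z ^+ n *: S - 1%:M)) *m
  block_mx (z ^+ n)%:M 0 0 (z ^- n)%:M.
Proof.
move=> z0; have zn : z ^+ n != 0 by rewrite expf_neq0.
rewrite (scalar_mx_block N N) add_block_mx !add0r !(addrC 1%:M) !subrK mulmx_block !mulmx0 !addr0 !add0r.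
by rewrite !mul_mx_scalar !scalerA mulfV// mulVf// !scale1r.
Qed.

Lemma rows_jump P Q X S W : block_mx P (P *m W + Q) X (X *m W + S) =
  block_mx P Q X S *m block_mx 1%:M W 0 1%:M.
Proof. by rewrite mulmx_block !mulmx1 !mulmx0 !addr0. Qed.

End BlockIdentities.

(** * Block rows of the left problem *)

Section Rows.
Context {R : realType} (g : R -> Cx R).
Context (hg : loop_at_origin g) (N : nat) (W : Cx R -> 'M[Cx R]_N).
Implicit Types (z w v : Cx R) (P Q : Cx R -> 'M[Cx R]_N) (d : 'M[Cx R]_N) (n : nat).

(* What a block row (P, Q) must satisfy for a solution of the left problem;
   (d1, d2) is the leading behaviour of (z^-n P, z^n Q) at infinity. *)
Definition row_ok n (d1 d2 : 'M[Cx R]_N) P Q :=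
  [/\ forall i j, entire (fun z => P z i j),
      forall i j z, ~ trace g z -> derivable (fun z => Q z i j) z 1,
      forall z, trace g z -> z != 0 -> exists Qp Qm,
        [/\ boundary_value (plus_side g) Q z Qp, boundary_value (minus_side g) Q z Qm &
            Qp = P z *m W z + Qm],
      forall i j, Oinv (fun z => (z ^- n *: P z - d1) i j) /\
                  Oinv (fun z => (z ^+ n *: Q z - d2) i j) &
      forall i j, small0 g (fun z => Q z i j)].

(** [T] is an arbitrary property of a scalar function and a value, so that this one case split
    serves derivatives, boundary values and orders of growth. *)
Lemma block_entries2 (P1 P2 P3 P4 : Cx R -> 'M[Cx R]_N) (v1 v2 v3 v4 : 'M[Cx R]_N)
    (T : (Cx R -> Cx R) -> Cx R -> Prop) :
  (forall i j, T (fun z => P1 z i j) (v1 i j)) -> (forall i j, T (fun z => P2 z i j) (v2 i j)) ->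
  (forall i j, T (fun z => P3 z i j) (v3 i j)) -> (forall i j, T (fun z => P4 z i j) (v4 i j)) ->
  forall i j, T (fun z => block_mx (P1 z) (P2 z) (P3 z) (P4 z) i j) (block_mx v1 v2 v3 v4 i j).
Proof.
move=> h1 h2 h3 h4 i j; have [i' ->|i' ->] := split_ordP i; have [j' ->|j' ->] := split_ordP j.
- have -> : (fun z => block_mx (P1 z) (P2 z) (P3 z) (P4 z) (lshift N i') (lshift N j')) =
    (fun z => P1 z i' j') by apply/funext => z; exact: block_mxEul.
  by rewrite block_mxEul.
- have -> : (fun z => block_mx (P1 z) (P2 z) (P3 z) (P4 z) (lshift N i') (rshift N j')) =
    (fun z => P2 z i' j') by apply/funext => z; exact: block_mxEur.
  by rewrite block_mxEur.
- have -> : (fun z => block_mx (P1 z) (P2 z) (P3 z) (P4 z) (rshift N i') (lshift N j')) =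
    (fun z => P3 z i' j') by apply/funext => z; exact: block_mxEdl.
  by rewrite block_mxEdl.
- have -> : (fun z => block_mx (P1 z) (P2 z) (P3 z) (P4 z) (rshift N i') (rshift N j')) =
    (fun z => P4 z i' j') by apply/funext => z; exact: block_mxEdr.
  by rewrite block_mxEdr.
Qed.

Lemma block_entries (P1 P2 P3 P4 : Cx R -> 'M[Cx R]_N) (T : (Cx R -> Cx R) -> Prop) :
  (forall i j, T (fun z => P1 z i j)) -> (forall i j, T (fun z => P2 z i j)) ->
  (forall i j, T (fun z => P3 z i j)) -> (forall i j, T (fun z => P4 z i j)) ->
  forall i j, T (fun z => block_mx (P1 z) (P2 z) (P3 z) (P4 z) i j).
Proof. by move=> h1 h2 h3 h4; exact: (@block_entries2 P1 P2 P3 P4 0 0 0 0 (fun f _ => T f)). Qed.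

Lemma boundary_block (S : set (Cx R)) (P1 P2 P3 P4 : Cx R -> 'M[Cx R]_N) z (v1 v2 v3 v4 : 'M[Cx R]_N) :
  boundary_value S P1 z v1 -> boundary_value S P2 z v2 -> boundary_value S P3 z v3 ->
  boundary_value S P4 z v4 ->
  boundary_value S (fun z => block_mx (P1 z) (P2 z) (P3 z) (P4 z)) z (block_mx v1 v2 v3 v4).
Proof.
move=> /mx_cvgP h1 /mx_cvgP h2 /mx_cvgP h3 /mx_cvgP h4; apply/mx_cvgP.
exact: (@block_entries2 P1 P2 P3 P4 v1 v2 v3 v4 (fun f v => f w @[w --> within S (nbhs z)] --> v)).
Qed.

Lemma entire_boundary (S : set (Cx R)) P z : (forall i j, entire (fun z => P z i j)) ->
  boundary_value S P z (P z).
Proof.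
move=> eP; apply/mx_cvgP => i j; apply/cx_withinP => e e0.
have ct : {for z, continuous (fun z => P z i j)} by apply: entire_continuous.
by have [d d0 hd] := (cx_contP _ _).1 ct e e0; exists d => // w /hd.
Qed.

Lemma entire_big0 P : (forall i j, entire (fun z => P z i j)) -> bigO_one_at0 g P.
Proof.
move=> eP.
have /choice[M hM] (ij : 'I_N * 'I_N) : exists M, forall u : Cx R, cabs u <= 1 -> cabs (P u ij.1 ij.2) <= M.
  by apply: bounded_disc; apply: entire_continuous; exact: eP.
exists (\sum_ij `|M ij|); apply/cx_nbhsP; exists 1; first exact: ltr01.
move=> w; rewrite subr0 => /ltW w1 _ i j; apply/cabs_le_real.
apply: le_trans (hM (i, j) w w1) _; apply: le_trans (ler_norm _) _.
by rewrite (bigD1 (i, j))//= lerDl sumr_ge0.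
Qed.

Lemma rows_RHP n P Q X S : row_ok n 1%:M 0 P Q -> row_ok n 0 1%:M X S ->
  left_RHP g W n (fun z => block_mx (P z) (Q z) (X z) (S z)).
Proof.
move=> [eP dQ jQ oP sQ] [eX dS jS oX sS]; split.
- move=> i j z nz; move: i j.
  apply: (@block_entries P Q X S (fun f => derivable f z 1)) => i j;
    [exact: eP|exact: dQ|exact: eX|exact: dS].
- move=> z Tz z0; have [Qp [Qm [h1 h2 hQ]]] := jQ z Tz z0.
  have [Sp [Sm [h3 h4 hS]]] := jS z Tz z0.
  exists (block_mx (P z) Qp (X z) Sp), (block_mx (P z) Qm (X z) Sm); split.
  + apply: boundary_block; [exact: (@entire_boundary _ P z eP)|exact: h1|exact: (@entire_boundary _ X z eX)|exact: h3].
  + apply: boundary_block; [exact: (@entire_boundary _ P z eP)|exact: h2|exact: (@entire_boundary _ X z eX)|exact: h4].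
  + by rewrite hQ hS; exact: rows_jump.
- exists (fun z => block_mx (z ^- n *: P z - 1%:M) (z ^+ n *: Q z) (z ^- n *: X z) (z ^+ n *: S z - 1%:M)).
  split.
    apply/bigO_invP => i j; move: i j.
    apply: (@block_entries _ _ _ _ Oinv) => i j.
    * by case: (oP i j).
    * by have [_] := oP i j; apply: Oinv_ext => z; rewrite subr0.
    * by have [] := oX i j => + _; apply: Oinv_ext => z; rewrite subr0.
    * by case: (oX i j).
  exists 1 => z nz _; apply: rows_asymp; exact: off_trace_neq0 hg _ nz.
- exists Q, S, P, X; split; first by move=> z _.
    by split; exact: entire_big0.
  by split; apply/littleo_small0.
Qed.

Lemma row_ext n d1 d2 P Q Q' : (forall z, ~ trace g z -> Q z = Q' z) ->
  row_ok n d1 d2 P Q -> row_ok n d1 d2 P Q'.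
Proof.
move=> QQ [eP dQ jQ oP sQ]; split.
- exact: eP.
- move=> i j z nz; have [d d0 hd] := trace_compl_open hg nz.
  apply: near_eq_derivable (dQ i j z nz).
  by apply/cx_nbhsP; exists d => // w /hd nw; rewrite QQ.
- have bv (S : set (Cx R)) z (v : 'M[Cx R]_N) : (forall w, S w -> ~ trace g w) -> boundary_value S Q z v -> boundary_value S Q' z v.
    move=> hS /mx_cvgP h; apply/mx_cvgP => i j; apply/cx_withinP => e e0.
    have /cx_withinP/(_ e e0)[d d0 hd] := h i j; exists d => // w wd Sw.
    by rewrite -QQ; [exact: hd|exact: hS].
  move=> z Tz z0; have [Qp [Qm [h1 h2 h3]]] := jQ z Tz z0; exists Qp, Qm; split; last exact: h3.
    by apply: bv h1 => w [].
  by apply: bv h2 => w [].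
- move=> i j; have [h1 [K [r [K0 r0 hK]]]] := oP i j; split=> //.
  have [M hM] := trace_bounded hg; exists K, (r + `|M| + 1); split; [exact: K0|by have := normr_ge0 M; lra|].
  move=> z zr; have nz : ~ trace g z by move=> /hM; have := ler_norm M; lra.
  rewrite !mxE -QQ//; have := hK z; rewrite !mxE; apply.
  by have := normr_ge0 M; lra.
- move=> i j e e0; have [d d0 hd] := sQ i j e e0; exists d => // w nw.
  by rewrite -QQ//; exact: hd.
Qed.

(** The lower row for n = 0, as fixed by the conventions for the index -1. *)
Lemma row_zero : row_ok 0 0 1%:M (fun=> 0) (fun=> 1%:M).
Proof.
have dc (v : Cx R) z : derivable (fun=> v : Cx R) z 1 by exact: derivable_cst.
split=> [i j z|i j z _|z Tz z0|i j|i j e e0].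
- exact: dc.
- exact: dc.
- exists 1%:M, 1%:M; rewrite mul0mx add0r; split; [exact: cvg_cst|exact: cvg_cst|exact: erefl].
- by split; apply: Oinv_ext Oinv0 => z; rewrite !mxE ?expr0 ?mul1r ?mulr0 subrr.
- exists e => // w _ we; rewrite mxE cabsM; apply: le_lt_trans we.
  by apply: ler_piMr; [exact: cabs_ge0|rewrite cabs_nat lern1; case: eqP].
Qed.

End Rows.

(** * Rows made of a matrix polynomial and its Cauchy transform *)

Section PolynomialRows.
Context {R : realType} (g : R -> Cx R).
Context (hg : loop_at_origin g) (N : nat) (W : Cx R -> 'M[Cx R]_N).
Hypothesis hB : bessel_type g W.
Hypothesis hI : forall n i j, cintegrable g (fun z => z ^+ n * W z i j).
Local Notation triple := (Cx R * Cx R * nat)%type.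
Local Notation bessel := (seq (triple * {k : Cx R -> Cx R | entire k})).
Implicit Types (z w v : Cx R) (f h : Cx R -> Cx R) (n k : nat).

Lemma twopii_neq0 : twopii R != 0.
Proof.
by rewrite -cabs_gt0 cabsE/= expr0n/= add0r sqrtr_sqr normr_gt0 mulf_neq0// gt_eqF// pi_gt0.
Qed.

Lemma cintegrable_Z v f : cintegrable g f -> cintegrable g (fun w => v * f w).
Proof.
move=> hf; have i1 := CInt_Z (@mi01 R) v hf.
have i2 : CInt `[0, 1] (pullback g (fun w => v * f w)).
  by apply: (eq_CInt (@mi01 R) _ i1) => t _; rewrite /pullback mulrA.
exact: i2.
Qed.

Lemma cintegrable_sum I (r : seq I) (f : I -> Cx R -> Cx R) : (forall i, cintegrable g (f i)) ->
  cintegrable g (fun w => \sum_(i <- r) f i w).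
Proof.
move=> hf; have i1 := CInt_sum (@mi01 R) r hf.
have i2 : CInt `[0, 1] (pullback g (fun w => \sum_(i <- r) f i w)).
  by apply: (eq_CInt (@mi01 R) _ i1) => t _; rewrite /pullback mulr_suml.
exact: i2.
Qed.

Lemma entire_poly n (a : nat -> Cx R) : entire (fun z => \sum_(k < n) z ^+ k * a k).
Proof.
have ec (v : Cx R) : entire (fun=> v) by move=> z; exact: derivable_cst.
have ex k : entire (fun z : Cx R => z ^+ k).
  elim: k => [|k ih].
    have -> : (fun z : Cx R => z ^+ 0) = fun=> 1 by apply/funext => z; rewrite expr0.
    exact: ec.
  have -> : (fun z : Cx R => z ^+ k.+1) = fun z => z * z ^+ k by apply/funext => z; rewrite exprS.
  by apply: entireM ih => z; exact: derivable_id.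
elim: n => [|n ih].
  have -> : (fun z => \sum_(k < 0) z ^+ k * a k) = fun=> 0 by apply/funext => z; rewrite big_ord0.
  exact: ec.
have -> : (fun z => \sum_(k < n.+1) z ^+ k * a k) = fun z => \sum_(k < n) z ^+ k * a k + z ^+ n * a n.
  by apply/funext => z; rewrite big_ord_recr.
by apply: (entireD ih); exact: (entireM (ex n) (ec (a n))).
Qed.

Lemma bessel_sum_big (I : Type) (r : seq I) (s : I -> bessel) : exists s', forall z l,
  bessel_sum s' z l = \sum_(i <- r) bessel_sum (s i) z l.
Proof.
elim: r => [|i r [s' hs]].
  by exists [::] => z l; rewrite /bessel_sum !big_nil.
by exists (s i ++ s') => z l; rewrite bessel_sum_cat hs big_cons.
Qed.

Definition good_fun f :=
  (exists lg (s : bessel), log_branch g lg /\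
     forall z, trace g z -> z != 0 -> f z = bessel_sum s z (lg z)) /\
  forall k, cintegrable g (fun w => w ^+ k * f w).

Definition mpol n (A : nat -> 'M[Cx R]_N) z := \sum_(k < n.+1) z ^+ k *: A k.

Lemma mpolE n A z i j : mpol n A z i j = \sum_(k < n.+1) z ^+ k * A k i j.
Proof. by rewrite /mpol summxE; apply: eq_bigr => k _; rewrite mxE. Qed.

(** Polynomials multiply into the entire coefficients, and the branch of the logarithm common to all
    entries of W lets the products be added. *)
Lemma good_entry n A i j : good_fun (fun z => (mpol n A z *m W z) i j).
Proof.
have E z : (mpol n A z *m W z) i j = \sum_l (\sum_(k < n.+1) z ^+ k * A k i l) * W z l j.
  by rewrite mxE; apply: eq_bigr => l _; rewrite mpolE.
split.
  have [lg [hl hW]] := hB; exists lg.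
  have /choice[s hs] (l : 'I_N) : exists s : bessel, forall z, trace g z -> z != 0 ->
      (\sum_(k < n.+1) z ^+ k * A k i l) * W z l j = bessel_sum s z (lg z).
    have [d [phi [p [lam [q [ha _ hE]]]]]] := hW l j.
    have ephi m : entire (phi m) by case: (ha m) => h _ _ _ z; exact: h.
    pose s0 : bessel := [seq ((lam m, p m, q m), exist _ (phi m) (ephi m)) | m <- index_enum 'I_d].
    have hs0 z : trace g z -> z != 0 -> W z l j = bessel_sum s0 z (lg z).
      move=> Tz z0; rewrite hE// /bessel_sum /s0 big_map; apply: eq_bigr => m _.
      by rewrite /bterm/= !mulrA.
    have [s hs] := bessel_sum_mul s0 (@entire_poly n.+1 (fun k => A k i l)).
    by exists s => z Tz z0; rewrite hs hs0.
  have [s' hs'] := bessel_sum_big (index_enum 'I_N) s.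
  exists s'; split=> // z Tz z0; rewrite E hs'; apply: eq_bigr => l _; exact: hs.
move=> k; have ii : cintegrable g (fun w => \sum_l \sum_(m < n.+1) A m i l * (w ^+ (k + m) * W w l j)).
  by apply: cintegrable_sum => l; apply: cintegrable_sum => m; exact: cintegrable_Z.
have -> : (fun w => w ^+ k * (mpol n A w *m W w) i j) =
    (fun w => \sum_l \sum_(m < n.+1) A m i l * (w ^+ (k + m) * W w l j)).
  apply/funext => w; rewrite E mulr_sumr; apply: eq_bigr => l _.
  rewrite mulrA mulr_sumr mulr_suml; apply: eq_bigr => m _; rewrite exprD; ring.
exact: ii.
Qed.

Lemma good_cauchy f : good_fun f ->
  [/\ forall z, ~ trace g z -> derivable (cauchy g f) z 1,
      forall z, trace g z -> z != 0 -> exists A : Cx R,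
        cauchy g f w @[w --> within (plus_side g) (nbhs z)] --> A /\
        cauchy g f w @[w --> within (minus_side g) (nbhs z)] --> A - twopii R * f z &
      small0 g (cauchy g f)].
Proof.
move=> [[lg [s [hl hs]]] hi].
have hf : cintegrable g f.
  have := hi 0%N; have -> // : (fun w => w ^+ 0 * f w) = f by apply/funext => w; rewrite mul1r.
split.
- by move=> z; exact: (cauchy_derivable hg hf).
- move=> z Tz z0; have l1 := loc_lip_log Tz z0 hl.1 hl.2.
  have l2 := loc_lip_bessel s z0 l1.
  apply: (plemelj hg Tz z0 _ hf); apply: loc_lip_ext z0 l2 => w Tw w0.
  by rewrite hs.
- exact: (cauchy_small0 hg hl hs hf).
Qed.

Lemma Oinv_eq_large f h r : (forall z, r <= cabs z -> f z = h z) -> Oinv f -> Oinv h.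
Proof.
move=> fh [K [r0 [K0 r00 hK]]]; exists K, (r0 + `|r|); split=> //; first by rewrite ltr_pwDl.
move=> z zr; have nr := normr_ge0 r; have rr := ler_norm r.
by rewrite -fh; [apply: hK; lra|lra].
Qed.

Lemma Oinv_cauchy h : cintegrable g h -> Oinv (cauchy g h).
Proof.
move=> hh; have [K [r [r0 hK]]] := cauchy_inf hg hh.
exists `|K|, r; split=> // z zr; have [_ h1] := hK z zr; apply: le_trans h1 _.
by apply: ler_wpM2r; [rewrite invr_ge0 cabs_ge0|exact: ler_norm].
Qed.

Lemma Oinv_pow n k v : (k < n)%N -> Oinv (fun z => z ^- n * (z ^+ k * v)).
Proof.
move=> kn; exists (cabs v), 1; split; [exact: cabs_ge0|exact: ltr01|] => z z1.
have z0 : 0 < cabs z by lra.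
rewrite !cabsM cabsV !cabsX mulrA [leRHS]mulrC; apply: ler_wpM2r; first exact: cabs_ge0.
rewrite ler_pdivrMl ?exprn_gt0// ler_pdivlMr// -exprSr.
exact: ler_weXn2l.
Qed.

(** The moments of order below n - 1 vanish and that of order n - 1 is - d2. Since 1/(w - z) begins
    with -1/z, the Cauchy transform is z^-n (d2 + O(1/z)). Upper rows have d2 = 0 and lower rows d2
    = I. *)
Lemma row_poly n A (d2 : 'M[Cx R]_N) :
  (forall k, (k.+1 < n)%N -> mint g (fun w => w ^+ k *: (mpol n A w *m W w)) = 0) ->
  (if n is m.+1 then mint g (fun w => w ^+ m *: (mpol n A w *m W w)) = - d2 else d2 = 0) ->
  row_ok g W n (A n) d2 (mpol n A) (fun z => mint g (fun w => (w - z)^-1 *: (mpol n A w *m W w))).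
Proof.
move=> orth top; pose f i j z := (mpol n A z *m W z) i j.
have gf i j : good_fun (f i j) by exact: good_entry.
have QE z i j : mint g (fun w => (w - z)^-1 *: (mpol n A w *m W w)) i j =
    (twopii R)^-1 * cauchy g (f i j) z.
  by rewrite mxE; congr (_ * cint g _); apply/funext => w; rewrite mxE.
have DE k i j : mint g (fun w => w ^+ k *: (mpol n A w *m W w)) i j =
    (twopii R)^-1 * cint g (fun w => w ^+ k * f i j w).
  by rewrite mxE; congr (_ * cint g _); apply/funext => w; rewrite mxE.
have QF i j : (fun z => mint g (fun w => (w - z)^-1 *: (mpol n A w *m W w)) i j) =
    fun z => (twopii R)^-1 * cauchy g (f i j) z by apply/funext => z; exact: QE.
split.
- move=> i j; have -> : (fun z => mpol n A z i j) = fun z => \sum_(k < n.+1) z ^+ k * A k i j.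
    by apply/funext => z; exact: mpolE.
  exact: (@entire_poly n.+1 (fun k => A k i j)).
- move=> i j z nz; rewrite QF; have [h _ _] := good_cauchy (gf i j).
  by apply: derivableM; [exact: derivable_cst|exact: h].
- move=> z Tz z0.
  have /choice[B hBB] (ij : 'I_N * 'I_N) : exists B : Cx R,
     cauchy g (f ij.1 ij.2) w @[w --> within (plus_side g) (nbhs z)] --> B /\
     cauchy g (f ij.1 ij.2) w @[w --> within (minus_side g) (nbhs z)] --> B - twopii R * f ij.1 ij.2 z.
    by have [_ h _] := good_cauchy (gf ij.1 ij.2); exact: h.
  exists (\matrix_(i, j) ((twopii R)^-1 * B (i, j))),
    (\matrix_(i, j) ((twopii R)^-1 * (B (i, j) - twopii R * f i j z))); split.
  + apply/mx_cvgP => i j; rewrite QF mxE.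
    have cb := (hBB (i, j)).1; apply: cvgM cb; exact: cvg_cst.
  + apply/mx_cvgP => i j; rewrite QF mxE.
    have cb := (hBB (i, j)).2; apply: cvgM cb; exact: cvg_cst.
  + apply/matrixP => i j; rewrite mxE [RHS]mxE [X in _ = _ + X]mxE -/(f i j z).
    by rewrite mulrBr mulrA mulVf ?twopii_neq0// mul1r addrC subrK.
- move=> i j; split.
    have o1 : Oinv (fun z => \sum_(k < n) z ^- n * (z ^+ k * A k i j)).
      by apply: Oinv_sum => k; exact: Oinv_pow.
    apply: (@Oinv_eq_large _ _ 1) o1 => z z1.
    have zn : z ^+ n != 0 by rewrite expf_neq0// -cabs_gt0; lra.
    rewrite !mxE mpolE big_ord_recr/= mulrDr -mulr_sumr mulrA mulVf// mul1r addrK//.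
  have cz k : cintegrable g (fun w => w ^+ k * f i j w) by exact: (gf i j).2.
  have o1 := OinvZ (twopii R)^-1 (Oinv_cauchy (cz n)).
  have [M [r [r0 hr]]] := cauchy_inf hg (cz n).
  apply: (@Oinv_eq_large _ _ r) o1 => z zr; have [nz _] := hr z zr.
  rewrite [RHS]mxE [X in _ = X + _]mxE [X in _ = _ + X]mxE QE.
  (* For n = 0 there is no moment and the transform is O(1/z) as it stands. Otherwise the vanishing
     moments give m factors 1/z, and the last expansion isolates d2. *)
  case: (n) top orth cz QE DE => [|m] /= top orth cz QE DE.
    rewrite top mxE subr0 expr0 mul1r; congr (_ * cauchy g _ z).
    by apply/funext => w; rewrite mul1r.
  have z0 := off_trace_neq0 hg nz.
  have cint0 k : (k < m)%N -> cint g (fun w => w ^+ k * f i j w) = 0.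
    move=> km; have := congr1 (fun X : 'M[Cx R]_N => X i j) (orth k km).
    rewrite DE [in RHS]mxE => /eqP; rewrite mulf_eq0 invr_eq0 (negbTE twopii_neq0) /=.
    by move/eqP.
  have e1 := cauchy_expand_n hg cz nz cint0.
  have E : (fun w => w * (w ^+ m * f i j w)) = (fun w => w ^+ m.+1 * f i j w).
    by apply/funext => w; rewrite mulrA exprS.
  have i1 := cz m.+1; rewrite -E in i1.
  have e2 := cauchy_expand hg (cz m) i1 nz; rewrite E in e2.
  have d2E : d2 i j = - ((twopii R)^-1 * cint g (fun w => w ^+ m * f i j w)).
    by rewrite -DE top mxE opprK.
  rewrite e1 e2 d2E opprK exprS.
  have zm : z ^+ m != 0 by rewrite expf_neq0.
  by field; rewrite zm z0 twopii_neq0.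
- move=> i j; rewrite QF; have [_ _ h] := good_cauchy (gf i j).
  apply: small0M h; exists (cabs (twopii R)^-1), 1; split; [exact: cabs_ge0|exact: ltr01|by []].
Qed.

End PolynomialRows.

Section Transposition.
Context {R : realType} (g : R -> Cx R) (N : nat).
Implicit Types (z w : Cx R).

Lemma boundary_tr (S : set (Cx R)) m n (F : Cx R -> 'M[Cx R]_(m, n)) z V :
  boundary_value S F z V -> boundary_value S (fun w => (F w)^T) z V^T.
Proof.
move=> /mx_cvgP h; apply/mx_cvgP => i j; rewrite mxE.
have -> : (fun w => (F w)^T i j) = (fun w => F w j i) by apply/funext => w; rewrite mxE.
exact: h.
Qed.

Lemma RHP_tr (W : Cx R -> 'M[Cx R]_N) n (Y : Cx R -> 'M[Cx R]_(N + N)) :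
  left_RHP g W n Y -> right_RHP g (fun z => (W z)^T) n (fun z => (Y z)^T).
Proof.
move=> [dY jY [E [oE [r hE]]] [s1 [s2 [b1 [b2 [hY [u1 u2] [l1 l2]]]]]]].
have big (b : Cx R -> 'M[Cx R]_N) : bigO_one_at0 g b -> bigO_one_at0 g (fun z => (b z)^T).
  by move=> [K hK]; exists K; apply: filterS hK => z hz i j; rewrite mxE.
have lit (s : Cx R -> 'M[Cx R]_N) : littleo_inv_at0 g s -> littleo_inv_at0 g (fun z => (s z)^T).
  move=> /littleo_small0 h; apply/littleo_small0 => i j e e0; have [d d0 hd] := h j i e e0.
  by exists d => // w nw wd; rewrite mxE; exact: hd.
split.
- move=> i j; have -> : (fun z => (Y z)^T i j) = (fun z => Y z j i) by apply/funext => z; rewrite mxE.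
  exact: dY.
- move=> z Tz z0; have [Yp [Ym [h1 h2 h3]]] := jY z Tz z0; exists Yp^T, Ym^T; split.
  + exact: boundary_tr h1.
  + exact: boundary_tr h2.
  + by rewrite h3 trmx_mul tr_block_mx !trmx1 trmx0.
- exists (fun z => (E z)^T); split.
    by case: oE => K [r0 [r00 hK]]; exists K, r0; split=> // z zr i j; rewrite mxE; exact: hK.
  exists r => z nz zr; rewrite hE// trmx_mul linearD/= trmx1; congr (_ *m _).
  by rewrite /asymp tr_block_mx !tr_scalar_mx !trmx0.
- exists (fun z => (s1 z)^T), (fun z => (s2 z)^T), (fun z => (b1 z)^T), (fun z => (b2 z)^T); split.
  + by move=> z nz; rewrite hY// tr_block_mx.
  + by split; exact: big.
  + by split; exact: lit.
Qed.

Lemma mint_tr m n (F : Cx R -> 'M[Cx R]_(m, n)) : (mint g F)^T = mint g (fun z => (F z)^T).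
Proof.
apply/matrixP => i j; rewrite !mxE; congr (_ * cint g _).
by apply/funext => z; rewrite mxE.
Qed.

End Transposition.

Section Existence.
Context {R : realType} (g : R -> Cx R).
Context (hg : loop_at_origin g) (N : nat).
Implicit Types (z w v : Cx R) (n k : nat).

Lemma mint_mull (B : 'M[Cx R]_N) (F : Cx R -> 'M[Cx R]_N) :
  (forall i j, cintegrable g (fun z => F z i j)) ->
  mint g (fun z => B *m F z) = B *m mint g F.
Proof.
move=> iF; apply/matrixP => i j; rewrite mxE [RHS]mxE.
have i1 l : CInt `[0, 1] (fun t => B i l * pullback g (fun z => F z l j) t).
  by apply: (CInt_Z (@mi01 R)); exact: iF.
have e1 : cint g (fun z => (B *m F z) i j) =
    CI `[0, 1] (fun t => \sum_l B i l * pullback g (fun z => F z l j) t).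
  apply: eq_CI => t _; rewrite /pullback mxE mulr_suml; apply: eq_bigr => l _.
  by rewrite mulrA.
rewrite e1 (CI_sum (@mi01 R) _ i1) mulr_sumr; apply: eq_bigr => l _.
by rewrite mxE (CIZ (@mi01 R) _ (iF l j)) mulrCA.
Qed.

Lemma left_exists (W : Cx R -> 'M[Cx R]_N) (P : nat -> Cx R -> 'M[Cx R]_N) (C : nat -> 'M[Cx R]_N) n :
  bessel_type g W -> (forall n i j, cintegrable g (fun z => z ^+ n * W z i j)) ->
  (forall n, exists A : nat -> 'M[Cx R]_N, A n = 1%:M /\ P n = mpol n A) ->
  (forall n, C n \in unitmx) ->
  (forall n k, (k <= n)%N -> mint g (fun z => z ^+ k *: (P n z *m W z)) =
     if n == k then invmx (C n) else 0) ->
  left_RHP g W n (fun z => block_mx (P n z) (mint g (fun w => (w - z)^-1 *: (P n w *m W w)))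
    (if n is m.+1 then - (C m *m P m z) else 0)
    (if n is m.+1 then - (C m *m mint g (fun w => (w - z)^-1 *: (P m w *m W w))) else 1%:M)).
Proof.
move=> hB hI hP uC orth.
have first_row : row_ok g W n 1%:M 0 (P n) (fun z => mint g (fun w => (w - z)^-1 *: (P n w *m W w))).
  have [A [An PA]] := hP n; have orthn := orth n; rewrite PA in orthn *; rewrite -An.
  apply: (row_poly hg hB hI) => [k kn|].
    by rewrite orthn 1?ltnW// 1?ltnW// gtn_eqF// ltnW.
  case: (n) orthn => [//|m] orthn.
  by rewrite orthn// oppr0 gtn_eqF.
case: n first_row => [|m] first_row.
  exact: (rows_RHP hg first_row (row_zero _ _)).
apply: (rows_RHP hg first_row).
have [A [Am PA]] := hP m; have orthm := orth m; rewrite PA in orthm *.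
(* The lower polynomial, of degree m, is read as one of degree m + 1 with top coefficient 0; this
   coefficient is the leading block d1 = 0 of the lower row. *)
pose A' k := if k == m.+1 then 0 else - C m *m A k.
have PE z : - (C m *m mpol m A z) = mpol m.+1 A' z.
  rewrite /mpol [RHS]big_ord_recr/= /A' eqxx scaler0 addr0 -mulNmx mulmx_sumr.
  by apply: eq_bigr => k _; rewrite ltn_eqF// scalemxAr.
have good k i j := (good_entry hB hI m A i j).2 k.
have CF k : mint g (fun w => w ^+ k *: (mpol m.+1 A' w *m W w)) =
    - C m *m mint g (fun w => w ^+ k *: (mpol m A w *m W w)).
  rewrite -mint_mull => [|i j].
    by congr mint; apply/funext => w; rewrite -PE -mulNmx -scalemxAr mulmxA.
  have -> : (fun z => (z ^+ k *: (mpol m A z *m W z)) i j) = fun z => z ^+ k * (mpol m A z *m W z) i j.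
    by apply/funext => z; rewrite mxE.
  exact: good.
have row2 := @row_poly R g hg N W hB hI m.+1 A' 1%:M.
have {}row2 : row_ok g W m.+1 0 1%:M (mpol m.+1 A')
    (fun z => mint g (fun w => (w - z)^-1 *: (mpol m.+1 A' w *m W w))).
  have A'E : A' m.+1 = 0 by rewrite /A' eqxx.
  rewrite -[X in row_ok _ _ _ X]A'E; apply: row2 => [k kn|].
    by rewrite CF orthm 1?ltnW// gtn_eqF// mulmx0.
  by rewrite CF orthm// eqxx mulNmx mulmxV.
have -> : (fun z => - (C m *m mpol m A z)) = mpol m.+1 A' by apply/funext => z; exact: PE.
(* The factor [C m] leaves the integral by linearity, for which the kernel must be integrable; this
   is known off the trace, hence the use of [row_ext]. *)
suff QQ z : ~ trace g z -> mint g (fun w => (w - z)^-1 *: (mpol m.+1 A' w *m W w)) =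
    - (C m *m mint g (fun w => (w - z)^-1 *: (mpol m A w *m W w))) by exact (row_ext hg QQ row2).
move=> nz; apply/esym; rewrite -mulNmx -mint_mull => [|i j].
  by congr mint; apply/funext => w; rewrite -PE -mulNmx -scalemxAr mulmxA.
have i0 : cintegrable g (fun w => (mpol m A w *m W w) i j).
  have := good 0%N i j.
  by have -> : (fun w => w ^+ 0 * (mpol m A w *m W w) i j) = fun w => (mpol m A w *m W w) i j
    by apply/funext => w; rewrite mul1r.
have i1 := CInt_cauchy hg i0 nz.
have i2 : CInt `[0, 1] (pullback g (fun w => ((w - z)^-1 *: (mpol m A w *m W w)) i j)).
  apply: (eq_CInt (@mi01 R) _ i1) => t _.
  by rewrite /pullback (mxE _ (fun i j => (g t - z)^-1 * (mpol m A (g t) *m W (g t)) i j)) mulrA.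
exact: i2.
Qed.

End Existence.

Section MatrixPolynomials.
Context {R : realType} (N : nat).
Implicit Types (z : Cx R) (P : {poly 'M[Cx R]_N.+1}).

Lemma scalar_expr z k : (z%:M : 'M[Cx R]_N.+1) ^+ k = (z ^+ k)%:M.
Proof. by elim: k => [|k ih]; rewrite ?expr0// !exprS ih -mulmxE scalar_mxM. Qed.

Lemma meval_mpol P n : P \is monic -> size P = n.+1 ->
  (P : seq _)`_n = 1%:M /\ meval P = mpol n (fun k => (P : seq _)`_k).
Proof.
move=> /monicP mP sP; split; first by move: mP; rewrite /lead_coef sP.
apply/funext => z; rewrite /meval /mpol horner_coef sP; apply: eq_bigr => k _.
by rewrite scalar_expr -mulmxE mul_mx_scalar.
Qed.

Lemma mpol_tr n (A : nat -> 'M[Cx R]_N.+1) z : (mpol n A z)^T = mpol n (fun k => (A k)^T) z.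
Proof. by rewrite /mpol linear_sum; apply: eq_bigr => k _; rewrite linearZ. Qed.

Lemma bessel_tr g (W : Cx R -> 'M[Cx R]_N.+1) : bessel_type g W -> bessel_type g (fun z => (W z)^T).
Proof.
move=> [lg [hl h]]; exists lg; split=> // j k; have [d [phi [p [lam [q [h1 h2 h3]]]]]] := h k j.
by exists d, phi, p, lam, q; split=> // z Tz z0; rewrite mxE h3.
Qed.

End MatrixPolynomials.

Theorem theorem1 (R : realType) (N : nat)
    (gamma : R -> Cx R) (hgamma : loop_at_origin gamma)
    (W : Cx R -> 'M[Cx R]_N.+1)
    (hB : bessel_type gamma W) (hreg : regular_weight gamma W)
    (PL PR : nat -> {poly 'M[Cx R]_N.+1}) (C : nat -> 'M[Cx R]_N.+1)
    (hP : biorthogonal gamma W PL PR C) (n : nat) :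
  unique_solution_off (trace gamma) (left_RHP gamma W n)
    (YL gamma W PL C n) /\
  unique_solution_off (trace gamma) (right_RHP gamma W n)
    (YR gamma W PR C n).
Proof.
have [hI _] := hreg.
apply: (left_right_unique hgamma).
  apply: (left_exists hgamma (P := fun n => meval (PL n)) n hB hI).
  - move=> m; have [[mP sP] _ _ _ _] := hP m; have [h1 h2] := meval_mpol mP sP.
    by exists (fun k => (PL m : seq _)`_k).
  - by move=> m; case: (hP m).
  - move=> m k km; have [_ _ _ h _] := hP m; rewrite -h//; congr mint.
    by apply/funext => z; rewrite mul_mx_scalar.
(* Transposition reverses products, so the right polynomials become left ones for W^T; inversion
   commutes with it, and the constants C_n become C_n^T. *)
pose W' z := (W z)^T; pose P' m z := (meval (PR m) z)^T; pose C' m := (C m)^T.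
have hI' m i j : cintegrable gamma (fun z => z ^+ m * W' z i j).
  have := hI m j i; congr (cintegrable gamma _).
  by apply/funext => z; rewrite /W' mxE.
have L : left_RHP gamma W' n (fun z => block_mx (P' n z) (mint gamma (fun w => (w - z)^-1 *: (P' n w *m W' w)))
    (if n is m.+1 then - (C' m *m P' m z) else 0)
    (if n is m.+1 then - (C' m *m mint gamma (fun w => (w - z)^-1 *: (P' m w *m W' w))) else 1%:M)).
  apply: (left_exists hgamma n (bessel_tr hB) hI').
  - move=> m; have [_ [mP sP] _ _ _] := hP m; have [h1 h2] := meval_mpol mP sP.
    exists (fun k => ((PR m : seq _)`_k)^T); split; first by rewrite h1 trmx1.
    by apply/funext => z; rewrite /P' h2 mpol_tr.
  - by move=> m; rewrite unitmx_tr; case: (hP m).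
  - move=> m k km; have [_ _ _ _ h] := hP m.
    have -> : (if m == k then invmx (C' m) else 0) = (if m == k then invmx (C m) else 0)^T.
      by case: eqP => _; rewrite ?trmx_inv ?trmx0.
    rewrite -h// mint_tr; congr mint.
    by apply/funext => z; rewrite mul_scalar_mx -scalemxAl linearZ/= trmx_mul.
have := RHP_tr L.
have -> : (fun z => (W' z)^T) = W by apply/funext => z; exact: trmxK.
congr (right_RHP gamma W n _); apply/funext => z.
have QE m : (mint gamma (fun w => (w - z)^-1 *: (P' m w *m W' w)))^T = QR gamma W PR m z.
  rewrite mint_tr /QR; congr mint; apply/funext => w.
  by rewrite linearZ/= trmx_mul !trmxK.
rewrite tr_block_mx QE /YR /P' trmxK; congr block_mx.
- by case: (n) => [|m]; rewrite ?trmx0// linearN/= trmx_mul !trmxK.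
- by case: (n) => [|m]; rewrite ?trmx1// linearN/= trmx_mul QE trmxK.
Qed.
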